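(* Let $\tau>2$ and $1<\alpha<\frac{1}{\tau-2}$. Let $\mathcal{G}=(\mathcal{V},\mathcal{E})$ be a (Euclidean) GIRG with parameters $\tau,\alpha,\theta_1,\theta_2,d,n$, and let $u,v$ be two vertices in the giant component, chosen uniformly at random. Denote by $\mathcal{T}$ the event that the rumour, started at $u$, is transmitted from $u$ to $v$ via the push-pull protocol within the first $(4+o(1))\cdot\frac{\log\log n}{|\log(\alpha(\tau-2))|}$ rounds. Then $\mathcal{T}$ happens with high probability.
   Context: All asymptotics are for $n\to\infty$ with the other parameters constant; ''with high probability'' (whp) means with probability $1-o(1)$. $\log$ is the natural logarithm. GIRG. Let $\tau>2$, $\alpha>1$, $0<\theta_1\le\theta_2\le 1$, $d,n\in\mathbb{N}$, and let $\mathcal{D}$ be a power-law distribution on $[1,\infty)$ with exponent $\tau$ (it has a density $f$ with $f(x)=\Theta(x^{-\tau})$, or, in the discrete case, point probabilities $\Theta(x^{-\tau})$). Let $\mathbb{T}^d=\mathbb{R}^d/\mathbb{Z}^d$ be the $d$-dimensional torus; for $a,b\in[0,1]$ let $|a-b|_T=\min\{|a-b|,1-|a-b|\}$, and for $x,y\in\mathbb{T}^d$ let $|x-y|_\infty=\max_{1\le i\le d}|x_i-y_i|_T$. Let $V_\infty(r)=\mathrm{Vol}(\{x\in\mathbb{T}^d: |x|_\infty\le r\})$. A (Euclidean) Geometric Inhomogeneous Random Graph (GIRG) is the random graph obtained as follows: (1) the vertex set $\mathcal{V}$ is a Poisson point process of intensity $n$ on $\mathbb{T}^d$; $x_v$ denotes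 the position of vertex $v$; (2) every vertex $v$ independently draws a weight $W_v\sim\mathcal{D}$; (3) every two distinct vertices $u,v$ are joined by an edge independently with probability $p_{uv}$ satisfying $\theta_1 m\le p_{uv}\le\theta_2 m$, where $m=\min\left\{\left(\frac{W_uW_v}{nV_\infty(|x_u-x_v|_\infty)}\right)^{\alpha},1\right\}$. The giant component is the unique connected component with $\Omega(n)$ vertices (it exists whp). (Synchronous) push-pull protocol. Initially only the start vertex knows the rumour. In each round, every (non-isolated) vertex independently chooses a uniformly random neighbour, and the two vertices share the rumour: if one of them knew it before this round, then both know it after this round. *)

(* Defs.v *)
From HB Require Import structures.
From mathcomp Require Import all_boot all_order all_algebra.
From mathcomp Require Import all_classical all_reals all_analysis.

Set Implicit Arguments.
Unset Strict Implicit.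
Unset Printing Implicit Defensive.

Import Order.TTheory GRing.Theory Num.Theory.
Import numFieldNormedType.Exports.

Local Open Scope classical_set_scope.
Local Open Scope ring_scope.

(* Points of the torus R^d / Z^d are represented by their unique representative
   in [0,1)^d. *)
Definition torus (R : realType) (d : nat) : set (d.-tuple R) :=
  [set x | forall i : 'I_d, 0 <= tnth x i < 1].

Definition torus_dist1 (R : realType) (a b : R) : R :=
  Num.min `|a - b| (1 - `|a - b|).

Definition torus_dist (R : realType) (d : nat) (x y : d.-tuple R) : R :=
  \big[Num.max/0]_(i < d) torus_dist1 (tnth x i) (tnth y i).

(* d-dimensional Lebesgue measure: the d-fold iterated product of the
   one-dimensional one, written as in product_measure1. *)
Fixpoint lebesgue_tuple (R : realType) (d : nat) : set (d.-tuple R) -> \bar R :=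
  match d with
  | 0%N => fun B => \d_([tuple] : 0.-tuple R) B
  | d'.+1 => fun B =>
      (\int[@lebesgue_measure R]_x
         lebesgue_tuple [set t : d'.-tuple R | B [tuple of x :: t]])%E
  end.

Definition ball_volume (R : realType) (d : nat) (r : R) : R :=
  fine (lebesgue_tuple
    [set x : d.-tuple R | torus x /\ torus_dist x [tuple 0 | _ < d] <= r]).

Definition power_law (R : realType) (tau : R)
    (D : probability (measurableTypeR R) R) : Prop :=
  (exists f : R -> R,
    [/\ measurable_fun [set: R] f,
        forall x, 1 <= x -> 0 <= f x,
        f \is 'Theta_(pinfty_nbhs R) (fun x : R => x `^ (- tau)) &
        forall A : set (measurableTypeR R), measurable A ->
          D A = (\int[@lebesgue_measure R]_(x in A `&` `[1%R, +oo[) (f x)%:E)%E])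
  \/
  (D [set x | exists2 k : nat, (0 < k)%N & x = k%:R] = 1%E /\
   ((fun k : nat => fine (D [set k%:R])) : nat -> R) \is 'Theta_\oo
     (fun k : nat => (k%:R : R) `^ (- tau))).

(* A vertex is a marked point: its position and its weight. *)
Notation vertex R d := (d.-tuple R * R)%type.

(* When n * V = 0 the ratio in the model is infinite and the minimum is 1; the
   case is singled out because division by zero returns zero in MathComp. *)
Definition girg_kernel (R : realType) (alpha : R) (d n : nat)
    (s t : vertex R d) : R :=
  let nV := n%:R * ball_volume d (torus_dist s.1 t.1) in
  if nV == 0 then 1 else Num.min ((s.2 * t.2 / nV) `^ alpha) 1.

Definition girg_edge_prob (R : realType) (alpha theta1 theta2 : R) (d n : nat)
    (p : vertex R d -> vertex R d -> R) : Prop :=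
  [/\ measurable_fun [set: vertex R d * vertex R d] (fun z => p z.1 z.2),
      forall s t, p s t = p t s &
      forall s t, torus s.1 -> torus t.1 -> 1 <= s.2 -> 1 <= t.2 ->
        theta1 * girg_kernel alpha n s t <= p s t
          <= theta2 * girg_kernel alpha n s t].

(* A probability space carrying the random graph, the two random vertices and
   the choices of the push-pull protocol.  At an outcome w the vertices are
   listed, in an arbitrary measurable order, as 0, ..., npts w - 1; the values
   of the other fields at labels that are not below npts w are irrelevant. *)
Record rumour_space (R : realType) (d : nat) := RumourSpace {
  rs_disp : measure_display;
  Omega : measurableType rs_disp;
  Pr : probability Omega R;
  npts : Omega -> nat;
  pos : nat -> Omega -> d.-tuple R;
  wt : nat -> Omega -> R;
  adj : nat -> nat -> Omega -> bool;
  start : Omega -> nat;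
  target : Omega -> nat;
  choice : nat -> nat -> Omega -> nat (* round, vertex *)
}.

Section Model.
Variables (R : realType) (d : nat) (S : rumour_space R d).
Local Notation P := (@Pr R d S).
Implicit Types (w : @Omega R d S) (k : nat).

Definition positions k w : k.-tuple (d.-tuple R) :=
  [tuple @pos _ _ S i w | i < k].

Definition marks k w : k.-tuple (vertex R d) :=
  [tuple (@pos _ _ S i w, @wt _ _ S i w) | i < k].

Definition graph_at w : rel 'I_(@npts _ _ S w) := fun i j => @adj _ _ S i j w.

Definition random_variables_measurable : Prop :=
  measurable_fun [set: @Omega _ _ S] (@npts _ _ S) /\
  (forall i, measurable_fun [set: @Omega _ _ S] (@pos _ _ S i)) /\
  (forall i, measurable_fun [set: @Omega _ _ S] (@wt _ _ S i)) /\
  (forall i j, measurable_fun [set: @Omega _ _ S] (@adj _ _ S i j)) /\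
  measurable_fun [set: @Omega _ _ S] (@start _ _ S) /\
  measurable_fun [set: @Omega _ _ S] (@target _ _ S) /\
  (forall t i, measurable_fun [set: @Omega _ _ S] (@choice _ _ S t i)).

Definition count_in (B : set (d.-tuple R)) w : nat :=
  (\sum_(i < @npts _ _ S w) (@pos _ _ S i w \in B))%N.

(* Counts of disjoint Borel sets are independent Poisson variables.  The second
   argument of poisson_prob is a dummy; poisson_prob is used rather than
   poisson_pmf because only the former is right at rate 0. *)
Definition poisson_process (intensity : R) : Prop :=
  (forall w (i : 'I_(@npts _ _ S w)), torus (@pos _ _ S i w)) /\
  forall (m : nat) (B : 'I_m -> set (d.-tuple R)) (c : 'I_m -> nat),
    (forall j, measurable (B j)) -> (forall j, B j `<=` @torus R d) ->
    trivIset setT B ->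
    P [set w | forall j, count_in (B j) w = c j] =
    (\prod_(j < m)
       poisson_prob (intensity * fine (lebesgue_tuple (B j))) 0 [set c j])%E.

(* Given the vertex set, the weights are independent with law D. *)
Definition iid_weights (D : probability (measurableTypeR R) R) : Prop :=
  forall (k : nat) (B : set (k.-tuple (d.-tuple R)))
         (A : 'I_k -> set (measurableTypeR R)),
    measurable B -> (forall i, measurable (A i)) ->
    P [set w | [/\ @npts _ _ S w = k, B (positions k w) &
                   forall i : 'I_k, A i (@wt _ _ S i w)]] =
    (P [set w | @npts _ _ S w = k /\ B (positions k w)]
       * \prod_(i < k) D (A i))%E.

Definition graph_event (k : nat) (C : set (k.-tuple (vertex R d)))
    (g : rel 'I_k) : set (@Omega _ _ S) :=
  [set w | [/\ @npts _ _ S w = k, C (marks k w) &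
               forall i j : 'I_k, @adj _ _ S i j w = g i j]].

Definition simple_graph (V : finType) (g : rel V) : Prop :=
  symmetric g /\ irreflexive g.

(* Given the vertices and their weights, the edges are independent. *)
Definition independent_edges (p : vertex R d -> vertex R d -> R) : Prop :=
  (forall w, simple_graph (@graph_at w)) /\
  forall (k : nat) (C : set (k.-tuple (vertex R d))) (g : rel 'I_k),
    measurable C -> simple_graph g ->
    P (graph_event C g) =
    (\int[P]_(w in [set w | @npts _ _ S w = k /\ C (marks k w)])
       (\prod_(i < k) \prod_(j < k | (i < j)%N)
          let q := p (tnth (marks k w) i) (tnth (marks k w) j) in
          if g i j then q else 1 - q)%:E)%E.

Definition girg (alpha theta1 theta2 : R) (n : nat)
    (D : probability (measurableTypeR R) R)
    (p : vertex R d -> vertex R d -> R) : Prop :=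
  [/\ poisson_process n%:R, iid_weights D,
      girg_edge_prob alpha theta1 theta2 n p & independent_edges p].

End Model.

Definition is_component (V : finType) (g : rel V) (K : {set V}) : Prop :=
  exists x, K = [set y | connect g x y]%SET.

(* The unique component with at least c * n vertices. *)
Definition is_giant (R : realType) (c : R) (n : nat) (V : finType) (g : rel V)
    (K : {set V}) : Prop :=
  [/\ is_component g K, c * n%:R <= #|K|%:R &
      forall K', is_component g K' -> c * n%:R <= #|K'|%:R -> K' = K].

(* contact t x y: in round t, the vertex x chooses the neighbour y. *)
Fixpoint informed (V : finType) (contact : nat -> rel V) (x0 : V) (r : nat)
    : {set V} :=
  match r with
  | 0%N => [set x0]%SET
  | r'.+1 =>
      let I := informed contact x0 r' in
      (I :|: [set y | [exists x in I, contact r' x y || contact r' y x]])%SET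
  end.

Section Protocol.
Variables (R : realType) (d : nat) (S : rumour_space R d).
Local Notation P := (@Pr R d S).

(* Given the graph, start and target are independent and uniform in the giant
   component. *)
Definition uniform_endpoints (c : R) (n : nat) : Prop :=
  forall (k : nat) (C : set (k.-tuple (vertex R d))) (g : rel 'I_k)
         (K : {set 'I_k}) (a b : 'I_k),
    measurable C -> simple_graph g -> is_giant c n g K ->
    a \in K -> b \in K ->
    P (graph_event C g `&`
         [set w | @start _ _ S w = a /\ @target _ _ S w = b]) =
    (P (@graph_event R d S k C g) * ((#|K|%:R ^- 2)%R)%:E)%E.

(* Given the graph and the endpoints, the non-isolated vertices choose
   independent uniform neighbours, independently in every round. *)
Definition uniform_choices : Prop :=
  forall (k : nat) (C : set (k.-tuple (vertex R d))) (g : rel 'I_k)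
         (a b : nat) (r : nat) (f : 'I_r -> 'I_k -> 'I_k),
    measurable C -> simple_graph g ->
    (forall t i, (0 < #|g i|)%N -> g i (f t i)) ->
    P (graph_event C g `&`
         [set w | [/\ @start _ _ S w = a, @target _ _ S w = b &
            forall (t : 'I_r) (i : 'I_k), (0 < #|g i|)%N -> @choice _ _ S t i w = f t i]]) =
    (P (graph_event C g `&`
          [set w | @start _ _ S w = a /\ @target _ _ S w = b])
     * (\prod_(t < r) \prod_(i < k | (0 < #|g i|)%N) (#|g i|%:R)^-1)%:E)%E.

Definition push_pull (c : R) (n : nat) : Prop :=
  [/\ random_variables_measurable S, uniform_endpoints c n & uniform_choices].

Definition contact_at (w : @Omega _ _ S) (t : nat) : rel 'I_(@npts _ _ S w) :=
  fun i j => graph_at i j && (@choice _ _ S t i w == j).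

(* The giant component exists and the rumour started at start reaches target
   within the first L rounds. *)
Definition transmitted_within (c : R) (n : nat) (L : R) : set (@Omega _ _ S) :=
  [set w | (exists K, is_giant c n (@graph_at R d S w) K) /\
     exists (a b : 'I_(@npts _ _ S w)) (r : nat),
       [/\ @start _ _ S w = a, @target _ _ S w = b, r%:R <= L &
           b \in informed (contact_at (w := w)) a r]].

End Protocol.

(* Main.v *)
Require Import Defs.
From HB Require Import structures.
From mathcomp Require Import all_boot all_order all_algebra.
From mathcomp Require Import all_classical all_reals all_analysis.
From mathcomp Require Import ring lra zify.
From mathcomp Require Import measurable_realfun.

Set Implicit Arguments.
Unset Strict Implicit.
Unset Printing Implicit Defensive.

Import Order.TTheory GRing.Theory Num.Theory.
Import numFieldNormedType.Exports.

Local Open Scope classical_set_scope.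
Local Open Scope ring_scope.

(** Cut the torus into a dyadic grid of 2^(db) cells, with b ~ log_2(n)/d, so
that each cell has between 1 and 2^d vertices in expectation, and let weight
class l consist of the weights in [2^l, 2^(l+1)[.  A box of side 2^i cells contains,
except with probability superpolynomially small in 2^i, a hub, i.e. a vertex of
weight about 2^(d sigma i), where sigma is slightly below 1/(tau-1).  If
gamma < 1/(alpha(tau-2)) and sigma is close to 1/(tau-1), the hubs of nested
boxes at scales i and gamma i have exponentially many (in i) common neighbours
inside the sub-box of side 2^(sigma i) around the lower hub: the expected number
is 2^(d i (sigma - alpha gamma (1 - sigma))).  By a first moment bound enough of
these have small degree, so a rumour crosses such a hop in two rounds with
overwhelming probability, and log log n / log gamma hops climb from a box of constant
size to the top hub.  Climbing from both endpoints costs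
4 log log n / log gamma rounds.

It remains to see that all but a small fraction of the vertices in large
components reach, inside a box of constant size, a hub from which the climb
works.  Each vertex is joined to the hub of its box with probability bounded
below, and these edges are exposed last (sprinkling).  The component of a vertex
among the well-behaved vertices either meets many boxes, and then one of the
sprinkled edges succeeds, or is small, and then it is a whole component of the
graph unless it touches a vertex that is not well-behaved; second moment bounds
show that the latter is rare.  This also gives uniqueness of the giant, and
Markov and Chernoff bounds over the scales give its existence.

All probabilities are computed after conditioning on the number of vertices,
their cells and their weight classes; only upper bounds by Poisson generating
functions are used for the cells.  A diagonal argument finally turns every
fixed eps > 0 into a sequence tending to 0. *)

(** * Finite product expectations *)

(** A hub of weight 2^(d sigma i) is linked with probability bounded below to every vertex within
    volume 2^(d sigma i); hence the sub-box of side 2^(sigma i). Its vertices see the hub of scale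
    gamma i with probability about 2^(-d alpha gamma i (1 - sigma)). At sigma = 1/(tau-1) the
    balance sigma - alpha gamma (1 - sigma) is positive exactly when alpha gamma (tau-2) < 1.
    Lowering sigma by the factor 1 - eta makes hubs plentiful, and [etaP] keeps a margin that pays
    for the degree caps.

    The weight factors need not have second moments, so the edges at the few bad vertices cannot be
    counted by Cauchy-Schwarz. Squared degrees are divided by the vertex's own weight factor, which
    leaves first moments only; the factor itself is truncated by means of a slightly larger
    exponent.

    The size constant of the giant must not depend on the tolerance, whereas the bottom scale of the
    climb does. Existence is therefore a separate argument with a fixed bottom scale, concentration
    over disjoint boxes at boundedly many scales and Markov above. Components of size c n are all
    the same because unreached vertices number fewer than c n and the others lead to one top hub. *)

Section FiniteProduct.
Variables (R : realFieldType) (I : finType).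

(** Expectation of [F] under the product of the laws [mu i]. Edges, sprinkling, weight classes and
    choices all have laws of this form, so after conditioning only finite sums remain. *)
Definition PE (T : finType) (mu : I -> T -> R) (F : {ffun I -> T} -> R) : R :=
  \sum_(f : {ffun I -> T}) (\prod_i mu i (f i)) * F f.

Definition is_pmf (T : finType) (mu : I -> T -> R) : Prop :=
  (forall i x, 0 <= mu i x) /\ (forall i, \sum_x mu i x = 1).

Section Basic.
Variables (T : finType) (mu : I -> T -> R).
Hypothesis mu_pmf : is_pmf mu.
Implicit Types F G : {ffun I -> T} -> R.

Lemma PE_weight_ge0 (f : {ffun I -> T}) : 0 <= \prod_i mu i (f i).
Proof. by apply: prodr_ge0 => i _; apply: mu_pmf.1. Qed.

Lemma eq_PE F G : F =1 G -> PE mu F = PE mu G.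
Proof. by move=> e; apply: eq_bigr => f _; rewrite e. Qed.

Lemma le_PE F G : (forall f, F f <= G f) -> PE mu F <= PE mu G.
Proof. by move=> e; apply: ler_sum => f _; rewrite ler_wpM2l ?PE_weight_ge0. Qed.

Lemma PE_ge0 F : (forall f, 0 <= F f) -> 0 <= PE mu F.
Proof. by move=> e; apply: sumr_ge0 => f _; rewrite mulr_ge0 ?PE_weight_ge0. Qed.

Lemma PE_prod (phi : I -> T -> R) :
  PE mu (fun f => \prod_i phi i (f i)) = \prod_i \sum_x mu i x * phi i x.
Proof.
rewrite bigA_distr_bigA; apply: eq_bigr => f _.
by rewrite big_split.
Qed.

Lemma PE1 : PE mu (fun=> 1) = 1.
Proof.
have := PE_prod (fun _ _ => 1).
rewrite (eq_PE (G := fun=> 1)); last by move=> f; rewrite big1.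
move=> ->; rewrite big1 // => i _.
by rewrite -[RHS](mu_pmf.2 i); apply: eq_bigr => x _; rewrite mulr1.
Qed.

Lemma PED F G : PE mu (fun f => F f + G f) = PE mu F + PE mu G.
Proof. by rewrite -big_split; apply: eq_bigr => f _; rewrite mulrDr. Qed.

Lemma PEZ (c : R) F : PE mu (fun f => c * F f) = c * PE mu F.
Proof. by rewrite /PE mulr_sumr; apply: eq_bigr => f _; rewrite mulrCA. Qed.

Lemma PEZr (c : R) F : PE mu (fun f => F f * c) = PE mu F * c.
Proof. by rewrite /PE mulr_suml; apply: eq_bigr => f _; rewrite mulrA. Qed.

Lemma PE_cst (c : R) : PE mu (fun=> c) = c.
Proof. by rewrite (eq_PE (G := fun=> c * 1)) ?PEZ ?PE1 ?mulr1 // => f; rewrite mulr1. Qed.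

Lemma PE_sum (J : Type) (r : seq J) (P : pred J) (F : J -> {ffun I -> T} -> R) :
  PE mu (fun f => \sum_(j <- r | P j) F j f) = \sum_(j <- r | P j) PE mu (F j).
Proof.
rewrite /PE exchange_big; apply: eq_bigr => f _.
by rewrite mulr_sumr.
Qed.

Lemma PE_markov F (x : R) : 0 < x -> (forall f, 0 <= F f) ->
  PE mu (fun f => (x <= F f)%R%:R) <= PE mu F / x.
Proof.
move=> x0 F0; rewrite -PEZr; apply: le_PE => f.
case: (boolP (x <= F f)) => h; last by rewrite mulr_ge0 // invr_ge0 ltW.
by rewrite ler_pdivlMr // mul1r.
Qed.

Lemma PE_markov_lt F (x : R) : 0 < x -> (forall f, 0 <= F f) ->
  PE mu (fun f => (x < F f)%R%:R) <= PE mu F / x.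
Proof.
move=> x0 F0; apply: le_trans (PE_markov x0 F0).
apply: le_PE => f; rewrite ler_nat; case: (ltP x (F f)) => // /ltW ->//.
Qed.

Lemma PE_coord (i : I) (phi : T -> R) :
  PE mu (fun f => phi (f i)) = \sum_x mu i x * phi x.
Proof.
rewrite (eq_PE (G := fun f => \prod_j (if j == i then phi (f j) else 1))).
  rewrite (PE_prod (fun j x => if j == i then phi x else 1)).
  rewrite (bigD1 i) //= eqxx [X in _ * X]big1 ?mulr1 // => j /negbTE ->.
  by rewrite -[RHS](mu_pmf.2 j); apply: eq_bigr => x _; rewrite mulr1.
move=> f; rewrite (bigD1 i) //= eqxx big1 ?mulr1 // => j /negbTE -> //.
Qed.

Lemma PE_coord2 (i j : I) (phi psi : T -> R) : i != j ->
  PE mu (fun f => phi (f i) * psi (f j)) =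
  (\sum_x mu i x * phi x) * (\sum_x mu j x * psi x).
Proof.
move=> ij.
rewrite (eq_PE (G := fun f => \prod_l
   (if l == i then phi (f l) else if l == j then psi (f l) else 1))).
  rewrite (PE_prod (fun l x => if l == i then phi x else if l == j then psi x else 1)).
  have ji : j != i by rewrite eq_sym.
  rewrite (bigD1 i) //= eqxx (bigD1 j) //= (negbTE ji) eqxx.
  rewrite [X in _ * (_ * X)]big1 ?mulr1 // => l /andP[/negbTE -> /negbTE ->].
  by rewrite -[RHS](mu_pmf.2 l); apply: eq_bigr => x _; rewrite mulr1.
have ji : j != i by rewrite eq_sym.
move=> f; rewrite (bigD1 i) //= eqxx (bigD1 j) //= (negbTE ji) eqxx.
by rewrite big1 ?mulr1 // => l /andP[/negbTE -> /negbTE ->].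
Qed.

End Basic.

(** Change of variables coordinate by coordinate. It serves resampling ([PE_mix]) and sprinkling
    ([GE_sprinkled]), where each coordinate is a function of two independent ones. *)
Lemma PE_push (T T' : finType) (nu : I -> T' -> R) (mu : I -> T -> R)
    (h : I -> T' -> T) (F : {ffun I -> T} -> R) :
  (forall i x, mu i x = \sum_(y | h i y == x) nu i y) ->
  PE nu (fun f => F [ffun i => h i (f i)]) = PE mu F.
Proof.
move=> muE.
rewrite /PE (partition_big (fun f : {ffun I -> T'} => [ffun i => h i (f i)]) predT) //=.
apply: eq_bigr => g _.
under eq_bigr => f /eqP -> do [].
rewrite -mulr_suml; congr (_ * _).
under [RHS]eq_bigr => i _ do rewrite muE.
rewrite (bigA_distr_big_dep (fun i y => h i y == g i)).
apply: eq_bigl => f; apply/eqP/familyP => [<- i|fg].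
  by rewrite /in_mem /= ffunE.
by apply/ffunP => i; rewrite ffunE; apply/eqP/fg.
Qed.

Lemma PE_pair (T T' : finType) (mu : I -> T -> R) (nu : I -> T' -> R)
    (F : {ffun I -> T} -> {ffun I -> T'} -> R) :
  PE mu (fun f => PE nu (F f)) =
  PE (fun i xy => mu i xy.1 * nu i xy.2)
     (fun f => F [ffun i => (f i).1] [ffun i => (f i).2]).
Proof.
rewrite /PE.
under eq_bigr => f _ do rewrite mulr_sumr.
rewrite pair_bigA /=.
rewrite (reindex (fun f : {ffun I -> T * T'} => ([ffun i => (f i).1], [ffun i => (f i).2]))) /=.
  apply: eq_bigr => f _; rewrite mulrA; congr (_ * _).
  by rewrite -big_split; apply: eq_bigr => i _; rewrite !ffunE.
exists (fun p : {ffun I -> T} * {ffun I -> T'} => [ffun i => (p.1 i, p.2 i)]).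
  by move=> f _; apply/ffunP => i; rewrite !ffunE -surjective_pairing.
by move=> [f g] _; congr (_, _); apply/ffunP => i; rewrite !ffunE.
Qed.

Definition depends_on (T : finType) (A : pred I) (F : {ffun I -> T} -> R) : Prop :=
  forall f g : {ffun I -> T}, (forall i, A i -> f i = g i) -> F f = F g.

(** Resampling the coordinates outside [A] does not change the law. Fixing [f] and averaging over
    [g] then plays the role of conditioning on the coordinates in [A]. *)
Lemma PE_mix (T : finType) (mu : I -> T -> R) (A : pred I)
    (F : {ffun I -> T} -> R) : is_pmf mu ->
  PE mu (fun f => PE mu (fun g => F [ffun i => if A i then f i else g i])) =
  PE mu F.
Proof.
move=> mu_pmf; rewrite PE_pair.
rewrite -(PE_push (h := fun i (xy : T * T) => if A i then xy.1 else xy.2)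
  (nu := fun i xy => mu i xy.1 * mu i xy.2)) /=.
  by apply: eq_PE => f; congr F; apply/ffunP => i; rewrite !ffunE.
move=> i x.
case: (A i).
  have -> : \sum_(y : T * T | y.1 == x) mu i y.1 * mu i y.2 =
      \sum_(y | y == x) \sum_y' mu i y * mu i y'.
    by rewrite pair_big; apply: eq_bigl => -[a b] /=; rewrite andbT.
  by rewrite big_pred1_eq -mulr_sumr mu_pmf.2 mulr1.
have -> : \sum_(y : T * T | y.2 == x) mu i y.1 * mu i y.2 =
    \sum_y \sum_(y' | y' == x) mu i y * mu i y'.
  by rewrite pair_big.
under eq_bigr => y _ do rewrite big_pred1_eq.
by rewrite -mulr_suml mu_pmf.2 mul1r.
Qed.

Lemma PE_indep (T : finType) (mu : I -> T -> R) (A B : pred I)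
    (F G : {ffun I -> T} -> R) : is_pmf mu ->
  depends_on A F -> depends_on B G -> (forall i, A i -> B i -> False) ->
  PE mu (fun f => F f * G f) = PE mu F * PE mu G.
Proof.
move=> mu_pmf dF dG AB.
rewrite -(PE_mix A (fun f => F f * G f) mu_pmf) -PEZr.
apply: eq_PE => f; rewrite -PEZ; apply: eq_PE => g; congr (_ * _).
  by apply: dF => i Ai; rewrite ffunE Ai.
by apply: dG => i Bi; rewrite ffunE; case: ifP => // Ai; case: (AB i).
Qed.

Lemma PE_indep_prod (T J : finType) (mu : I -> T -> R) (S : pred J) (B : J -> pred I)
    (F : J -> {ffun I -> T} -> R) : is_pmf mu ->
  (forall j, S j -> depends_on (B j) (F j)) ->
  (forall i j j', S j -> S j' -> B j i -> B j' i -> j = j') ->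
  PE mu (fun f => \prod_(j | S j) F j f) = \prod_(j | S j) PE mu (F j).
Proof.
move=> mu_pmf dF dB.
rewrite -[RHS]big_filter (eq_PE _ (G := fun f => \prod_(j <- [seq l <- index_enum J | S l]) F j f));
  last by move=> f; rewrite big_filter.
have: {in [seq l <- index_enum J | S l], forall j, S j} by move=> j; rewrite mem_filter => /andP[].
have: uniq ([seq l <- index_enum J | S l]) by rewrite filter_uniq ?index_enum_uniq.
elim: [seq l <- index_enum J | S l] => [_ _|j s IH /= /andP[js us] sS].
  by rewrite big_nil (eq_PE _ (G := fun=> 1)) ?PE1 // => f; rewrite big_nil.
rewrite big_cons -IH //; last by move=> l ls; apply: sS; rewrite inE ls orbT.
rewrite (eq_PE _ (G := fun f => F j f * \prod_(l <- s) F l f));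
  last by move=> f; rewrite big_cons.
have Sj : S j by apply: sS; rewrite inE eqxx.
apply: (@PE_indep T mu (B j) (fun i => has (fun l => B l i) s)) => //.
- exact: dF.
- move=> f g fg; rewrite big_seq [RHS]big_seq; apply: eq_bigr => l ls.
  apply: dF; first by apply: sS; rewrite inE ls orbT.
  by move=> i Bi; apply: fg; apply/hasP; exists l.
- move=> i Bi /hasP[l ls Bli].
  have e : j = l by apply: (dB i) => //; apply: sS; rewrite inE ls orbT.
  by rewrite e ls in js.
Qed.

End FiniteProduct.

(** * Independent Bernoulli coordinates *)

Section Bernoulli.
Variables (R : realFieldType) (I : finType).

Definition bern (q : I -> R) (i : I) (x : bool) : R := if x then q i else 1 - q i.

Lemma bern_pmf (q : I -> R) : (forall i, 0 <= q i <= 1) -> is_pmf (bern q).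
Proof.
move=> q01; split=> [i [] /=|i]; rewrite /bern ?subr_ge0; try by case/andP: (q01 i).
by rewrite big_bool /= addrC subrK.
Qed.

Lemma PE_bern_coord (q : I -> R) i : (forall i, 0 <= q i <= 1) ->
  PE (bern q) (fun f => (f i)%:R) = q i.
Proof.
move=> q01; rewrite (PE_coord (bern_pmf q01) i (fun x : bool => x%:R)).
by rewrite big_bool /bern /= mulr1 mulr0 addr0.
Qed.

Lemma PE_bern_coord2 (q : I -> R) i j : (forall i, 0 <= q i <= 1) -> i != j ->
  PE (bern q) (fun f => (f i)%:R * (f j)%:R) = q i * q j.
Proof.
move=> q01 ij.
rewrite (PE_coord2 (bern_pmf q01) (fun x : bool => x%:R) (fun x : bool => x%:R) ij).
by rewrite !big_bool /bern /= !mulr1 !mulr0 !addr0.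
Qed.

Lemma PE_none (q : I -> R) (S : pred I) : (forall i, 0 <= q i <= 1) ->
  PE (bern q) (fun f => [forall i, S i ==> ~~ f i]%:R) = \prod_(i | S i) (1 - q i).
Proof.
move=> q01.
rewrite (eq_PE _ (G := fun f => \prod_i (if S i then (~~ f i)%:R else 1))).
  rewrite (PE_prod _ (fun i x => if S i then (~~ x)%:R else 1)).
  rewrite [RHS]big_mkcond; apply: eq_bigr => i _; rewrite big_bool /bern /=.
  by case: ifP => _ /=; rewrite ?mulr0 ?mulr1 ?add0r // addrC subrK.
move=> f; case: (boolP [forall i, _]) => [/forallP h|].
  by rewrite big1 // => i _; have := h i; case: (S i) => //= ->.
rewrite negb_forall => /existsP[i]; rewrite negb_imply negbK => /andP[Si fi].
by rewrite (bigD1 i) //= Si fi mul0r.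
Qed.

End Bernoulli.

(** * Spreading of the rumour on a fixed graph *)

Section Spread.
Variables (V : finType) (contact : nat -> rel V).
Implicit Types (t r : nat) (A B : {set V}).

(** [informed] with an arbitrary starting round [t] and starting set [A], so that runs of the
    protocol can be concatenated ([spread_cat]). *)
Fixpoint spread t A r : {set V} :=
  if r is r'.+1 then
    let J := spread t A r' in
    (J :|: [set y | [exists x in J, contact (t + r')%N x y || contact (t + r')%N y x]])%SET
  else A.

Lemma informed_spread x r : informed contact x r = spread 0 [set x]%SET r.
Proof. by elim: r => //= r ->; rewrite add0n. Qed.

Lemma spreadS t A B r : A \subset B -> spread t A r \subset spread t B r.
Proof.
move=> AB; elim: r => //= r IH; apply/fintype.subsetP => y; rewrite !inE.
case/orP => [yA|/existsP[x /andP[xA xy]]]; first by rewrite (fintype.subsetP IH).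
by apply/orP; right; apply/existsP; exists x; rewrite (fintype.subsetP IH _ xA).
Qed.

Lemma spread_cat t A r1 r2 :
  spread t A (r1 + r2) = spread (t + r1) (spread t A r1) r2.
Proof. by elim: r2 => [|r2 IH]; rewrite ?addn0 // addnS /= IH addnA. Qed.

Lemma spread_sub t A r r' : (r <= r')%N -> spread t A r \subset spread t A r'.
Proof.
move=> /subnKC <-; rewrite spread_cat; elim: (r' - r)%N => //= s IH.
by apply: fintype.subset_trans IH _; apply: finset.subsetUl.
Qed.

Lemma spread_step t A r r' x y : (r < r')%N -> x \in spread t A r ->
  contact (t + r)%N x y || contact (t + r)%N y x -> y \in spread t A r'.
Proof.
move=> rr' xA xy; apply: (fintype.subsetP (spread_sub t A rr')); rewrite /= !inE.
by apply/orP; right; apply/existsP; exists x; rewrite xA.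
Qed.

End Spread.

Lemma eq_spread (V : finType) (c c' : nat -> rel V) t A r :
  (forall s x y, (t <= s < t + r)%N -> c s x y = c' s x y) ->
  spread c t A r = spread c' t A r.
Proof.
elim: r => //= r IH h; rewrite IH; last first.
  by move=> s x y ?; apply: h; lia.
congr (_ :|: _)%SET; apply/setP => y; rewrite !inE; apply: eq_existsb => x.
by rewrite !h; lia.
Qed.

Section PushPull.
Variables (R : realFieldType) (V : finType) (T : nat) (g : rel V).
Hypothesis gsym : symmetric g.

(* An isolated vertex makes no choice; its coordinate is fixed to itself so
   that the law stays a probability. *)
Definition choice_law (e : 'I_T * V) (y : V) : R :=
  if (0 < #|g e.2|)%N then (g e.2 y)%:R / #|g e.2|%:R else (y == e.2)%:R.

Lemma choice_law_pmf : is_pmf choice_law.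
Proof.
split=> [e y|e]; rewrite /choice_law; case: (boolP (0 < #|g e.2|)%N) => h //.
  rewrite -mulr_suml -(natr_sum R).
  have -> : (\sum_(i : V) g e.2 i)%N = #|g e.2|.
    rewrite -sum1_card [RHS]big_mkcond; apply: eq_bigr => i _.
    by rewrite unfold_in; case: (g _ _).
  by rewrite divff // pnatr_eq0 -lt0n.
by rewrite (bigD1 e.2) //= eqxx big1 ?addr0 // => y /negbTE ->.
Qed.

(** Choices are drawn for [T] rounds only; later rounds carry no contact, hence the bound on
    [t0 + r] in [spreads]. *)
Definition pp_contact (f : {ffun 'I_T * V -> V}) (t : nat) : rel V :=
  fun x y => if insub t is Some t' then g x y && (f (t', x) == y) else false.

Lemma pp_contactE f (t : 'I_T) x y :
  pp_contact f t x y = g x y && (f (t, x) == y).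
Proof. by rewrite /pp_contact valK. Qed.

(* Uniform in the starting round t0, so that error bounds add up along paths.
   *)
Definition spreads (r : nat) (e : R) (x y : V) : Prop :=
  forall t0, (t0 + r <= T)%N ->
  PE choice_law (fun f => (y \notin spread (pp_contact f) t0 [set x]%SET r)%:R) <= e.

Lemma spreads_le r e e' x y : e <= e' -> spreads r e x y -> spreads r e' x y.
Proof. by move=> ee h t0 tT; apply: le_trans ee; apply: h. Qed.

Lemma spreads_refl r e x : 0 <= e -> spreads r e x x.
Proof.
move=> e0 t0 _.
rewrite (eq_PE _ (G := fun=> 0)) ?(PE_cst choice_law_pmf) // => f.
by rewrite (fintype.subsetP (spread_sub _ _ _ (leq0n r))) //= inE.
Qed.

(** Union bound: if the first stage informs [y], the second one, restarted from [y] alone at round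
    [t0 + r], can only inform fewer vertices than the true process. No independence of the stages is
    used. *)
Lemma spreads_comp r r' e e' x y z :
  spreads r e x y -> spreads r' e' y z -> spreads (r + r') (e + e') x z.
Proof.
move=> h h' t0 tT.
have t1 : (t0 + r <= T)%N by lia.
have t2 : (t0 + r + r' <= T)%N by lia.
apply: le_trans (lerD (h t0 t1) (h' (t0 + r)%N t2)).
rewrite -PED; apply: (le_PE choice_law_pmf) => f; rewrite -natrD ler_nat.
rewrite spread_cat.
case: (boolP (y \in _)) => [yin|_]; last by case: (_ \notin _); case: (_ \notin _).
case: (boolP (z \in spread (pp_contact f) (t0 + r) [set y]%SET r')) => [zin|_];
  last by case: (_ \notin _).
by rewrite (fintype.subsetP (spreadS _ _ _ _) _ zin) // finset.sub1set.
Qed.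

Lemma PE_choice (t : 'I_T) z x : g z x ->
  PE choice_law (fun f => (f (t, z) == x)%:R) = (#|g z|%:R)^-1.
Proof.
move=> gzx; rewrite (PE_coord choice_law_pmf (t, z) (fun v => (v == x)%:R)).
rewrite (bigD1 x) //= eqxx big1 ?addr0 ?mulr1; last first.
  by move=> y /negbTE ->; rewrite mulr0.
rewrite /choice_law /= ifT ?gzx ?mul1r //.
by apply/card_gt0P; exists x.
Qed.

Lemma PE_choice2 (t s : 'I_T) z x y : t != s -> g z x -> g z y ->
  PE choice_law (fun f => (f (t, z) == x)%:R * (f (s, z) == y)%:R) = (#|g z|%:R)^-2.
Proof.
move=> ts gzx gzy.
have tsz : (t, z) != (s, z) by rewrite xpair_eqE (negbTE ts).
rewrite (PE_coord2 choice_law_pmf (fun v => (v == x)%:R) (fun v => (v == y)%:R) tsz).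
rewrite -(PE_coord choice_law_pmf (t, z) (fun v => (v == x)%:R)).
rewrite -(PE_coord choice_law_pmf (s, z) (fun v => (v == y)%:R)).
by rewrite !PE_choice // -exprVn expr2.
Qed.

(** Only the choices of the endpoint of low degree are used: it pushes if it is [x] and pulls if it
    is [y]. Its choices in the [r] rounds are independent, each hitting the other endpoint with
    probability at least [Dl%:R^-1]. *)
Lemma spreads_link r (Dl : nat) x y : g x y ->
  (#|g x| <= Dl)%N || (#|g y| <= Dl)%N ->
  spreads r ((1 - Dl%:R^-1) ^+ r) x y.
Proof.
move=> gxy dg t0 tT.
have [z [w [gzw dz hzw]]] : exists z w, [/\ g z w, (#|g z| <= Dl)%N &
    (z = x /\ w = y) \/ (z = y /\ w = x)].
  case/orP: dg => h; first by exists x, y; split=> //; left.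
  by exists y, x; rewrite gsym; split=> //; right.
have lt (j : 'I_r) : (t0 + j < T)%N by have := ltn_ord j; lia.
apply: (@le_trans _ _ (PE choice_law (fun f => \prod_(j : 'I_r | predT j)
   (1 - (f (Ordinal (lt j), z) == w)%:R)))).
  apply: (le_PE choice_law_pmf) => f.
  case: (boolP (y \in _)) => /= [_|yn].
    by apply: prodr_ge0 => j _; rewrite subr_ge0 lern1; case: (_ == _).
  rewrite big1 // => j _; case: eqP => [e|_]; last by rewrite subr0.
  case/negP: yn; apply: (@spread_step _ _ _ _ j r x) => //.
    by rewrite (fintype.subsetP (spread_sub _ _ _ (leq0n j))) //= inE.
  rewrite -[(t0 + j)%N]/(val (Ordinal (lt j))) !pp_contactE.
  by case: hzw => -[<- <-]; rewrite gzw e eqxx ?orbT.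
rewrite (PE_indep_prod (B := fun j e => e == (Ordinal (lt j), z)) choice_law_pmf).
- apply: (@le_trans _ _ (\prod_(j : 'I_r | predT j) (1 - Dl%:R^-1))); last first.
    by rewrite prodr_const card_ord.
  have dz0 : (0 < #|g z|)%N by apply/card_gt0P; exists w.
  apply: ler_prod => j _; rewrite PED (PE_cst choice_law_pmf).
  rewrite (eq_PE _ (G := fun f : {ffun _ -> _} => (-1) * (f (Ordinal (lt j), z) == w)%:R)); last by move=> f; rewrite mulN1r.
  rewrite PEZ PE_choice // mulN1r subr_ge0 invf_le1 ?ltr0n // ler1n dz0 /=.
  by rewrite lerD2l lerN2 lef_pV2 ?posrE ?ltr0n ?ler_nat // (leq_trans dz0).
- by move=> j _ f f' h; rewrite h.
- move=> i j j' _ _ /eqP -> /eqP[e]; apply/val_inj/eqP; move/eqP: e.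
  by rewrite eqn_add2l.
Qed.

(** A common neighbour [z] that chooses [x] in the first round and [y] in the second carries the
    rumour across. Only the degree of [z] matters, so [x] and [y] may be hubs of huge degree, and
    distinct [z] act independently. *)
Lemma spreads_hop (m Dl : nat) x y :
  (m <= #|[pred z | [&& g z x, g z y & (#|g z| <= Dl)%N]]|)%N ->
  spreads 2 ((1 - Dl%:R^-2) ^+ m) x y.
Proof.
set S := [pred z | _] => mS t0 tT.
have lt0 : (t0 < T)%N by lia.
have lt1 : (t0.+1 < T)%N by lia.
pose a := Ordinal lt0; pose b := Ordinal lt1.
have ab : a != b by rewrite -val_eqE /=; lia.
apply: (@le_trans _ _ (PE choice_law (fun f => \prod_(z | S z)
   (1 - (f (a, z) == x)%:R * (f (b, z) == y)%:R)))).
  apply: (le_PE choice_law_pmf) => f.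
  case: (boolP (y \in _)) => [_|yn].
    by apply: prodr_ge0 => z _; rewrite subr_ge0 -natrM lern1; do 2!case: (_ == _).
  rewrite big1 // => z /and3P[gzx gzy _].
  case: eqP => [e|_]; last by rewrite mul0r subr0.
  case: eqP => [e'|_]; last by rewrite mulr0 subr0.
  case/negP: yn; apply: (@spread_step _ _ _ _ 1 2 z) => //; last first.
    rewrite addn1 -[t0.+1]/(val b) !pp_contactE gzy e' eqxx //.
  apply: (@spread_step _ _ _ _ 0 1 x); rewrite ?inE // addn0.
  by rewrite -[t0]/(val a) !pp_contactE gzx e eqxx orbT.
rewrite (PE_indep_prod (B := fun z e => e.2 == z) choice_law_pmf).
(* For [m = 0] the claimed bound is 1 and nothing prevents [Dl] from being 0. *)
- have [->|m0] := posnP m.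
    rewrite expr0; apply: (@le_trans _ _ (\prod_(z | S z) 1)); last by rewrite big1.
    apply: ler_prod => z /and3P[gzx gzy dz].
    rewrite PED (PE_cst choice_law_pmf).
    rewrite (eq_PE _ (G := fun f : {ffun _ -> _} => (-1) * ((f (a, z) == x)%:R * (f (b, z) == y)%:R))); last by move=> f; rewrite mulN1r.
    rewrite PEZ PE_choice2 // mulN1r subr_ge0 gerBl invr_ge0 exprn_ge0 // andbT.
    have dz0 : (0 < #|g z|)%N by apply/card_gt0P; exists x.
    by rewrite invf_le1 ?exprn_gt0 ?ltr0n // exprn_ege1 // ler1n.
  have Dl0 : (0 < Dl)%N.
    have /card_gt0P[z /and3P[gzx gzy]] : (0 < #|S|)%N by apply: leq_trans mS.
    by apply: leq_trans; apply/card_gt0P; exists x.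
  apply: (@le_trans _ _ (\prod_(z | S z) (1 - Dl%:R^-2))).
    apply: ler_prod => z /and3P[gzx gzy dz].
    rewrite PED (PE_cst choice_law_pmf).
    rewrite (eq_PE _ (G := fun f : {ffun _ -> _} => (-1) * ((f (a, z) == x)%:R * (f (b, z) == y)%:R))); last by move=> f; rewrite mulN1r.
    rewrite PEZ PE_choice2 // mulN1r subr_ge0.
    have dz0 : (0 < #|g z|)%N by apply/card_gt0P; exists x.
    rewrite invf_le1 ?exprn_gt0 ?ltr0n // exprn_ege1 ?ler1n //=.
    by rewrite lerD2l lerN2 lef_pV2 ?posrE ?exprn_gt0 ?ltr0n // lerXn2r ?nnegrE // ler_nat.
  rewrite prodr_const; apply: ler_wiXn2l; last exact: mS.
    by rewrite subr_ge0 invf_le1 ?exprn_gt0 ?ltr0n // exprn_ege1 // ler1n.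
  by rewrite gerBl invr_ge0 exprn_ge0.
- move=> z _ f f' h; rewrite !h //=.
- by move=> i z z' _ _ /eqP <- /eqP.
Qed.

End PushPull.

(** * A Chernoff bound from joint moments *)

Section Chernoff.
Variables (R : realType).

Lemma expRN1_le : expR (- 1) <= 2^-1 :> R.
Proof.
rewrite expRN lef_pV2 ?posrE ?expR_gt0 //.
by apply: le_trans (expR_ge1Dx _); rewrite -natr1.
Qed.

Lemma half_le_expR : 2^-1 <= expR (- 2^-1) :> R.
Proof. by apply: le_trans (expR_ge1Dx _); lra. Qed.

Lemma half_expn_le (x : nat) : 2^-1 ^+ x <= expR (- (x%:R / 2)) :> R.
Proof.
have -> : - (x%:R / 2) = x%:R * (- 2^-1) :> R by lra.
rewrite expRM_natl.
by rewrite lerXn2r ?nnegrE ?invr_ge0 ?expR_ge0 // half_le_expR.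
Qed.

Lemma onem_le_expRN (x : R) : 1 - x <= expR (- x).
Proof. by have := expR_ge1Dx (- x). Qed.

Lemma chernoff_count (O : Type) (E : (O -> R) -> R) (J : finType) (S : {set J})
    (X : J -> O -> bool) (p : R) (x : nat) : 0 <= p ->
  (forall F G : O -> R, (forall w, F w <= G w) -> E F <= E G) ->
  (forall (c : R) F, E (fun w => c * F w) = c * E F) ->
  (forall (A : finType) (F : A -> O -> R),
     E (fun w => \sum_(a : A) F a w) = \sum_(a : A) E (F a)) ->
  (forall B : {set J}, B \subset S ->
     E (fun w => \prod_(j in B) (X j w)%:R) <= p ^+ #|B|) ->
  E (fun w => (x <= \sum_(j in S) X j w)%N%:R)
    <= expR (p * #|S|%:R - x%:R / 2).
Proof.
move=> p0 Ele EZ Esum EX.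
pose Y j w : R := (j \in S)%:R * (X j w)%:R.
have EY (B : {set J}) : E (fun w => \prod_i (if i \in B then Y i w else 1)) <=
    \prod_i (if i \in B then (i \in S)%:R * p else 1).
  case: (boolP (B \subset S)) => BS; last first.
    case/fintype.subsetPn: BS => j jB jS.
    have e0 (w : O) : \prod_i (if i \in B then Y i w else 1) = 0.
      by rewrite (bigD1 j) //= jB /Y (negbTE jS) !mul0r.
    rewrite [X in _ <= X](bigD1 j) //= jB (negbTE jS) !mul0r.
    apply: le_trans (Ele _ (fun w => 0 * 0) _) _; last by rewrite EZ mul0r.
    by move=> w; rewrite e0 mul0r.
  rewrite -big_mkcond /= (eq_bigr (fun=> p)); last first.
    by move=> i iB; rewrite (fintype.subsetP BS) ?mul1r.
  rewrite prodr_const; apply: le_trans (EX B BS).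
  apply: Ele => w; rewrite -big_mkcond /=; apply: ler_prod => i iB.
  by rewrite /Y (fintype.subsetP BS) // mul1r lexx andbT.
have step1 : E (fun w => (x <= \sum_(j in S) X j w)%N%:R) <=
   2^-1 ^+ x * \prod_(j : J) (1 + (j \in S)%:R * p).
  under [X in _ <= _ * X]eq_bigr do rewrite addrC.
  rewrite bigA_distr.
  apply: (@le_trans _ _ (2^-1 ^+ x * \sum_(B : {set J}) E (fun w => \prod_i (if i \in B then Y i w else 1)))); last first.
    by rewrite ler_wpM2l ?exprn_ge0 ?invr_ge0 //; apply: ler_sum => B _; apply: EY.
  rewrite -Esum -EZ; apply: Ele => w.
  rewrite -bigA_distr.
  have -> : \prod_i (Y i w + 1) = 2 ^+ (\sum_(j in S) X j w)%N.
    rewrite (big_morph (GRing.exp (2 : R)) (exprD 2) (expr0 2)) [RHS]big_mkcond /=.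
    apply: eq_bigr => j _; rewrite /Y; case: (j \in S); rewrite ?mul0r ?add0r // mul1r.
    by case: (X j w); rewrite ?expr1 ?expr0 ?add0r //= -[in RHS](natrD _ 1 1).
  case: leqP => h; last by rewrite mulr_ge0 ?exprn_ge0 ?invr_ge0.
  rewrite exprVn mulrC ler_pdivlMr ?exprn_gt0 // mul1r.
  by rewrite ler_eXn2l // ltr1n.
apply: (le_trans step1).
rewrite expRD mulrC; apply: ler_pM => //.
- by apply: prodr_ge0 => j _; rewrite addr_ge0 ?mulr_ge0.
- rewrite mulr_natr -[p *+ _]mulr_natl expRM_natl -prodr_const [X in _ <= X]big_mkcond /=.
  apply: ler_prod => j _; case: (j \in S); rewrite ?mul1r ?mul0r ?addr0 ?lexx ?ler01 //.
  by rewrite addr_ge0 // expR_ge1Dx.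
- exact: half_expn_le.
Qed.

End Chernoff.

(** * Random graphs with independent edges *)

Section RandomGraph.
Variables (R : realType) (k : nat).
Implicit Types (i j v y h : 'I_k).

(* Edges are indexed by pairs (i, j) with i < j; the other coordinates are
   never open (see [edge_law]). *)
Definition ed i j : 'I_k * 'I_k := if (i < j)%N then (i, j) else (j, i).

Lemma edC i j : ed i j = ed j i.
Proof.
rewrite /ed; case: (ltngtP i j) => // /val_inj ->//.
Qed.

Lemma ed_inj i j i' j' : ed i j = ed i' j' ->
  (i = i' /\ j = j') \/ (i = j' /\ j = i').
Proof. by rewrite /ed; do 2!case: ifP => _; case=> -> ->; [left|right|right|left]. Qed.

Definition adjf (f : {ffun 'I_k * 'I_k -> bool}) : rel 'I_k :=
  fun i j => (i != j) && f (ed i j).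

Lemma adjfC f : symmetric (adjf f).
Proof. by move=> i j; rewrite /adjf edC eq_sym. Qed.

Lemma adjf_irr f : irreflexive (adjf f).
Proof. by move=> i; rewrite /adjf eqxx. Qed.

Definition edge_law (q : 'I_k -> 'I_k -> R) (e : 'I_k * 'I_k) : R :=
  if (e.1 < e.2)%N then q e.1 e.2 else 0.

Definition edge_prob (q : 'I_k -> 'I_k -> R) : Prop :=
  (forall i j, q i j = q j i) /\ (forall i j, 0 <= q i j <= 1).

Lemma edge_law01 q : edge_prob q -> forall e, 0 <= edge_law q e <= 1.
Proof. by move=> [_ q01] e; rewrite /edge_law; case: ifP; rewrite ?lexx ?ler01. Qed.

Lemma edge_law_ed q i j : edge_prob q -> i != j -> edge_law q (ed i j) = q i j.
Proof.
move=> [qC _] ij; rewrite /ed /edge_law; case: (ltngtP i j) => /= [->|->|/val_inj/eqP]//.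
by rewrite (negbTE ij).
Qed.

Definition GE q F := PE (bern (edge_law q)) F.

Lemma GE_pmf q : edge_prob q -> is_pmf (bern (edge_law q)).
Proof. by move=> /edge_law01/bern_pmf. Qed.

Lemma GE_adj q i j : edge_prob q -> i != j ->
  GE q (fun f => (adjf f i j)%:R) = q i j.
Proof.
move=> qp ij; rewrite -[RHS](edge_law_ed qp ij).
rewrite -(PE_bern_coord (ed i j) (edge_law01 qp)).
by apply: eq_PE => f; rewrite /adjf ij.
Qed.

Lemma GE_adj2 q i j j' : edge_prob q -> i != j -> i != j' -> j != j' ->
  GE q (fun f => (adjf f i j)%:R * (adjf f i j')%:R) = q i j * q i j'.
Proof.
move=> qp ij ij' jj'; rewrite -(edge_law_ed qp ij) -(edge_law_ed qp ij').
rewrite -(PE_bern_coord2 (edge_law01 qp)); last first.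
  apply/eqP => /ed_inj[[_ /eqP]|[/eqP]]; rewrite ?(negbTE jj') //.
  by rewrite (negbTE ij').
by apply: eq_PE => f; rewrite /adjf ij ij'.
Qed.

Section Connectors.
Variables (q : 'I_k -> 'I_k -> R) (h h' : 'I_k) (Y : pred 'I_k) (q1 q2 : R).
Hypotheses (qp : edge_prob q) (hh' : h != h').
Hypothesis Yh : forall y, Y y -> y != h /\ y != h'.
Hypotheses (q10 : 0 <= q1) (q20 : 0 <= q2).
Hypothesis q1P : forall y, Y y -> q1 <= q y h.
Hypothesis q2P : forall y, Y y -> q2 <= q y h'.

Definition connector_edges (e : 'I_k * 'I_k) : bool :=
  [exists y, Y y && ((e == ed y h) || (e == ed y h'))].

Definition connectors f : pred 'I_k := fun y => adjf f y h && adjf f y h'.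

(** Distinct [y] use disjoint pairs of edges, and [W] ignores all of these, so given the other edges
    the connectors in [W] are independent, each with probability at least [q1 * q2]. The bound is
    Markov for exp(m - count), with exp(-1) at most 1/2. *)
Lemma connectors_few (W : {ffun 'I_k * 'I_k -> bool} -> pred 'I_k) (m y0 : R) :
  (forall f f' : {ffun 'I_k * 'I_k -> bool}, (forall e, ~~ connector_edges e -> f e = f' e) -> W f = W f') ->
  (forall f y, W f y -> Y y) ->
  GE q (fun f => ((#|[pred y | W f y && connectors f y]|%:R < m)
            && (y0 <= #|W f|%:R))%R%:R) <= expR (m - y0 * q1 * q2 / 2).
Proof.
move=> dW WY.
rewrite /GE -(PE_mix (predC connector_edges) _ (GE_pmf qp)).
apply: le_trans (_ : PE (bern (edge_law q)) (fun=> expR (m - y0 * q1 * q2 / 2)) <= _);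
  last by rewrite PE_cst //; exact: GE_pmf.
apply: (le_PE (GE_pmf qp)) => f.
pose mixf (g : {ffun 'I_k * 'I_k -> bool}) : {ffun 'I_k * 'I_k -> bool} :=
  [ffun i => if predC connector_edges i then f i else g i].
rewrite (eq_PE _ (G := fun g => ((#|[pred y | W (mixf g) y && connectors (mixf g) y]|%:R < m)
   && (y0 <= #|W (mixf g)|%:R))%R%:R)) //.
have WE g : W (mixf g) = W f.
  by apply: dW => e ne; rewrite ffunE /= ne.
case: (leP y0 #|W f|%:R) => yW; last first.
  rewrite (eq_PE _ (G := fun=> 0)) ?PE_cst ?expR_ge0 //; first exact: GE_pmf.
  by move=> g; rewrite WE leNgt yW andbF.
have adjE g y v : W f y -> (v == h) || (v == h') -> adjf (mixf g) y v = g (ed y v).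
  move=> Wy vh; have [yh yh'] := Yh (WY _ _ Wy).
  rewrite /adjf; have -> : y != v by case/orP: vh => /eqP ->.
  rewrite ffunE /= ifN // negbK; apply/existsP; exists y; rewrite (WY _ _ Wy) /=.
  by case/orP: vh => /eqP ->; rewrite eqxx ?orbT.
pose Z (g : {ffun 'I_k * 'I_k -> bool}) y : R := 1 - 2^-1 * ((g (ed y h))%:R * (g (ed y h'))%:R).
have Z0 (g : {ffun 'I_k * 'I_k -> bool}) y : 0 <= Z g y.
  by rewrite /Z; case: (g _); case: (g _) => /=; lra.
apply: (@le_trans _ _ (PE (bern (edge_law q)) (fun g => expR m * \prod_(y | W f y) Z g y))).
  apply: (le_PE (GE_pmf qp)) => g; rewrite WE yW andbT.
  case: ltP => h1 /=; last by rewrite mulr_ge0 ?expR_ge0 ?prodr_ge0.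
  apply: (@le_trans _ _ (expR m * \prod_(y | W f y) expR (- (connectors (mixf g) y)%:R))); last first.
    rewrite ler_wpM2l ?expR_ge0 //; apply: ler_prod => y Wy; rewrite expR_ge0 /=.
    rewrite /connectors !(adjE _ _ _ Wy) ?eqxx ?orbT // /Z.
    have e1 : expR (- 1) <= 1 - 2^-1 * (1 * 1) :> R by have := expRN1_le R; lra.
    by case: (g (ed y h)); case: (g (ed y h')) => /=; rewrite ?(mulr1n, mulr0n, mulr0, mul0r, subr0, oppr0, expR0).
  rewrite -expR_sum -expRD -[X in X <= _]expR0 ler_expR sumrN subr_ge0.
  rewrite -natr_sum; apply: le_trans (ltW h1).
  rewrite ler_nat -sum1_card big_mkcondr /=; apply: leq_sum => y _.
  by case: (connectors _ _).
rewrite PEZ expRD ler_wpM2l ?expR_ge0 //.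
rewrite (PE_indep_prod (B := fun y e => (e == ed y h) || (e == ed y h')) (GE_pmf qp)); first last.
- move=> e y y' Wy Wy'; have [yh yh'] := Yh (WY _ _ Wy); have [y'h y'h'] := Yh (WY _ _ Wy').
  case/orP => /eqP -> /orP[] /eqP/ed_inj [[]|[]] //.
  + by move=> e1 _; rewrite e1 eqxx in yh.
  + by move=> e1 _; rewrite e1 eqxx in yh'.
  + by move=> e1 _; rewrite e1 eqxx in yh.
  + by move=> e1 _; rewrite e1 eqxx in yh'.
- by move=> y Wy g g' gg; rewrite /Z !gg ?eqxx ?orbT.
apply: (@le_trans _ _ (\prod_(y | W f y) expR (- (q1 * q2 / 2)))).
  apply: ler_prod => y Wy; have [yh yh'] := Yh (WY _ _ Wy).
  rewrite PE_ge0 //; last exact: GE_pmf.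
  apply: le_trans (onem_le_expRN _).
  rewrite (eq_PE _ (G := fun g : {ffun 'I_k * 'I_k -> bool} => 1 + (- 2^-1) * ((g (ed y h))%:R * (g (ed y h'))%:R))); last first.
    by move=> g; rewrite /Z mulNr.
  rewrite PED PE_cst; last exact: GE_pmf.
  rewrite PEZ PE_bern_coord2; last 2 first.
  - exact: edge_law01.
  - apply/eqP => /ed_inj[[_ /eqP]|[/eqP]]; rewrite ?(negbTE hh') //.
    by rewrite (negbTE yh').
  rewrite !edge_law_ed // mulNr lerD2l lerN2 mulrC ler_wpM2l //.
  by apply: ler_pM => //; [apply: q1P|apply: q2P]; apply: WY Wy.
rewrite prodr_const -expRM_natl ler_expR mulrN lerN2.
have := ler_wpM2r (mulr_ge0 q10 q20) yW.
by have -> : #|[pred y | W f y]| = #|W f| by []; lra.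
Qed.

(* Counts potential neighbours outside the edges towards h and h', so it is
   independent of the event that y is a connector.  The relation sm adds the
   vertices of the same small box, which majorises the sprinkled edges. *)
Definition outer_degree (sm : rel 'I_k) f y : nat :=
  #|[pred v | [&& v != y, v != h, v != h' & adjf f y v || sm y v]]|.

(** If the total outer degree over [Y] is below [M], at most [M / Dl%:R] vertices exceed [Dl], so at
    least [y0] remain for [connectors_few]. The total is controlled by Markov, which gives the first
    error term. *)
Lemma connectors_few_low (sm : rel 'I_k) (K : 'I_k -> 'I_k -> R) (Dl : nat) (m y0 M : R) :
  (forall y v, y != v -> q y v + (sm y v)%:R <= K y v) ->
  0 < M -> (0 < Dl)%N -> y0 + M / Dl%:R <= #|Y|%:R ->
  GE q (fun f => (#|[pred y | [&& Y y, connectors f y & (outer_degree sm f y <= Dl)%N]]|%:R < m)%R%:R)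
   <= (\sum_(y | Y y) \sum_(v | (v != y) && (v != h)) K y v) / M
      + expR (m - y0 * q1 * q2 / 2).
Proof.
move=> KP M0 Dl0 YM.
pose W f : pred 'I_k := fun y => Y y && (outer_degree sm f y <= Dl)%N.
pose tot f : R := \sum_(y | Y y) (outer_degree sm f y)%:R.
apply: (@le_trans _ _ (GE q (fun f => (M <= tot f)%R%:R) + expR (m - y0 * q1 * q2 / 2))); last first.
  rewrite lerD2r; apply: le_trans (PE_markov (GE_pmf qp) M0 _) _.
    by move=> f; apply: sumr_ge0 => y _.
  rewrite ler_wpM2r ?invr_ge0 ?(ltW M0) //.
  rewrite /tot PE_sum; apply: ler_sum => y Yy.
  apply: (@le_trans _ _ (GE q (fun f => \sum_(v | (v != y) && (v != h)) ((adjf f y v)%:R + (sm y v)%:R)))).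
    apply: (le_PE (GE_pmf qp)) => f; rewrite /outer_degree -sum1_card natr_sum.
    rewrite [X in X <= _]big_mkcond [X in _ <= X]big_mkcond; apply: ler_sum => v _ /=.
    rewrite inE; case: (v != y); case: (v != h) => //=; last first.
    by case: (v != h') => //=; case: (adjf f y v); case: (sm y v); rewrite /= ?addr0 ?add0r ?lexx ?ler01 // ?lerDl ?ler01 // addr_ge0.
  rewrite /GE PE_sum; apply: ler_sum => v /andP[vy vh].
  rewrite PED PE_cst; last exact: GE_pmf.
  have yv : y != v by rewrite eq_sym.
  by rewrite -[X in X + _]/(GE q (fun f => (adjf f y v)%:R)) GE_adj //; apply: KP.
apply: le_trans (lerD (lexx _) (@connectors_few W m y0 _ _)).
- rewrite -PED; apply: (le_PE (GE_pmf qp)) => f.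
  have -> : #|[pred y | W f y && connectors f y]| =
      #|[pred y | [&& Y y, connectors f y & (outer_degree sm f y <= Dl)%N]]|.
    by apply: eq_card => y; rewrite !inE /W -andbA; congr (_ && _); rewrite andbC.
  case: (ltP _ m) => //= _; last by rewrite addr0 ler0n.
  case: (leP M (tot f)) => tM; first by rewrite lerDl.
  suff -> : y0 <= #|W f|%:R by rewrite lerDr.
  apply: le_trans (_ : #|Y|%:R - M / Dl%:R <= _); first by lra.
  rewrite lerBlDr -lerBlDl.
  rewrite ler_pdivlMr ?ltr0n //; apply: le_trans (ltW tM).
  have cY : (#|Y| = #|W f| + #|[pred y | Y y && (Dl < outer_degree sm f y)%N]|)%N.
    rewrite -(cardID (W f) Y); congr (_ + _)%N; apply: eq_card => y; rewrite !inE /W /in_mem /=.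
      by case: (Y y).
    by rewrite negb_and -ltnNge; case: (Y y); rewrite ?andbF ?andbT.
  rewrite /tot cY natrD addrAC subrr add0r -natrM -natr_sum ler_nat.
  rewrite -sum1_card big_distrl /= big_mkcondr /=; apply: leq_sum => y _.
  by case: ltnP => // ?; rewrite mul1n ltnW.
- move=> f f' ff; apply: funext => y; rewrite /W /outer_degree.
  case: (boolP (Y y)) => //= Yy; congr (_ <= _)%N.
  have [yh yh'] := Yh Yy.
  apply: eq_card => v; rewrite !inE; case: (eqVneq v y) => //= vy.
  case: (eqVneq v h) => //= vh; case: (eqVneq v h') => //= vh'.
  rewrite /adjf eq_sym vy /= ff //.
  apply/existsPn => y'; rewrite negb_and -implybE; apply/implyP => Yy'.
  have [y'h y'h'] := Yh Yy'.
  apply/negP => /orP[] /eqP/ed_inj[[_ e]|[e _]]; 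
    by [rewrite e eqxx in vh|rewrite e eqxx in vh'|rewrite e eqxx in yh|rewrite e eqxx in yh'].
- by move=> f y /andP[].
Qed.

End Connectors.
End RandomGraph.

(** * Balls and components of a graph *)

Section Balls.
Variables (V : finType) (r : rel V).
Implicit Types (x y u : V) (t : nat).

Fixpoint ball_in t u : {set V} :=
  if t is t'.+1 then
    (ball_in t' u :|: [set y | [exists x in ball_in t' u, r x y]])%SET
  else [set u]%SET.

Lemma ball_step t u x y : x \in ball_in t u -> r x y -> y \in ball_in t.+1 u.
Proof.
by move=> xB xy; rewrite /= !inE; apply/orP; right; apply/existsP; exists x; rewrite xB.
Qed.

Lemma ball_refl t u : u \in ball_in t u.
Proof. by elim: t => [|t IH] /=; rewrite !inE ?IH. Qed.

Lemma ball_subS t u : ball_in t u \subset ball_in t.+1 u.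
Proof. exact: finset.subsetUl. Qed.

Lemma ball_trans s t u x y :
  x \in ball_in s u -> y \in ball_in t x -> y \in ball_in (s + t) u.
Proof.
move=> xB; elim: t y => [|t IH] y /=; first by rewrite inE => /eqP ->; rewrite addn0.
rewrite addnS /= !inE => /orP[/IH ->//|/existsP[z /andP[/IH zB zy]]].
by apply/orP; right; apply/existsP; exists z; rewrite zB.
Qed.

Lemma ball_sym t x y : symmetric r -> y \in ball_in t x -> x \in ball_in t y.
Proof.
move=> rC; elim: t y => [|t IH] y /=; first by rewrite !inE eq_sym.
rewrite !inE => /orP[/IH xB|/existsP[z /andP[/IH xB zy]]]; first by rewrite xB.
have zy1 : z \in ball_in 1 y by rewrite (@ball_step 0 y y) ?ball_refl // rC.
by have := ball_trans zy1 xB; rewrite add1n /= !inE.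
Qed.

(** Each step either adds a vertex or leaves the ball unchanged, and a ball that stops growing is
    closed under [r]. *)
Lemma ball_closure t u : (t < #|ball_in t u|)%N \/ ball_in t u = [set y | connect r u y]%SET.
Proof.
have conn s y : y \in ball_in s u -> connect r u y.
  elim: s y => [|s IH] y /=; first by rewrite inE => /eqP ->.
  rewrite !inE => /orP[/IH //|/existsP[z /andP[/IH uz zy]]].
  exact: connect_trans uz (connect1 zy).
suff : (t < #|ball_in t u|)%N \/ ball_in t.+1 u = ball_in t u.
  case=> [h|h]; [by left|right].
  apply/setP => y; rewrite inE; apply/idP/idP; first exact: conn.
  case/connectP => p; elim/last_ind: p y => [|p z IH] y /=; first by move=> _ ->; exact: ball_refl.
  rewrite rcons_path last_rcons => /andP[pp lz] ->.
  by rewrite -h; apply: (ball_step (IH _ pp erefl) lz).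
elim: t => [|t IH]; first by left; rewrite cards1.
have [e|e] := eqVneq (ball_in t.+1 u) (ball_in t u).
  right; have stepE m : ball_in m.+1 u =
    (ball_in m u :|: [set y | [exists x in ball_in m u, r x y]])%SET by [].
  by rewrite stepE e -stepE e.
left; case: IH => [IH|IH]; last by rewrite IH eqxx in e.
apply: leq_ltn_trans IH _; apply: proper_card.
by rewrite finset.properEneq eq_sym e ball_subS.
Qed.

End Balls.

Lemma ball_mono (V : finType) (r r' : rel V) t u :
  (forall x y, r x y -> r' x y) -> ball_in r t u \subset ball_in r' t u.
Proof.
move=> rr; elim: t => //= t IH; apply/fintype.subsetP => y.
rewrite !inE => /orP[/(fintype.subsetP IH) ->//|/existsP[x /andP[xB xy]]].
by apply/orP; right; apply/existsP; exists x; rewrite (fintype.subsetP IH) // rr.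
Qed.

(** * Local exploration with sprinkled hub edges *)

Section LocalPhase.
Variables (R : realType) (k : nat) (U : finType) (box : 'I_k -> U) (hb : 'I_k -> 'I_k).
Hypothesis box_hb : forall y, box (hb y) = box y.
Hypothesis hb_hb : forall y, hb (hb y) = hb y.

Definition hub_edges (e : 'I_k * 'I_k) : bool :=
  [exists y, (y != hb y) && (e == ed y (hb y))].

Definition hub_law (dl : R) (e : 'I_k * 'I_k) : R := if hub_edges e then dl else 0.

Variables (vg : pred 'I_k) (f f' : {ffun 'I_k * 'I_k -> bool}) (s L : nat).

Definition sprinkled : {ffun 'I_k * 'I_k -> bool} :=
  [ffun e => f e || (hub_edges e && f' e)].

Definition good_adj : rel 'I_k := fun x y => [&& vg x, vg y & adjf f x y].

Lemma good_adjC : symmetric good_adj.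
Proof. by move=> x y; rewrite /good_adj adjfC andbCA. Qed.

Definition local_ball u := ball_in good_adj (s * L) u.

(** A hub counts as linked to itself: a ball that contains a hub needs no sprinkled edge. *)
Definition linked_to_hub y := (y == hb y) || f' (ed y (hb y)).

Definition many_boxes u := (s <= #|[set box y | y in local_ball u]%SET|)%N.

(* The only way for a small good component not to be a whole component of the
   graph. *)
Definition near_bad u : bool :=
  [&& vg u, #|[set y | connect good_adj u y]%SET| <= s * L &
      [exists y, connect good_adj u y && [exists z, ~~ vg z && adjf f y z]]]%N.

Lemma sprinkled_sub x y : adjf f x y -> adjf sprinkled x y.
Proof. by rewrite /adjf => /andP[-> fe] /=; rewrite ffunE fe. Qed.

Lemma linked_adj y : y != hb y -> linked_to_hub y -> adjf sprinkled y (hb y).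
Proof.
rewrite /linked_to_hub /adjf => ny; rewrite (negbTE ny) /= ffunE => ->.
by rewrite andbT; apply/orP; right; apply/existsP; exists y; rewrite ny eqxx.
Qed.

Hypothesis vgL : forall y, vg y -> (#|[pred v | vg v && (box v == box y)]| <= L)%N.

Lemma local_ball_vg u y : vg u -> y \in local_ball u -> vg y.
Proof.
move=> vu; rewrite /local_ball; elim: (s * L)%N y => [|t IH] y /=.
  by rewrite inE => /eqP ->.
by rewrite !inE => /orP[/IH //|/existsP[z /andP[_ /and3P[]]]].
Qed.

Lemma card_le_boxes u : vg u -> (#|local_ball u| <= #|[set box y | y in local_ball u]%SET| * L)%N.
Proof.
move=> vu; rewrite -sum1_card (partition_big box (mem [set box y | y in local_ball u]%SET)) /=; last first.
  by move=> y yB; apply: finset.imset_f.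
rewrite mulnC -[X in (_ <= L * X)%N]sum1_card big_distrr /=; apply: leq_sum => b /imsetP[y yB ->].
rewrite muln1 sum1_card; apply: leq_trans (vgL (local_ball_vg vu yB)).
apply/subset_leq_card/fintype.subsetP => v; rewrite !inE => /andP[vB ->].
by rewrite (local_ball_vg vu vB).
Qed.

(** If the good ball meets fewer than [s] boxes, it has at most [s * L] vertices, so it is an entire
    good component. When no edge of [f] leads from it to a bad vertex and none of its vertices is
    linked, no edge leaves it even after sprinkling, and it is a whole component. *)
Lemma local_phase u : vg u ->
  [\/ exists2 y, y \in local_ball u & linked_to_hub y,
      many_boxes u && [forall y, (y \in local_ball u) ==> ~~ linked_to_hub y],
      near_bad u |
      (#|[set y | connect (adjf sprinkled) u y]%SET| <= s * L)%N].
Proof.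
move=> vu; case: (boolP [exists y, (y \in local_ball u) && linked_to_hub y]) => [/existsP[y /andP[yB ly]]|].
  by constructor 1; exists y.
rewrite negb_exists => /forallP nl.
case: (boolP (many_boxes u)) => [mb|nmb].
  by constructor 2; apply/forallP => y; rewrite implybE -negb_and nl.
have cB : (#|local_ball u| <= s * L)%N.
  apply: leq_trans (card_le_boxes vu) _; rewrite leq_mul2r.
  by move: nmb; rewrite /many_boxes -ltnNge => /ltnW ->; rewrite orbT.
have {}cl : local_ball u = [set y | connect good_adj u y]%SET.
  have [|//] := ball_closure good_adj (s * L) u.
  by rewrite ltnNge -/(local_ball u) cB.
case: (boolP (near_bad u)) => [nb|]; first by constructor 3.
rewrite /near_bad vu -cl cB /= negb_exists => /forallP nb.
constructor 4; apply: leq_trans cB; apply/subset_leq_card/fintype.subsetP => y.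
rewrite inE => /connectP[p]; elim/last_ind: p y => [|p z IH] y /=.
  by move=> _ ->; rewrite cl inE.
rewrite rcons_path last_rcons => /andP[pp] + ->.
set w := last u p => wz; have wB : w \in local_ball u by apply: IH.
have nlw : ~~ linked_to_hub w by have := nl w; rewrite wB.
have /negP nbw := nb w.
case: (boolP (adjf f w z)) => [awz|nwz].
  have vz : vg z.
    apply/negP => /negP nvz; apply: nbw; move: wB; rewrite cl inE => -> /=.
    by apply/existsP; exists z; rewrite nvz.
  move: (wB); rewrite cl !inE => uw; apply: connect_trans uw (connect1 _).
  by rewrite /good_adj vz awz (local_ball_vg vu wB).
case/andP: wz => nwz' ; rewrite ffunE => /orP[fe|/andP[/existsP[x /andP[nx /eqP e]] fe]].
  by rewrite /adjf nwz' fe in nwz.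
(* A sprinkled edge at [w] either joins [w] to its hub or has [w] itself as hub; in both cases [w]
   is linked, contrary to [nlw]. *)
case/ed_inj: e => -[e1 e2].
  case/negP: nlw; rewrite /linked_to_hub [in hb w]e1 -e2 fe orbT //.
by case/negP: nlw; rewrite /linked_to_hub e1 hb_hb eqxx.
Qed.

(** Charge [u] to an edge from a bad vertex [z] to some [y] in the good component of [u]. Such a
    component has at most [s * L] vertices, so no edge is charged more often. *)
Lemma near_bad_card :
  (\sum_u near_bad u <= s * L * \sum_(z | ~~ vg z) #|adjf f z|)%N.
Proof.
apply: (@leq_trans (\sum_(z | ~~ vg z) \sum_(y | adjf f z y)
   #|[pred u | near_bad u && connect good_adj u y]|)%N).
  rewrite [X in (_ <= X)%N](eq_bigr (fun z => \sum_u \sum_(y | adjf f z y)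
      (near_bad u && connect good_adj u y))%N); last first.
    move=> z _; rewrite [RHS]exchange_big /=; apply: eq_bigr => y _.
    by rewrite -sum1_card big_mkcond; apply: eq_bigr => u _; rewrite inE; case: (_ && _).
  rewrite exchange_big; apply: leq_sum => u _ /=.
  case: (boolP (near_bad u)) => // nb.
  case/and3P: (nb) => _ _ /existsP[y /andP[uy /existsP[z /andP[vz yz]]]].
  have zy : adjf f z y by rewrite adjfC.
  by rewrite (bigD1 z vz) /= (bigD1 y zy) /= uy.
rewrite big_distrr /=; apply: leq_sum => z vz.
rewrite -sum1_card big_distrr /= ; apply: leq_sum => y _; rewrite muln1.
case: (pickP [pred u | near_bad u && connect good_adj u y]) => [u0|e0]; last first.
  by rewrite eq_card0.
move=> /andP[/and3P[_ c0 _] u0y]; apply: leq_trans c0.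
apply/subset_leq_card/fintype.subsetP => u; rewrite !inE => /andP[_ uy].
apply: connect_trans u0y _; by rewrite (sym_connect_sym good_adjC).
Qed.

End LocalPhase.

Section LocalSprinkle.
Variables (R : realType) (k : nat) (U : finType) (box : 'I_k -> U) (hb : 'I_k -> 'I_k).
Hypothesis box_hb : forall y, box (hb y) = box y.

Lemma ed_box y : box (ed y (hb y)).1 = box y.
Proof. by rewrite /ed; case: ifP => _ //=. Qed.

(** For fixed [f] the ball is fixed as well. A hub edge determines its box, so at least [s] distinct
    hub edges would have to be closed; if the ball contains a hub, the event is impossible. *)
Lemma many_boxes_unlinked (vg : pred 'I_k) (f : {ffun 'I_k * 'I_k -> bool}) (s L : nat) (dl : R) u :
  0 <= dl <= 1 -> many_boxes box vg f s L u ->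
  PE (bern (hub_law hb dl)) (fun f' =>
    [forall y, (y \in local_ball vg f s L u) ==> ~~ linked_to_hub hb f' y]%:R)
  <= (1 - dl) ^+ s.
Proof.
move=> /andP[dl0 dl1] mb.
have q01 e : 0 <= hub_law hb dl e <= 1.
  by rewrite /hub_law; case: ifP => _; rewrite ?dl0 ?lexx ?ler01.
case: (boolP [exists y, (y \in local_ball vg f s L u) && (y == hb y)]) => [/existsP[y /andP[yB yh]]|].
  rewrite (eq_PE _ (G := fun=> 0)) ?PE_cst ?exprn_ge0 ?subr_ge0 //; first exact: bern_pmf.
  move=> f'; case: forallP => // /(_ y).
  by rewrite yB /linked_to_hub yh.
rewrite negb_exists => /forallP nh.
pose E := [set ed y (hb y) | y in local_ball vg f s L u]%SET.
apply: (@le_trans _ _ (PE (bern (hub_law hb dl)) (fun f' => [forall e, (e \in E) ==> ~~ f' e]%:R))).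
  apply: (le_PE (bern_pmf q01)) => f'; rewrite ler_nat.
  case: (boolP [forall y, _]) => // /forallP hf; rewrite lt0b.
  apply/forallP => e; apply/implyP => /imsetP[y yB ->].
  by have := hf y; rewrite yB /= /linked_to_hub negb_or => /andP[].
rewrite (PE_none (mem E) q01).
rewrite (eq_bigr (fun=> 1 - dl)); last first.
  move=> e /imsetP[y yB ->]; rewrite /hub_law ifT //.
  by apply/existsP; exists y; rewrite eqxx andbT; have := nh y; rewrite yB.
rewrite prodr_const; apply: ler_wiXn2l; rewrite ?subr_ge0 ?gerBl //.
apply: leq_trans mb _.
have -> : [set box y | y in local_ball vg f s L u]%SET = [set box e.1 | e in E]%SET.
  apply/setP => b; apply/imsetP/imsetP => [[y yB ->]|[e /imsetP[y yB ->] ->]].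
    by exists (ed y (hb y)); rewrite ?ed_box //; apply: finset.imset_f.
  by exists y; rewrite ?ed_box.
exact: leq_imset_card.
Qed.

End LocalSprinkle.

(** * Random configurations of cells and weight classes *)

Section PoissonWeights.
Variable R : realType.
Implicit Types lam : R.

Definition pois lam (m : nat) : R := lam ^+ m / m`!%:R * expR (- lam).

Lemma pois_ge0 lam m : 0 <= lam -> 0 <= pois lam m.
Proof. by move=> l0; rewrite /pois !mulr_ge0 ?exprn_ge0 ?invr_ge0 ?expR_ge0. Qed.

Lemma expR_partial_sum (x : R) (K : nat) : 0 <= x ->
  \sum_(m < K) x ^+ m / m`!%:R <= expR x.
Proof.
move=> x0; rewrite expRE.
have -> : pseries (fun n => n`!%:R^-1) x = series (exp_coeff x).
  apply: funext => n; rewrite /pseries /series /=; apply: eq_bigr => m _.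
  by rewrite /exp_coeff mulrC.
have -> : \sum_(m < K) x ^+ m / m`!%:R = series (exp_coeff x) K.
  by rewrite /series /= big_mkord.
apply: nondecreasing_cvgn_le; last exact: is_cvg_series_exp_coeff.
by apply: nondecreasing_series => m _ _; exact: exp_coeff_ge0.
Qed.

Lemma pois_pgf lam (a : R) (K : nat) : 0 <= lam -> 0 <= a ->
  \sum_(m < K) pois lam m * a ^+ m <= expR (lam * (a - 1)).
Proof.
move=> l0 a0; rewrite mulrBr mulr1 expRD.
have -> : \sum_(m < K) pois lam m * a ^+ m =
    (\sum_(m < K) (lam * a) ^+ m / m`!%:R) * expR (- lam).
  by rewrite mulr_suml; apply: eq_bigr => m _; rewrite /pois exprMn; ring.
by rewrite ler_wpM2r ?expR_ge0 // expR_partial_sum ?mulr_ge0.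
Qed.

(** Bound for the third moment of a Poisson variable: m <= 3 exp(m/3) gives m^3 <= 27 exp(m), and
    the generating function is evaluated at e. *)
Definition pois_cube lam : R := 27 * expR (lam * (expR 1 - 1)).

Lemma pois_cubeP lam (K : nat) : 0 <= lam ->
  \sum_(m < K) pois lam m * m%:R ^+ 3 <= pois_cube lam.
Proof.
move=> l0; rewrite /pois_cube.
apply: le_trans (ler_wpM2l _ (pois_pgf K l0 (expR_ge0 1))); last by [].
rewrite mulr_sumr; apply: ler_sum => m _; rewrite [leRHS]mulrCA ler_wpM2l ?pois_ge0 //.
rewrite -expRM_natl mulr1.
have -> : expR m%:R = expR (m%:R / 3) ^+ 3 :> R by rewrite -expRM_natl; congr expR; lra.
have h : m%:R / 3 <= expR (m%:R / 3) :> R.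
  by apply: le_trans (expR_ge1Dx _); rewrite lerDr.
have -> : 27 * expR (m%:R / 3) ^+ 3 = (3 * expR (m%:R / 3)) ^+ 3 :> R by ring.
rewrite lerXn2r ?nnegrE ?mulr_ge0 ?expR_ge0 //; lra.
Qed.

End PoissonWeights.

Lemma PE_coord3 (R : realFieldType) (I T : finType) (mu : I -> T -> R) (i j l : I)
    (a b e : T -> R) : is_pmf mu -> i != j -> i != l -> j != l ->
  PE mu (fun f => a (f i) * b (f j) * e (f l)) =
  (\sum_x mu i x * a x) * (\sum_x mu j x * b x) * (\sum_x mu l x * e x).
Proof.
move=> mp ij il jl.
rewrite (PE_indep (A := fun t => t != l) (B := pred1 l)
  (F := fun f => a (f i) * b (f j)) (G := fun f => e (f l)) mp).
- by rewrite PE_coord2 // PE_coord.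
- by move=> f g h; rewrite !h.
- by move=> f g h; rewrite !h /=.
- by move=> t /negP h /eqP e0; apply: h; rewrite e0.
Qed.

Section ConfigExpectation.
Variables (R : realType) (C L : finType) (K : nat) (lam : R).
Variables (pi : forall k, {ffun 'I_k -> C} -> R) (D : L -> R).
Hypothesis lam0 : 0 <= lam.
Hypothesis pi0 : forall k c, 0 <= pi (k := k) c.
Hypothesis D0 : forall l, 0 <= D l.
Hypothesis D1 : \sum_l D l = 1.

Definition cnt k (c : {ffun 'I_k -> C}) (x : C) : nat := #|[pred i | c i == x]|.

Hypothesis piP : forall psi : C -> nat -> R, (forall x m, 0 <= psi x m) ->
  \sum_(k < K) \sum_(c : {ffun 'I_k -> C}) pi c * \prod_x psi x (cnt c x)
    <= \prod_x \sum_(m < K) pois lam m * psi x m.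

Definition config_fun : Type :=
  forall k, {ffun 'I_k -> C} -> {ffun 'I_k -> L} -> R.

(** Expectation over the number of vertices, truncated at [K], their cells weighted by [pi], and
    independent classes of law [D]. The total mass may be below 1, which is harmless for upper
    bounds. *)
Definition CE (F : config_fun) : R :=
  \sum_(k < K) \sum_(c : {ffun 'I_k -> C}) pi c * PE (fun=> D) (F k c).

Lemma weights_pmf (k : nat) : is_pmf (fun _ : 'I_k => D).
Proof. by split. Qed.

Lemma le_CE (F G : config_fun) : (forall k c l, F k c l <= G k c l) -> CE F <= CE G.
Proof.
move=> FG; apply: ler_sum => k _; apply: ler_sum => c _.
by rewrite ler_wpM2l //; apply: (le_PE (weights_pmf k)) => l; exact: FG.
Qed.

Lemma CED (F G : config_fun) : CE (fun k c l => F k c l + G k c l) = CE F + CE G.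
Proof.
rewrite -big_split; apply: eq_bigr => k _; rewrite -big_split; apply: eq_bigr => c _.
by rewrite PED mulrDr.
Qed.

Lemma CEZ (x : R) (F : config_fun) : CE (fun k c l => x * F k c l) = x * CE F.
Proof.
rewrite mulr_sumr; apply: eq_bigr => k _; rewrite mulr_sumr; apply: eq_bigr => c _.
by rewrite PEZ mulrCA.
Qed.

Lemma CE_sum (A : Type) (s : seq A) (P : pred A) (F : A -> config_fun) :
  CE (fun k c l => \sum_(a <- s | P a) F a k c l) = \sum_(a <- s | P a) CE (F a).
Proof.
rewrite [RHS]exchange_big; apply: eq_bigr => k _.
rewrite [RHS]exchange_big; apply: eq_bigr => c _.
by rewrite PE_sum mulr_sumr.
Qed.

Lemma CE_markov (F : config_fun) (x : R) : 0 < x -> (forall k c l, 0 <= F k c l) ->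
  CE (fun k c l => (x <= F k c l)%R%:R) <= CE F / x.
Proof.
move=> x0 F0; rewrite mulrC -CEZ; apply: le_CE => k c l.
case: (boolP (x <= _)) => h; last by rewrite mulr_ge0 // invr_ge0 ltW.
by rewrite mulrC ler_pdivlMr // mul1r.
Qed.

Lemma prod_cnt k (c : {ffun 'I_k -> C}) (Phi : C -> R) :
  \prod_i Phi (c i) = \prod_x Phi x ^+ cnt c x.
Proof.
rewrite (partition_big c predT) //=; apply: eq_bigr => x _.
rewrite (eq_bigr (fun=> Phi x)); last by move=> i /eqP ->.
by rewrite prodr_const; congr (_ ^+ _); apply: eq_card => i; rewrite !inE.
Qed.

(** The exponential formula for a marked Poisson process, as an inequality: averaging over classes
    turns the product over vertices into a product of powers of cell counts, to which [piP]
    applies. *)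
Lemma CE_prod (phi : C -> L -> R) : (forall x l, 0 <= phi x l) ->
  CE (fun k c l => \prod_i phi (c i) (l i)) <=
  expR (lam * \sum_x (\sum_l D l * phi x l - 1)).
Proof.
move=> phi0; pose Phi x := \sum_l D l * phi x l.
have Phi0 x : 0 <= Phi x by apply: sumr_ge0 => l _; rewrite mulr_ge0.
rewrite /CE (eq_bigr (fun k : 'I_K => \sum_(c : {ffun 'I_k -> C}) pi c * \prod_x Phi x ^+ cnt c x)); last first.
  move=> k _; apply: eq_bigr => c _; congr (_ * _).
  by rewrite -prod_cnt (PE_prod (fun _ => D) (fun i => phi (c i))).
apply: le_trans (piP (psi := fun x m => Phi x ^+ m) _) _.
  by move=> x m; rewrite exprn_ge0.
rewrite mulr_sumr expR_sum; apply: ler_prod => x _.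
rewrite pois_pgf // sumr_ge0 // => m _.
by rewrite mulr_ge0 ?pois_ge0 ?exprn_ge0.
Qed.

Let C3 := pois_cube lam.

Lemma cnt_cube (x : C) :
  \sum_(k < K) \sum_(c : {ffun 'I_k -> C}) pi c * (cnt c x)%:R ^+ 3 <= C3.
Proof.
rewrite (eq_bigr (fun k : 'I_K => \sum_(c : {ffun 'I_k -> C}) pi c *
    \prod_y (if y == x then (cnt c y)%:R ^+ 3 else 1))); last first.
  move=> k _; apply: eq_bigr => c _; congr (_ * _).
  by rewrite (bigD1 x) //= eqxx big1 ?mulr1 // => y /negbTE ->.
apply: le_trans (piP (psi := fun y m => if y == x then m%:R ^+ 3 else 1) _) _.
  by move=> y m; case: ifP => // _; rewrite exprn_ge0.
have S0 y : 0 <= \sum_(m < K) pois lam m * (if y == x then m%:R ^+ 3 else 1).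
  by apply: sumr_ge0 => m _; rewrite mulr_ge0 ?pois_ge0 //; case: ifP => // _; rewrite exprn_ge0.
rewrite (bigD1 x) //= eqxx -[C3]mulr1; apply: ler_pM.
- by have := S0 x; rewrite eqxx.
- by apply: prodr_ge0 => y _; exact: S0.
- exact: pois_cubeP.
apply: (@le_trans _ _ (\prod_(y | y != x) 1)); last by rewrite big1.
apply: ler_prod => y /negbTE yx; rewrite S0 /= yx.
have := pois_pgf K lam0 (@ler01 R); rewrite subrr mulr0 expR0.
by move=> h; apply: le_trans h; apply: ler_sum => m _; rewrite expr1n.
Qed.

Lemma cnt_sum (k : nat) (c : {ffun 'I_k -> C}) (F : C -> R) :
  \sum_i F (c i) = \sum_x (cnt c x)%:R * F x.
Proof.
rewrite (partition_big c predT) //=; apply: eq_bigr => x _.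
rewrite (eq_bigr (fun=> F x)); last by move=> i /eqP ->.
by rewrite sumr_const mulr_natl; congr (_ *+ _); apply: eq_card => i; rewrite !inE.
Qed.

(** A product of three cell counts is at most the sum of their cubes, so the third moment of a
    single cell suffices and no joint law of cells enters. *)
Lemma CE_cnt3 (A : C -> C -> C -> R) : (forall x y z, 0 <= A x y z) ->
  \sum_(k < K) \sum_(c : {ffun 'I_k -> C}) pi c * (\sum_i \sum_j \sum_m A (c i) (c j) (c m))
  <= 3 * C3 * \sum_x \sum_y \sum_z A x y z.
Proof.
move=> A0.
apply: (@le_trans _ _ (\sum_(k < K) \sum_(c : {ffun 'I_k -> C}) \sum_x \sum_y \sum_z
   A x y z * (pi c * (cnt c x)%:R ^+ 3 + pi c * (cnt c y)%:R ^+ 3 + pi c * (cnt c z)%:R ^+ 3))).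
  apply: ler_sum => k _; apply: ler_sum => c _.
  rewrite (cnt_sum c (fun x => \sum_j \sum_m A x (c j) (c m))) mulr_sumr.
  apply: ler_sum => x _; rewrite (cnt_sum c (fun y => \sum_m A x y (c m))) !mulr_sumr.
  apply: ler_sum => y _; rewrite (cnt_sum c (fun z => A x y z)) !mulr_sumr.
  apply: ler_sum => z _.
  rewrite -!mulrDr [A x y z * _]mulrC -!mulrA ler_wpM2l // !mulrA ler_wpM2r //.
  set a : R := _%:R; set b : R := _%:R; set e : R := _%:R.
  have [a0 b0 e0] : [/\ 0 <= a, 0 <= b & 0 <= e] by [].
  have key (u v w : R) : 0 <= u -> u <= w -> 0 <= v -> v <= w -> u * v * w <= w ^+ 3.
    move=> u0 uw v0 vw; have w0 := le_trans u0 uw.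
    by rewrite exprSr ler_wpM2r // expr2 ler_pM.
  have ca := exprn_ge0 3 a0; have cb := exprn_ge0 3 b0; have ce := exprn_ge0 3 e0.
  have [ab|/ltW ba] := leP a b; have [be|/ltW eb] := leP b e.
  - have := key a b e a0 (le_trans ab be) b0 be; lra.
  - have := key a e b a0 ab e0 eb; rewrite -mulrA [e * b]mulrC mulrA; lra.
  - have [ae|/ltW ea] := leP a e.
      have := key a b e a0 ae b0 be; lra.
    have := key b e a b0 ba e0 ea; rewrite mulrC mulrA; lra.
  - have := key b e a b0 ba e0 (le_trans eb ba); rewrite mulrC mulrA; lra.
under eq_bigr => k _ do (rewrite exchange_big; under eq_bigr => x _ do
  (rewrite exchange_big; under eq_bigr => y _ do rewrite exchange_big)).
rewrite exchange_big mulr_sumr; apply: ler_sum => x _.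
rewrite exchange_big mulr_sumr; apply: ler_sum => y _.
rewrite exchange_big mulr_sumr; apply: ler_sum => z _ /=.
under eq_bigr => k _ do rewrite -mulr_sumr.
rewrite -mulr_sumr mulrC ler_wpM2r //.
under eq_bigr => k _ do rewrite !big_split.
rewrite !big_split /=.
have := cnt_cube x; have := cnt_cube y; have := cnt_cube z; lra.
Qed.

Definition Dmean (a : L -> R) : R := \sum_l D l * a l.

Lemma Dmean_ge0 a : (forall l, 0 <= a l) -> 0 <= Dmean a.
Proof. by move=> a0; apply: sumr_ge0 => l _; rewrite mulr_ge0. Qed.

Lemma CE_moment3 (A : C -> C -> C -> R) (a b e : L -> R) :
  (forall x y z, 0 <= A x y z) ->
  (forall l, 0 <= a l) -> (forall l, 0 <= b l) -> (forall l, 0 <= e l) ->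
  CE (fun k c l => \sum_i \sum_(j | j != i) \sum_(m | (m != i) && (m != j))
     A (c i) (c j) (c m) * (a (l i) * b (l j) * e (l m)))
  <= 3 * C3 * (\sum_x \sum_y \sum_z A x y z) * (Dmean a * Dmean b * Dmean e).
Proof.
move=> A0 a0 b0 e0.
apply: le_trans (ler_wpM2r _ (CE_cnt3 A0)); last by rewrite !mulr_ge0 ?Dmean_ge0.
rewrite mulr_suml; apply: ler_sum => k _; rewrite mulr_suml; apply: ler_sum => c _.
rewrite -[leRHS]mulrA ler_wpM2l // PE_sum mulr_suml; apply: ler_sum => i _.
rewrite PE_sum mulr_suml big_mkcond; apply: ler_sum => j _; case: ifP => ji; last first.
  by rewrite mulr_ge0 ?sumr_ge0 // !mulr_ge0 ?Dmean_ge0.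
rewrite PE_sum mulr_suml big_mkcond; apply: ler_sum => m _; case: ifP => mij; last first.
  by rewrite mulr_ge0 // !mulr_ge0 ?Dmean_ge0.
case/andP: mij => mi mj.
have [ij im jm] : [/\ i != j, i != m & j != m] by rewrite ![_ == m]eq_sym [i == j]eq_sym.
by rewrite PEZ (PE_coord3 a b e (weights_pmf k) ij im jm).
Qed.

(** Reduced to triples by confining the third index to the cell of the first one; taking it equal to
    the first shows that nothing is lost. *)
Lemma CE_moment2 (A : C -> C -> R) (a b : L -> R) :
  (forall x y, 0 <= A x y) -> (forall l, 0 <= a l) -> (forall l, 0 <= b l) ->
  CE (fun k c l => \sum_i \sum_(j | j != i) A (c i) (c j) * (a (l i) * b (l j)))
  <= 3 * C3 * (\sum_x \sum_y A x y) * (Dmean a * Dmean b).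
Proof.
move=> A0 a0 b0.
have B0 x y z : 0 <= A x y * (x == z)%:R by rewrite mulr_ge0.
have sE x y : \sum_z A x y * (x == z)%:R = A x y.
  by rewrite (bigD1 x) //= eqxx mulr1 big1 ?addr0 // => z; rewrite eq_sym => /negbTE ->; rewrite mulr0.
have := CE_cnt3 B0.
under [X in _ * X]eq_bigr => x _ do under eq_bigr => y _ do rewrite sE.
move=> h; apply: le_trans (ler_wpM2r _ h); last by rewrite !mulr_ge0 ?Dmean_ge0.
rewrite mulr_suml; apply: ler_sum => k _; rewrite mulr_suml; apply: ler_sum => c _.
rewrite -[leRHS]mulrA ler_wpM2l // PE_sum mulr_suml; apply: ler_sum => i _.
rewrite PE_sum mulr_suml big_mkcond; apply: ler_sum => j _.
have nn : 0 <= \sum_m A (c i) (c j) * (c i == c m)%:R by apply: sumr_ge0.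
case: ifP => ji; last by rewrite mulr_ge0 // !mulr_ge0 ?Dmean_ge0.
rewrite PEZ (PE_coord2 (weights_pmf k) a b); last by rewrite eq_sym.
rewrite ler_wpM2r ?mulr_ge0 ?Dmean_ge0 //.
by rewrite (bigD1 i) //= eqxx mulr1 lerDl sumr_ge0.
Qed.

Lemma CE_moment1 (A : C -> R) (a : L -> R) :
  (forall x, 0 <= A x) -> (forall l, 0 <= a l) ->
  CE (fun k c l => \sum_i A (c i) * a (l i)) <= 3 * C3 * (\sum_x A x) * Dmean a.
Proof.
move=> A0 a0.
have B0 x y z : 0 <= A x * ((x == y)%:R * (x == z)%:R) by rewrite !mulr_ge0.
have sE x : \sum_y \sum_z A x * ((x == y)%:R * (x == z)%:R) = A x.
  rewrite (bigD1 x) //= [X in _ + X]big1 ?addr0; last first.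
    by move=> y; rewrite eq_sym => /negbTE ->; rewrite big1 // => z _; rewrite mul0r mulr0.
  rewrite (bigD1 x) //= eqxx !mulr1 big1 ?addr0 // => z; rewrite eq_sym => /negbTE ->.
  by rewrite !mulr0.
have := CE_cnt3 B0.
under [X in _ * X]eq_bigr => x _ do rewrite sE.
move=> h; apply: le_trans (ler_wpM2r (Dmean_ge0 a0) h).
rewrite mulr_suml; apply: ler_sum => k _; rewrite mulr_suml; apply: ler_sum => c _.
rewrite -[leRHS]mulrA ler_wpM2l // PE_sum mulr_suml; apply: ler_sum => i _.
rewrite PEZ (PE_coord (weights_pmf k)) ler_wpM2r ?Dmean_ge0 //.
rewrite (bigD1 i) //= (bigD1 i) //= eqxx !mulr1 -addrA lerDl addr_ge0 //.
  by apply: sumr_ge0 => j _; rewrite !mulr_ge0.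
by apply: sumr_ge0 => j _; apply: sumr_ge0 => m _; rewrite !mulr_ge0.
Qed.

End ConfigExpectation.

(** * The dyadic grid *)

Section Grid.
Variables (d b : nat).

Definition cellT := {ffun 'I_d -> 'I_(2 ^ b)}.
Implicit Types c : cellT.

Definition same_box (i : nat) : rel cellT :=
  fun c c' => [forall j, (c j %/ 2 ^ i == c' j %/ 2 ^ i)%N].

Lemma same_boxP i c c' :
  reflect (forall j, (c j %/ 2 ^ i)%N = (c' j %/ 2 ^ i)%N) (same_box i c c').
Proof. by apply: (iffP forallP) => h j; apply/eqP/h. Qed.

Lemma same_box_refl i c : same_box i c c.
Proof. exact/same_boxP. Qed.

Lemma same_box_sym i c c' : same_box i c c' = same_box i c' c.
Proof. by apply/same_boxP/same_boxP => h j; rewrite h. Qed.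

Lemma same_box_trans i : transitive (same_box i).
Proof. by move=> c1 c2 c3 /same_boxP h /same_boxP h'; apply/same_boxP => j; rewrite h h'. Qed.

Lemma same_box_eq i c c' c'' : same_box i c c' -> same_box i c c'' = same_box i c' c''.
Proof.
move=> h; apply/idP/idP; apply: same_box_trans => //.
by rewrite same_box_sym.
Qed.

Lemma same_boxW i i' c c' : (i <= i')%N -> same_box i c c' -> same_box i' c c'.
Proof.
move=> /subnKC <- /same_boxP h; apply/same_boxP => j.
by rewrite expnD !divnMA h.
Qed.

Lemma same_box_top i c c' : (b <= i)%N -> same_box i c c'.
Proof.
move=> bi; apply/same_boxP => j.
have lt (x : 'I_(2 ^ b)) : (x < 2 ^ i)%N.
  by apply: leq_trans (ltn_ord x) _; rewrite leq_exp2l.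
by rewrite !divn_small.
Qed.

Lemma card_interval (m i q : nat) : (q.+1 * 2 ^ i <= m)%N ->
  #|[pred x : 'I_m | x %/ 2 ^ i == q]%N| = (2 ^ i)%N.
Proof.
move=> qm; have i0 : (0 < 2 ^ i)%N by rewrite expn_gt0.
have lt (y : 'I_(2 ^ i)) : (q * 2 ^ i + y < m)%N.
  by apply: leq_trans qm; rewrite mulSn addnC -addSn leq_add2r ltn_ord.
rewrite -[RHS]card_ord -(card_imset _ (f := fun y : 'I_(2 ^ i) => Ordinal (lt y))); last first.
  by move=> x y [] /addnI/val_inj.
apply: eq_card => x; rewrite !inE; apply/idP/imsetP.
  move=> /eqP xq; exists (Ordinal (ltn_pmod x i0)) => //.
  by apply: val_inj; rewrite /= -xq -divn_eq.
by move=> [y _ ->] /=; rewrite divnMDl // divn_small ?addn0.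
Qed.

Lemma card_same_box i c : (i <= b)%N -> #|[pred c' | same_box i c c']| = (2 ^ (d * i))%N.
Proof.
move=> ib.
have -> : #|[pred c' | same_box i c c']| =
    #|family (fun j => [pred x : 'I_(2 ^ b) | x %/ 2 ^ i == c j %/ 2 ^ i]%N)|.
  apply: eq_card => c'; rewrite [in RHS]unfold_in inE; apply: eq_forallb => j.
  by rewrite inE eq_sym.
rewrite card_family foldrE big_image /=.
rewrite (eq_bigr (fun=> 2 ^ i)%N); last first.
  move=> j _; apply: card_interval.
  have e : (2 ^ b = 2 ^ (b - i) * 2 ^ i)%N by rewrite -expnD subnK.
  rewrite [X in (_ <= X)%N]e leq_mul2r; apply/orP; right.
  by rewrite ltn_divLR ?expn_gt0 // -e.
by rewrite prod_nat_const card_ord -expnM mulnC.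
Qed.

Lemma card_cellT : #|{: cellT}| = (2 ^ (d * b))%N.
Proof. by rewrite card_ffun !card_ord mulnC expnM. Qed.

End Grid.

Section KernelSum.
Variables (R : realType) (beta : R).
Hypothesis beta1 : 1 < beta.

(* Exponent beta <= alpha instead of alpha: min(x^alpha, 1) <= x^beta still
   bounds the edge probabilities, and beta < tau - 1 makes the weight moments
   finite. *)
Definition decay (r : nat) : R := (maxn 1 r)%:R `^ (- beta).

Lemma decay_ge0 r : 0 <= decay r. Proof. exact: powR_ge0. Qed.

Lemma decay_le r r' : (r <= r')%N -> decay r' <= decay r.
Proof.
move=> rr; rewrite /decay !powRN lef_pV2 ?posrE ?powR_gt0 ?ltr0n ?leq_max //.
apply: ge0_ler_powR; rewrite ?nnegrE ?ler_nat //; first by rewrite ltW // (lt_trans ltr01).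
by lia.
Qed.

Definition decay_sum : R := 1 + (1 - 2 `^ (1 - beta))^-1.

Lemma two_powR_lt1 (x : R) : x < 0 -> (2 : R) `^ x < 1.
Proof.
move=> x0; rewrite /powR pnatr_eq0 /= -[ltRHS]expR0 ltr_expR nmulr_rlt0 //.
by rewrite ln_gt0 // ltr1n.
Qed.

(** Cauchy condensation: the block from 2^e to 2^(e+1) contributes at most 2^((1 - beta) e). *)
Lemma decay_sumP (M : nat) : \sum_(r < M) decay r <= decay_sum.
Proof.
have q1 : (2 : R) `^ (1 - beta) < 1 by apply: two_powR_lt1; rewrite subr_lt0.
have q0 : 0 < (2 : R) `^ (1 - beta) by rewrite powR_gt0.
have step (e : nat) : \sum_(r < 2 ^ e) decay r <= 1 + \sum_(j < e) (2 `^ (1 - beta)) ^+ j.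
  elim: e => [|e IH].
    by rewrite expn0 big_ord1 big_ord0 addr0 /decay /= powR1.
  rewrite expnSr muln2 -addnn big_split_ord /= big_ord_recr /= addrA lerD //.
  apply: (@le_trans _ _ (\sum_(i < 2 ^ e) decay (2 ^ e))).
    by apply: ler_sum => i _; apply: decay_le; rewrite leq_addr.
  rewrite sumr_const card_ord -[X in X <= _]mulr_natl /decay.
  have -> : maxn 1 (2 ^ e) = (2 ^ e)%N by apply/maxn_idPr; rewrite expn_gt0.
  have -> : (2 ^ e)%:R = 2 `^ e%:R :> R by rewrite natrX powR_mulrn.
  have -> : (2 `^ (1 - beta)) ^+ e = 2 `^ (e%:R * (1 - beta)) :> R.
    by rewrite -powR_mulrn ?powR_ge0 // -powRrM mulrC.
  rewrite -powRrM -powRD; last by rewrite pnatr_eq0 /= implybT.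
  by rewrite le_eqVlt; apply/orP; left; apply/eqP; congr (_ `^ _); ring.
have M2 : (M <= 2 ^ M)%N by apply/ltnW/ltn_expl.
apply: (@le_trans _ _ (\sum_(r < 2 ^ M) decay r)).
  by rewrite -(subnKC M2) big_split_ord /= lerDl sumr_ge0 // => r _; exact: decay_ge0.
apply: le_trans (step M) _; rewrite lerD2l.
set q := 2 `^ (1 - beta) in q1 q0 *.
have q1' : 0 < 1 - q by rewrite subr_gt0.
rewrite -[leRHS]mul1r ler_pdivlMr // mulrC.
have := subrX1 q M; have := exprn_ge0 M (ltW q0); nra.
Qed.

Lemma ler_sum_inj (I : finType) (P : pred I) (M : nat) (phi : I -> nat) (G : nat -> R) :
  (forall r, 0 <= G r) -> (forall i, P i -> (phi i < M)%N) ->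
  (forall i j, P i -> P j -> phi i = phi j -> i = j) ->
  \sum_(i | P i) G (phi i) <= \sum_(r < M) G r.
Proof.
move=> G0 ltM inj.
have -> : \sum_(i | P i) G (phi i) = \sum_(r < M) \sum_(i | P i && (phi i == r)) G r.
  rewrite (exchange_big_dep P) /=; last by move=> r i _ /andP[].
  apply: eq_bigr => i Pi; rewrite (big_pred1 (Ordinal (ltM i Pi))) // => r.
  by rewrite Pi /= eq_sym -val_eqE.
apply: ler_sum => r _; rewrite sumr_const -mulr_natr.
rewrite -[leRHS]mulr1 ler_wpM2l // lern1.
apply/card_le1_eqP => i j; rewrite !unfold_in => /andP[Pi /eqP ei] /andP[Pj /eqP ej].
by apply: inj => //; rewrite ei ej.
Qed.

(** Distance on the cycle of length [m]; [maxn] minus [minn] is the absolute difference in [nat]. *)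
Definition cyc (m : nat) (x y : nat) : nat :=
  minn (maxn x y - minn x y) (m - (maxn x y - minn x y)).

(** The factor 4 counts the two arms of the minimum in [cyc] and, for each, the two sides [y <= x]
    and [x < y], on which the distance is injective. *)
Lemma cyc_sum (m : nat) (x : 'I_m) : \sum_(y < m) decay (cyc m x y) <= 4 * decay_sum.
Proof.
pose a (y : 'I_m) := (maxn x y - minn x y)%N.
have half (phi : nat -> nat) : (forall r, (r < m)%N -> (phi r <= m)%N) ->
  (forall r r', (r < m)%N -> (r' < m)%N -> phi r = phi r' -> r = r') ->
  \sum_(y < m) decay (phi (a y)) <= 2 * decay_sum.
  move=> phim inj.
  have lta (y : 'I_m) : (a y < m)%N by rewrite /a; have := ltn_ord x; have := ltn_ord y; lia.
  rewrite (bigID (fun y : 'I_m => (y <= x)%N)) /= mulrDl !mul1r lerD //.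
  - apply: le_trans (decay_sumP m.+1).
    apply: (ler_sum_inj (phi := fun y => phi (a y))) decay_ge0 _ _ => [y _|y z yx zx /inj].
      by rewrite ltnS phim.
    by move=> h; apply: val_inj; have := h (lta y) (lta z); rewrite /a /=; lia.
  - apply: le_trans (decay_sumP m.+1).
    apply: (ler_sum_inj (phi := fun y => phi (a y))) decay_ge0 _ _ => [y _|y z yx zx /inj].
      by rewrite ltnS phim.
    by move=> h; apply: val_inj; have := h (lta y) (lta z); rewrite /a /=; lia.
apply: (@le_trans _ _ (\sum_(y < m) (decay (a y) + decay (m - a y)))).
  apply: ler_sum => y _; rewrite /cyc -/(a y).
  by case: (leqP (a y) (m - a y)) => _; rewrite ?lerDl ?lerDr decay_ge0.
rewrite big_split /=; have -> : 4 * decay_sum = 2 * decay_sum + 2 * decay_sum by ring.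
apply: lerD; first by apply: (half id) => [r /ltnW|].
apply: (half (fun r => (m - r)%N)) => [r _|r r' rm rm']; first exact: leq_subr.
by lia.
Qed.

(** The volume in the kernel is a power of the largest coordinate distance, hence up to rounding at
    least the product of all coordinate distances. This product form makes the sum over cells
    factorise. *)
Definition cell_decay d b (c c' : cellT d b) : R := \prod_j decay (cyc (2 ^ b) (c j) (c' j)).

Lemma cell_decay_ge0 d b (c c' : cellT d b) : 0 <= cell_decay c c'.
Proof. by apply: prodr_ge0 => j _; exact: decay_ge0. Qed.

Lemma cell_decay_sum d b (c : cellT d b) :
  \sum_c' cell_decay c c' <= (4 * decay_sum) ^+ d.
Proof.
rewrite /cell_decay -(bigA_distr_bigA (fun (j : 'I_d) (y : 'I_(2 ^ b)) => decay (cyc (2 ^ b) (c j) y))) /=.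
apply: (@le_trans _ _ (\prod_(j < d) (4 * decay_sum))); last by rewrite prodr_const card_ord.
apply: ler_prod => j _; rewrite cyc_sum andbT.
by apply: sumr_ge0 => y _; exact: decay_ge0.
Qed.

End KernelSum.

(** * Hubs and chains of hubs *)

Section Chain.
Variables (R : realType) (d b k : nat) (cell : 'I_k -> cellT d b) (cl : 'I_k -> nat).
Variables (a z nxt : nat -> nat) (i0 J L : nat) (Kf : 'I_k -> 'I_k -> R).
Variables (Mc Mg m : nat -> R) (Dl : nat -> nat).
Implicit Types (i : nat) (c : cellT d b) (u v y h : 'I_k).
Implicit Types f : {ffun 'I_k * 'I_k -> bool}.

Definition vbox i : rel 'I_k := fun v w => same_box i (cell v) (cell w).

(** Hubs have class exactly [a i], so their weight is known up to a factor 2. The choice depends on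
    the box only, not on the cell [c] ([hub_eq]). *)
Definition hub i c : option 'I_k :=
  [pick h | same_box i (cell h) c && (cl h == a i)].

Definition box_count i c : nat := #|[pred v | same_box i (cell v) c]|.

(* An upper bound for the expected outer degrees in the sub-box of h. *)
Definition hub_load h i : R :=
  \sum_(y | vbox (z i) y h && (y != h)) \sum_(v | (v != y) && (v != h)) Kf y v.

(** All sub-boxes and all candidates of class [a i] are tested, so the condition does not depend on
    which hub is picked. Loads are controlled only from scale [J] on; below [J] the constant bound
    [Dp] on [load] takes over ([vgood]). *)
Definition cgood i c : bool :=
  [&& isSome (hub i c),
      [forall c', same_box i c' c ==> (2 ^ (d * z i) <= 4 * box_count (z i) c')%N],
      (i == i0) ==> (box_count i c <= L)%N &
      (J <= i)%N ==> [forall h, same_box i (cell h) c && (cl h == a i) ==> (hub_load h i <= Mc i)]].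

Definition cchain c : bool := [forall i : 'I_b.+1, (i0 <= i)%N ==> cgood i c].

Definition conn_set f i h h' : pred 'I_k := fun y =>
  [&& [&& vbox (z i) y h, y != h & y != h'], connectors h h' f y &
      (J <= i)%N ==> (outer_degree h h' (vbox i0) f y <= Dl i)%N].

Definition stepok f i c : bool :=
  match hub i c, hub (nxt i) c with
  | Some h, Some h' => (h == h') || (m i <= #|conn_set f i h h'|%:R)
  | _, _ => false
  end.

Definition gchain f c : bool := [forall i : 'I_b, (i0 <= i)%N ==> stepok f i c].

Definition cellgood f c := cchain c && gchain f c.

(* All vertices of the same i0-box are counted as neighbours: this bounds the
   degree after sprinkling as well. *)
Definition degp f y : nat := #|[pred v | (v != y) && (adjf f y v || vbox i0 y v)]|.

(** Bounding the degree sum of the whole [Jb]-box of [u] bounds at once the degree of [u] and those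
    of all connectors used at the scales up to [Jb]. *)
Definition load (Jb : nat) f u : nat := (\sum_(y | vbox Jb u y) degp f y)%N.

Definition vgood (Jb Dp : nat) f : pred 'I_k :=
  fun u => cellgood f (cell u) && (load Jb f u <= Dp)%N.

(* The default value makes [hb v = v] when the box of v has no hub. *)
Definition hb v : 'I_k := odflt v (hub i0 (cell v)).

Lemma hub_eq i c c' : same_box i c c' -> hub i c = hub i c'.
Proof.
move=> cc; apply: eq_pick => h; rewrite ![same_box i (cell h) _]same_box_sym.
by rewrite (same_box_eq _ cc).
Qed.

Lemma hubP i c h : hub i c = Some h -> same_box i (cell h) c /\ cl h = a i.
Proof. by rewrite /hub; case: pickP => // h' /andP[s /eqP e] [<-]. Qed.

Lemma hb_vbox v : same_box i0 (cell (hb v)) (cell v).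
Proof.
rewrite /hb; case e: (hub i0 (cell v)) => [h|] /=; last exact: same_box_refl.
by case: (hubP e).
Qed.

Lemma hb_hb v : hb (hb v) = hb v.
Proof.
rewrite {1}/hb (hub_eq (hb_vbox v)) /hb; case: (hub i0 (cell v)) => //=.
Qed.

(** The box as a set of cells: a name for it in a finite type, as the local phase requires. *)
Definition boxid v : {set cellT d b} := [set c | same_box i0 (cell v) c]%SET.

Lemma boxidE v w : (boxid v == boxid w) = vbox i0 v w.
Proof.
apply/eqP/idP => [e|h].
  have : cell w \in boxid w by rewrite inE same_box_refl.
  by rewrite -e inE.
by apply/setP => c; rewrite !inE (same_box_eq _ h).
Qed.

Lemma boxid_hb v : boxid (hb v) = boxid v.
Proof. by apply/eqP; rewrite boxidE; exact: hb_vbox. Qed.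

Lemma cchainP c i : cchain c -> (i0 <= i <= b)%N -> cgood i c.
Proof.
move=> /forallP h /andP[i0i ib]; have ib' : (i < b.+1)%N by [].
by have := h (Ordinal ib'); rewrite /= i0i.
Qed.

Lemma gchainP f c i : gchain f c -> (i0 <= i < b)%N -> stepok f i c.
Proof. by move=> /forallP h /andP[i0i ib]; have := h (Ordinal ib); rewrite /= i0i. Qed.

Section StepProb.
Variables (q : 'I_k -> 'I_k -> R) (q1 q2 yn : nat -> R).
Hypothesis qp : edge_prob q.
Hypothesis qK : forall y v, y != v -> q y v + (vbox i0 y v)%:R <= Kf y v.
Hypothesis q10 : forall i, 0 <= q1 i.
Hypothesis q20 : forall i, 0 <= q2 i.
Hypothesis z_le : forall i, (z i <= i)%N.
Hypothesis nxt_ge : forall i, (i < b)%N -> (i <= nxt i)%N.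
Hypothesis q1P : forall i y h, (i0 <= i < b)%N -> y != h -> vbox (z i) y h -> cl h = a i -> q1 i <= q y h.
Hypothesis q2P : forall i y h, (i0 <= i < b)%N -> y != h -> vbox (nxt i) y h -> cl h = a (nxt i) -> q2 i <= q y h.
Hypothesis ynP : forall i, (i0 <= i < b)%N ->
  yn i + (if (J <= i)%N then Mg i / (Dl i)%:R else 0) <= (2 ^ (d * z i))%:R / 4 - 2.
Hypothesis mP : forall i, (i0 <= i < b)%N -> 4 * m i <= yn i * q1 i * q2 i.
Hypothesis DlP : forall i, (0 < Dl i)%N.
Hypothesis MgP : forall i, 0 < Mg i.

Definition step_fail i : R := expR (- m i) + (if (J <= i)%N then Mc i / Mg i else 0).

Lemma subbox_card i c h h' : cgood i c -> same_box i (cell h) c ->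
  (2 ^ (d * z i))%:R / 4 - 2 <=
   #|[pred y | [&& vbox (z i) y h, y != h & y != h']]|%:R :> R.
Proof.
move=> /and4P[_ /forallP/(_ (cell h)) + _ _] hc; rewrite hc /= => big.
have : (box_count (z i) (cell h) <=
   #|[pred y | [&& vbox (z i) y h, y != h & y != h']]| + 2)%N.
  rewrite /box_count; have -> : 2%N = (#|pred1 h| + #|pred1 h'|)%N by rewrite !card1.
  rewrite addnA.
  have sub : [pred v | same_box (z i) (cell v) (cell h)] \subset
     [predU [predU [pred y | [&& vbox (z i) y h, y != h & y != h']] & pred1 h] & pred1 h'].
    apply/fintype.subsetP => y; rewrite !inE /vbox => ->.
    by case: (y == h); case: (y == h').
  apply: leq_trans (subset_leq_card sub) _.
  apply: leq_trans (_ : #|[predU [pred y | [&& vbox (z i) y h, y != h & y != h']] & pred1 h]| + #|pred1 h'| <= _)%N.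
    by rewrite -cardUI leq_addr.
  by rewrite leq_add2r -cardUI leq_addr.
move=> h2; have {}h2 : (2 ^ (d * z i) <= 4 * (#|[pred y | [&& vbox (z i) y h, y != h & y != h']]| + 2))%N.
  by apply: leq_trans big _; rewrite leq_mul2l h2 orbT.
move: h2; rewrite -(ler_nat R) natrM natrD; lra.
Qed.

(** The vertices of the sub-box of the lower hub are the potential connectors; they lie in the box
    of the upper hub as well. From scale [J] on, the low-degree version of the count costs the extra
    Markov term. If the two hubs coincide there is nothing to cross. *)
Lemma step_prob i c : (i0 <= i < b)%N -> (nxt i <= b)%N -> cgood i c -> cgood (nxt i) c ->
  GE q (fun f => (~~ stepok f i c)%:R) <= step_fail i.
Proof.
move=> ib nb ci cn; have GP := GE_pmf qp.
case/and4P: (ci) => + _ _ hl; case eh: (hub i c) => [h|//] _.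
case/and4P: (cn) => + _ _ _; case eh': (hub (nxt i) c) => [h'|//] _.
have [sh ch] := hubP eh; have [sh' ch'] := hubP eh'.
have e0 : 0 <= step_fail i.
  rewrite /step_fail addr_ge0 ?expR_ge0 //; case: ifP => // Ji.
  have := hl; rewrite Ji /= => /forallP/(_ h); rewrite sh ch eqxx /= => hM.
  rewrite divr_ge0 ?(ltW (MgP _)) //; apply: le_trans hM.
  apply: sumr_ge0 => y _; apply: sumr_ge0 => v /andP[vy _].
  by apply: le_trans (qK _); rewrite 1?eq_sym // addr_ge0 //; case/andP: (qp.2 y v).
rewrite /GE; have [hh'|hh'] := eqVneq h h'.
  rewrite (eq_PE _ (G := fun=> 0)) ?PE_cst // => f.
  by rewrite /stepok eh eh' hh' eqxx.
pose Y : pred 'I_k := [pred y | [&& vbox (z i) y h, y != h & y != h']].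
have YP y : Y y -> y != h /\ y != h' by move=> /and3P[].
have ii : (i <= nxt i)%N by apply: nxt_ge; case/andP: ib.
have Y1 y : Y y -> q1 i <= q y h by move=> /and3P[? ? ?]; apply: q1P.
have Y2 y : Y y -> q2 i <= q y h'.
  move=> /and3P[yh ? ?]; apply: q2P => //.
  have yc : same_box i (cell y) c by apply: same_box_trans (same_boxW (z_le i) yh) sh.
  apply: same_box_trans (same_boxW ii yc) _.
  by rewrite same_box_sym.
have Ycard := subbox_card h' ci sh.
rewrite (eq_PE _ (G := fun f => (#|conn_set f i h h'|%:R < m i)%R%:R)); last first.
  by move=> f; rewrite /stepok eh eh' (negbTE hh') /= ltNge.
have yb := ynP ib; have mb := mP ib.
rewrite /step_fail; case: (leqP J i) yb => Ji yb.
  rewrite addrC.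
  have M0 := MgP i.
  have key := @connectors_few_low R k q h h' Y (q1 i) (q2 i) qp hh' YP (q10 i) (q20 i) Y1 Y2
    (vbox i0) Kf (Dl i) (m i) (yn i) (Mg i) qK M0 (DlP i) (le_trans yb Ycard).
  apply: le_trans (le_trans key _).
    apply: (le_PE GP) => f; rewrite le_eqVlt; apply/orP; left; apply/eqP.
    congr ((_%:R < _)%R%:R); apply: eq_card => y; rewrite inE unfold_in /conn_set Ji.
    by rewrite /Y /= -!andbA.
  apply: lerD; last by rewrite ler_expR; lra.
  have := hl; rewrite Ji /= => /forallP/(_ h); rewrite sh ch eqxx /= => hM.
  rewrite ler_wpM2r ?invr_ge0 ?(ltW M0) //; apply: le_trans hM.
  rewrite /hub_load big_mkcond [leRHS]big_mkcond; apply: ler_sum => y _.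
  have nn : 0 <= \sum_(v | (v != y) && (v != h)) Kf y v.
    apply: sumr_ge0 => v /andP[vy _].
    by apply: le_trans (qK _); rewrite 1?eq_sym // addr_ge0 //; case/andP: (qp.2 y v).
  rewrite /Y /=; case: (vbox _ _ _); case: (y != h) => //=; by case: (y != h').
rewrite addr0.
have := @connectors_few R k q h h' Y (q1 i) (q2 i) qp hh' YP (q10 i) (q20 i) Y1 Y2
  (fun=> Y) (m i) (yn i) (fun _ _ _ => erefl) (fun _ _ => id).
move=> key; apply: le_trans (le_trans key _); last by rewrite ler_expR; lra.
apply: (le_PE GP) => f; rewrite le_eqVlt; apply/orP; left; apply/eqP.
have -> : yn i <= #|Y|%:R by apply: le_trans Ycard; move: yb; rewrite addr0.
rewrite andbT; congr ((_%:R < _)%R%:R); apply: eq_card => y; rewrite inE unfold_in /conn_set.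
by rewrite leqNgt Ji /= andbT.
Qed.

End StepProb.
Section Reach.
Variables (f f' : {ffun 'I_k * 'I_k -> bool}).
Let G : rel 'I_k := adjf (sprinkled hb f f').

Lemma sprinkled_vbox y v : G y v -> (v != y) && (adjf f y v || vbox i0 y v).
Proof.
rewrite /G {1}/adjf => /andP[yv]; rewrite [v == y]eq_sym yv /= /adjf yv /= ffunE.
case/orP => [->//|/andP[/existsP[x /andP[_ /eqP e]] _]].
apply/orP; right; have hx := hb_vbox x.
case: (ed_inj e) => -[-> ->]; rewrite /vbox //.
by rewrite same_box_sym.
Qed.

Lemma deg_sprinkled y : (#|G y| <= degp f y)%N.
Proof.
by apply/subset_leq_card/fintype.subsetP => v; rewrite inE => /sprinkled_vbox.
Qed.

Lemma deg_sprinkled_outer h h' y : (#|G y| <= (outer_degree h h' (vbox i0) f y).+2)%N.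
Proof.
set S := [pred v | [&& v != y, v != h, v != h' & adjf f y v || vbox i0 y v]].
have sub : [pred v | G y v] \subset [predU [predU S & pred1 h] & pred1 h'].
  apply/fintype.subsetP => v; rewrite !inE => /sprinkled_vbox/andP[-> ->].
  by case: (v == h); case: (v == h').
rewrite -addn2 /outer_degree; apply: leq_trans (subset_leq_card sub) _.
apply: leq_trans (_ : #|[predU S & pred1 h]| + #|pred1 h'| <= _)%N.
  by rewrite -cardUI leq_addr.
rewrite card1 -(addn1 1) addnA leq_add2r -[X in (_ <= _ + X)%N](card1 h) -cardUI.
exact: leq_addr.
Qed.

(* Edges with an endpoint of bounded degree: the rumour crosses them within
   boundedly many rounds, whichever direction it travels. *)
Definition low_link (g : rel 'I_k) (Dp : nat) : rel 'I_k :=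
  fun x y => g x y && ((#|g x| <= Dp)%N || (#|g y| <= Dp)%N).

(** The two extra units in the degree bound account for the hubs themselves, which [outer_degree]
    leaves out. *)
Definition hop (g : rel 'I_k) i : rel 'I_k := fun x y =>
  (x == y) || (m i <= #|[pred y' | [&& g y' x, g y' y & (#|g y'| <= (Dl i).+2)%N]]|%:R).

Definition sc (j : nat) : nat := iter j nxt i0.

(** Only the values [h j] with [jJ <= j <= N] matter: the part below [jJ] is covered by the [l] low
    links. *)
Definition reach (g : rel 'I_k) (Dp l jJ N : nat) u H : Prop :=
  exists h : nat -> 'I_k,
    [/\ h jJ \in ball_in (low_link g Dp) l u,
        forall j, (jJ <= j < N)%N -> hop g (sc j) (h j) (h j.+1) & h N = H].

Lemma low_linkC g Dp : symmetric g -> symmetric (low_link g Dp).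
Proof. by move=> gC x y; rewrite /low_link gC orbC. Qed.

Lemma load_deg Jb u y : vbox Jb u y -> (degp f y <= load Jb f u)%N.
Proof. by move=> uy; rewrite /load (bigD1 y) //= leq_addr. Qed.

Variables (jJ N Jb : nat).
Hypothesis jJN : (jJ <= N)%N.
Hypothesis scN : sc N = b.
Hypothesis sc_lt : forall j, (j < N)%N -> (i0 <= sc j < b)%N.
Hypothesis scJ : forall j, (jJ <= j < N)%N -> (J <= sc j)%N.
Hypothesis scJb : forall j, (j < jJ)%N -> (sc j <= Jb)%N.
Hypothesis m_gt0 : forall i, 0 < m i.
Hypothesis z_le : forall i, (z i <= i)%N.

Lemma chain_step c j : cellgood f c -> (j < N)%N ->
  exists h h', [/\ hub (sc j) c = Some h, hub (sc j.+1) c = Some h' &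
    (h == h') || (m (sc j) <= #|conn_set f (sc j) h h'|%:R)].
Proof.
move=> /andP[_ gc] jN; have := gchainP gc (sc_lt jN).
rewrite /stepok -[nxt (sc j)]/(sc j.+1).
by case: (hub (sc j) c) => // h; case: (hub (sc j.+1) c) => // h'; exists h, h'.
Qed.

Lemma conn_setP i h h' y : conn_set f i h h' y ->
  [/\ G y h, G y h', vbox (z i) y h & ((J <= i)%N -> (#|G y| <= (Dl i).+2)%N)].
Proof.
move=> /and3P[/and3P[yh _ _] /andP[y1 y2] lw]; split=> //.
- exact: sprinkled_sub.
- exact: sprinkled_sub.
- by move=> Ji; apply: leq_trans (deg_sprinkled_outer h h' y) _; move: lw; rewrite Ji.
Qed.

Lemma chain_hop c j h h' : cellgood f c -> (jJ <= j < N)%N ->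
  hub (sc j) c = Some h -> hub (sc j.+1) c = Some h' -> hop G (sc j) h h'.
Proof.
move=> gc jb; have := scJ jb; case/andP: jb => _ jN Js e e'.
have [h1 [h1' []]] := chain_step gc jN; rewrite e e' => -[<-] [<-].
rewrite /hop; case: (h == h') => //= mh; apply: le_trans mh _; rewrite ler_nat.
apply/subset_leq_card/fintype.subsetP => y; rewrite unfold_in => /conn_setP[yh yh' _ /(_ Js) dy].
by rewrite inE yh yh' dy.
Qed.

(** Below [jJ] one connector per hop is enough. It lies in the [Jb]-box of [u], so the bound on
    [load] makes both of its edges low links, two per hop. *)
Lemma chain_low Dp u j : cellgood f (cell u) -> (load Jb f u <= Dp)%N -> (j <= jJ)%N ->
  exists2 h0, hub i0 (cell u) = Some h0 &
  exists2 h, hub (sc j) (cell u) = Some h & h \in ball_in (low_link G Dp) (2 * j) h0.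
Proof.
move=> gc ld; elim: j => [|j IH] jj.
  have [e|Npos] := posnP N.
    have e0 : i0 = b by rewrite -scN e.
    have := cchainP (proj1 (andP gc)) (i := i0); rewrite e0 leqnn /= => /(_ isT) /and4P[+ _ _ _].
    by case eb: (hub b (cell u)) => [h|] // _; exists h => //; exists h; rewrite /= ?e0 ?inE.
  have [h [_ [e _ _]]] := chain_step gc Npos.
  by exists h => //; exists h => //; rewrite inE.
have [h0 e0 [h e hb0]] := IH (ltnW jj); exists h0 => //.
have [h1 [h' [e1 e' conn]]] := chain_step gc (leq_trans jj jJN).
exists h' => //; move: e1 conn; rewrite e => -[<-] conn.
rewrite mulnS addnC; apply: ball_trans hb0 _.
case/orP: conn => [/eqP <-|mh]; first exact: ball_refl.
have : 0 < #|conn_set f (sc j) h h'|%:R :> R by apply: lt_le_trans mh.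
rewrite ltr0n => /card_gt0P[y]; rewrite unfold_in => /conn_setP[yh yh' yz _].
have yu : vbox Jb u y.
  have [sh _] := hubP e.
  apply: (same_boxW (scJb jj)).
  rewrite same_box_sym; apply: same_box_trans (same_boxW (z_le _) yz) sh.
have dy : (#|G y| <= Dp)%N.
  exact: leq_trans (deg_sprinkled y) (leq_trans (load_deg yu) ld).
have hy : y \in ball_in (low_link G Dp) 1 h.
  have yh0 : G h y by rewrite /G adjfC.
  by apply: (@ball_step _ _ 0 h h); rewrite ?ball_refl // /low_link yh0 dy orbT.
by apply: (ball_step hy); rewrite /low_link yh' dy.
Qed.

(** The number of low links is made of [s * L] steps inside the good ball, one sprinkled edge to the
    hub of the box, and [2 * jJ] steps up to scale [sc jJ]. The top box contains every cell, so the
    hub of [y] at scale [b] is the hub of [u]. *)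
Lemma vgood_reach Dp s u y H : vgood Jb Dp f u -> hub b (cell u) = Some H ->
  y \in local_ball (vgood Jb Dp f) f s L u -> linked_to_hub hb f' y ->
  reach G Dp (s * L + 1 + 2 * jJ) jJ N u H.
Proof.
move=> vu eH yB ly.
have vy : vgood Jb Dp f y by apply: local_ball_vg vu yB.
case/andP: (vy) => gy ldy.
have [h0 e0 [h e hB]] := chain_low gy ldy (leqnn jJ).
exists (fun j => odflt u (hub (sc j) (cell y))); split.
- rewrite e /=; apply: ball_trans hB; apply: (@ball_trans _ _ _ _ _ y).
    apply: (fintype.subsetP (ball_mono _ _ _) _ yB) => v w /and3P[vv vw vwa].
    rewrite /low_link /G sprinkled_sub //= -/G; apply/orP; left.
    case/andP: vv => _ ldv; apply: leq_trans (deg_sprinkled v) (leq_trans _ ldv).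
    exact: (load_deg (same_box_refl _ _)).
  have hby : hb y = h0 by rewrite /hb e0.
  have [ey|ny] := eqVneq y (hb y); first by rewrite -hby -ey ball_refl.
  apply: (@ball_step _ _ 0 y y); rewrite ?ball_refl // /low_link -hby.
  have -> /= : G y (hb y) by apply: linked_adj.
  apply/orP; left; apply: leq_trans (deg_sprinkled y) (leq_trans _ ldy).
  exact: (load_deg (same_box_refl _ _)).
- move=> j jb; have [|h1 [h2 [e1 e2 _]]] := chain_step gy (j := j); first by case/andP: jb.
  by rewrite e1 e2 /=; apply: (chain_hop gy jb e1 e2).
- by rewrite scN (hub_eq (c' := cell u)) ?eH // same_box_top.
Qed.

End Reach.
End Chain.

(** An edge is absent when both independent layers leave it closed; the hypothesis says that these
    probabilities multiply to [1 - q y v]. *)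
Lemma GE_sprinkled (R : realType) (k : nat) (hb : 'I_k -> 'I_k) (q qg : 'I_k -> 'I_k -> R)
    (dl : R) (F : {ffun 'I_k * 'I_k -> bool} -> R) :
  edge_prob q -> edge_prob qg ->
  (forall y v, y != v ->
    1 - q y v = (1 - qg y v) * (if hub_edges hb (ed y v) then 1 - dl else 1)) ->
  GE qg (fun f => PE (bern (hub_law hb dl)) (fun f' => F (sprinkled hb f f'))) = GE q F.
Proof.
move=> qp qgp qE; rewrite /GE PE_pair.
rewrite -(PE_push (h := fun e (xy : bool * bool) => xy.1 || (hub_edges hb e && xy.2))
  (nu := fun i xy => bern (edge_law qg) i xy.1 * bern (hub_law hb dl) i xy.2)) /=.
  by apply: eq_PE => f; congr F; apply/ffunP => i; rewrite !ffunE.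
move=> e c.
have -> : \sum_(y : bool * bool | y.1 || hub_edges hb e && y.2 == c)
      bern (edge_law qg) e y.1 * bern (hub_law hb dl) e y.2 =
  \sum_(x : bool) \sum_(y : bool | x || hub_edges hb e && y == c)
     bern (edge_law qg) e x * bern (hub_law hb dl) e y.
  by rewrite pair_big_dep.
have E1 : 1 - edge_law q e =
  (1 - edge_law qg e) * (if hub_edges hb e then 1 - dl else 1).
  rewrite /edge_law; case: (ltnP e.1 e.2) => e12.
    have ne : e.1 != e.2 by rewrite -val_eqE /= neq_ltn e12.
    rewrite qE //; congr (_ * _).
    by rewrite /ed e12 -surjective_pairing.
  case: ifP => [/existsP[y /andP[ny /eqP ey]]|_]; last by rewrite subr0 mulr1.
  exfalso; move: e12 ny; rewrite ey /ed; case: ltngtP => //= [||/val_inj <-]; rewrite ?eqxx //.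
  - by case: ltngtP.
  - by case: ltngtP.
rewrite big_bool /= (big_mkcond (fun y => true == c))
  (big_mkcond (fun y => hub_edges hb e && y == c)) !big_bool /=.
move: E1; rewrite /bern /hub_law; case: (hub_edges hb e); case: c => /=; lra.
Qed.

(** If n exceeds A/w, then n w / A exceeds 1. This trades a first power for a square, whose total is
    controlled, at the price of a term independent of n. *)
Lemma natr_le_quad (R : realFieldType) (n : nat) (A w : R) : 0 < A -> 0 < w ->
  n%:R <= w * n%:R ^+ 2 / A + A / w :> R.
Proof.
move=> A0 w0; have n0 : 0 <= n%:R :> R by [].
have [h|h] := leP n%:R (A / w).
  by rewrite (le_trans h) // lerDr divr_ge0 ?(ltW A0) // mulr_ge0 ?exprn_ge0 ?(ltW w0).
apply: (@le_trans _ _ (w * n%:R ^+ 2 / A)); last first.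
  by rewrite lerDl divr_ge0 ?(ltW A0) ?(ltW w0).
rewrite ler_pdivlMr // expr2 mulrA mulrC ler_wpM2r //.
by move: h; rewrite ltr_pdivrMr // mulrC => /ltW.
Qed.

(** * Counting the vertices from which the climb fails *)

Section LocalAssembly.
Variables (R : realType) (d b k : nat) (cell : 'I_k -> cellT d b) (cl : 'I_k -> nat).
Variables (a z nxt : nat -> nat) (i0 J L : nat) (Kf : 'I_k -> 'I_k -> R).
Variables (Mc Mg m : nat -> R) (Dl : nat -> nat) (Jb Dp s : nat).
Variables (w Mw : 'I_k -> R).
Implicit Types f : {ffun 'I_k * 'I_k -> bool}.
Let chainc := cchain cell cl a z i0 J L Kf Mc.
Let gch := gchain cell cl a z nxt i0 J m Dl.
Let vg f := vgood cell cl a z nxt i0 J L Kf Mc m Dl Jb Dp f.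
Let hubb := hb cell cl a i0.
Let bid := boxid cell i0.
Let dgp f y := degp cell i0 f y.

Definition broken_chains f : nat := #|[pred c | chainc c && ~~ gch f c]|.
(** The weight [w y] will be the inverse of the weight factor of [y]: the expected squared degree is
    quadratic in that factor, and its second moment may be infinite. *)
Definition weighted_sqdegree f : R := \sum_y w y * (dgp f y)%:R ^+ 2.
Definition total_load f : nat := (\sum_u load cell i0 Jb f u)%N.
Definition unlinked_spread f f' : nat := #|[pred u | vg f u && (many_boxes bid (vg f) f s L u &&
   [forall y, (y \in local_ball (vg f) f s L u) ==> ~~ linked_to_hub hubb f' y])]|.

Section Expectations.
Variable q : 'I_k -> 'I_k -> R.
Hypothesis qp : edge_prob q.
Hypothesis qK : forall y v, y != v -> q y v + (vbox cell i0 y v)%:R <= Kf y v.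
Hypothesis w0 : forall y, 0 <= w y.

Let counted f y v : R := (adjf f y v)%:R + (vbox cell i0 y v)%:R.

Lemma counted_mean y v : v != y -> GE q (fun f => counted f y v) <= Kf y v.
Proof.
move=> vy; have yv : y != v by rewrite eq_sym.
rewrite /GE PED PE_cst; last exact: GE_pmf.
by rewrite -[X in X + _]/(GE q (fun f => (adjf f y v)%:R)) GE_adj //; apply: qK.
Qed.

Lemma degp_counted f y : (dgp f y)%:R <= \sum_(v | v != y) counted f y v.
Proof.
rewrite /dgp /degp -sum1_card natr_sum big_mkcond [leRHS]big_mkcond.
apply: ler_sum => v _; rewrite inE; case: (v != y) => //=.
rewrite /counted; case: (adjf f y v); case: (vbox _ _ _ _);
  by rewrite /= ?addr0 ?add0r ?lexx ?lerDl ?ler01.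
Qed.

Lemma degp_mean y : GE q (fun f => (dgp f y)%:R) <= \sum_(v | v != y) Kf y v.
Proof.
apply: le_trans (le_PE (GE_pmf qp) (degp_counted ^~ y)) _.
by rewrite PE_sum; apply: ler_sum => v vy; apply: counted_mean.
Qed.

(** Diagonal terms are squares of indicators and give the first sum; for [v != t] the two edges at
    [y] are independent. *)
Lemma degp_square_mean y : GE q (fun f => (dgp f y)%:R ^+ 2) <=
  \sum_(v | v != y) Kf y v + \sum_(v | v != y) \sum_(t | (t != y) && (t != v)) Kf y v * Kf y t.
Proof.
pose chi f v : R := ((v != y) && (adjf f y v || vbox cell i0 y v))%:R.
have dE f : (dgp f y)%:R = \sum_v chi f v.
  rewrite /dgp /degp -sum1_card natr_sum big_mkcond; apply: eq_bigr => v _.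
  by rewrite inE /chi; case: ifP => // ->.
have chiC f v : v != y -> chi f v <= counted f y v.
  rewrite /chi /counted => ->; case: (adjf f y v); case: (vbox _ _ _ _);
  by rewrite /= ?addr0 ?add0r ?lexx ?lerDl ?ler01.
apply: (@le_trans _ _ (GE q (fun f => \sum_(v | v != y) counted f y v +
   \sum_(v | v != y) \sum_(t | (t != y) && (t != v)) counted f y v * counted f y t))).
  apply: (le_PE (GE_pmf qp)) => f; rewrite dE expr2 mulr_suml -big_split /= [leRHS]big_mkcond.
  apply: ler_sum => v _; rewrite /= mulr_sumr; case: (eqVneq v y) => [->|vy] /=.
    by rewrite big1 // => t _; rewrite {1}/chi eqxx /= mul0r.
  rewrite (bigD1 v) //=; apply: lerD.
    apply: le_trans (chiC f v vy); rewrite /chi; by case: (_ && _); rewrite /= ?mulr0 ?mulr1.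
  rewrite big_mkcond [leRHS]big_mkcond; apply: ler_sum => t _ /=.
  case: (eqVneq t v) => [->|tv]; first by rewrite andbF.
  case: (eqVneq t y) => [->|ty] /=; first by rewrite {2}/chi eqxx mulr0.
  by apply: ler_pM; rewrite ?ler0n // chiC.
rewrite /GE PED; apply: lerD.
  by rewrite PE_sum; apply: ler_sum => v vy; apply: counted_mean.
rewrite PE_sum; apply: ler_sum => v vy; rewrite PE_sum; apply: ler_sum => t /andP[ty tv].
have [yv yt vt] : [/\ y != v, y != t & v != t] by rewrite ![y == _]eq_sym [v == t]eq_sym.
have e1 := GE_adj2 qp yv yt vt.
rewrite (eq_PE _ (G := fun f => (adjf f y v)%:R * (adjf f y t)%:R + ((vbox cell i0 y t)%:R * (adjf f y v)%:R
  + ((vbox cell i0 y v)%:R * (adjf f y t)%:R + (vbox cell i0 y v)%:R * (vbox cell i0 y t)%:R)))); last first.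
  by move=> f; rewrite /counted; ring.
rewrite !PED !PEZ PE_cst; last exact: GE_pmf.
move: e1 (GE_adj qp yv) (GE_adj qp yt); rewrite /GE => -> -> ->.
apply: le_trans (_ : (q y v + (vbox cell i0 y v)%:R) * (q y t + (vbox cell i0 y t)%:R) <= _).
  by rewrite le_eqVlt; apply/orP; left; apply/eqP; ring.
have [/andP[qv _] /andP[qt _]] := (qp.2 y v, qp.2 y t).
by apply: ler_pM; rewrite ?addr_ge0 //; apply: qK.
Qed.

Lemma weighted_sqdegree_mean : GE q weighted_sqdegree <= \sum_y w y * (\sum_(v | v != y) Kf y v +
   \sum_(v | v != y) \sum_(t | (t != y) && (t != v)) Kf y v * Kf y t).
Proof.
rewrite /GE /weighted_sqdegree PE_sum; apply: ler_sum => y _; rewrite PEZ ler_wpM2l //.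
exact: degp_square_mean.
Qed.

Lemma total_load_mean : GE q (fun f => (total_load f)%:R) <=
  \sum_u \sum_(y | vbox cell Jb u y) \sum_(v | v != y) Kf y v.
Proof.
rewrite (_ : GE q _ = GE q (fun f => \sum_u \sum_(y | vbox cell Jb u y) (dgp f y)%:R)); last first.
  apply: eq_PE => f; rewrite /total_load natr_sum; apply: eq_bigr => u _.
  by rewrite /load natr_sum.
rewrite /GE PE_sum; apply: ler_sum => u _; rewrite PE_sum; apply: ler_sum => y _.
exact: degp_mean.
Qed.

Lemma broken_chains_mean (sf : nat -> R) : (forall i, 0 <= sf i) ->
  (forall i c, (i0 <= i < b)%N -> chainc c ->
     GE q (fun f => (~~ stepok cell cl a z nxt i0 J m Dl f i c)%:R) <= sf i) ->
  GE q (fun f => (broken_chains f)%:R) <= #|{: cellT d b}|%:R * \sum_(i < b | (i0 <= i)%N) sf i.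
Proof.
move=> sf0 sfP.
have key c : chainc c -> GE q (fun f => (~~ gch f c)%:R) <= \sum_(i < b | (i0 <= i)%N) sf i.
  move=> cc; apply: (@le_trans _ _ (GE q (fun f => \sum_(i < b | (i0 <= i)%N)
     (~~ stepok cell cl a z nxt i0 J m Dl f i c)%:R))).
    apply: (le_PE (GE_pmf qp)) => f; case: (boolP (gch f c)) => /= [_|].
      by apply: sumr_ge0.
    rewrite negb_forall => /existsP[i]; rewrite negb_imply => /andP[i0i ns].
    by rewrite (bigD1 i) //= ns lerDl sumr_ge0.
  rewrite /GE PE_sum; apply: ler_sum => i i0i; apply: sfP => //.
  by rewrite i0i ltn_ord.
have S0 : 0 <= \sum_(i < b | (i0 <= i)%N) sf i by apply: sumr_ge0.
apply: (@le_trans _ _ (GE q (fun f => \sum_(c | chainc c) (~~ gch f c)%:R))).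
  apply: (le_PE (GE_pmf qp)) => f; rewrite /broken_chains -sum1_card natr_sum big_mkcondr /=.
  by apply: ler_sum => c _; case: (~~ _).
rewrite /GE PE_sum.
apply: (@le_trans _ _ (\sum_c \sum_(i < b | (i0 <= i)%N) sf i)).
  rewrite big_mkcond; apply: ler_sum => c _; case: ifP => // cc; exact: key.
by rewrite sumr_const mulr_natl.
Qed.

End Expectations.

Lemma unlinked_spread_mean f (dl : R) : 0 <= dl <= 1 ->
  PE (bern (hub_law hubb dl)) (fun f' => (unlinked_spread f f')%:R) <= k%:R * (1 - dl) ^+ s.
Proof.
move=> dl01.
have P : is_pmf (bern (hub_law hubb dl)).
  by apply: bern_pmf => e; rewrite /hub_law; case: ifP => _ //; rewrite lexx ler01.
rewrite (eq_PE _ (G := fun f' => \sum_u (vg f u && (many_boxes bid (vg f) f s L u &&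
   [forall y, (y \in local_ball (vg f) f s L u) ==> ~~ linked_to_hub hubb f' y]))%:R)); last first.
  move=> f'; rewrite /unlinked_spread -sum1_card natr_sum big_mkcond; apply: eq_bigr => u _.
  by rewrite inE; case: ifP => // ->.
rewrite PE_sum; apply: (@le_trans _ _ (\sum_(u < k) (1 - dl) ^+ s)); last first.
  by rewrite sumr_const card_ord mulr_natl.
apply: ler_sum => u _; case/andP: (dl01) => dl0 dl1.
case: (boolP (many_boxes bid (vg f) f s L u)) => mb; last first.
  by rewrite (eq_PE _ (G := fun=> 0)) ?PE_cst ?exprn_ge0 ?subr_ge0 // => f'; rewrite andbF.
apply: le_trans (many_boxes_unlinked (boxid_hb cell cl a i0) dl01 mb).
by apply: (le_PE P) => f'; rewrite ler_nat; case: (vg f u).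
Qed.

Lemma vgood_box_card f y : (i0 <= b)%N -> vg f y ->
  (#|[pred v | vg f v && (bid v == bid y)]| <= L)%N.
Proof.
move=> i0b /andP[/andP[cc _] _]; have := cchainP cc (i := i0).
rewrite leqnn i0b => /(_ isT)/and4P[_ _ + _]; rewrite eqxx /=; apply: leq_trans.
apply/subset_leq_card/fintype.subsetP => v; rewrite !inE => /andP[_].
by rewrite boxidE.
Qed.

Section Deterministic.
Variables (f f' : {ffun 'I_k * 'I_k -> bool}) (jJ N : nat) (H : 'I_k).
Hypothesis i0b : (i0 <= b)%N.
Hypothesis jJN : (jJ <= N)%N.
Hypothesis scN : sc nxt i0 N = b.
Hypothesis sc_lt : forall j, (j < N)%N -> (i0 <= sc nxt i0 j < b)%N.
Hypothesis scJ : forall j, (jJ <= j < N)%N -> (J <= sc nxt i0 j)%N.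
Hypothesis scJb : forall j, (j < jJ)%N -> (sc nxt i0 j <= Jb)%N.
Hypothesis m_gt0 : forall i, 0 < m i.
Hypothesis z_le : forall i, (z i <= i)%N.
Hypothesis HP : forall c h, hub cell cl a b c = Some h -> h = H.

Let G := adjf (sprinkled hubb f f').

(* Vertices in large components from which the climb along the hubs is
   impossible. *)
Definition failing u : bool :=
  (s * L < #|[set y | connect G u y]%SET|)%N &&
  ~~ `[< reach nxt i0 m Dl G Dp (s * L + 1 + 2 * jJ) jJ N u H >].

(** Of the four outcomes of [local_phase], the first yields [reach] and the last a component of at
    most [s * L] vertices. The other two, and the vertices that are not good, give the three
    terms. *)
Lemma failing_card :
  (#|failing| <= unlinked_spread f f' + #|[pred u | ~~ vg f u]| + s * L * \sum_(u | ~~ vg f u) dgp f u)%N.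
Proof.
have sub : (#|failing| <= #|[pred u | ~~ vg f u]| + (unlinked_spread f f' + \sum_u near_bad (vg f) f s L u))%N.
  have -> : (\sum_u near_bad (vg f) f s L u)%N = #|[pred u | near_bad (vg f) f s L u]|.
    by rewrite -sum1_card [RHS]big_mkcond; apply: eq_bigr => u _; rewrite inE; case: (near_bad _ _ _ _ _).
  set A := [pred u | ~~ vg f u]; set B := [pred u | near_bad _ _ _ _ u].
  set X := [pred u | vg f u && (many_boxes bid (vg f) f s L u &&
   [forall y, (y \in local_ball (vg f) f s L u) ==> ~~ linked_to_hub hubb f' y])].
  have sub : failing \subset [predU A & [predU X & B]].
    apply/fintype.subsetP => u /andP[cu nr]; rewrite !inE.
    case: (boolP (vg f u)) => //= vu.
    case: (local_phase (hb_hb cell cl a i0) f f' s (fun y => @vgood_box_card f y i0b) vu).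
    - move=> [y yB ly]; case/negP: nr; apply/asboolP.
      have gu : cellgood cell cl a z nxt i0 J L Kf Mc m Dl f (cell u) by case/andP: vu.
      have := cchainP (proj1 (andP gu)) (i := b); rewrite i0b leqnn => /(_ isT)/and4P[+ _ _ _].
      case eH : (hub cell cl a b (cell u)) => [h|] // _.
      rewrite -(HP eH).
      exact: (vgood_reach jJN scN sc_lt scJ scJb m_gt0 z_le vu eH yB ly).
    - by move=> ->.
    - by move=> ->; rewrite orbT.
    - by rewrite leqNgt cu.
  apply: leq_trans (subset_leq_card sub) _.
  apply: leq_trans (_ : #|A| + #|[predU X & B]| <= _)%N; first by rewrite -cardUI leq_addr.
  by rewrite leq_add2l -cardUI leq_addr.
apply: leq_trans sub _; rewrite addnCA addnA leq_add2l.
apply: leq_trans (near_bad_card (vg f) f s L) _.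
rewrite leq_mul2l; apply/orP; right; apply: leq_sum => u _.
apply/subset_leq_card/fintype.subsetP => v; rewrite inE => uv.
rewrite unfold_in in uv; have -> : v != u by case/andP: uv; rewrite eq_sym.
by rewrite /adjf uv.
Qed.

Variables (A A3 : R) (e : nat).
Hypotheses (A_gt0 : 0 < A) (A3_gt0 : 0 < A3).
Hypothesis w_gt0 : forall y, 0 < w y.
Hypothesis wM : forall y, (w y)^-1 <= A ^- 2 * Mw y + A ^+ e.

Definition cell_count (c : cellT d b) : nat := #|[pred u | cell u == c]|.

(** Few bad cells might still hold many vertices; a cell count is at most its square over [A3] plus
    [A3], and the squares are bounded in total. The last term is Markov for the loads. *)
Lemma nonvgood_card (x0 x1 x3 n2 : R) :
  #|[pred c | ~~ chainc c]|%:R <= x0 -> (broken_chains f)%:R <= x1 -> (total_load f)%:R <= x3 ->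
  \sum_c (cell_count c)%:R ^+ 2 <= n2 ->
  #|[pred u | ~~ vg f u]|%:R <= n2 / A3 + A3 * (x0 + x1) + x3 / Dp.+1%:R.
Proof.
move=> h0 h1 h3 h2.
pose bc : pred (cellT d b) := fun c => ~~ (chainc c && gch f c).
apply: (@le_trans _ _ (#|[pred u | bc (cell u)]|%:R + #|[pred u | Dp < load cell i0 Jb f u]%N|%:R)).
  rewrite -natrD ler_nat.
  have sub : [pred u | ~~ vg f u] \subset [predU [pred u | bc (cell u)] & [pred u | Dp < load cell i0 Jb f u]%N].
    apply/fintype.subsetP => u; rewrite !inE /vg /vgood negb_and -ltnNge.
    by rewrite /bc.
  by apply: leq_trans (subset_leq_card sub) _; rewrite -cardUI leq_addr.
apply: lerD; last first.
  rewrite ler_pdivlMr ?ltr0n //; apply: le_trans h3; rewrite -natrM ler_nat /total_load.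
  rewrite -sum1_card big_distrl /= [X in (X <= _)%N]big_mkcond; apply: leq_sum => u _.
  by rewrite inE mul1n; case: ltnP.
have -> : #|[pred u | bc (cell u)]| = (\sum_(c | bc c) cell_count c)%N.
  rewrite -sum1_card (partition_big cell bc) //=; apply: eq_bigr => c bcc.
  rewrite sum1_card; apply: eq_card => u; rewrite !unfold_in /=.
  by case: eqP => [->|]; rewrite ?andbF // andbT.
rewrite natr_sum.
apply: (@le_trans _ _ (\sum_(c | bc c) ((cell_count c)%:R ^+ 2 / A3 + A3))).
  apply: ler_sum => c _.
  by have := natr_le_quad (cell_count c) A3_gt0 ltr01; rewrite mul1r divr1.
rewrite big_split /= -mulr_suml; apply: lerD.
  rewrite ler_wpM2r ?invr_ge0 ?(ltW A3_gt0) //; apply: le_trans h2.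
  by rewrite big_mkcond; apply: ler_sum => c _; case: ifP => // _; rewrite exprn_ge0.
rewrite sumr_const -mulr_natr ler_wpM2l ?(ltW A3_gt0) //.
apply: le_trans (lerD h0 h1); rewrite -natrD ler_nat.
have sub : bc \subset [predU [pred c | ~~ chainc c] & [pred c | chainc c && ~~ gch f c]].
  apply/fintype.subsetP => c; rewrite unfold_in !inE /bc negb_and.
  by case: (chainc c).
by apply: leq_trans (subset_leq_card sub) _; rewrite -cardUI leq_addr.
Qed.

Lemma failing_bound (x2 mm nv x4 : R) :
  weighted_sqdegree f <= x2 -> \sum_y Mw y <= mm -> (forall y, 0 <= Mw y) ->
  #|[pred u | ~~ vg f u]|%:R <= nv -> (unlinked_spread f f')%:R <= x4 ->
  #|failing|%:R <= x4 + nv * (1 + (s * L)%:R * A ^+ e.+1) + (s * L)%:R * (x2 + mm) / A.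
Proof.
move=> h2 hm M0 hv h4.
have Ai : 0 <= A^-1 by rewrite invr_ge0 ltW.
(* Bad vertices are few but their degrees are unbounded. [natr_le_quad] charges high degrees to the
   weighted squares, and [wM] splits the inverse weight into a part small on average and a constant
   paid once per bad vertex. *)
have key : \sum_(u | ~~ vg f u) (dgp f u)%:R <= x2 / A + (mm / A + A ^+ e.+1 * nv).
  apply: (@le_trans _ _ (\sum_(u | ~~ vg f u) (w u * (dgp f u)%:R ^+ 2 / A + (Mw u / A + A ^+ e.+1)))).
    apply: ler_sum => u _; apply: le_trans (natr_le_quad (dgp f u) A_gt0 (w_gt0 u)) _.
    rewrite lerD2l; apply: le_trans (ler_wpM2l (ltW A_gt0) (wM u)) _.
    rewrite mulrDr -exprS lerD2r mulrA expr2 invfM mulrA divff ?gt_eqF // mul1r mulrC //.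
  rewrite big_split /=; apply: lerD.
    rewrite -mulr_suml ler_wpM2r //; apply: le_trans h2; rewrite /weighted_sqdegree big_mkcond.
    apply: ler_sum => u _; case: ifP => // _.
    by rewrite mulr_ge0 ?exprn_ge0 // ltW.
  rewrite big_split /=; apply: lerD.
    rewrite -mulr_suml ler_wpM2r //; apply: le_trans hm; rewrite big_mkcond.
    by apply: ler_sum => u _; case: ifP.
  rewrite sumr_const -mulr_natr ler_wpM2l ?exprn_ge0 ?(ltW A_gt0) //.
have := failing_card; rewrite -(ler_nat R) !natrD natrM => /le_trans; apply.
rewrite natr_sum.
have sl : 0 <= (s * L)%:R :> R by [].
have := ler_wpM2l sl key.
by rewrite [(s * L)%:R * (x2 + mm) / A]mulrAC -mulrA; lra.
Qed.

End Deterministic.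
End LocalAssembly.

(** * Existence of a large component *)

Section BoxBase.
Variables (d b : nat).
Implicit Types c : cellT d b.

Lemma base_lt (i : nat) (x : 'I_(2 ^ b)) : (x %/ 2 ^ i * 2 ^ i < 2 ^ b)%N.
Proof. exact: leq_ltn_trans (leq_trunc_div _ _) (ltn_ord x). Qed.

(** The lower corner cell serves as the canonical representative of a box; distinct base cells stand
    for disjoint boxes. *)
Definition box_base i c : cellT d b := [ffun j => Ordinal (base_lt i (c j))].

Lemma box_base_same i c : same_box i (box_base i c) c.
Proof. by apply/same_boxP => j; rewrite ffunE /= mulnK ?expn_gt0. Qed.

Lemma box_base_eq i c c' : same_box i c c' -> box_base i c = box_base i c'.
Proof.
move=> /same_boxP h; apply/ffunP => j; rewrite !ffunE; apply: val_inj => /=.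
by rewrite h.
Qed.

Definition is_base i : {set cellT d b} := [set c | box_base i c == c]%SET.

Lemma box_base_is_base i c : box_base i c \in is_base i.
Proof. by rewrite inE (box_base_eq (box_base_same i c)). Qed.

Lemma is_base_inj i c c' : c \in is_base i -> c' \in is_base i -> same_box i c c' -> c = c'.
Proof. by rewrite !inE => /eqP e /eqP e' /box_base_eq h; rewrite -e -e' h. Qed.

Lemma sum_base i (P : pred (cellT d b)) : (i <= b)%N ->
  (forall c c', same_box i c c' -> P c = P c') ->
  (#|P| = #|[pred c | (c \in is_base i) && P c]| * 2 ^ (d * i))%N.
Proof.
move=> ib PP; rewrite -sum1_card (partition_big (box_base i) [pred c | (c \in is_base i) && P c]) /=; last first.
  by move=> c Pc; rewrite box_base_is_base (PP _ _ (box_base_same i c)).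
rewrite (eq_bigr (fun=> 2 ^ (d * i))%N); last first.
  move=> c /andP[cb Pc]; rewrite sum1_card -(card_same_box c ib); apply: eq_card => c'.
  rewrite !unfold_in /=; apply/andP/idP => [[_ /eqP <-]|h].
    by apply: box_base_same.
  split; first by rewrite -[_ c']/(P c') -(PP _ _ h).
  by move: cb; rewrite inE => /eqP <-; rewrite (box_base_eq h).
by rewrite sum_nat_const.
Qed.

Lemma card_base i : (i <= b)%N -> (#|is_base i| * 2 ^ (d * i) = 2 ^ (d * b))%N.
Proof.
move=> ib; rewrite -(card_cellT d b) [RHS](@sum_base i predT ib) //.
by congr (_ * _)%N; apply: eq_card => c; rewrite [in RHS]inE /= andbT.
Qed.

End BoxBase.

Section Existence.
Variables (R : realType) (d b k : nat) (cell : 'I_k -> cellT d b) (cl : 'I_k -> nat).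
Variables (a z nxt : nat -> nat) (i0 J L : nat) (Kf : 'I_k -> 'I_k -> R).
Variables (Mc m : nat -> R) (Dl : nat -> nat).
Implicit Types f : {ffun 'I_k * 'I_k -> bool}.
Let chainc := cchain cell cl a z i0 J L Kf Mc.
Let stp := stepok cell cl a z nxt i0 J m Dl.
Let gch := gchain cell cl a z nxt i0 J m Dl.
Let hubb := hb cell cl a i0.
Hypothesis Jb : (b <= J)%N.
Hypothesis z_le : forall i, (z i <= i)%N.
Hypothesis nxt_ge : forall i, (i < b)%N -> (i <= nxt i)%N.

Lemma stp_box f i c c' : (i < b)%N -> same_box i c c' -> stp f i c = stp f i c'.
Proof.
by move=> ib cc; rewrite /stp /stepok (hub_eq _ _ _ cc) (hub_eq _ _ _ (same_boxW (nxt_ge ib) cc)).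
Qed.

Definition step_block i c (e : 'I_k * 'I_k) : bool :=
  match hub cell cl a i c, hub cell cl a (nxt i) c with
  | Some h, Some h' => [exists y, [&& vbox cell (z i) y h, y != h & y != h'] &&
                          ((e == ed y h) || (e == ed y h'))]
  | _, _ => false
  end.

(** Since [b <= J], the degree clause of [conn_set] is void and the step looks at connector edges
    only. With degree bounds, steps in different boxes would interact. *)
Lemma stp_depends i c : (i < b)%N ->
  depends_on (step_block i c) (fun f => (~~ stp f i c)%:R : R).
Proof.
move=> ib f g fg; congr ((~~ _)%:R); rewrite /stp /stepok; move: fg; rewrite /step_block.
case: (hub _ _ _ i c) => // h; case: (hub _ _ _ (nxt i) c) => // h' fg.
congr (_ || (_ <= _%:R)); apply: eq_card => y; rewrite !unfold_in /conn_set.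
have -> : (J <= i)%N = false by apply/negbTE; rewrite -ltnNge (leq_trans ib).
rewrite /= !andbT; case: (boolP [&& _, _ & _]) => //= hy.
by rewrite /connectors /adjf !fg //; apply/existsP; exists y; rewrite hy eqxx ?orbT.
Qed.

(** An edge shared by two boxes with different connector ends makes each connector a hub of the
    other box. If the upper boxes agree, so do their hubs, which are not connectors, and this forces
    equal lower boxes; otherwise the connector would lie in two disjoint upper boxes. *)
Lemma step_block_disjoint i c c' e : (i < b)%N -> c \in is_base d b i -> c' \in is_base d b i ->
  step_block i c e -> step_block i c' e -> c = c'.
Proof.
move=> ib bc bc'; rewrite /step_block.
case eh : (hub _ _ _ i c) => [h|//]; case eh' : (hub _ _ _ (nxt i) c) => [h'|//].
case eg : (hub _ _ _ i c') => [g|//]; case eg' : (hub _ _ _ (nxt i) c') => [g'|//].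
case/existsP => y /andP[/and3P[yh yn yn'] ey] /existsP[x /andP[/and3P[xg xn xn'] ex]].
have [sh _] := hubP eh; have [sh' _] := hubP eh'.
have [sg _] := hubP eg; have [sg' _] := hubP eg'.
have yc : same_box i (cell y) c := same_box_trans (same_boxW (z_le i) yh) sh.
have xc : same_box i (cell x) c' := same_box_trans (same_boxW (z_le i) xg) sg.
apply: (is_base_inj bc bc').
have [xy|xy] := eqVneq x y.
  by apply: same_box_trans xc; rewrite -xy in yc; rewrite same_box_sym xy; move: yc; rewrite xy.
exfalso.
have ii := nxt_ge ib.
have {}ey : exists2 v, (v == h) || (v == h') & e = ed y v.
  by case/orP: ey => /eqP ->; [exists h|exists h']; rewrite ?eqxx ?orbT.
have {}ex : exists2 v, (v == g) || (v == g') & e = ed x v.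
  by case/orP: ex => /eqP ->; [exists g|exists g']; rewrite ?eqxx ?orbT.
case: ey => v vh ey; case: ex => u ug; rewrite ey => /ed_inj [[e1 _]|[e1 e2]]; first by rewrite e1 eqxx in xy.
subst y v.
have [cc|ncc] := boolP (same_box (nxt i) c c').
  have hg : h' = g' by move: eh'; rewrite (hub_eq _ _ _ cc) eg' => -[].
  case/orP: ug => /eqP eu; last by rewrite eu hg eqxx in yn'.
  case/orP: vh => /eqP ev; last by rewrite ev hg eqxx in xn'.
  have : same_box i c c' by apply: same_box_trans sg; rewrite -eu same_box_sym.
  move=> c2; have := is_base_inj bc bc' c2 => c3; subst c'.
  by move: eg; rewrite eh -ev => -[gx]; rewrite -gx eqxx in xn.
case/negP: ncc; rewrite same_box_sym.
apply: same_box_trans (same_boxW ii yc).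
case/orP: ug => /eqP ->; rewrite same_box_sym //.
exact: same_boxW ii sg.
Qed.

Section Count.
Variable q : 'I_k -> 'I_k -> R.
Hypothesis qp : edge_prob q.
Variable sf : nat -> R.
Hypothesis sf0 : forall i, 0 <= sf i.
Hypothesis sfP : forall i c, (i0 <= i < b)%N -> chainc c ->
  GE q (fun f => (~~ stp f i c)%:R) <= sf i.

Definition failing_base i : {set cellT d b} := [set c in is_base d b i | [exists c', same_box i c c' && chainc c']]%SET.

Definition step_failures i f : nat := #|[pred c | chainc c && ~~ stp f i c]|.

(** A failing box contributes all of its 2^(d i) cells. Disjoint blocks of edges make the failures
    independent over boxes, as [chernoff_count] requires. *)
Lemma step_failures_count i (x : nat) : (i0 <= i < b)%N ->
  GE q (fun f => (x * 2 ^ (d * i) <= step_failures i f)%N%:R) <=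
  expR (sf i * #|is_base d b i|%:R - x%:R / 2).
Proof.
move=> ib; have ib' : (i < b)%N by case/andP: ib.
pose X c f := ~~ stp f i c.
have GP := GE_pmf qp.
apply: (@le_trans _ _ (GE q (fun f => (x <= \sum_(c in failing_base i) X c f)%N%:R))).
  apply: (le_PE GP) => f; rewrite ler_nat.
  case: (leqP (x * _)) => // h; rewrite lt0b.
  have : (step_failures i f <= #|[pred c | [exists c', same_box i c c' && chainc c'] && X c f]|)%N.
    apply/subset_leq_card/fintype.subsetP => c; rewrite !inE => /andP[cc ns].
    by rewrite /X ns andbT; apply/existsP; exists c; rewrite same_box_refl.
  rewrite (sum_base (ltnW ib')); last first.
    move=> c c' cc; congr (_ && _); last by rewrite /X (stp_box f ib' cc).
    by apply: eq_existsb => c''; rewrite (same_box_eq _ cc).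
  move=> /(leq_trans h); rewrite leq_pmul2r ?expn_gt0 //; move/leq_trans; apply.
  rewrite -sum1_card [X in (X <= _)%N]big_mkcond [X in (_ <= X)%N]big_mkcond; apply: leq_sum => c _.
  by rewrite !inE; case: (_ == c); case: [exists c', _] => //=; case: (X c f).
apply: le_trans (_ : expR (sf i * #|failing_base i|%:R - x%:R / 2) <= _); last first.
  rewrite ler_expR lerD2r ler_wpM2l // ler_nat; apply: subset_leq_card.
  by apply/fintype.subsetP => c; rewrite !inE => /andP[].
apply: (chernoff_count (E := GE q)) => //.
- by move=> F G; apply: le_PE.
- by move=> w F; rewrite /GE PEZ.
- by move=> A F; rewrite /GE PE_sum.
- move=> B /fintype.subsetP BS.
  rewrite /GE (PE_indep_prod (B := fun c => step_block i c) GP).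
  + rewrite -prodr_const; apply: ler_prod => c cB.
    rewrite PE_ge0 //=.
    have := BS c cB; rewrite !inE => /andP[_ /existsP[c' /andP[cc cc']]].
    rewrite (eq_PE _ (G := fun f => (~~ stp f i c')%:R)); first exact: sfP.
    by move=> f; rewrite /X (stp_box f ib' cc).
  + by move=> c _; apply: stp_depends.
  + move=> e c c' cB cB'; apply: step_block_disjoint => //.
    * by have := BS c cB; rewrite inE => /andP[].
    * by have := BS c' cB'; rewrite inE => /andP[].
Qed.

Lemma step_failures_mean i : (i0 <= i < b)%N ->
  GE q (fun f => (step_failures i f)%:R) <= sf i * (2 ^ (d * b))%:R.
Proof.
move=> ib; have GP := GE_pmf qp.
rewrite (_ : GE q _ = GE q (fun f => \sum_(c | chainc c) (~~ stp f i c)%:R)); last first.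
  apply: eq_PE => f; rewrite /step_failures -sum1_card natr_sum big_mkcondr /=.
  by apply: eq_bigr => c _; case: (~~ _).
rewrite /GE PE_sum; apply: (@le_trans _ _ (\sum_(c : cellT d b) sf i)).
  by rewrite big_mkcond; apply: ler_sum => c _; case: ifP => // cc; apply: sfP.
by rewrite sumr_const card_cellT mulr_natr.
Qed.

Lemma nongchain_count f :
  (#|[pred c | chainc c && ~~ gch f c]| <= \sum_(i < b | (i0 <= i)%N) step_failures i f)%N.
Proof.
rewrite /step_failures; under [X in (_ <= X)%N]eq_bigr => i _ do rewrite -sum1_card big_mkcond.
rewrite exchange_big /= -sum1_card [X in (X <= _)%N]big_mkcond; apply: leq_sum => c _.
rewrite inE; case: ifP => // /andP[cc]; rewrite negb_forall => /existsP[i].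
rewrite negb_imply => /andP[i0i ns]; rewrite (bigD1 i) //= inE cc.
by rewrite -/(stp f i c) in ns; rewrite ns.
Qed.

End Count.

Section Attach.
Variable f : {ffun 'I_k * 'I_k -> bool}.
Hypothesis i0b : (i0 <= b)%N.
Hypothesis i0big : (8 <= 2 ^ (d * i0))%N.
Let good c := cellgood cell cl a z nxt i0 J L Kf Mc m Dl f c.

Definition attachable : pred 'I_k := fun y => good (cell y) && (y != hubb y).

(** Sum the lower bounds over the sub-boxes of cells in the box: each vertex is counted once for
    every cell of its sub-box. *)
Lemma good_box_count c : good c -> (2 ^ (d * i0) <= 4 * box_count cell i0 c)%N.
Proof.
move=> /andP[cc _]; have := cchainP cc (i := i0); rewrite leqnn i0b => /(_ isT).
case/and4P => _ /forallP sub _ _.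
have z0 : (0 < 2 ^ (d * z i0))%N by rewrite expn_gt0.
rewrite -(leq_pmul2r z0).
apply: (@leq_trans (\sum_(c' | same_box i0 c' c) 4 * box_count cell (z i0) c')%N).
  apply: (@leq_trans (\sum_(c' | same_box i0 c' c) 2 ^ (d * z i0))%N).
    rewrite sum_nat_const leq_mul2r -(card_same_box c i0b); apply/orP; right.
    by apply/subset_leq_card/fintype.subsetP => c'; rewrite inE unfold_in same_box_sym.
  by apply: leq_sum => c' cc'; have := sub c'; rewrite cc'.
rewrite -big_distrr /= -mulnA leq_mul2l /=.
rewrite /box_count; under eq_bigr => c' _ do rewrite -sum1_card big_mkcond.
rewrite exchange_big -[X in (_ <= X * _)%N]sum1_card big_distrl /= [X in (_ <= X)%N]big_mkcond.
apply: leq_sum => v _; rewrite inE mul1n.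
case: (boolP (same_box i0 (cell v) c)) => vc; last first.
  rewrite big1 // => c' cc'; rewrite inE; case: ifP => // vc'.
  by case/negP: vc; apply: same_box_trans (same_boxW (z_le i0) vc') cc'.
rewrite -big_mkcondr sum1_card -(card_same_box (cell v) (leq_trans (z_le i0) i0b)).
apply/subset_leq_card/fintype.subsetP => c'; rewrite unfold_in => /andP[_].
by rewrite !inE.
Qed.

Hypothesis good_box : forall c c', same_box i0 c c' -> good c = good c'.

(** A good box holds at least a quarter of 2^(d i0) vertices, of which only one is the hub; as 2^(d
    i0) is at least 8, an eighth remains. *)
Lemma attachable_card : (#|good| <= 8 * #|attachable|)%N.
Proof.
have s0 : (0 < 2 ^ (d * i0))%N by rewrite expn_gt0.
rewrite -(leq_pmul2r s0).
have step c : good c -> (2 ^ (d * i0) <= 8 * #|[pred y | same_box i0 (cell y) c && (y != hubb y)]|)%N.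
  move=> gc; have := good_box_count gc.
  have : (box_count cell i0 c <= #|[pred y | same_box i0 (cell y) c && (y != hubb y)]| + 1)%N.
    rewrite /box_count -(cardID [pred y | y != hubb y]) leq_add //.
    apply/card_le1_eqP => x y; rewrite !inE !negbK => /andP[/eqP ex xc] /andP[/eqP ey yc].
    rewrite ex ey /hubb /hb; have xy : same_box i0 (cell x) (cell y).
      by apply: same_box_trans xc _; rewrite same_box_sym.
    case/andP: gc => cc _; have := cchainP cc (i := i0); rewrite leqnn i0b => /(_ isT)/and4P[+ _ _ _].
    by rewrite -(hub_eq _ _ _ xc) (hub_eq _ _ _ xy); case: (hub _ _ _ _ _).
  lia.
apply: (@leq_trans (\sum_(c | good c) 8 * #|[pred y | same_box i0 (cell y) c && (y != hubb y)]|)%N).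
  rewrite -sum1_card big_distrl /=; apply: leq_sum => c gc; rewrite mul1n; exact: step.
rewrite -big_distrr /= -mulnA leq_mul2l /=.
under eq_bigr => c _ do rewrite -sum1_card big_mkcond.
rewrite exchange_big /= -[X in (_ <= X * _)%N]sum1_card big_distrl /= [X in (_ <= X)%N]big_mkcond.
apply: leq_sum => y _; rewrite mul1n unfold_in /attachable.
case: (boolP (y == hubb y)) => yh /=.
  by rewrite big1 // => c _; rewrite inE yh andbF.
rewrite andbT; case: (boolP (good (cell y))) => gy; last first.
  rewrite big1 // => c gc; rewrite inE; case: ifP => // /andP[yc _].
  by rewrite (good_box yc) gc in gy.
rewrite -big_mkcondr sum1_card -(card_same_box (cell y) i0b).
apply/subset_leq_card/fintype.subsetP => c'; rewrite unfold_in => /andP[_].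
by rewrite !inE => /andP[].
Qed.

Definition attached (f' : {ffun 'I_k * 'I_k -> bool}) : pred 'I_k :=
  fun y => attachable y && f' (ed y (hubb y)).

(** Distinct non-hub vertices have distinct hub edges. The exponential moment gives the exponent dl
    x/4 - dl x/2. *)
Lemma attached_few (dl x : R) : 0 <= dl <= 1 -> x <= #|attachable|%:R ->
  PE (bern (hub_law hubb dl)) (fun f' => (#|attached f'|%:R < dl * x / 4)%R%:R)
   <= expR (- (dl * x / 4)).
Proof.
move=> /andP[dl0 dl1] xW.
have q01 e : 0 <= hub_law hubb dl e <= 1.
  by rewrite /hub_law; case: ifP => _; rewrite ?dl0 ?lexx ?ler01.
have P := bern_pmf q01.
apply: (@le_trans _ _ (PE (bern (hub_law hubb dl)) (fun f' : {ffun _ -> _} => expR (dl * x / 4) *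
   \prod_(y | attachable y) (1 - 2^-1 * (f' (ed y (hubb y)))%:R)))).
  apply: (le_PE P) => f'; case: ltP => h /=; last first.
    rewrite mulr_ge0 ?expR_ge0 ?prodr_ge0 // => y _.
    by case: (f' _) => /=; rewrite ?mulr0 ?mulr1 ?subr0 //; lra.
  apply: (@le_trans _ _ (expR (dl * x / 4) * \prod_(y | attachable y) expR (- (f' (ed y (hubb y)))%:R))); last first.
    rewrite ler_wpM2l ?expR_ge0 //; apply: ler_prod => y _; rewrite expR_ge0 /=.
    have e1 : expR (- 1) <= 1 - 2^-1 * 1 :> R by have := expRN1_le R; lra.
    by case: (f' _) => /=; rewrite ?(mulr1n, mulr0n, mulr0, subr0, oppr0, expR0).
  rewrite -expR_sum -expRD -[X in X <= _]expR0 ler_expR sumrN subr_ge0 -natr_sum.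
  apply: le_trans (ltW h); rewrite ler_nat -sum1_card.
  rewrite [X in (X <= _)%N]big_mkcond [X in (_ <= X)%N]big_mkcond; apply: leq_sum => y _.
  by rewrite unfold_in /attached; case: (attachable y) => //=; case: (f' _).
rewrite PEZ.
rewrite (PE_indep_prod (B := fun y e => e == ed y (hubb y)) P).
- apply: (@le_trans _ _ (expR (dl * x / 4) * \prod_(y | attachable y) expR (- (dl / 2)))).
    rewrite ler_wpM2l ?expR_ge0 //; apply: ler_prod => y /andP[_ yh].
    rewrite PE_ge0 //=; last by move=> f'; case: (f' _) => /=; rewrite ?mulr0 ?mulr1 ?subr0 //; lra.
    rewrite (eq_PE _ (G := fun f' : {ffun 'I_k * 'I_k -> bool} => 1 + (- 2^-1) * (f' (ed y (hubb y)))%:R)); last first.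
      by move=> f'; rewrite mulNr.
    rewrite PED PE_cst // PEZ PE_bern_coord // /hub_law ifT; last first.
      by apply/existsP; exists y; rewrite yh eqxx.
    by apply: le_trans (onem_le_expRN _); lra.
  rewrite prodr_const -expRM_natl -expRD ler_expR.
  have := ler_wpM2l dl0 xW; lra.
- by move=> y _ g g' gg; rewrite gg.
- move=> e y y' /andP[_ yh] /andP[_ yh'] /eqP -> /eqP/ed_inj[[]//|[e1 e2]].
  have h2 := hb_hb cell cl a i0 y; rewrite -/hubb e2 in h2.
  by rewrite h2 eqxx in yh'.
Qed.

Section Component.
Variables (f' : {ffun 'I_k * 'I_k -> bool}) (N : nat) (H : 'I_k).
Hypothesis scN : sc nxt i0 N = b.
Hypothesis sc_lt : forall j, (j < N)%N -> (i0 <= sc nxt i0 j < b)%N.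
Hypothesis m_gt0 : forall i, 0 < m i.
Hypothesis HP : forall c h, hub cell cl a b c = Some h -> h = H.
Let G := adjf (sprinkled hubb f f').

Lemma chain_connect c j : good c -> (j <= N)%N ->
  exists h0 h, [/\ hub cell cl a i0 c = Some h0, hub cell cl a (sc nxt i0 j) c = Some h & connect G h0 h].
Proof.
move=> gc; elim: j => [_|j IH jN].
  case/andP: gc => cc _; have := cchainP cc (i := i0); rewrite leqnn i0b => /(_ isT)/and4P[+ _ _ _].
  by rewrite -[sc nxt i0 0]/i0; case: (hub _ _ _ _ _) => // h _; exists h, h.
have [h0 [h [e0 e con]]] := IH (ltnW jN).
have [h1 [h' [e1 e' st]]] := chain_step sc_lt gc jN.
exists h0, h'; split=> //; move: e1 st; rewrite e => -[<-] st.
apply: connect_trans con _; case/orP: st => [/eqP ->//|mh].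
have : 0 < #|conn_set cell z i0 J Dl f (sc nxt i0 j) h h'|%:R :> R by apply: lt_le_trans mh.
rewrite ltr0n => /card_gt0P[y]; rewrite unfold_in => /and3P[_ /andP[yh yh'] _].
apply: connect_trans (connect1 (_ : G h y)) (connect1 (_ : G y h')).
  by rewrite /G adjfC sprinkled_sub.
exact: sprinkled_sub.
Qed.

Lemma attached_component : (#|attached f'| <= #|[set y | connect G H y]%SET|)%N.
Proof.
apply/subset_leq_card/fintype.subsetP => y; rewrite unfold_in inE => /andP[/andP[gy yh] fy].
have [h0 [h [e0]]] := chain_connect gy (leqnn N); rewrite scN => /HP -> con.
have hy : hubb y = h0 by rewrite /hubb /hb e0.
have yG : G y h0 by rewrite -hy; apply: linked_adj => //; rewrite /linked_to_hub fy orbT.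
rewrite (sym_connect_sym (@adjfC _ _)); exact: connect_trans (connect1 yG) con.
Qed.

End Component.
End Attach.
End Existence.

(** * Moments of the configuration *)

Section ConfigBounds.
Variables (R : realType) (d b B K : nat) (lam : R).
Local Notation C := (cellT d b).
Variables (pi : forall k, {ffun 'I_k -> C} -> R) (D : 'I_B -> R).
Hypothesis lam1 : 1 <= lam.
Hypothesis pi0 : forall k c, 0 <= pi (k := k) c.
Hypothesis D0 : forall l, 0 <= D l.
Hypothesis D1 : \sum_l D l = 1.
Hypothesis piP : forall psi : C -> nat -> R, (forall x m, 0 <= psi x m) ->
  \sum_(k < K) \sum_(c : {ffun 'I_k -> C}) pi c * \prod_x psi x (cnt c x)
    <= \prod_x \sum_(m < K) pois lam m * psi x m.

Let lam0 : 0 <= lam. Proof. exact: le_trans ler01 lam1. Qed.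

Local Notation CEx := (@CE R C 'I_B K pi D).
Let leCE (F G : config_fun R C 'I_B) :
  (forall k c l, F k c l <= G k c l) -> CEx F <= CEx G.
Proof. by apply: le_CE. Qed.

Let prodCE (phi : C -> 'I_B -> R) : (forall x l, 0 <= phi x l) ->
  CEx (fun k c l => \prod_i phi (c i) (l i)) <=
  expR (lam * \sum_x (\sum_l D l * phi x l - 1)).
Proof. by apply: CE_prod. Qed.

Let ZCE (x : R) (F : config_fun R C 'I_B) : CEx (fun k c l => x * F k c l) = x * CEx F.
Proof. exact: CEZ. Qed.

Definition classes k (l : {ffun 'I_k -> 'I_B}) : 'I_k -> nat := fun v => l v.

Definition class_mass (n : nat) : R := \sum_(l < B | val l == n) D l.

Variables (a z : nat -> nat).

Definition in_boxes (i : nat) (S : {set C}) (x : C) : bool := box_base i x \in S.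

Lemma card_in_boxes i (S : {set C}) : (i <= b)%N -> S \subset is_base d b i ->
  #|[pred x | in_boxes i S x]| = (#|S| * 2 ^ (d * i))%N.
Proof.
move=> ib /fintype.subsetP SB; rewrite (sum_base ib); last first.
  by move=> c c' cc; rewrite !inE /in_boxes (box_base_eq cc).
congr (_ * _)%N; apply: eq_card => c; rewrite !inE /in_boxes.
apply/andP/idP => [[/eqP e]|cS]; first by rewrite e.
by have := SB c cS; rewrite inE => /eqP e; rewrite e.
Qed.

Lemma in_boxesP i (S : {set C}) x : S \subset is_base d b i ->
  reflect (exists2 c, c \in S & same_box i x c) (in_boxes i S x).
Proof.
move=> /fintype.subsetP SB; apply: (iffP idP) => [xS|[c cS xc]].
  by exists (box_base i x); rewrite // same_box_sym box_base_same.
rewrite /in_boxes (box_base_eq xc); have := SB c cS; rewrite inE => /eqP ->.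
exact: cS.
Qed.

Definition no_hub i (c : C) k (cc : {ffun 'I_k -> C}) (l : {ffun 'I_k -> 'I_B}) : bool :=
  ~~ isSome (hub cc (classes l) a i c).

Definition few i (c : C) k (cc : {ffun 'I_k -> C}) (l : {ffun 'I_k -> 'I_B}) : bool :=
  (4 * box_count cc i c < 2 ^ (d * i))%N.

Definition hubless_prob i : R := expR (- (lam * (2 ^ (d * i))%:R * class_mass (a i))).
Definition few_prob i : R := expR (- ((2 ^ (d * i))%:R / 4)).

(** A joint bound over a family of disjoint boxes, in the form needed by [chernoff_count]: the
    product of indicators is that no vertex of class [a i] lies in the union, a product over
    vertices to which the exponential formula applies. *)
Lemma no_hub_joint i (S : {set C}) : (i <= b)%N -> S \subset is_base d b i ->
  CEx (fun k cc l => \prod_(c in S) (no_hub i c cc l)%:R) <= hubless_prob i ^+ #|S|.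
Proof.
move=> ib SB.
pose phi (x : C) (l : 'I_B) : R := (~~ (in_boxes i S x && (val l == a i)))%:R.
apply: (@le_trans _ _ (CEx (fun k cc l => \prod_v phi (cc v) (l v)))).
  apply: leCE => k cc l.
  case: (boolP [forall v, ~~ (in_boxes i S (cc v) && (val (l v) == a i))]) => [/forallP h|].
    rewrite [leRHS]big1; last by move=> v _; rewrite /phi h.
    apply: (@le_trans _ _ (\prod_(c in S) 1)); last by rewrite big1.
    by apply: ler_prod => c _; rewrite ler0n lern1 leq_b1.
  rewrite negb_forall => /existsP[v]; rewrite negbK => /andP[/(in_boxesP _ SB)[c cS xc] lv].
  rewrite (bigD1 c) //= /no_hub /hub; case: pickP => [h _|/(_ v)].
    by rewrite mul0r prodr_ge0.
  by rewrite xc [classes l v == a i]lv.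
apply: le_trans (@prodCE phi _) _; first by move=> x l; rewrite /phi.
rewrite /hubless_prob -expRM_natl ler_expR.
have E x : \sum_l D l * phi x l - 1 = - ((in_boxes i S x)%:R * class_mass (a i)).
  rewrite -[X in _ - X = _]D1 -sumrB /class_mass [X in _ = - (_ * X)]big_mkcond mulr_sumr -sumrN; apply: eq_bigr => l _.
  by rewrite /phi; case: (in_boxes _ _ _); case: (_ == _) => /=; ring.
under eq_bigr do rewrite E.
rewrite sumrN -mulr_suml -natr_sum.
have -> : (\sum_x in_boxes i S x)%N = #|[pred x | in_boxes i S x]|.
  by rewrite -sum1_card [RHS]big_mkcond; apply: eq_bigr => x _; rewrite inE; case: (in_boxes _ _ _).
rewrite card_in_boxes // natrM le_eqVlt; apply/orP; left; apply/eqP; ring.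
Qed.

(** Exponential Markov with parameter -1 over the union of the boxes: each box gives exp(y/4) from
    the threshold and at most exp(-y/2) from the generating function, since 1 - exp(-1) is at least
    1/2 and [lam] at least 1. *)
Lemma few_joint i (S : {set C}) : (i <= b)%N -> S \subset is_base d b i ->
  CEx (fun k cc l => \prod_(c in S) (few i c cc l)%:R) <= few_prob i ^+ #|S|.
Proof.
move=> ib SB.
pose phi (x : C) (l : 'I_B) : R := expR (- (in_boxes i S x)%:R).
pose y : R := (2 ^ (d * i))%:R.
have y0 : 0 <= y by [].
apply: (@le_trans _ _ (CEx (fun k cc l => expR (#|S|%:R * (y / 4)) * \prod_v phi (cc v) (l v)))).
  apply: leCE => k cc l.
  rewrite /phi -expR_sum sumrN -natr_sum.
  have -> : (\sum_v in_boxes i S (cc v))%N = (\sum_(c in S) box_count cc i c)%N.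
    rewrite /box_count; under [RHS]eq_bigr do rewrite -sum1_card big_mkcond.
    rewrite exchange_big; apply: eq_bigr => v _ /=.
    case: (in_boxesP (cc v) SB) => [[c cS vc]|nc].
      rewrite (bigD1 c) //= inE vc big1 // => c' /andP[c'S c'c]; rewrite inE.
      case: ifP => // vc'; case/eqP: c'c; apply: (@is_base_inj d b i).
      - exact: (fintype.subsetP SB).
      - exact: (fintype.subsetP SB).
      - by apply: same_box_trans vc; rewrite same_box_sym.
    by rewrite big1 // => c cS; rewrite inE; case: ifP => // vc; case: nc; exists c.
  rewrite -expRD natr_sum.
  have -> : #|S|%:R * (y / 4) - \sum_(c in S) (box_count cc i c)%:R =
     \sum_(c in S) (y / 4 - (box_count cc i c)%:R) :> R.
    by rewrite sumrB sumr_const mulr_natl.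
  rewrite expR_sum; apply: ler_prod => c cS; rewrite ler0n /=.
  rewrite /few; case: ltnP => h; last by rewrite expR_ge0.
  rewrite -[X in X <= _]expR0 ler_expR.
  by move: h; rewrite -(ltr_nat R) natrM -/y; lra.
rewrite (ZCE (expR (#|S|%:R * (y / 4))) (fun k cc l => \prod_v phi (cc v) (l v))).
have := @prodCE phi (fun x l => expR_ge0 _).
move=> h; apply: le_trans (ler_wpM2l (expR_ge0 _) h) _.
rewrite -expRD /few_prob -expRM_natl ler_expR -/y.
have E x : \sum_l D l * phi x l - 1 <= - ((in_boxes i S x)%:R / 2).
  rewrite /phi -mulr_suml D1 mul1r; case: (in_boxes _ _ _) => /=.
    by have := expRN1_le R; lra.
  by rewrite oppr0 expR0; lra.
have : \sum_x (\sum_l D l * phi x l - 1) <= - ((#|S|%:R * y) / 2).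
  apply: (@le_trans _ _ (\sum_x - ((in_boxes i S x)%:R / 2))); first by apply: ler_sum => x _; exact: E.
  rewrite sumrN lerN2 -mulr_suml -natr_sum.
  have -> : (\sum_x in_boxes i S x)%N = #|[pred x | in_boxes i S x]|.
    by rewrite -sum1_card [RHS]big_mkcond; apply: eq_bigr => x _; rewrite inE; case: (in_boxes _ _ _).
  by rewrite card_in_boxes // natrM.
move=> sm.
have Sy : 0 <= #|S|%:R * y by rewrite mulr_ge0.
have := ler_wpM2l lam0 sm.
have : #|S|%:R * y <= lam * (#|S|%:R * y) by rewrite ler_peMl.
lra.
Qed.

Lemma joint_single (i : nat) (p : R) (X : forall c k, {ffun 'I_k -> C} -> {ffun 'I_k -> 'I_B} -> bool) c :
  (forall c c', same_box i c c' -> forall k cc l, X c k cc l = X c' k cc l) ->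
  (forall S : {set C}, S \subset is_base d b i ->
    CEx (fun k cc l => \prod_(c in S) (X c k cc l)%:R) <= p ^+ #|S|) ->
  CEx (fun k cc l => (X c k cc l)%:R) <= p.
Proof.
move=> Xs XS; have := XS [set box_base i c]%SET; rewrite finset.sub1set box_base_is_base => /(_ isT).
rewrite cards1 expr1; apply: le_trans; apply: leCE => k cc l.
by rewrite big_set1 (Xs _ _ (box_base_same i c)).
Qed.

Lemma no_hub_prob i c : (i <= b)%N ->
  CEx (fun k cc l => (no_hub i c cc l)%:R) <= hubless_prob i.
Proof.
move=> ib; apply: (@joint_single i (hubless_prob i) (@no_hub i)).
  by move=> c1 c2 cc k cl l; rewrite /no_hub (hub_eq _ _ _ cc).
by move=> S; apply: no_hub_joint.
Qed.

Lemma few_box_prob i c : (i <= b)%N ->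
  CEx (fun k cc l => (few i c cc l)%:R) <= few_prob i.
Proof.
move=> ib; apply: (@joint_single i (few_prob i) (@few i)).
  move=> c1 c2 cc k cl l; rewrite /few /box_count; congr (_ * _ < _)%N.
  apply: eq_card => v; rewrite !inE ![same_box i (cl v) _]same_box_sym.
  by rewrite (same_box_eq _ cc).
by move=> S; apply: few_joint.
Qed.

Definition overfull_prob i L : R := expR (lam * (2 ^ (d * i))%:R * (expR 1 - 1) - L%:R).

Lemma overfull_box_prob i c L : (i <= b)%N ->
  CEx (fun k cc l => (L < box_count cc i c)%N%:R) <= overfull_prob i L.
Proof.
move=> ib.
pose phi (x : C) (l : 'I_B) : R := expR (same_box i x c)%:R.
apply: (@le_trans _ _ (CEx (fun k cc l => expR (- L%:R) * \prod_v phi (cc v) (l v)))).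
  apply: leCE => k cc l.
  rewrite /phi -expR_sum -natr_sum -expRD.
  have -> : (\sum_v same_box i (cc v) c)%N = box_count cc i c.
    by rewrite /box_count -sum1_card [RHS]big_mkcond; apply: eq_bigr => v _; rewrite inE; case: (same_box _ _ _).
  case: ltnP => h; last by rewrite expR_ge0.
  rewrite -[X in X <= _]expR0 ler_expR; move: h; rewrite -(ltr_nat R); lra.
rewrite (ZCE (expR (- L%:R)) (fun k cc l => \prod_v phi (cc v) (l v))).
have := @prodCE phi (fun x l => expR_ge0 _).
move=> h; apply: le_trans (ler_wpM2l (expR_ge0 _) h) _.
rewrite -expRD ler_expR addrC lerD2r -mulrA ler_wpM2l //.
have E x : \sum_l D l * phi x l - 1 = (same_box i c x)%:R * (expR 1 - 1).
  rewrite /phi -mulr_suml D1 mul1r same_box_sym; case: (same_box _ _ _); rewrite /= ?expR0; ring.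
under eq_bigr do rewrite E.
rewrite -mulr_suml -natr_sum -(card_same_box c ib).
have -> // : (\sum_x same_box i c x)%N = #|[pred x | same_box i c x]|.
by rewrite -sum1_card [RHS]big_mkcond; apply: eq_bigr => x _; rewrite inE; case: (same_box _ _ _).
Qed.

Section Moments.
Variables (i0 : nat) (KA beta : R) (W1 W2 : 'I_B -> R).
Hypothesis i0b : (i0 <= b)%N.
Hypothesis KA0 : 0 <= KA.
Hypothesis beta1 : 1 < beta.
Hypothesis W1ge1 : forall l, 1 <= W1 l.
Hypothesis W2ge0 : forall l, 0 <= W2 l.

(** The second summand counts every pair within an [i0]-box, hence every edge that sprinkling may
    add. *)
Definition ker (x y : C) : R := KA * cell_decay beta x y + (same_box i0 x y)%:R.
Definition ker_mass : R := KA * (4 * decay_sum beta) ^+ d + (2 ^ (d * i0))%:R.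
Definition kernel k (cc : {ffun 'I_k -> C}) (l : {ffun 'I_k -> 'I_B}) (y v : 'I_k) : R :=
  W1 (l y) * W1 (l v) * ker (cc y) (cc v).
Definition mean1 : R := Dmean D W1.

Let C3 := pois_cube lam.
Let nC : R := (2 ^ (d * b))%:R.
Let W1ge0 l : 0 <= W1 l. Proof. exact: le_trans ler01 (W1ge1 l). Qed.

Lemma ker_ge0 x y : 0 <= ker x y.
Proof. by rewrite addr_ge0 // mulr_ge0 // cell_decay_ge0. Qed.

Lemma ker_sum x : \sum_y ker x y <= ker_mass.
Proof.
rewrite big_split /= -mulr_sumr lerD //; first by rewrite ler_wpM2l // cell_decay_sum.
rewrite -natr_sum ler_nat -(card_same_box x i0b) -sum1_card [X in (_ <= X)%N]big_mkcond /=.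
by apply: leq_sum => y _; rewrite inE; case: (same_box _ _ _).
Qed.

Lemma mean1_ge1 : 1 <= mean1.
Proof.
rewrite -D1 /mean1 /Dmean; apply: ler_sum => l _.
by rewrite ler_peMr.
Qed.

Lemma box_sum_const (i : nat) (x : C) (F : C -> R) (w : R) : (i <= b)%N -> 0 <= w ->
  (forall y, F y <= w) -> \sum_y (same_box i y x)%:R * F y <= (2 ^ (d * i))%:R * w.
Proof.
move=> ib w0 Fw; apply: (@le_trans _ _ (\sum_y (same_box i y x)%:R * w)).
  by apply: ler_sum => y _; rewrite ler_wpM2l.
rewrite -mulr_suml -natr_sum ler_wpM2r // ler_nat -(card_same_box x ib) -sum1_card [X in (_ <= X)%N]big_mkcond /=.
by apply: leq_sum => y _; rewrite inE same_box_sym; case: (same_box _ _ _).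
Qed.

Lemma sum_const_le (F : C -> R) (w : R) : (forall x, F x <= w) -> \sum_x F x <= nC * w.
Proof.
move=> Fw; apply: (@le_trans _ _ (\sum_(x : C) w)); first exact: ler_sum.
by rewrite sumr_const card_cellT mulr_natl.
Qed.

Lemma C3_ge0 : 0 <= C3.
Proof. by rewrite /C3 /pois_cube mulr_ge0 ?expR_ge0. Qed.

Lemma ker_mass_ge0 : 0 <= ker_mass.
Proof.
rewrite /ker_mass addr_ge0 // mulr_ge0 // exprn_ge0 // mulr_ge0 //.
rewrite /decay_sum addr_ge0 // invr_ge0 subr_ge0 ltW // two_powR_lt1 // subr_lt0 //.
Qed.

Definition bad_hub i (Mc : nat -> R) (c : C) k (cc : {ffun 'I_k -> C}) (l : {ffun 'I_k -> 'I_B}) : bool :=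
  [exists h, (same_box i (cc h) c && (classes l h == a i)) &&
     (Mc i < hub_load cc z (kernel cc l) h i)].

(** The load is summed over all candidates for the hub, which avoids the dependence on the choice;
    Markov then needs one moment over three distinct vertices. *)
Lemma bad_hub_prob i Mc c : (i <= b)%N -> (z i <= b)%N -> 0 < Mc i ->
  CEx (fun k cc l => (bad_hub i Mc c cc l)%:R) <=
  3 * C3 * ((2 ^ (d * i))%:R * (2 ^ (d * z i))%:R * ker_mass) *
    (class_mass (a i) * mean1 * mean1) / Mc i.
Proof.
move=> ib zb M0.
pose A (x y v : C) : R := (same_box i x c)%:R * ((same_box (z i) y x)%:R * ker y v).
have A0 x y v : 0 <= A x y v by rewrite !mulr_ge0 ?ker_ge0.
pose al (l : 'I_B) : R := (val l == a i)%:R.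
have al0 l : 0 <= al l by [].
have key := CE_moment3 lam0 pi0 D0 D1 piP A0 al0 W1ge0 W1ge0.
have alE : Dmean D al = class_mass (a i).
  by rewrite /Dmean /class_mass [RHS]big_mkcond; apply: eq_bigr => l _; rewrite /al; case: eqP; rewrite ?mulr1 ?mulr0.
rewrite alE in key.
have SA : \sum_x \sum_y \sum_v A x y v <= (2 ^ (d * i))%:R * (2 ^ (d * z i))%:R * ker_mass.
  rewrite -mulrA; have km := ker_mass_ge0.
  apply: le_trans (box_sum_const (F := fun x => \sum_y \sum_v (same_box (z i) y x)%:R * ker y v) c ib _ _).
  - by apply: ler_sum => x _; rewrite mulr_sumr; apply: ler_sum => y _; rewrite mulr_sumr.
  - by rewrite mulr_ge0.
  - move=> x; apply: le_trans (box_sum_const (F := fun y => \sum_v ker y v) x zb km _).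
      by apply: ler_sum => y _; rewrite mulr_sumr.
    by move=> y; exact: ker_sum.
rewrite ler_pdivlMr //.
apply: (@le_trans _ _ (3 * C3 * (\sum_x \sum_y \sum_v A x y v) * (class_mass (a i) * mean1 * mean1))); last first.
  rewrite ler_wpM2r ?ler_wpM2l ?mulr_ge0 ?C3_ge0 //.
  - by rewrite -alE; apply: Dmean_ge0.
  - exact: le_trans ler01 mean1_ge1.
  - exact: le_trans ler01 mean1_ge1.
apply: le_trans key; rewrite mulrC -ZCE; apply: leCE => k cc l.
case: (boolP (bad_hub _ _ _ _ _)) => /=; last first.
  move=> _; rewrite mulr0; apply: sumr_ge0 => h _; apply: sumr_ge0 => y _; apply: sumr_ge0 => v _.
  by rewrite mulr_ge0 // !mulr_ge0.
move=> /existsP[h /andP[/andP[hc ha] hM]]; rewrite mulr1; apply: le_trans (ltW hM) _.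
rewrite (bigD1 h) //=; rewrite -[leLHS]addr0; apply: lerD; last first.
  apply: sumr_ge0 => h' _; apply: sumr_ge0 => y _; apply: sumr_ge0 => v _.
  by rewrite mulr_ge0 // !mulr_ge0.
rewrite /hub_load big_mkcondl [leRHS]big_mkcond [leLHS]big_mkcond /=; apply: ler_sum => y _.
case: (boolP (y != h)) => // yh; case: (boolP (vbox _ _ _ _)) => yz; last first.
  by apply: sumr_ge0 => v _; rewrite mulr_ge0 // !mulr_ge0.
rewrite (eq_bigl (fun v => (v != h) && (v != y))); last by move=> v; rewrite andbC.
apply: ler_sum => v _; rewrite /kernel /A hc /al ha !mul1r.
rewrite -[same_box _ _ _]/(vbox cc (z i) y h) yz mul1r le_eqVlt; apply/orP; left; apply/eqP; ring.
Qed.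

(** Dividing by [W1 (l y)] leaves products in which the weight factor of each vertex occurs at most
    once, so a finite first moment suffices. *)
Definition sqload_sum k (cc : {ffun 'I_k -> C}) (l : {ffun 'I_k -> 'I_B}) : R :=
  \sum_y (W1 (l y))^-1 * (\sum_(v | v != y) kernel cc l y v +
   \sum_(v | v != y) \sum_(t | (t != y) && (t != v)) kernel cc l y v * kernel cc l y t).

Lemma sqload_mean : CEx sqload_sum <=
  3 * C3 * (nC * (ker_mass + ker_mass ^+ 2)) * mean1 ^+ 3.
Proof.
have km := ker_mass_ge0.
have one0 (l : 'I_B) : (0 : R) <= (fun=> 1) l by exact: ler01.
have k2 := CE_moment2 lam0 pi0 D0 D1 piP ker_ge0 one0 W1ge0.
have B0 x y v : 0 <= ker x y * ker x v by rewrite mulr_ge0 ?ker_ge0.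
have k3 := CE_moment3 lam0 pi0 D0 D1 piP B0 W1ge0 W1ge0 W1ge0.
have m1 := mean1_ge1.
have Dm1 : Dmean D (fun=> 1) = 1 by rewrite /Dmean; under eq_bigr do rewrite mulr1.
apply: le_trans (_ : CEx (fun k cc l => (\sum_i \sum_(j | j != i) ker (cc i) (cc j) * (1 * W1 (l j))) +
   (\sum_i \sum_(j | j != i) \sum_(m | (m != i) && (m != j)) ker (cc i) (cc j) * ker (cc i) (cc m) *
      (W1 (l i) * W1 (l j) * W1 (l m)))) <= _).
  apply: leCE => k cc l; rewrite -big_split /=; apply: ler_sum => y _.
  have Wn : W1 (l y) != 0 by rewrite gt_eqF // (lt_le_trans ltr01).
  rewrite mulrDr; apply: lerD.
    rewrite mulr_sumr; apply: ler_sum => v _; rewrite /kernel le_eqVlt; apply/orP; left; apply/eqP.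
    by field.
  rewrite mulr_sumr; apply: ler_sum => v _; rewrite mulr_sumr; apply: ler_sum => t _.
  by rewrite /kernel le_eqVlt; apply/orP; left; apply/eqP; field.
rewrite CED; apply: le_trans (lerD k2 k3) _; rewrite Dm1 mul1r -/mean1.
have s2 : \sum_x \sum_y ker x y <= nC * ker_mass by apply: sum_const_le => x; apply: ker_sum.
have s3 : \sum_x \sum_y \sum_v ker x y * ker x v <= nC * ker_mass ^+ 2.
  apply: sum_const_le => x; under eq_bigr do rewrite -mulr_sumr.
  rewrite -mulr_suml expr2; apply: ler_pM; rewrite ?ker_sum //; apply: sumr_ge0 => y _; exact: ker_ge0.
have C30 := C3_ge0.
have nC0 : 0 <= nC by [].
have mm : mean1 <= mean1 ^+ 3.
  by rewrite -[leLHS]expr1 ler_weXn2l.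
have m0 : 0 <= mean1 := le_trans ler01 m1.
have -> : mean1 * mean1 * mean1 = mean1 ^+ 3 by ring.
rewrite mulrDr mulrDr mulrDl; apply: lerD.
  by apply: ler_pM => //; rewrite ?ler_wpM2l ?mulr_ge0 //; apply: sumr_ge0 => x _; apply: sumr_ge0 => y _; exact: ker_ge0.
by rewrite ler_wpM2r ?exprn_ge0 // ler_wpM2l ?mulr_ge0.
Qed.

Definition boxload_sum (Jb : nat) k (cc : {ffun 'I_k -> C}) (l : {ffun 'I_k -> 'I_B}) : R :=
  \sum_u \sum_(y | vbox cc Jb u y) \sum_(v | v != y) kernel cc l y v.

Lemma boxload_mean Jb : (Jb <= b)%N -> CEx (boxload_sum Jb) <=
  3 * C3 * (nC * (3 * (2 ^ (d * Jb))%:R * ker_mass)) * mean1 ^+ 2.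
Proof.
move=> Jbb; have km := ker_mass_ge0.
have k2 := CE_moment2 lam0 pi0 D0 D1 piP ker_ge0 W1ge0 W1ge0.
pose A (x y v : C) : R := (same_box Jb y x)%:R * ker x v.
have A0 x y v : 0 <= A x y v by rewrite mulr_ge0 ?ker_ge0.
have one0 (l : 'I_B) : (0 : R) <= (fun=> 1) l by exact: ler01.
have k3 := CE_moment3 lam0 pi0 D0 D1 piP A0 W1ge0 one0 W1ge0.
have Dm1 : Dmean D (fun=> 1) = 1 by rewrite /Dmean; under eq_bigr do rewrite mulr1.
(* The pair sum occurs twice, for [u = y] and for [v = u]; the remaining terms have three distinct
   vertices. *)
apply: le_trans (_ : CEx (fun k cc l => 2 * (\sum_i \sum_(j | j != i) ker (cc i) (cc j) * (W1 (l i) * W1 (l j))) +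
   (\sum_i \sum_(j | j != i) \sum_(m | (m != i) && (m != j)) A (cc i) (cc j) (cc m) *
      (W1 (l i) * 1 * W1 (l m)))) <= _).
  apply: leCE => k cc l; rewrite /boxload_sum (exchange_big_dep predT) //= mulr_sumr -big_split /=.
  apply: ler_sum => y _; rewrite exchange_big /=.
  set T := \sum_(j | j != y) ker (cc y) (cc j) * _.
  have TE : T = \sum_(v | v != y) kernel cc l y v by apply: eq_bigr => v _; rewrite /kernel; ring.
  have k0 v : 0 <= kernel cc l y v by rewrite !mulr_ge0 ?ker_ge0.
  rewrite exchange_big /= (bigD1 y) /=; last exact: same_box_refl.
  rewrite -TE mulrDl !mul1r -addrA lerD2l.
  apply: (@le_trans _ _ (\sum_(u | u != y) ((same_box Jb (cc u) (cc y))%:R * kernel cc l y u +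
     \sum_(m | (m != y) && (m != u)) A (cc y) (cc u) (cc m) * (W1 (l y) * 1 * W1 (l m))))).
    rewrite [leLHS]big_mkcond [leRHS]big_mkcond; apply: ler_sum => u _ /=.
    case: (eqVneq u y) => [->|uy]; first by rewrite andbF.
    rewrite andbT; rewrite /A -[same_box _ _ _]/(vbox cc Jb u y); case: (vbox _ _ _ _); rewrite /= ?mulr1n ?mulr0n.
      rewrite TE (bigD1 u) //= mul1r lerD2l; apply: ler_sum => v _.
      by rewrite mul1r /kernel le_eqVlt; apply/orP; left; apply/eqP; ring.
    by rewrite mul0r add0r; apply: sumr_ge0 => v _; rewrite !mul0r.
  rewrite big_split /= lerD2r TE; apply: ler_sum => v _.
  by case: (same_box _ _ _); rewrite ?mul1r ?mul0r.
rewrite CED ZCE.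
apply: le_trans (lerD (ler_wpM2l _ k2) k3) _; first by [].
rewrite Dm1 mulr1 -/mean1.
have C30 := C3_ge0.
have nC0 : 0 <= nC by [].
have m0 : 0 <= mean1 := le_trans ler01 mean1_ge1.
have s2 : \sum_x \sum_y ker x y <= nC * ker_mass by apply: sum_const_le => x; apply: ker_sum.
have s3 : \sum_x \sum_y \sum_v A x y v <= nC * ((2 ^ (d * Jb))%:R * ker_mass).
  apply: sum_const_le => x; apply: le_trans (box_sum_const (F := fun y => \sum_v ker x v) x Jbb km _).
    by apply: ler_sum => y _; rewrite /A mulr_sumr.
  by move=> y; exact: ker_sum.
have P1 : (1 : R) <= (2 ^ (d * Jb))%:R by rewrite ler1n expn_gt0.
have e2 : \sum_x \sum_y ker x y <= nC * ((2 ^ (d * Jb))%:R * ker_mass).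
  by apply: le_trans s2 _; rewrite ler_wpM2l // ler_peMl.
have c0 : 0 <= 3 * C3 * (mean1 * mean1) by rewrite !mulr_ge0.
have := ler_wpM2l c0 e2; have := ler_wpM2l c0 s3.
rewrite -/C3 expr2.
generalize (\sum_x \sum_y ker x y) (\sum_x \sum_y \sum_v A x y v) ((2 ^ (d * Jb))%:R : R) ker_mass mean1.
by clear one0; generalize C3 nC => c n u v w x y; lra.
Qed.

Lemma sum_W2_mean : CEx (fun k cc l => \sum_v W2 (l v)) <= 3 * C3 * nC * Dmean D W2.
Proof.
have one0 (x : C) : (0 : R) <= (fun=> 1) x by exact: ler01.
have := CE_moment1 lam0 pi0 D0 D1 piP one0 W2ge0.
rewrite sumr_const card_cellT; apply: le_trans; apply: leCE => k cc l.
by apply: ler_sum => v _; rewrite mul1r.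
Qed.

Lemma cells_square_mean : CEx (fun k cc l => \sum_c (cell_count cc c)%:R ^+ 2) <= nC * C3.
Proof.
rewrite (CE_sum _ _ _ _ _ (fun c k cc l => (cell_count cc c)%:R ^+ 2)).
apply: sum_const_le => x; apply: le_trans (cnt_cube lam0 piP x).
apply: ler_sum => k _; apply: ler_sum => cc _.
rewrite (PE_cst (weights_pmf D0 D1 k)) ler_wpM2l // -[cell_count cc x]/(cnt cc x).
by rewrite -!natrX ler_nat; case: (cnt cc x) => // n; apply: leq_pexp2l.
Qed.

End Moments.
End ConfigBounds.

(** * Reduction to the discrete model *)

Section FiniteProb.
Local Open Scope classical_set_scope.
Variables (R : realType) (dd : measure_display) (T : measurableType dd) (P : probability T R).
Implicit Types (A E : set T).

Definition fP A : R := fine (P A).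

Lemma fPE A : measurable A -> (fP A)%:E = P A.
Proof. by move=> mA; rewrite fineK // fin_num_measure. Qed.

Lemma fP_ge0 A : 0 <= fP A.
Proof. by rewrite fine_ge0. Qed.

Lemma fP_le A E : measurable A -> measurable E -> A `<=` E -> fP A <= fP E.
Proof. by move=> mA mE AE; rewrite -lee_fin !fPE // le_measure ?inE. Qed.

Lemma fP_setT : fP setT = 1.
Proof. by rewrite /fP probability_setT. Qed.

Lemma fP_le1 A : measurable A -> fP A <= 1.
Proof. by move=> mA; rewrite -lee_fin fPE // probability_le1. Qed.

Section Finite.
Variables (I : finType) (Q : pred I) (A : I -> set T).
Hypothesis mA : forall i, Q i -> measurable (A i).
Hypothesis disj : forall i j w, Q i -> Q j -> A i w -> A j w -> i = j.

Lemma measurable_finite_union : measurable [set w | exists2 i, Q i & A i w].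
Proof.
have -> : [set w | exists2 i, Q i & A i w] = \bigcup_(i in [set` Q]) A i.
  by apply/seteqP; split=> w [i Qi Ai]; exists i.
apply: fin_bigcup_measurable; first exact: finite_finset.
by move=> i; exact: mA.
Qed.

Lemma fP_sum : \sum_(i | Q i) fP (A i) = fP [set w | exists2 i, Q i & A i w].
Proof.
apply: EFin_inj; rewrite fPE; last exact: measurable_finite_union.
rewrite -sumEFin -big_filter; set r := [seq _ <- _ | _].
have rQ i : i \in r -> Q i by rewrite mem_filter => /andP[].
have ur : uniq r by rewrite filter_uniq // index_enum_uniq.
have -> : [set w | exists2 i, Q i & A i w] = [set w | exists2 i, i \in r & A i w].
  apply/seteqP; split=> w [i Qi Ai]; exists i => //; last exact: rQ.
  by rewrite mem_filter [Q i]Qi mem_index_enum.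
elim: r rQ ur => [_ _|i s IH rQ /andP[nis us]].
  rewrite big_nil (_ : [set _ | _] = set0) ?measure0 //.
  by apply/seteqP; split=> // w [].
have Qi : Q i by apply: rQ; rewrite inE eqxx.
have sQ j : j \in s -> Q j by move=> js; apply: rQ; rewrite inE js orbT.
rewrite big_cons IH // fPE ?mA //; last exact: mA.
have -> : [set w | exists2 j, j \in i :: s & A j w] = A i `|` [set w | exists2 j, j \in s & A j w].
  apply/seteqP; split=> w /=.
    by move=> [j]; rewrite inE => /orP[/eqP ->|js] Aj; [left|right; exists j].
  by case=> [Ai|[j js Aj]]; [exists i; rewrite ?inE ?eqxx|exists j; rewrite // inE js orbT].
rewrite measureU //.
- exact: mA.
- have -> : [set w | exists2 j, j \in s & A j w] = \bigcup_(j in [set` s]) A j.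
    by apply/seteqP; split=> w [j js Aj]; exists j.
  apply: fin_bigcup_measurable; first exact: finite_finset.
  by move=> j /sQ; exact: mA.
- apply/seteqP; split=> // w [Ai [j js Aj]].
  by move: nis; rewrite (disj Qi (sQ _ js) Ai Aj) js.
Qed.

Lemma fP_sum_le E : measurable E -> (forall i, Q i -> A i `<=` E) -> \sum_(i | Q i) fP (A i) <= fP E.
Proof.
move=> mE AE; rewrite fP_sum; apply: fP_le => //; first exact: measurable_finite_union.
by move=> w [i Qi]; exact: AE.
Qed.

End Finite.

Lemma fP_sum_eq (I : finType) (A : I -> set T) E : (forall i, measurable (A i)) ->
  (forall i j w, A i w -> A j w -> i = j) -> (forall w, E w <-> exists i, A i w) ->
  \sum_i fP (A i) = fP E.
Proof.
move=> mA dA EA; rewrite fP_sum //; last by move=> i j w _ _; exact: dA.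
congr fP; apply/seteqP; split=> w; first by move=> [i _ Ai]; apply/EA; exists i.
by move=> /EA[i Ai]; exists i.
Qed.

Lemma tail_small (X : T -> nat) (eta : R) : measurable_fun setT X -> 0 < eta ->
  exists K, 1 - eta <= fP [set w | (X w < K)%N].
Proof.
move=> mX eta0; pose F K := [set w | (X w < K)%N].
have mF K : measurable (F K).
  rewrite (_ : F K = setT `&` X @^-1` [set i | (i < K)%N]); last by rewrite setTI.
  exact: mX.
have : (P \o F) K @[K --> \oo] --> P (\bigcup_K F K).
  apply: nondecreasing_cvg_mu => //; first exact: bigcup_measurable.
  by move=> i j ij; apply/subsetPset => w /= wi; apply: leq_trans wi ij.
have -> : \bigcup_K F K = setT.
  by apply/seteqP; split=> // w _; exists (X w).+1 => //=; rewrite /F /= ltnSn.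
rewrite probability_setT => cv.
have {}cv : fP (F K) @[K --> \oo] --> (1 : R).
  apply: fine_cvg; exact: cv.
have [K _ /(_ K (leqnn K))] := @cvgr_ge R _ _ _ _ _ cv (1 - eta) (ltac:(lra)).
by exists K.
Qed.

End FiniteProb.

Lemma measurable_eq_nat (dd : measure_display) (T : measurableType dd) (X : T -> nat) m :
  measurable_fun setT X -> measurable [set w | X w = m].
Proof.
move=> mX; rewrite (_ : [set _ | _] = setT `&` X @^-1` [set m]); last by rewrite setTI.
exact: mX.
Qed.

Lemma measurable_eq_bool (dd : measure_display) (T : measurableType dd) (X : T -> bool) m :
  measurable_fun setT X -> measurable [set w | X w = m].
Proof.
move=> mX; rewrite (_ : [set _ | _] = setT `&` X @^-1` [set m]); last by rewrite setTI.
exact: mX.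
Qed.

Lemma measurable_forall_fin (dd : measure_display) (T : measurableType dd) (I : finType)
    (A : I -> set T) : (forall i, measurable (A i)) -> measurable [set w | forall i, A i w].
Proof.
move=> mA; rewrite (_ : [set _ | _] = \bigcap_(i in setT) A i).
  by apply: fin_bigcap_measurable => //; exact: finite_finset.
by apply/seteqP; split=> w h i; [move=> _; exact: h|exact: h].
Qed.

Section Space.
Local Open Scope classical_set_scope.
Variables (R : realType) (d : nat) (S : rumour_space R d) (cg : R) (n : nat).
Hypothesis rvm : random_variables_measurable S.
Local Notation P := (@Pr R d S).
Local Notation Om := (@Omega R d S).

Let m_npts : measurable_fun setT (@npts R d S). Proof. by case: rvm. Qed.
Let m_pos i : measurable_fun setT (@pos R d S i). Proof. by case: rvm => _ []. Qed.
Let m_wt i : measurable_fun setT (@wt R d S i). Proof. by case: rvm => _ [_ []]. Qed.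
Let m_adj i j : measurable_fun setT (@adj R d S i j).
Proof. by case: rvm => _ [_ [_ []]]. Qed.
Let m_start : measurable_fun setT (@start R d S).
Proof. by case: rvm => _ [_ [_ [_ []]]]. Qed.
Let m_target : measurable_fun setT (@target R d S).
Proof. by case: rvm => _ [_ [_ [_ [_ []]]]]. Qed.
Let m_choice t i : measurable_fun setT (@Defs.choice R d S t i).
Proof. by case: rvm => _ [_ [_ [_ [_ [_]]]]]. Qed.

Lemma measurable_marks k : measurable_fun setT (@marks R d S k).
Proof.
apply/measurable_fun_tnthP => i.
rewrite (_ : _ \o _ = fun w => (@pos R d S i w, @wt R d S i w)); last first.
  by apply: funext => w /=; rewrite tnth_mktuple.
exact: measurable_fun_pair.
Qed.

Lemma measurable_marks_event k (C : set (k.-tuple (vertex R d))) : measurable C ->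
  measurable [set w | @npts R d S w = k /\ C (@marks R d S k w)].
Proof.
move=> mC; rewrite (_ : [set _ | _] = [set w | @npts R d S w = k] `&` (setT `&` @marks R d S k @^-1` C)).
  by apply: measurableI; [exact: measurable_eq_nat|exact: measurable_marks].
by rewrite setTI.
Qed.

Lemma measurable_graph k (g : rel 'I_k) :
  measurable [set w | forall i j : 'I_k, @adj R d S i j w = g i j].
Proof.
apply: measurable_forall_fin => i; apply: measurable_forall_fin => j.
exact: measurable_eq_bool.
Qed.

Lemma measurable_graph_event k (C : set (k.-tuple (vertex R d))) (g : rel 'I_k) :
  measurable C -> measurable (@graph_event R d S k C g).
Proof.
move=> mC; rewrite (_ : graph_event C g =
   [set w | @npts R d S w = k /\ C (@marks R d S k w)] `&` [set w | forall i j : 'I_k, @adj R d S i j w = g i j]).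
  by apply: measurableI; [exact: measurable_marks_event|exact: measurable_graph].
by apply/seteqP; split=> w /=; [case=> ? ? ?|case=> [[? ?] ?]].
Qed.

Lemma measurable_endpoints (a b : nat) :
  measurable [set w | @start R d S w = a /\ @target R d S w = b].
Proof.
rewrite (_ : [set _ | _] = [set w | @start R d S w = a] `&` [set w | @target R d S w = b]) //.
by apply: measurableI; exact: measurable_eq_nat.
Qed.

Lemma measurable_choices k r (Q : 'I_r -> 'I_k -> bool) (f : 'I_r -> 'I_k -> nat) :
  measurable [set w | forall t i, Q t i -> @Defs.choice R d S t i w = f t i].
Proof.
apply: measurable_forall_fin => t; apply: measurable_forall_fin => i.
case: (Q t i); last by rewrite [X in measurable X](_ : _ = setT) //; apply/seteqP; split.
rewrite [X in measurable X](_ : _ = [set w | @Defs.choice R d S t i w = f t i]).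
  exact: measurable_eq_nat.
by apply/seteqP; split=> w /=; [apply|move=> ? _].
Qed.

(** The discrete data that decide transmission within [r] rounds. Choices are optional because a
    recorded value need not be a label below [k]. *)
Definition snapshot k r : Type :=
  ({ffun 'I_k * 'I_k -> bool} * {ffun 'I_r * 'I_k -> option 'I_k})%type.

Definition snap_contact k r (x : snapshot k r) (t : nat) : rel 'I_k :=
  fun i j => x.1 (i, j) && (if insub t is Some t' then x.2 (t', i) == Some j else false).

Definition snap_ok k r (L : R) (x : snapshot k r) (a b : 'I_k) : Prop :=
  [/\ exists K, is_giant cg n (fun i j => x.1 (i, j)) K, r%:R <= L &
      b \in informed (snap_contact x) a r].

Definition snap_at k r (x : snapshot k r) (a b : nat) (w : Om) : Prop :=
  [/\ @npts R d S w = k,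
      forall i j : 'I_k, @adj R d S i j w = x.1 (i, j),
      @start R d S w = a /\ @target R d S w = b &
      forall (t : 'I_r) (i : 'I_k), insub (@Defs.choice R d S t i w) = x.2 (t, i)].

Lemma measurable_snap_at k r x a b : measurable [set w | @snap_at k r x a b w].
Proof.
rewrite (_ : [set _ | _] = [set w | @npts R d S w = k] `&`
   ([set w | forall i j : 'I_k, @adj R d S i j w = x.1 (i, j)] `&`
   ([set w | @start R d S w = a /\ @target R d S w = b] `&`
    [set w | forall (t : 'I_r) (i : 'I_k), insub (@Defs.choice R d S t i w) = x.2 (t, i)]))); last first.
  by apply/seteqP; split=> w /=; [case=> ? ? ? ?|case=> ? [? [? ?]]].
apply: measurableI; first exact: measurable_eq_nat.
apply: measurableI; first exact: (measurable_graph (fun i j => x.1 (i, j))).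
apply: measurableI; first exact: measurable_endpoints.
apply: measurable_forall_fin => t; apply: measurable_forall_fin => i.
rewrite [X in measurable X](_ : _ = setT `&` @Defs.choice R d S t i @^-1` [set m | insub m = x.2 (t, i)]).
  exact: m_choice.
by rewrite setTI.
Qed.

Lemma contact_snap (w : Om) r (x : snapshot (@npts R d S w) r) a b :
  snap_at x a b w -> forall A : {set _},
  spread (@contact_at R d S w) 0 A r = spread (snap_contact x) 0 A r.
Proof.
move=> [_ xg _ xc] A; apply: eq_spread => t i j /andP[_ tr]; rewrite add0n in tr.
rewrite /contact_at /snap_contact /graph_at xg; congr (_ && _).
rewrite (insubT (fun t => (t < r)%N) tr) -xc /=.
case: insubP => [u _ <-|]; first by [].
by move=> h; apply/eqP => e; case/negP: h; rewrite e ltn_ord.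
Qed.

Lemma transmitted_snap (w : Om) (L : R) :
  transmitted_within (S := S) cg n L w <->
  exists k r (x : snapshot k r) (a b : 'I_k), snap_ok L x a b /\ snap_at x a b w.
Proof.
split.
  move=> [[K gK] [a [b [r [sa tb rL bi]]]]].
  pose x : snapshot (@npts R d S w) r :=
    ([ffun e : 'I__ * 'I__ => @graph_at R d S w e.1 e.2],
     [ffun e : 'I_r * 'I__ => insub (@Defs.choice R d S e.1 e.2 w)]).
  exists (@npts R d S w), r, x, a, b.
  have sn : snap_at x a b w.
    by split=> //= [i j|t i]; rewrite ffunE.
  split=> //; split=> //=; last first.
    by rewrite informed_spread -(contact_snap sn) -informed_spread.
  exists K; rewrite (_ : (fun _ _ => _) = @graph_at R d S w) //.
  by apply: funext => i; apply: funext => j; rewrite ffunE.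
move=> [k [r [x [a [b [[[K gK] rL bi] sn]]]]]].
case: (sn) => ek; subst k => xg [sa tb] xc.
split.
  exists K; rewrite (_ : @graph_at R d S w = (fun i j => x.1 (i, j))) //.
  by apply: funext => i; apply: funext => j; rewrite -xg.
exists a, b, r; split=> //.
by rewrite informed_spread (contact_snap sn) -informed_spread.
Qed.

(** A countable union over the number of vertices, the number of rounds and the finitely many
    successful snapshots. *)
Lemma measurable_transmitted (L : R) : measurable (transmitted_within (S := S) cg n L).
Proof.
rewrite (_ : transmitted_within cg n L = \bigcup_k \bigcup_r
  [set w | exists2 y : snapshot k r * 'I_k * 'I_k, `[< snap_ok L y.1.1 y.1.2 y.2 >] &
     snap_at y.1.1 y.1.2 y.2 w]).
  apply: bigcup_measurable => k _; apply: bigcup_measurable => r _.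
  apply: (measurable_finite_union (A := fun y : snapshot k r * 'I_k * 'I_k => [set w | snap_at y.1.1 y.1.2 y.2 w])).
  by move=> y _; exact: measurable_snap_at.
apply/seteqP; split=> w.
  move=> /transmitted_snap[k [r [x [a [b [ok sn]]]]]].
  by exists k => //; exists r => //; exists (x, a, b) => //; apply/asboolP.
move=> [k _ [r _ [[[x a] b] /asboolP ok sn]]]; apply/transmitted_snap.
by exists k, r, x, a, b.
Qed.

Section Choices.
Variables (T : nat) (L : R).
Hypothesis TL : T%:R <= L.
Hypothesis uend : uniform_endpoints S cg n.
Hypothesis uch : uniform_choices S.

Definition success k (g : rel 'I_k) (a b : 'I_k) (f : {ffun 'I_T * 'I_k -> 'I_k}) : bool :=
  b \in informed (pp_contact g f) a T.

Definition choice_event k (g : rel 'I_k) (a b : nat) (f : {ffun 'I_T * 'I_k -> 'I_k}) : set Om :=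
  [set w | [/\ @start R d S w = a, @target R d S w = b &
     forall (t : 'I_T) (i : 'I_k), (0 < #|g i|)%N -> @Defs.choice R d S t i w = f (t, i)]].

Lemma measurable_choice_event k (g : rel 'I_k) a b f : measurable (@choice_event k g a b f).
Proof.
rewrite (_ : choice_event _ _ _ _ = [set w | @start R d S w = a /\ @target R d S w = b] `&`
  [set w | forall (t : 'I_T) (i : 'I_k), (0 < #|g i|)%N -> @Defs.choice R d S t i w = f (t, i)]).
  by apply: measurableI; [exact: measurable_endpoints|exact: (measurable_choices (fun _ i => (0 < #|g i|)%N))].
by apply/seteqP; split=> w /=; [case=> ? ? ?|case=> [[? ?] ?]].
Qed.

Lemma transmitted_success (w : Om) k (g : rel 'I_k) (K : {set 'I_k}) (a b : 'I_k) f :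
  @npts R d S w = k -> (forall i j : 'I_k, @adj R d S i j w = g i j) ->
  is_giant cg n g K -> choice_event g a b f w -> success g a b f ->
  transmitted_within (S := S) cg n L w.
Proof.
move=> ek; subst k => ag gK [sa tb fc] suc.
have ge : @graph_at R d S w = g by apply: funext => i; apply: funext => j; rewrite -ag.
split; first by exists K; rewrite ge.
exists a, b, T; split=> //; move: suc; rewrite /success !informed_spread.
rewrite (@eq_spread _ (pp_contact g f) (@contact_at R d S w)) // => t x y /andP[_ tT].
rewrite add0n in tT; rewrite -[t]/(val (Ordinal tT)) pp_contactE /contact_at ge.
case: (boolP (g x y)) => //= gxy; rewrite -(inj_eq val_inj) [val (f _)](_ : _ = nat_of_ord (f (Ordinal tT, x))) // -fc //.
by apply/card_gt0P; exists y.
Qed.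

Definition win k (g : rel 'I_k) (K : {set 'I_k}) : R :=
  \sum_(a in K) \sum_(b in K) #|K|%:R ^- 2 * PE (@choice_law R _ T g) (fun f => (success g a b f)%:R).

Lemma transmitted_lower k (C : set (k.-tuple (vertex R d))) (g : rel 'I_k) (K : {set 'I_k}) :
  measurable C -> simple_graph g -> is_giant cg n g K ->
  fP P (graph_event C g) * win g K <= fP P (graph_event C g `&` transmitted_within (S := S) cg n L).
Proof.
move=> mC sg gK; have mG := measurable_graph_event g mC.
(* The model leaves the choice of an isolated vertex free. Fixing that coordinate makes the choice
   events of different [f] disjoint and matches [choice_law]. *)
pose can (f : {ffun 'I_T * 'I_k -> 'I_k}) := [forall e : 'I_T * 'I_k, if (0 < #|g e.2|)%N then g e.2 (f e) else f e == e.2].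
pose Q (x : 'I_k * 'I_k * {ffun 'I_T * 'I_k -> 'I_k}) :=
  [&& x.1.1 \in K, x.1.2 \in K, can x.2 & success g x.1.1 x.1.2 x.2].
pose A (x : 'I_k * 'I_k * {ffun 'I_T * 'I_k -> 'I_k}) := graph_event C g `&` choice_event g x.1.1 x.1.2 x.2.
have mA x : measurable (A x) by apply: measurableI => //; exact: measurable_choice_event.
apply: le_trans (fP_sum_le (Q := Q) (A := A) P _ _ _ _); last first.
- move=> [[a b] f] /and4P[aK bK cf suc] w [[ek cm ag] ce]; split; first by split.
  exact: transmitted_success ek ag gK ce suc.
- by apply: measurableI => //; exact: measurable_transmitted.
- move=> [[a b] f] [[a' b'] f'] w /and4P[_ _ cf _] /and4P[_ _ cf' _] [_ [sa tb fc]] [_ [sa' tb' fc']].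
  have -> : a = a' by apply/val_inj; exact: etrans (esym sa) sa'.
  have -> : b = b' by apply/val_inj; exact: etrans (esym tb) tb'.
  congr (_, _); apply/ffunP => -[t i].
  move/forallP: cf => /(_ (t, i)); move/forallP: cf' => /(_ (t, i)) /=.
  case: ifP => [gi _ _|_ /eqP -> /eqP -> //].
  by apply/val_inj; exact: etrans (esym (fc t i gi)) (fc' t i gi).
- by [].
have E a b f : a \in K -> b \in K -> can f ->
    fP P (A (a, b, f)) = fP P (graph_event C g) * #|K|%:R ^- 2 * \prod_e choice_law R g e (f e).
  move=> aK bK cf; apply: EFin_inj; rewrite fPE // EFinM EFinM fPE //.
  have gf (t : 'I_T) i : (0 < #|g i|)%N -> g i (f (t, i)).
    by move=> gi; move/forallP: cf => /(_ (t, i)) /=; rewrite gi.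
  have := uch a b mC sg gf; rewrite (uend mC sg gK aK bK) => e.
  rewrite /A; apply: etrans e _.
  congr (_ * _%:E)%E; rewrite pair_big_dep /= [LHS]big_mkcond; apply: eq_bigr => -[t i] _ /=.
  rewrite /choice_law /=; move/forallP: cf => /(_ (t, i)) /=.
  case: ifP => [_ -> /=|_ -> //]; by rewrite mul1r.
rewrite (eq_bigr (fun x : 'I_k * 'I_k * {ffun 'I_T * 'I_k -> 'I_k} => (fP P (graph_event C g) * #|K|%:R ^- 2 * \prod_e choice_law R g e (x.2 e)))); last first.
  by move=> [[a b] f] /and4P[aK bK cf _]; rewrite E.
rewrite /win mulr_sumr.
rewrite le_eqVlt; apply/orP; left; apply/eqP.
transitivity (\sum_(a in K) \sum_(b in K) \sum_(f : {ffun 'I_T * 'I_k -> 'I_k} | can f && success g a b f)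
   (fP P (graph_event C g) * #|K|%:R ^- 2 * \prod_e choice_law R g e (f e))); last first.
  rewrite pair_big_dep /= pair_big_dep /=; apply: eq_bigl => -[[a b] f] /=.
  by rewrite /Q /= -andbA.
under [LHS]eq_bigr => a _ do rewrite mulr_sumr.
apply: eq_bigr => a aK; apply: eq_bigr => b bK; rewrite mulrA /PE mulr_sumr [RHS]big_mkcond.
apply: eq_bigr => f _; case: (boolP (can f)) => cf /=.
  by case: (success g a b f); rewrite ?mulr1 ?mulr0.
rewrite (_ : \prod_i _ = 0) ?mul0r ?mulr0 //.
move: cf; rewrite negb_forall => /existsP[e he].
rewrite (bigD1 e) //= /choice_law; move: he; case: ifP => [_ /negbTE ->|_ /negbTE ->].
  by rewrite mul0r mul0r.
by rewrite mul0r.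
Qed.

End Choices.
End Space.

Section Reduction.
Local Open Scope classical_set_scope.
Variables (R : realType) (d : nat) (S : rumour_space R d) (n : nat).
Variables (p : vertex R d -> vertex R d -> R) (D : probability (measurableTypeR R) R).
Hypothesis rvm : random_variables_measurable S.
Hypothesis pm : measurable_fun [set: vertex R d * vertex R d] (fun z => p z.1 z.2).
Hypothesis ind : independent_edges S p.
Hypothesis iid : iid_weights S D.
Local Notation P := (@Pr R d S).
Local Notation Om := (@Omega R d S).

Let m_npts : measurable_fun setT (@npts R d S). Proof. by case: rvm. Qed.
Let m_pos i : measurable_fun setT (@pos R d S i). Proof. by case: rvm => _ []. Qed.
Let m_wt i : measurable_fun setT (@wt R d S i). Proof. by case: rvm => _ [_ []]. Qed.

Definition edge_probs k (w : Om) : 'I_k -> 'I_k -> R :=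
  fun i j => p (@pos R d S i w, @wt R d S i w) (@pos R d S j w, @wt R d S j w).

Lemma measurable_edge_probs k (i j : 'I_k) : measurable_fun setT (fun w => edge_probs w i j).
Proof.
rewrite (_ : (fun _ => _) = (fun z => p z.1 z.2) \o
  (fun w => ((@pos R d S i w, @wt R d S i w), (@pos R d S j w, @wt R d S j w)))) //.
apply: measurableT_comp => //; apply: measurable_fun_pair; exact: measurable_fun_pair.
Qed.

Section Graph.
Variables (k : nat) (C : set (k.-tuple (vertex R d))) (Gam : pred {ffun 'I_k * 'I_k -> bool}) (e2 : R).
Hypothesis mC : measurable C.
Hypothesis Cq : forall w, @npts R d S w = k -> C (@marks R d S k w) ->
  edge_prob (@edge_probs k w) /\ GE (@edge_probs k w) (fun f => (~~ Gam f)%:R) <= e2.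

(** One representative per graph: only coordinates (i, j) with i < j may be open, so different
    representatives describe disjoint events. *)
Definition canonical_graph (f : {ffun 'I_k * 'I_k -> bool}) : bool :=
  [forall e : 'I_k * 'I_k, f e ==> (e.1 < e.2)%N].

Let E : set Om := [set w | @npts R d S w = k /\ C (@marks R d S k w)].
Let W f (w : Om) : R := \prod_(i < k) \prod_(j < k | (i < j)%N)
   (if adjf f i j then edge_probs w i j else 1 - edge_probs w i j).

Let mE : measurable E. Proof. exact: measurable_marks_event. Qed.

Lemma measurable_graph_weight f : measurable_fun setT (W f).
Proof.
rewrite (_ : W f = fun w => \prod_(i < k) \prod_(j < k)
   (if (i < j)%N then if adjf f i j then edge_probs w i j else 1 - edge_probs w i j else 1)); last first.
  by apply: funext => w; apply: eq_bigr => i _; rewrite big_mkcond.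
apply: measurable_prod => i _; apply: measurable_prod => j _.
case: (i < j)%N => //; case: (adjf f i j); first exact: measurable_edge_probs.
by apply: measurable_realfun.measurable_funB => //; exact: measurable_edge_probs.
Qed.

Lemma graph_weightE f w : edge_prob (@edge_probs k w) -> canonical_graph f ->
  W f w = \prod_e bern (edge_law (edge_probs w)) e (f e).
Proof.
move=> qp /forallP cf; rewrite /W pair_big_dep /= [LHS]big_mkcond; apply: eq_bigr => -[i j] _ /=.
rewrite /bern /edge_law /=; have := cf (i, j) => /=.
case: ltnP => ij; last by rewrite implybF => /negbTE ->; rewrite subr0.
move=> _; rewrite /adjf /ed ij; have -> // : i != j by rewrite -val_eqE neq_ltn ij.
Qed.

Lemma graph_event_prob f : canonical_graph f ->
  P (graph_event C (adjf f)) = (\int[P]_(w in E) (W f w)%:E)%E.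
Proof.
move=> cf; rewrite ind.2 //; last by split; [exact: adjfC|exact: adjf_irr].
apply: eq_integral => w _; congr EFin; apply: eq_bigr => i _; apply: eq_bigr => j _ /=.
by rewrite !tnth_mktuple.
Qed.

(** Edge probabilities still vary with the exact positions and weights. The bound [e2] holds at
    every outcome in the event and is integrated over it. *)
Lemma graph_lower :
  (1 - e2) * fP P E <= \sum_(f | canonical_graph f && Gam f) fP P (graph_event C (adjf f)).
Proof.
rewrite -lee_fin EFinM fPE // -sumEFin.
rewrite (eq_bigr (fun f => \int[P]_(w in E) (W f w)%:E)%E); last first.
  by move=> f /andP[cf _]; rewrite fPE ?graph_event_prob //; exact: measurable_graph_event.
rewrite -big_filter -ge0_integral_sum //; last 2 first.
- by move=> f; apply/measurable_realfun.measurable_EFinP; apply: measurable_funTS; exact: measurable_graph_weight.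
- move=> f w [ek cm]; rewrite lee_fin; apply: prodr_ge0 => i _; apply: prodr_ge0 => j _.
  have [[_ q01] _] := Cq ek cm; have /andP[q0 q1] := q01 i j.
  by case: ifP => // _; rewrite subr_ge0.
rewrite -integral_cst //.
have [e21|e21] := leP 0 (1 - e2); last first.
  apply: (@le_trans _ _ 0%E).
    rewrite integral_cst // mule_le0_ge0 ?measure_ge0 // lee_fin ltW //.
  apply: integral_ge0 => w [ek cm]; apply: sume_ge0 => f _; rewrite lee_fin.
  apply: prodr_ge0 => i _; apply: prodr_ge0 => j _.
  have [[_ q01] _] := Cq ek cm; have /andP[q0 q1] := q01 i j.
  by case: ifP => // _; rewrite subr_ge0.
apply: ge0_le_integral => //.
- by apply: emeasurable_sum => f; apply/measurable_realfun.measurable_EFinP; apply: measurable_funTS; exact: measurable_graph_weight.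
- move=> w [ek cm]; have [qp ge] := Cq ek cm.
  rewrite sumEFin lee_fin big_filter /=.
  rewrite (eq_bigr (fun f : {ffun 'I_k * 'I_k -> bool} => \prod_e bern (edge_law (edge_probs w)) e (f e))); last first.
    by move=> f /andP[cf _]; exact: graph_weightE.
  have -> : \sum_(f | canonical_graph f && Gam f) \prod_e bern (edge_law (edge_probs w)) e (f e) =
      GE (edge_probs w) (fun f => (Gam f)%:R).
    rewrite /GE /PE big_mkcond; apply: eq_bigr => f _.
    case: (boolP (canonical_graph f)) => /= cf; first by case: (Gam f); rewrite ?mulr1 ?mulr0.
    rewrite (_ : \prod_i _ = 0) ?mul0r //.
    move: cf; rewrite negb_forall => /existsP[e]; rewrite negb_imply => /andP[fe ne].
    by rewrite (bigD1 e) //= /bern fe /edge_law (negbTE ne) mul0r.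
  have : GE (edge_probs w) (fun f => (Gam f)%:R) + GE (edge_probs w) (fun f => (~~ Gam f)%:R) = 1.
    rewrite /GE -PED; apply: etrans (PE_cst (GE_pmf qp) 1); apply: eq_PE => f.
    by case: (Gam f); rewrite /= ?addr0 ?add0r.
  lra.
Qed.

End Graph.

Section Types.
Variables (C L : finType) (cset : C -> set (d.-tuple R)) (lset : L -> set R).
Hypothesis mcset : forall x, measurable (cset x).
Hypothesis mlset : forall x, measurable (lset x).
Let mlsetD x : measurable (lset x : set (measurableTypeR R)). Proof. exact: mlset. Qed.
Hypothesis cdisj : forall x y s, cset x s -> cset y s -> x = y.
Hypothesis ldisj : forall x y s, lset x s -> lset y s -> x = y.
Hypothesis ccover : forall s, torus s -> exists x, cset x s.
Hypothesis lcover : forall s, exists x, lset x s.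
Hypothesis in_torus : forall w (i : 'I_(@npts R d S w)), torus (@pos R d S i w).

Definition types_set k (c : {ffun 'I_k -> C}) (l : {ffun 'I_k -> L}) : set (k.-tuple (vertex R d)) :=
  [set s | forall i, cset (c i) (tnth s i).1 /\ lset (l i) (tnth s i).2].

Lemma measurable_types_set k c l : measurable (@types_set k c l).
Proof.
apply: measurable_forall_fin => i.
rewrite [X in measurable X](_ : _ = (setT `&` (fun s : k.-tuple (vertex R d) => (tnth s i).1) @^-1` cset (c i)) `&`
  (setT `&` (fun s : k.-tuple (vertex R d) => (tnth s i).2) @^-1` lset (l i))); last first.
  by rewrite !setTI.
apply: measurableI.
- have mf : measurable_fun setT (fun s : k.-tuple (vertex R d) => (tnth s i).1).
    by apply: (measurableT_comp measurable_fst); exact: measurable_tnth.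
  exact: mf.
- have mf : measurable_fun setT (fun s : k.-tuple (vertex R d) => (tnth s i).2).
    by apply: (measurableT_comp measurable_snd); exact: measurable_tnth.
  exact: mf.
Qed.

Definition cells_set k (c : {ffun 'I_k -> C}) : set (k.-tuple (d.-tuple R)) :=
  [set s | forall i, cset (c i) (tnth s i)].

Lemma measurable_cells_set k c : measurable (@cells_set k c).
Proof.
apply: measurable_forall_fin => i.
rewrite [X in measurable X](_ : _ = setT `&` (fun s : k.-tuple (d.-tuple R) => tnth s i) @^-1` cset (c i)); last first.
  by rewrite setTI.
by apply: measurable_tnth.
Qed.

Definition cell_law k (c : {ffun 'I_k -> C}) : R :=
  fP P [set w | @npts R d S w = k /\ cells_set c (@positions R d S k w)].

Definition class_law (l : L) : R := fine (D (lset l)).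

Lemma measurable_positions k : measurable_fun setT (@positions R d S k).
Proof.
apply/measurable_fun_tnthP => i.
by rewrite (_ : _ \o _ = @pos R d S i) //; apply: funext => w /=; rewrite tnth_mktuple.
Qed.

Lemma measurable_cells_event k (c : {ffun 'I_k -> C}) :
  measurable [set w | @npts R d S w = k /\ cells_set c (@positions R d S k w)].
Proof.
rewrite (_ : [set _ | _] = [set w | @npts R d S w = k] `&` (setT `&` @positions R d S k @^-1` cells_set c)).
  apply: measurableI; first exact: measurable_eq_nat.
  by apply: measurable_positions => //; exact: measurable_cells_set.
by rewrite setTI.
Qed.

Lemma types_law k (c : {ffun 'I_k -> C}) (l : {ffun 'I_k -> L}) :
  fP P [set w | @npts R d S w = k /\ types_set c l (@marks R d S k w)] =
  cell_law c * \prod_i class_law (l i).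
Proof.
apply: EFin_inj; rewrite EFinM /cell_law !fPE; last first.
- by apply: measurable_marks_event => //; exact: measurable_types_set.
- exact: measurable_cells_event.
have -> : (\prod_i class_law (l i))%:E = (\prod_(i < k) D (lset (l i)))%E.
  rewrite -prodEFin; apply: eq_bigr => i _.
  by rewrite /class_law fineK // fin_num_measure.
rewrite -(iid (measurable_cells_set c) (fun i => mlsetD (l i))); congr (P _).
apply/seteqP; split=> w /=.
  move=> [ek h]; split=> // i; first by rewrite tnth_mktuple; have [] := h i; rewrite tnth_mktuple.
  by have [] := h i; rewrite tnth_mktuple.
move=> [ek h h']; split=> // i; rewrite tnth_mktuple; split=> //=.
by have := h i; rewrite tnth_mktuple.
Qed.

Lemma class_law_ge0 l : 0 <= class_law l.
Proof. by rewrite fine_ge0. Qed.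

Lemma cell_law_ge0 k (c : {ffun 'I_k -> C}) : 0 <= cell_law c.
Proof. exact: fP_ge0. Qed.

Lemma class_law_sum : \sum_l class_law l = 1.
Proof.
rewrite -(fP_setT D); apply: (fP_sum_eq D (A := lset)) => //.
Qed.

Lemma cell_law_sum k : \sum_(c : {ffun 'I_k -> C}) cell_law c = fP P [set w | @npts R d S w = k].
Proof.
apply: (fP_sum_eq P (A := fun c => [set w | @npts R d S w = k /\ cells_set c (@positions R d S k w)])).
- exact: measurable_cells_event.
- move=> c c' w [_ h] [_ h']; apply/ffunP => i; exact: cdisj (h i) (h' i).
- move=> w; split; last by move=> [c []].
  move=> ek; have tor (i : 'I_k) : torus (@pos R d S i w).
    by move: i; rewrite -ek => i; exact: in_torus.
  have [f fc] := boolp.choice (fun i => ccover (tor i)).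
  by exists [ffun i => f i]; split=> // i; rewrite ffunE tnth_mktuple.
Qed.

Section Assembly.
Variables (cg : R) (T K : nat) (Lr eta e1 e2 e3 : R).
Variable good : forall k, {ffun 'I_k -> C} -> {ffun 'I_k -> L} -> bool.
Variable Gam : forall k, pred {ffun 'I_k * 'I_k -> bool}.
Hypothesis TL : T%:R <= Lr.
Hypothesis uend : uniform_endpoints S cg n.
Hypothesis uch : uniform_choices S.
Hypothesis tailK : 1 - eta <= fP P [set w | (@npts R d S w < K)%N].
Hypothesis goodP : CE K cell_law class_law (fun k c l => (~~ good c l)%:R) <= e1.
Hypothesis GamP : forall k (c : {ffun 'I_k -> C}) (l : {ffun 'I_k -> L}), good c l ->
  forall w, @npts R d S w = k -> types_set c l (@marks R d S k w) ->
  edge_prob (@edge_probs k w) /\ GE (@edge_probs k w) (fun f => (~~ Gam f)%:R) <= e2.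
Hypothesis winP : forall k (f : {ffun 'I_k * 'I_k -> bool}), Gam f ->
  exists2 G, is_giant cg n (adjf f) G & 1 - e3 <= win R T (adjf f) G.
Hypotheses (e21 : e2 <= 1) (e31 : e3 <= 1).

Let trans := transmitted_within (S := S) cg n Lr.
Let mtrans : measurable trans. Proof. exact: measurable_transmitted. Qed.

Lemma size_lower k :
  (1 - e3) * (1 - e2) * \sum_(c : {ffun 'I_k -> C}) cell_law c * PE (fun=> class_law) (fun l => (good c l)%:R)
   <= fP P ([set w | @npts R d S w = k] `&` trans).
Proof.
pose X := ({ffun 'I_k -> C} * {ffun 'I_k -> L} * {ffun 'I_k * 'I_k -> bool})%type.
pose Q (x : X) := good x.1.1 x.1.2 && (canonical_graph x.2 && Gam x.2).
pose A (x : X) := graph_event (types_set x.1.1 x.1.2) (adjf x.2) `&` trans.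
have mA x : measurable (A x).
  by apply: measurableI => //; apply: measurable_graph_event => //; exact: measurable_types_set.
apply: le_trans (fP_sum_le P (Q := Q) (A := A) _ _ _ _); last first.
- by move=> x _ w [[ek _ _] tr]; split.
- by apply: measurableI => //; exact: measurable_eq_nat.
- move=> [[c l] f] [[c' l'] f'] w /and3P[_ cf _] /and3P[_ cf' _] [[_ t g] _] [[_ t' g'] _].
  congr (_, _, _); apply/ffunP.
  + by move=> i; apply: cdisj (t i).1 (t' i).1.
  + by move=> i; apply: ldisj (t i).2 (t' i).2.
  + move=> [i j]; have := g i j; rewrite g' /= /adjf.
    move/forallP: cf => /(_ (i, j)) /=; move/forallP: cf' => /(_ (i, j)) /=.
    case: ltnP => ij; last by rewrite !implybF => /negbTE -> /negbTE ->.
    by move=> _ _; rewrite -val_eqE neq_ltn ij /= /ed ij.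
- by [].
rewrite (eq_bigl (fun x : X => (true && good x.1.1 x.1.2) && (canonical_graph x.2 && Gam x.2))) //.
rewrite -(pair_big_dep (fun x : {ffun 'I_k -> C} * {ffun 'I_k -> L} => true && good x.1 x.2)
  (fun _ f => canonical_graph f && Gam f)
  (fun x f => fP P (A (x, f)))) /=.
rewrite -(pair_big_dep xpredT (fun c l => good c l)
  (fun c l => \sum_(f | canonical_graph f && Gam f) fP P (A (c, l, f)))) /=.
rewrite mulr_sumr; apply: ler_sum => c _; rewrite /PE mulr_sumr mulr_sumr [leRHS]big_mkcond.
apply: ler_sum => l _; case: ifP => gcl; last by rewrite mulr0 mulr0 mulr0.
rewrite mulr1 -types_law -mulrA.
have e3' : 0 <= 1 - e3 by rewrite subr_ge0.
have := graph_lower (measurable_types_set c l) (GamP gcl).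
move=> /(ler_wpM2l e3')/le_trans; apply; rewrite mulr_sumr; apply: ler_sum => f /andP[cf gf].
have [G gG wG] := winP gf.
have sg : simple_graph (adjf f) by split; [exact: adjfC|exact: adjf_irr].
apply: le_trans (transmitted_lower rvm TL uend uch (measurable_types_set c l) sg gG).
by rewrite mulrC ler_wpM2l ?fP_ge0.
Qed.

Lemma transmitted_prob : (1 - e3) * (1 - e2) * (1 - eta - e1) <= fP P trans.
Proof.
apply: (@le_trans _ _ (\sum_(k < K) fP P ([set w | @npts R d S w = k] `&` trans))); last first.
  apply: fP_sum_le => //.
  - by move=> k _; apply: measurableI => //; exact: measurable_eq_nat.
  - by move=> i j w _ _ [+ _] [+ _] => /= -> /val_inj.
apply: (@le_trans _ _ (\sum_(k < K) (1 - e3) * (1 - e2) *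
   \sum_(c : {ffun 'I_k -> C}) cell_law c * PE (fun=> class_law) (fun l => (good c l)%:R))); last first.
  by apply: ler_sum => k _; exact: size_lower.
rewrite -mulr_sumr ler_wpM2l ?mulr_ge0 ?subr_ge0 //.
rewrite -[leRHS]/(CE K cell_law class_law (fun k c l => (good c l)%:R)).
have cw := weights_pmf class_law_ge0 class_law_sum.
have : CE K cell_law class_law (fun k c l => (good c l)%:R) +
   CE K cell_law class_law (fun k c l => (~~ good c l)%:R) = fP P [set w | (@npts R d S w < K)%N].
  rewrite -CED /CE; transitivity (\sum_(k < K) fP P [set w | @npts R d S w = k]).
    apply: eq_bigr => k _; rewrite -cell_law_sum; apply: eq_bigr => c _.
    rewrite [X in _ * X](_ : _ = 1) ?mulr1 //.
    apply: etrans (PE_cst (cw k) 1); apply: eq_PE => l.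
    by case: (good c l); rewrite /= ?addr0 ?add0r.
  apply: (fP_sum_eq P (A := fun k : 'I_K => [set w | @npts R d S w = k])).
  - by move=> k; exact: measurable_eq_nat.
  - by move=> i j w /= -> /val_inj.
  - move=> w; split=> [h|[k /= ->]]; first by exists (Ordinal h).
    exact: ltn_ord.
move=> e; rewrite lerBlDr; move: tailK; rewrite -e => h; apply: le_trans h _.
by rewrite lerD2l.
Qed.

End Assembly.
End Types.
End Reduction.

(** * Volumes of cells and balls, and the law of the cell counts *)

Section BoxVolume.
Local Open Scope classical_set_scope.
Variable R : realType.
Local Open Scope ereal_scope.

Lemma lebesgue_tuple0 (d : nat) : @lebesgue_tuple R d set0 = 0.
Proof.
elim: d => [|d IH] /=; first by rewrite diracE in_set0.
by rewrite integral0_eq // => x _; rewrite (_ : [set _ | _] = set0).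
Qed.

Lemma lebesgue_tuple_box (d : nat) (I : 'I_d -> set R) : (forall j, measurable (I j)) ->
  lebesgue_tuple [set x : d.-tuple R | forall j, I j (tnth x j)] =
  \prod_(j < d) @lebesgue_measure R (I j).
Proof.
elim: d I => [|d IH] I mI /=.
  rewrite big_ord0 diracE (_ : _ \in _) //; apply/mem_set => -[].
  by [].
rewrite big_ord_recl muleC.
rewrite -(@integral_cst _ (measurableTypeR R) R (@lebesgue_measure R) _ (mI ord0)) [RHS]integral_mkcond; apply: eq_integral => x _.
rewrite patchE; case: ifPn => xI.
  rewrite -IH //; congr (lebesgue_tuple _); apply/seteqP; split=> t h j.
    by have := h (lift ord0 j); rewrite tnthS.
  case: (unliftP ord0 j) => [j' ->|->]; first by rewrite tnthS.
  by rewrite tnth0; apply: set_mem.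
rewrite (_ : [set _ | _] = set0) ?lebesgue_tuple0 //.
apply/seteqP; split=> // t h; have := h ord0; rewrite tnth0 => h0.
by move: xI; rewrite notin_setE.
Qed.

End BoxVolume.

Section Cells.
Local Open Scope classical_set_scope.
Variables (R : realType) (d b : nat).
Local Notation C := (cellT d b).

Definition cell_set (c : C) : set (d.-tuple R) :=
  [set x | forall j, (c j)%:R / 2 ^+ b <= tnth x j < (c j).+1%:R / 2 ^+ b].

Let side0 : 0 < 2 ^+ b :> R. Proof. by rewrite exprn_gt0. Qed.

Lemma measurable_cell_set c : measurable (cell_set c).
Proof.
apply: measurable_forall_fin => j.
rewrite [X in measurable X](_ : _ = setT `&` (fun x : d.-tuple R => tnth x j) @^-1`
   `[(c j)%:R / 2 ^+ b, (c j).+1%:R / 2 ^+ b[).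
  by apply: measurable_tnth => //; exact: measurable_itv.
by rewrite setTI; apply/seteqP; split=> x /=; rewrite in_itv.
Qed.

Lemma cell_set_torus c : cell_set c `<=` @torus R d.
Proof.
move=> x h j; have /andP[h1 h2] := h j; apply/andP; split.
  by apply: le_trans h1; rewrite divr_ge0 // ltW.
apply: lt_le_trans h2 _; rewrite ler_pdivrMr // mul1r.
by rewrite -natrX ler_nat.
Qed.

Lemma cell_set_inj c c' x : cell_set c x -> cell_set c' x -> c = c'.
Proof.
move=> h h'; apply/ffunP => j; apply: val_inj.
have /andP[h1 h2] := h j; have /andP[h3 h4] := h' j.
have := le_lt_trans h1 h4; have := le_lt_trans h3 h2.
by rewrite !ltr_pM2r ?invr_gt0 // !ltr_nat /=; lia.
Qed.

Lemma cell_set_cover x : torus x -> exists c, cell_set c x.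
Proof.
move=> tx.
have lt j : (Num.truncn (tnth x j * 2 ^+ b) < 2 ^ b)%N.
  have /andP[x0 x1] := tx j.
  rewrite truncn_lt_nat; first by rewrite natrX gtr_pMl.
  by rewrite mulr_ge0 // ltW.
exists [ffun j => Ordinal (lt j)] => j; rewrite ffunE /=.
have /andP[x0 x1] := tx j.
have p0 : 0 <= tnth x j * 2 ^+ b by rewrite mulr_ge0 // ltW.
by rewrite ler_pdivrMr // ltr_pdivlMr // -truncn_ge_nat // leqnn -truncn_le_nat leqnn.
Qed.

Lemma cell_volume c : lebesgue_tuple (cell_set c) = ((2 ^+ (d * b))^-1)%:E.
Proof.
pose I (j : 'I_d) : set R := `[(c j)%:R / 2 ^+ b, (c j).+1%:R / 2 ^+ b[%classic.
have mI j : measurable (I j) by exact: measurable_itv.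
rewrite (_ : cell_set c = [set x | forall j : 'I_d, I j (tnth x j)]); last first.
  by apply/seteqP; split=> x h j; have := h j; rewrite /I /= in_itv.
rewrite (lebesgue_tuple_box mI); transitivity (\prod_(j < d) ((2 ^+ b)^-1 : R)%:E)%E.
  apply: eq_bigr => j _; rewrite /I lebesgue_measure_itv /= lte_fin ltr_pM2r ?invr_gt0 // ltr_nat ltnSn.
  by rewrite -EFinB -mulrBl -natrB // subSnn mul1r.
by rewrite prodEFin prodr_const card_ord -exprVn -exprM mulnC exprVn.
Qed.

End Cells.

Section BallVolume.
Local Open Scope classical_set_scope.
Variables (R : realType) (d : nat).

(** In one coordinate the ball around 0 is the union of [0, r] and [1 - r, 1[, two disjoint pieces
    when 2 r < 1 and everything otherwise. *)
Lemma ball_volumeE (r : R) : 0 <= r -> ball_volume d r = (Num.min (2 * r) 1) ^+ d.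
Proof.
move=> r0; rewrite /ball_volume.
pose I : set R := [set x | 0 <= x < 1 /\ (x <= r \/ 1 - r <= x)].
have key : measurable I /\ @lebesgue_measure R I = (Num.min (2 * r) 1)%:E.
  have [h|h] := ltP (2 * r) 1.
    rewrite (_ : I = `[0, r] `|` `[1 - r, 1[).
      split; first by apply: measurableU; exact: measurable_itv.
      rewrite measureU; [|exact: measurable_itv|exact: measurable_itv|].
        have e1 : @lebesgue_measure R (`[0, r]%classic : set R) = r%:E.
          rewrite lebesgue_measure_itv /= lte_fin; case: ifP => [r1|/negbT].
            by rewrite -EFinB subr0.
          by rewrite -leNgt => r1; have -> : r = 0 by lra.
        have e2 : @lebesgue_measure R (`[1 - r, 1[%classic : set R) = r%:E.
          rewrite lebesgue_measure_itv /= lte_fin; have -> : 1 - r < 1 = (0 < r) by rewrite gtrBl.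
          case: ifP => [r1|/negbT]; first by rewrite -EFinB; congr EFin; ring.
          by rewrite -leNgt => r1; have -> : r = 0 by lra.
        transitivity (r%:E + r%:E)%E; first by congr (_ + _)%E; [exact: e1|exact: e2].
        by rewrite -EFinD; congr EFin; ring.
      apply/seteqP; split=> // x /=; rewrite !in_itv /= => -[/andP[a1 a2] /andP[a3 a4]].
      by exfalso; lra.
    apply/seteqP; split=> x /=; rewrite !in_itv /= => -[].
      by move=> /andP[x0 x1] [xr|xr]; [left|right]; apply/andP.
    - by move=> /andP[x0 x1]; split; [apply/andP; split=> //; lra|left].
    - by move=> /andP[x0 x1]; split; [apply/andP; split=> //; lra|right].
  rewrite (_ : I = `[0, 1[).
    by split; [exact: measurable_itv|rewrite lebesgue_measure_itv /= lte_fin ltr01 -EFinB subr0].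
  apply/seteqP; split=> x /=; rewrite in_itv /=; first by case.
  move=> /andP[x0 x1]; split; first by apply/andP.
  by have [?|?] := leP x r; [left|right; lra].
have -> : [set x : d.-tuple R | torus x /\ torus_dist x [tuple 0 | _ < d] <= r] =
   [set x | forall j, I (tnth x j)].
  apply/seteqP; split=> x.
    move=> [tx]; rewrite /torus_dist => /bigmax_leP[_ h] j; split; first exact: tx.
    have /andP[x0 x1] := tx j; have := h j isT; rewrite tnth_mktuple /torus_dist1 subr0 ger0_norm //.
    by rewrite ge_min => /orP[?|?]; [left|right; lra].
  move=> h; split; first by move=> j; have [] := h j.
  apply/bigmax_leP; split=> // j _; have [/andP[x0 x1] h'] := h j.
  rewrite tnth_mktuple /torus_dist1 subr0 ger0_norm // ge_min.
  by apply/orP; case: h' => ?; [left|right; lra].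
rewrite (lebesgue_tuple_box (fun _ => key.1)).
by under eq_bigr => j _ do rewrite key.2; rewrite prodEFin prodr_const card_ord.
Qed.

End BallVolume.

Section PoissonCells.
Local Open Scope classical_set_scope.
Variables (R : realType) (d : nat) (S : rumour_space R d) (n b : nat).
Hypothesis rvm : random_variables_measurable S.
Hypothesis pp : poisson_process S n%:R.
Hypothesis n_gt0 : (0 < n)%N.
Local Notation P := (@Pr R d S).
Local Notation Om := (@Omega R d S).
Local Notation C := (cellT d b).

(* Expected number of vertices per cell. *)
Definition cell_rate : R := n%:R / 2 ^+ (d * b).

Lemma cell_rate_gt0 : 0 < cell_rate.
Proof. by rewrite divr_gt0 ?ltr0n // exprn_gt0. Qed.

Lemma measurable_count_in (B : set (d.-tuple R)) m : measurable B ->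
  measurable [set w : Om | count_in B w = m].
Proof.
move=> mB; have [m_npts [m_pos _]] := rvm.
rewrite (_ : [set _ | _] = \bigcup_k ([set w | @npts R d S w = k] `&`
   [set w | exists2 g : {ffun 'I_k -> bool}, (\sum_i g i == m)%N &
       forall i : 'I_k, (@pos R d S i w \in B) = g i])).
  apply: bigcup_measurable => k _; apply: measurableI; first exact: measurable_eq_nat.
  apply: measurable_finite_union => g _; apply: measurable_forall_fin => i.
  have mp : measurable (setT `&` @pos R d S i @^-1` B) by exact: m_pos.
  rewrite [X in measurable X](_ : _ = if g i then setT `&` @pos R d S i @^-1` B else ~` (setT `&` @pos R d S i @^-1` B)).
    by case: (g i) => //; exact: measurableC.
  apply/seteqP; split=> w; case: (g i) => /=; rewrite ?setTI /preimage /=.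
  - by move/set_mem.
  - by move=> h [_ /mem_set]; rewrite h.
  - by move=> [_ /mem_set].
  - by move=> h; apply/negbTE; rewrite notin_setE => h'; apply: h.
apply/seteqP; split=> w.
  move=> /= cw; exists (@npts R d S w) => //; split=> //.
  exists [ffun i : 'I__ => @pos R d S i w \in B]; last by move=> i; rewrite ffunE.
  by apply/eqP; rewrite -cw /count_in; apply: eq_bigr => i _; rewrite ffunE.
move=> [k _ [/= ek [g /eqP sg h]]]; subst k; rewrite /count_in -sg.
by apply: eq_bigr => i _; rewrite h.
Qed.

Lemma poisson_prob1 (x : R) m : 0 < x -> poisson_prob x 0 [set m] = (pois x m)%:E.
Proof.
by move=> x0; rewrite /poisson_prob x0 esum_set1 ?lee_fin ?poisson_pmf_ge0 // /poisson_pmf x0 /pois.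
Qed.

Lemma cell_counts (M : C -> nat) :
  fP P [set w | forall x, count_in (cell_set x) w = M x] = \prod_x pois cell_rate (M x).
Proof.
have := pp.2 #|{: C}| (fun j => cell_set (enum_val j)) (fun j => M (enum_val j)).
move=> /(_ (fun j => measurable_cell_set (enum_val j)) (fun j => @cell_set_torus _ _ _ _)).
move=> h; rewrite /fP (_ : [set _ | _] = [set w | forall j : 'I_#|{: C}|, count_in (cell_set (enum_val j)) w = M (enum_val j)]).
  rewrite h; last first.
    apply/trivIsetP => i j _ _ ij; apply/seteqP; split=> // x [xi xj].
    by case/eqP: ij; apply/enum_val_inj; exact: cell_set_inj xi xj.
  transitivity (fine (\prod_(j < #|{: C}|) (pois cell_rate (M (enum_val j)))%:E)%E).
    congr fine; apply: eq_bigr => j _.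
    by rewrite (@cell_volume R d b (enum_val j)) /= poisson_prob1 ?cell_rate_gt0.
  rewrite prodEFin /= [RHS](reindex (@enum_val C predT)) //=.
  exact/onW_bij/enum_val_bij.
apply/seteqP; split=> w h' x; first exact: h'.
by have := h' (enum_rank x); rewrite enum_rankK.
Qed.

(** Regroup by the vector of cell counts, whose law is the product of Poisson weights. Fewer than
    [K] vertices force every count below [K] but not conversely, so this is an inequality. *)
Lemma poisson_cells (K : nat) (psi : C -> nat -> R) : (forall x m, 0 <= psi x m) ->
  \sum_(k < K) \sum_(c : {ffun 'I_k -> C}) cell_law S (@cell_set R d b) c * \prod_x psi x (cnt c x)
    <= \prod_x \sum_(m < K) pois cell_rate m * psi x m.
Proof.
move=> psi0.
pose A (M : {ffun C -> 'I_K}) : set Om := [set w | forall x, count_in (cell_set x) w = M x].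
have mA M : measurable (A M).
  by apply: measurable_forall_fin => x; apply: measurable_count_in; exact: measurable_cell_set.
pose B k (c : {ffun 'I_k -> C}) : set Om := [set w | @npts R d S w = k /\ cells_set (@cell_set R d b) c (@positions R d S k w)].
have mB k c : measurable (@B k c).
  by apply: measurable_cells_event => //; exact: measurable_cell_set.
have cntw k (c : {ffun 'I_k -> C}) w x : B k c w -> count_in (cell_set x) w = cnt c x.
  move=> [ek]; subst k => cc; rewrite /count_in /cnt -sum1_card [RHS]big_mkcond.
  apply: eq_bigr => i _; rewrite inE; have := cc i; rewrite tnth_mktuple => ci.
  case: eqP => [<-|ne]; first by rewrite mem_set.
  by rewrite memNset // => xi; case: ne; exact: cell_set_inj ci xi.
have AE M : fP P (A M) = \prod_x pois cell_rate (M x) by exact: cell_counts.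
rewrite bigA_distr_bigA /=.
pose psiM (M : {ffun C -> 'I_K}) := \prod_x psi x (M x).
pose cntf k (c : {ffun 'I_k -> C}) (M : {ffun C -> 'I_K}) := [forall x, val (M x) == cnt c x].
apply: (@le_trans _ _ (\sum_(M : {ffun C -> 'I_K}) psiM M *
   \sum_(k < K) \sum_(c : {ffun 'I_k -> C} | cntf k c M) fP P (B k c))).
  under [leRHS]eq_bigr do rewrite mulr_sumr.
  rewrite exchange_big /=; apply: ler_sum => k _.
  under [leRHS]eq_bigr => M _ do rewrite big_mkcond mulr_sumr.
  rewrite exchange_big /=; apply: ler_sum => c _.
  have lt x : (cnt c x < K)%N.
    by apply: leq_ltn_trans (ltn_ord k); rewrite -[X in (_ <= X)%N]card_ord; exact: max_card.
  rewrite (bigD1 [ffun x => Ordinal (lt x)]) //= ifT; last by apply/forallP => x; rewrite ffunE.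
  rewrite -[leLHS]addr0; apply: lerD.
    rewrite mulrC /psiM; under [X in _ <= X * _]eq_bigr do rewrite ffunE.
    by [].
  apply: sumr_ge0 => M _; rewrite mulr_ge0 //; first by apply: prodr_ge0.
  by case: ifP => // _; exact: fP_ge0.
apply: ler_sum => M _; rewrite big_split /= mulrC -AE ler_wpM2r //; first by apply: prodr_ge0.
apply: (@le_trans _ _ (\sum_(k < K) fP P ([set w | @npts R d S w = k] `&` A M))).
  apply: ler_sum => k _; apply: fP_sum_le => //.
  - move=> c c' w _ _ [_ h] [_ h']; apply/ffunP => i; exact: cell_set_inj (h i) (h' i).
  - by apply: measurableI => //; apply: measurable_eq_nat; case: rvm.
  - move=> c /forallP cM w bw; split; first by case: bw.
    by move=> x; rewrite (cntw _ _ _ _ bw) (eqP (cM x)).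
apply: fP_sum_le => //.
- by move=> k _; apply: measurableI => //; apply: measurable_eq_nat; case: rvm.
- by move=> i j w _ _ [+ _] [+ _] => /= -> /val_inj.
Qed.

End PoissonCells.

Section Classes.
Local Open Scope classical_set_scope.
Variables (R : realType) (M : nat).

(* The last class collects all weights below 1 or at least 2^M. *)
Definition class_set (l : 'I_M.+1) : set R :=
  if val l == M then ~` `[1, 2 ^+ M[ else `[2 ^+ l, 2 ^+ l.+1[.

Lemma class_setP (l : 'I_M.+1) x : (l < M)%N -> class_set l x -> 2 ^+ l <= x < 2 ^+ l.+1.
Proof. by move=> lM; rewrite /class_set /= (ltn_eqF lM) /= in_itv. Qed.

Lemma measurable_class_set l : measurable (class_set l).
Proof.
rewrite /class_set; case: ifP => _; last exact: measurable_itv.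
by apply: measurableC; exact: measurable_itv.
Qed.

Lemma class_exists (x : R) : 1 <= x < 2 ^+ M -> exists2 l : nat, (l < M)%N & 2 ^+ l <= x < 2 ^+ l.+1.
Proof.
elim: M => [|m IH] /andP[x1 x2]; first by move: x2; rewrite expr0 ltNge x1.
have [h|h] := leP (2 ^+ m) x; first by exists m; rewrite // h x2.
by have [|l lm lx] := IH; [rewrite x1|exists l => //; exact: ltnW].
Qed.

Lemma class_set_cover x : exists l, class_set l x.
Proof.
have [h|h] := boolP (1 <= x < 2 ^+ M).
  have [l lM lx] := class_exists h.
  by exists (inord l); rewrite /class_set /= inordK ?ltnS 1?ltnW // (ltn_eqF lM) /= in_itv.
by exists ord_max; rewrite /class_set /= eqxx /= in_itv /=; exact/negP.
Qed.

Lemma expr2_interval (x : R) (l l' : nat) : 2 ^+ l <= x < 2 ^+ l.+1 -> 2 ^+ l' <= x < 2 ^+ l'.+1 -> l = l'.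
Proof.
move=> /andP[a1 a2] /andP[b1 b2]; have := le_lt_trans a1 b2; have := le_lt_trans b1 a2.
by rewrite -!natrX !ltr_nat !ltn_exp2l //; lia.
Qed.

Lemma class_set_inj l l' x : class_set l x -> class_set l' x -> l = l'.
Proof.
have in_range (i : 'I_M.+1) : (i < M)%N -> 2 ^+ i <= x < 2 ^+ i.+1 -> 1 <= x < 2 ^+ M.
  move=> iM /andP[a1 a2]; apply/andP; split.
    by apply: le_trans a1; rewrite exprn_ege1 // ler1n.
  by apply: lt_le_trans a2 _; rewrite ler_weXn2l // ler1n.
move=> h h'; apply: val_inj => /=.
have [e|n] := eqVneq (val l) M; have [e'|n'] := eqVneq (val l') M; first by rewrite e e'.
- have l'M : (l' < M)%N by rewrite ltn_neqAle n' -ltnS ltn_ord.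
  move: h; rewrite /class_set e eqxx /= in_itv /= => /negP; rewrite (in_range l') //.
  exact: class_setP.
- have lM : (l < M)%N by rewrite ltn_neqAle n -ltnS ltn_ord.
  move: h'; rewrite /class_set e' eqxx /= in_itv /= => /negP; rewrite (in_range l) //.
  exact: class_setP.
- have l'M : (l' < M)%N by rewrite ltn_neqAle n' -ltnS ltn_ord.
  have lM : (l < M)%N by rewrite ltn_neqAle n -ltnS ltn_ord.
  by apply: (@expr2_interval x); apply: class_setP.
Qed.

End Classes.

Lemma prod_powR (R : realType) (I : finType) (a : I -> R) (x : R) : (forall i, 0 <= a i) ->
  \prod_i (a i `^ x) = (\prod_i a i) `^ x.
Proof.
move=> a0; suff [] : 0 <= \prod_i a i /\ \prod_i (a i `^ x) = (\prod_i a i) `^ x by [].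
apply: (big_ind2 (fun u v : R => 0 <= v /\ u = v `^ x)); first by rewrite powR1.
  by move=> u v u' v' [v0 ->] [v0' ->]; split; [exact: mulr_ge0|rewrite powRM].
by move=> i _; split.
Qed.

Lemma cyc_le (m x y : nat) : (x < m)%N -> (maxn 1 (cyc m x y) <= m)%N.
Proof. by rewrite /cyc; lia. Qed.

Section Distances.
Local Open Scope classical_set_scope.
Variables (R : realType) (b : nat).
Local Notation side := (2 ^+ b : R).
Implicit Types (x y : R).

Let side0 : 0 < side. Proof. by rewrite exprn_gt0. Qed.

(** Cells at cyclic distance k contain only points at distance at least k - 1 sides, and k - 1 is at
    least k/2 once k is at least 2. Adjacent cells admit no such bound. *)
Lemma torus_dist1_lower (c c' : 'I_(2 ^ b)) x y :
  c%:R / side <= x < c.+1%:R / side -> c'%:R / side <= y < c'.+1%:R / side ->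
  (1 < cyc (2 ^ b) c c')%N -> (cyc (2 ^ b) c c')%:R / side <= 2 * torus_dist1 x y.
Proof.
move=> /andP[x1 x2] /andP[y1 y2] cy.
have hc := ltn_ord c; have hc' := ltn_ord c'.
move: x1 x2 y1 y2; rewrite !ler_pdivrMr // !ltr_pdivlMr //.
set X := x * side; set Y := y * side => x1 x2 y1 y2.
have E : 2 * torus_dist1 x y * side = 2 * Num.min `|X - Y| (side - `|X - Y|).
  rewrite -mulrA /torus_dist1 minr_pMl ?(ltW side0) // mulrBl mul1r.
  by rewrite -{1 3}(gtr0_norm side0) -normrM mulrBl.
rewrite E /cyc; set k := cyc _ _ _ in cy *.
have key : (maxn c c' - minn c c')%:R - 1 <= `|X - Y| <= (maxn c c' - minn c c')%:R + 1.
  have [h|h] := leqP c c'.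
    have hR : c%:R <= c'%:R :> R by rewrite ler_nat.
    rewrite natrB //; rewrite -!natr1 in x2 y2.
    apply/andP; split; first by rewrite distrC; apply: le_trans (ler_norm _); lra.
    by rewrite ler_norml; apply/andP; split; lra.
  have hR : c'%:R <= c%:R :> R by rewrite ler_nat ltnW.
  rewrite natrB 1?ltnW //; rewrite -!natr1 in x2 y2.
  apply/andP; split; first by apply: le_trans (ler_norm _); lra.
  by rewrite ler_norml; apply/andP; split; lra.
have k2 : 2 <= k%:R :> R by rewrite ler_nat.
have k1 : k%:R <= (maxn c c' - minn c c')%:R :> R by rewrite ler_nat geq_minl.
have k3 : k%:R <= side - (maxn c c' - minn c c')%:R.
  rewrite -natrX -natrB ?ler_nat ?geq_minr //.
  by apply: leq_trans (leq_subr _ _) _; rewrite geq_max (ltnW hc) (ltnW hc').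
have /andP[k4 k5] := key.
have : k%:R / 2 <= Num.min `|X - Y| (side - `|X - Y|) by rewrite le_min; apply/andP; split; lra.
lra.
Qed.

Lemma torus_dist1_upper (c c' : 'I_(2 ^ b)) (i : nat) x y :
  c%:R / side <= x < c.+1%:R / side -> c'%:R / side <= y < c'.+1%:R / side ->
  (c %/ 2 ^ i = c' %/ 2 ^ i)%N -> torus_dist1 x y <= 2 ^+ i / side.
Proof.
move=> /andP[x1 x2] /andP[y1 y2] cc.
rewrite /torus_dist1 ge_min; apply/orP; left.
move: x1 x2 y1 y2; rewrite !ler_pdivrMr // !ltr_pdivlMr // => x1 x2 y1 y2.
rewrite ler_pdivlMr // -(gtr0_norm side0) -normrM mulrBl.
have i0 : (0 < 2 ^ i)%N by rewrite expn_gt0.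
have e1 := divn_eq c (2 ^ i); have e2 := divn_eq c' (2 ^ i).
have l1 := ltn_pmod c i0; have l2 := ltn_pmod c' i0.
have h1 : (c.+1 <= c' + 2 ^ i)%N by rewrite cc in e1; lia.
have h2 : (c'.+1 <= c + 2 ^ i)%N by rewrite cc in e1; lia.
move: h1 h2; rewrite -!(ler_nat R) !natrD natrX => h1 h2.
by rewrite ler_norml; apply/andP; split; lra.
Qed.

End Distances.

Section KernelBounds.
Local Open Scope classical_set_scope.
Variables (R : realType) (d b n : nat) (alpha beta lam : R).
Hypothesis lamE : n%:R = lam * 2 ^+ (d * b).
Hypothesis lam1 : 1 <= lam.
Hypotheses (beta1 : 1 < beta) (beta_le : beta <= alpha).
Variables (s t : vertex R d) (c c' : cellT d b) (l l' : nat).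
Hypotheses (sc : cell_set c s.1) (tc : cell_set c' t.1).
Hypotheses (sl : 2 ^+ l <= s.2 < 2 ^+ l.+1) (tl : 2 ^+ l' <= t.2 < 2 ^+ l'.+1).

Let r := torus_dist s.1 t.1.
Let r0 : 0 <= r. Proof. exact: bigmax_ge_id. Qed.
Let r_ge j : torus_dist1 (tnth s.1 j) (tnth t.1 j) <= r.
Proof. exact: le_bigmax. Qed.
Let W : R := s.2 * t.2.
Let W_lo : 2 ^+ (l + l') <= W.
Proof.
case/andP: sl => s1 _; case/andP: tl => t1 _.
by rewrite exprD; apply: ler_pM; rewrite ?exprn_ge0.
Qed.
Let W_hi : W <= 4 * 2 ^+ (l + l').
Proof.
case/andP: sl => s1 s2; case/andP: tl => t1 t2.
rewrite (_ : 4 * 2 ^+ (l + l') = 2 ^+ l.+1 * 2 ^+ l'.+1); last by rewrite exprD !exprS; ring.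
by apply: ler_pM; rewrite ?(ltW s2) ?(ltW t2) // (le_trans _ s1, le_trans _ t1) ?exprn_ge0.
Qed.
Let W0 : 0 < W. Proof. by apply: lt_le_trans W_lo; rewrite exprn_gt0. Qed.

Let kernelE : girg_kernel alpha n s t =
  if n%:R * Num.min (2 * r) 1 ^+ d == 0 then 1 else Num.min ((W / (n%:R * Num.min (2 * r) 1 ^+ d)) `^ alpha) 1.
Proof. by rewrite /girg_kernel ball_volumeE. Qed.

Lemma kernel_lower i : same_box i c c' ->
  Num.min ((2 ^+ (l + l') / (lam * 2 ^+ (d * i.+1))) `^ alpha) 1 <= girg_kernel alpha n s t.
Proof.
move=> /same_boxP cc; rewrite kernelE; case: ifPn => nV; first by rewrite ge_min lexx orbT.
set V := n%:R * _ in nV *.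
have V0 : 0 < V by rewrite lt0r nV mulr_ge0 // exprn_ge0 // le_min ler01 mulr_ge0.
have L0 : 0 < lam * 2 ^+ (d * i.+1) by rewrite mulr_gt0 ?exprn_gt0 // (lt_le_trans ltr01).
have a0 : 0 <= alpha by apply: le_trans beta_le; apply: le_trans (ltW beta1).
rewrite le_min ge_min [X in _ && X]ge_min lexx orbT andbT; apply/orP; left.
apply: ge0_ler_powR; rewrite ?nnegrE ?divr_ge0 ?exprn_ge0 ?(ltW L0) ?(ltW V0) ?(ltW W0) //.
apply: ler_pM; rewrite ?invr_ge0 ?exprn_ge0 ?(ltW L0) //.
rewrite lef_pV2 ?posrE // /V lamE -mulrA ler_wpM2l //; first by apply: le_trans lam1.
rewrite mulnC exprM -exprMn -mulnC exprM.
apply: lerXn2r; rewrite ?nnegrE ?exprn_ge0 ?mulr_ge0 ?le_min ?mulr_ge0 ?ler01 //.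
have side0 : 0 < 2 ^+ b :> R by rewrite exprn_gt0.
rewrite mulrC -ler_pdivlMr // ge_min; apply/orP; left.
rewrite exprS -mulrA ler_pM2l // /r /torus_dist.
by apply/bigmax_leP; split; [rewrite divr_ge0 ?exprn_ge0|move=> j _; apply: torus_dist1_upper (sc j) (tc j) (cc j)].
Qed.

(** If the cells are equal or adjacent in every coordinate, [cell_decay] is 1 and the kernel is at
    most 1. Otherwise the torus distance dominates every coordinate and the volume is at least the
    product of the cyclic distances. *)
Lemma kernel_upper :
  girg_kernel alpha n s t <= 4 `^ beta * (2 `^ (beta * l%:R) * 2 `^ (beta * l'%:R)) * cell_decay beta c c'.
Proof.
have b0 : 0 <= beta by apply: le_trans (ltW beta1).
have k1 : girg_kernel alpha n s t <= 1 by rewrite kernelE; case: ifP => // _; rewrite ge_min lexx orbT.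
have pow1 (x : R) : 1 <= x -> 1 <= x `^ beta.
  by move=> x1; rewrite -[X in X <= _](powRr0 x) ler_powR.
have [/forallP h|] := boolP [forall j, (cyc (2 ^ b) (c j) (c' j) <= 1)%N].
  apply: le_trans k1 _; rewrite /cell_decay big1 ?mulr1; last first.
    move=> j _; rewrite /decay (_ : maxn 1 _ = 1%N) ?powR1 //; by apply/maxn_idPl.
  have p2 (m : nat) : 1 <= 2 `^ (beta * m%:R) :> R.
    by rewrite -[X in X <= _](powRr0 2) ler_powR ?ler1n // mulr_ge0.
  have := pow1 4 (ltac:(lra)); have := p2 l; have := p2 l'.
  by move=> h1 h2 h3; rewrite -[X in X <= _]mulr1; apply: ler_pM => //; rewrite -[X in X <= _]mulr1; apply: ler_pM.
rewrite negb_forall => /existsP[j0]; rewrite -ltnNge => j0P.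
have side0 : 0 < 2 ^+ b :> R by rewrite exprn_gt0.
pose Q : R := \prod_j (maxn 1 (cyc (2 ^ b) (c j) (c' j)))%:R.
have Q0 : 0 < Q by apply: prodr_gt0 => j _; rewrite ltr0n leq_max.
have V_lo : Q <= n%:R * Num.min (2 * r) 1 ^+ d.
  rewrite lamE -mulrA; apply: (@le_trans _ _ (2 ^+ (d * b) * Num.min (2 * r) 1 ^+ d)); last first.
    rewrite ler_peMl // mulr_ge0 ?exprn_ge0 // le_min ler01 mulr_ge0 //.
  rewrite mulnC exprM -exprMn /Q -[X in _ ^+ X]card_ord -prodr_const; apply: ler_prod => j _; rewrite ler0n /=.
  rewrite mulrC -ler_pdivrMr // le_min; apply/andP; split; last first.
    by rewrite ler_pdivrMr // mul1r -natrX ler_nat cyc_le.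
  (* A coordinate with adjacent cells is compared with the distant coordinate [j0], which the
     maximum distance also dominates. *)
  have [h|h] := leqP (cyc (2 ^ b) (c j) (c' j)) 1.
    apply: le_trans (_ : (cyc (2 ^ b) (c j0) (c' j0))%:R / 2 ^+ b <= _).
      by rewrite ler_wpM2r ?invr_ge0 ?(ltW side0) // ler_nat ltnW.
    apply: le_trans (torus_dist1_lower (sc j0) (tc j0) j0P) _.
    by rewrite ler_pM2l.
  apply: le_trans (torus_dist1_lower (sc j) (tc j) h) _.
  by rewrite ler_pM2l.
have V0 := lt_le_trans Q0 V_lo.
rewrite kernelE gt_eqF //; set x := W / _.
have x0 : 0 < x by rewrite divr_gt0.
apply: (@le_trans _ _ (x `^ beta)).
  have [h|h] := leP x 1.
    by rewrite ge_min; apply/orP; left; apply: ger_powR => //; rewrite x0.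
  by rewrite ge_min; apply/orP; right; apply: pow1; exact: ltW.
have -> : cell_decay beta c c' = (Q^-1) `^ beta.
  by rewrite /cell_decay /decay prod_powR // -/Q -[Q^-1]powR_inv1 ?(ltW Q0) // -powRrM mulN1r.
have p2 (m : nat) : 2 `^ (beta * m%:R) = (2 ^+ m) `^ beta :> R.
  by rewrite -powR_mulrn // -powRrM mulrC.
rewrite !p2 -!powRM ?exprn_ge0 ?mulr_ge0 ?exprn_ge0 ?invr_ge0 ?(ltW Q0) //.
apply: ge0_ler_powR => //; rewrite ?nnegrE ?(ltW x0) ?mulr_ge0 ?exprn_ge0 ?invr_ge0 ?(ltW Q0) //.
apply: ler_pM; rewrite ?(ltW W0) ?invr_ge0 ?(ltW V0) //; first by rewrite -exprD.
by rewrite lef_pV2 ?posrE.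
Qed.

End KernelBounds.

Section Admissible.
Local Open Scope classical_set_scope.
Variables (R : realType) (d b k : nat) (th alpha beta lam : R).
Variables (c : 'I_k -> cellT d b) (l : 'I_k -> nat).

Definition link_low (s : nat) (i j : 'I_k) : R :=
  th * Num.min ((2 ^+ (l i + l j) / (lam * 2 ^+ (d * s.+1))) `^ alpha) 1.

(** Everything that the discrete argument uses about the edge probabilities, expressed by cells and
    classes alone. *)
Definition admissible (q : 'I_k -> 'I_k -> R) : Prop :=
  [/\ edge_prob q,
      forall i j, q i j <= 4 `^ beta * (2 `^ (beta * (l i)%:R) * 2 `^ (beta * (l j)%:R)) * cell_decay beta (c i) (c j) &
      forall i j s, same_box s (c i) (c j) -> link_low s i j <= q i j].

End Admissible.

Section DiscreteReduction.
Local Open Scope classical_set_scope.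
Variables (R : realType) (d n b M : nat) (alpha beta theta1 theta2 : R).
Variables (D : probability (measurableTypeR R) R) (S : rumour_space R d).
Variable p : vertex R d -> vertex R d -> R.
Hypothesis n_gt0 : (0 < n)%N.
Hypotheses (beta1 : 1 < beta) (beta_le : beta <= alpha).
Hypotheses (th1 : 0 < theta1) (th12 : theta1 <= theta2) (th2 : theta2 <= 1).
Hypothesis G : girg S alpha theta1 theta2 n D p.
Variable cg : R.
Hypothesis pp : push_pull S cg n.
Local Notation lam := (@cell_rate R d n b).
Hypothesis lam1 : 1 <= lam.
Local Notation C := (cellT d b).

Definition class_prob (l : 'I_M.+1) : R := class_law D (@class_set R M) l.

(* Only this inequality is needed of the law of the cells, and it survives
   truncating the number of vertices at K. *)
Definition sub_poisson (K : nat) (pi : forall k, {ffun 'I_k -> C} -> R) : Prop :=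
  (forall k c, 0 <= pi k c) /\
  forall psi : C -> nat -> R, (forall x m, 0 <= psi x m) ->
  \sum_(k < K) \sum_(c : {ffun 'I_k -> C}) pi k c * \prod_x psi x (cnt c x)
    <= \prod_x \sum_(m < K) pois lam m * psi x m.

Variables (T : nat) (Lr e1 e2 e3 : R).
Variable good : forall k, {ffun 'I_k -> C} -> {ffun 'I_k -> 'I_M.+1} -> bool.
Variable Gam : forall k, pred {ffun 'I_k * 'I_k -> bool}.
Hypothesis TL : T%:R <= Lr.
Hypothesis good_heavy : forall k (c : {ffun 'I_k -> C}) (l : {ffun 'I_k -> 'I_M.+1}), good c l -> forall i, (l i < M)%N.
Hypothesis goodP : forall K pi, sub_poisson K pi ->
  CE K pi class_prob (fun k c l => (~~ good c l)%:R) <= e1.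
Hypothesis GamP : forall k (c : {ffun 'I_k -> C}) (l : {ffun 'I_k -> 'I_M.+1}), good c l ->
  forall q, admissible theta1 alpha beta lam c (fun i => l i) q ->
  GE q (fun f => (~~ Gam f)%:R) <= e2.
Hypothesis winP : forall k (f : {ffun 'I_k * 'I_k -> bool}), Gam f ->
  exists2 K, is_giant cg n (adjf f) K & 1 - e3 <= win R T (adjf f) K.
Hypotheses (e21 : e2 <= 1) (e31 : e3 <= 1).

Lemma lamE : n%:R = lam * 2 ^+ (d * b).
Proof. by rewrite /cell_rate mulfVK // gt_eqF // exprn_gt0. Qed.

Lemma admissible_edge_probs k (c : {ffun 'I_k -> C}) (l : {ffun 'I_k -> 'I_M.+1}) w :
  (forall i, (l i < M)%N) -> @npts R d S w = k ->
  types_set (@cell_set R d b) (@class_set R M) c l (@marks R d S k w) ->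
  admissible theta1 alpha beta lam c (fun i => l i) (@edge_probs R d S p k w).
Proof.
case: G => _ _ [_ psym pb] _ lM ek tw.
have sc i : cell_set (c i) (@pos R d S i w) by have [] := tw i; rewrite tnth_mktuple.
have sl i : 2 ^+ l i <= @wt R d S i w < 2 ^+ (l i).+1.
  by have [_] := tw i; rewrite tnth_mktuple; apply: class_setP.
have w1 (i : 'I_k) : 1 <= @wt R d S i w.
  by case/andP: (sl i) => h _; apply: le_trans h; rewrite exprn_ege1 // ler1n.
have to (i : 'I_k) : torus (@pos R d S i w) by exact: cell_set_torus (sc i).
have th0 : 0 <= theta2 by apply: le_trans th12; exact: ltW.
have k0 s t : 0 <= @girg_kernel R alpha d n s t.
  by rewrite /girg_kernel; case: ifP => // _; rewrite le_min powR_ge0 ler01.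
have k1 s t : @girg_kernel R alpha d n s t <= 1.
  by rewrite /girg_kernel; case: ifP => // _; rewrite ge_min lexx orbT.
have bd (i j : 'I_k) := pb (@pos R d S i w, @wt R d S i w) (@pos R d S j w, @wt R d S j w)
  (to i) (to j) (w1 i) (w1 j).
split.
- split=> i j; first exact: psym.
  have /andP[h1 h2] := bd i j; apply/andP; split.
    by apply: le_trans h1; rewrite mulr_ge0 // ltW.
  apply: le_trans h2 _; rewrite -[X in _ <= X](mulr1 1); exact: ler_pM.
- move=> i j; have /andP[_ h2] := bd i j; apply: le_trans h2 _.
  apply: le_trans (_ : 1 * @girg_kernel R alpha d n (@pos R d S i w, @wt R d S i w) (@pos R d S j w, @wt R d S j w) <= _).
    by rewrite ler_wpM2r.
  rewrite mul1r; exact: (kernel_upper (s := (@pos R d S i w, @wt R d S i w)) (t := (@pos R d S j w, @wt R d S j w)) lamE lam1 beta1 beta_le (sc i) (sc j) (sl i) (sl j)).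
- move=> i j s cc; have /andP[h1 _] := bd i j; apply: le_trans h1.
  rewrite /link_low ler_wpM2l ?(ltW th1) //.
  exact: (kernel_lower (s := (@pos R d S i w, @wt R d S i w)) (t := (@pos R d S j w, @wt R d S j w)) lamE lam1 beta1 beta_le (sc i) (sc j) (sl i) (sl j) cc).
Qed.

Lemma transmitted_discrete (eta : R) : 0 < eta ->
  (1 - e3) * (1 - e2) * (1 - eta - e1) <= fP (@Pr R d S) (transmitted_within (S := S) cg n Lr).
Proof.
move=> eta0; case: (G) => poi iid [pm _ _] ind; case: pp => rvm uend uch.
have [K tailK] := tail_small (@Pr R d S) (proj1 rvm) eta0.
apply: (@transmitted_prob R d S n p D rvm pm ind iid C 'I_M.+1 (@cell_set R d b) (@class_set R M)
   _ _ _ _ _ _ _ cg T K Lr eta e1 e2 e3 good Gam) => //.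
- exact: measurable_cell_set.
- exact: measurable_class_set.
- exact: cell_set_inj.
- exact: class_set_inj.
- exact: cell_set_cover.
- exact: class_set_cover.
- exact: poi.1.
- apply: goodP; split; first by move=> k c; exact: cell_law_ge0.
  by move=> psi psi0; exact: poisson_cells.
- move=> k c l gcl w ek tw; have ad := admissible_edge_probs (good_heavy gcl) ek tw.
  by split; [case: ad|exact: GamP ad].
Qed.

End DiscreteReduction.

(** * Power-law weights and the choice of scales *)

Section PowerLaw.
Local Open Scope classical_set_scope.
Variables (R : realType) (tau : R) (D : probability (measurableTypeR R) R).
Hypothesis htau : 2 < tau.
Hypothesis hD : power_law tau D.
Local Notation mu := (@lebesgue_measure R).

Definition dyadic (l : nat) : set R := `[2 ^+ l, 2 ^+ l.+1[.
Definition dyadic_decay : R := 2 `^ (1 - tau).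
Local Notation v := dyadic_decay.

Let mdyadic l : measurable (dyadic l : set (measurableTypeR R)).
Proof. exact: (@measurable_itv R). Qed.

Let mray : measurable (`[1, +oo[%classic : set (measurableTypeR R)).
Proof. exact: (@measurable_itv R). Qed.

Lemma dyadic_length l : mu (dyadic l) = (2 ^+ l)%:E.
Proof.
rewrite /dyadic lebesgue_measure_itv /= lte_fin ltr_eXn2l ?ltr1n // ltnSn -EFinB exprS.
by congr EFin; ring.
Qed.

Lemma dyadic_ge1 l x : dyadic l x -> 1 <= x.
Proof.
by rewrite /dyadic /= in_itv /= => /andP[h _]; apply: le_trans h; rewrite exprn_ege1 // ler1n.
Qed.

Lemma dyadic_powR l x : dyadic l x -> (2 ^+ l.+1) `^ (- tau) <= x `^ (- tau) <= (2 ^+ l) `^ (- tau).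
Proof.
move=> dx; have x1 := dyadic_ge1 dx; move: dx; rewrite /dyadic /= in_itv /= => /andP[h1 h2].
have t0 : 0 <= tau by apply: le_trans (ltW htau).
have x0 : 0 < x by apply: lt_le_trans x1.
rewrite !powRN; apply/andP; split; rewrite lef_pV2 ?posrE ?powR_gt0 ?exprn_gt0 //.
  by apply: ge0_ler_powR => //; rewrite ?nnegrE ?exprn_ge0 // ltW.
by apply: ge0_ler_powR => //; rewrite ?nnegrE ?exprn_ge0 // ltW.
Qed.

Lemma decay_powR l : (2 ^+ l) `^ (- tau) * 2 ^+ l = v ^+ l.
Proof.
rewrite /dyadic_decay -[2 ^+ l](@powR_mulrn R) // -powRrM -powRD; last by rewrite pnatr_eq0 implybT.
by rewrite -powR_mulrn ?powR_ge0 // -powRrM; congr (_ `^ _); ring.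
Qed.

Lemma decay_powRS l : (2 ^+ l.+1) `^ (- tau) * 2 ^+ l = 2 `^ (- tau) * v ^+ l.
Proof. by rewrite -decay_powR mulrA exprS powRM ?exprn_ge0. Qed.

Lemma exp2_exceeds (A : R) : exists l0 : nat, forall l, (l0 <= l)%N -> A < 2 ^+ l.
Proof.
exists (Num.truncn A).+1 => l hl.
apply: lt_le_trans (_ : l%:R <= _); last by rewrite -natrX ler_nat ltnW // ltn_expl.
by case: l hl => // l hl; rewrite -truncn_le_nat.
Qed.

(** The density and the discrete case of [power_law] are merged here; these two-sided bounds with
    ratio 2^(1 - tau) are the only quantitative information on [D] used later. *)
Lemma dyadic_mass : exists c C l0, [/\ 0 < c, 0 < C &
  forall l, (l0 <= l)%N -> c * v ^+ l <= fP D (dyadic l) <= C * v ^+ l].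
Proof.
case: hD => [[f [mf f0 fT fD]]|[E1 fT]].
  move: fT; rewrite qualifE => /asboolP[[/= k1 k2] /andP[/= k10 k20]] [A [_ hA]].
  have [l0 hl0] := exp2_exceeds A.
  exists (k1 * 2 `^ (- tau)), k2, l0; split=> //; first by rewrite mulr_gt0 ?powR_gt0.
  move=> l /hl0 Al.
  have fx x : dyadic l x -> k1 * (2 ^+ l.+1) `^ (- tau) <= f x <= k2 * (2 ^+ l) `^ (- tau).
    move=> dx; have x1 := dyadic_ge1 dx; have /andP[p1 p2] := dyadic_powR dx.
    have Ax : A < x by move: dx; rewrite /dyadic /= in_itv /= => /andP[h _]; exact: lt_le_trans h.
    have [h1 h2] := hA x Ax; rewrite (ger0_norm (powR_ge0 _ _)) in h1 h2.
    rewrite (ger0_norm (f0 _ x1)) in h1 h2; apply/andP; split.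
      by apply: le_trans h1; rewrite ler_pM2l.
    by apply: le_trans h2 _; rewrite ler_pM2l.
  have DE : D (dyadic l) = (\int[mu]_(x in dyadic l) (f x)%:E)%E.
    rewrite fD //; congr (integral _ _ _); apply/setIidPl => x /dyadic_ge1.
    by rewrite /= in_itv /= => ->.
  have cst0 k : (\int[mu]_(x in dyadic l) (cst k%:E x))%E = (k * 2 ^+ l)%:E.
    by rewrite integral_cst // EFinM; congr (_ * _)%E; exact: dyadic_length.
  have mfE : measurable_fun (dyadic l) (EFin \o f).
    by apply/measurable_realfun.measurable_EFinP; exact: measurable_funTS.
  have nn k x : 0 < k -> dyadic l x -> (0 <= (k * x `^ (- tau))%:E)%E.
    by move=> k0 _; rewrite lee_fin mulr_ge0 ?powR_ge0 // ltW.
  apply/andP; split; rewrite -lee_fin fPE // DE.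
    rewrite -mulrA -decay_powRS mulrA -cst0; apply: ge0_le_integral => //.
    - by move=> x _; rewrite lee_fin mulr_ge0 ?powR_ge0 // ltW.
    - by move=> x dx; rewrite lee_fin; case/andP: (fx x dx).
  rewrite -decay_powR mulrA -cst0; apply: ge0_le_integral => //.
  - by move=> x dx; rewrite lee_fin; apply: f0; exact: dyadic_ge1 dx.
  - by move=> x dx; rewrite lee_fin; case/andP: (fx x dx).
move: fT; rewrite qualifE => /asboolP[[/= k1 k2] /andP[/= k10 k20]] [N _ hN].
exists (k1 * 2 `^ (- tau)), k2, N; split=> //; first by rewrite mulr_gt0 ?powR_gt0.
move=> l Nl.
set E := [set x | exists2 k : nat, _ & _] in E1.
have mE : measurable (E : set (measurableTypeR R)).
  rewrite (_ : E = \bigcup_k (if (0 < k)%N then [set k%:R] else set0)).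
    by apply: bigcup_measurable => k _; case: ifP.
  apply/seteqP; split=> x; first by move=> [k k0 ->]; exists k => //; rewrite k0.
  by move=> [k _]; case: ifP => // k0 ->; exists k.
have E0 : fP D (~` E) = 0 by rewrite /fP probability_setC // E1 subee.
(* The interval meets the support in 2^l integers; the complement of [E] is added as one more piece,
   of mass zero. *)
have DE : fP D (dyadic l) = \sum_(i < 2 ^ l) fP D [set (2 ^ l + i)%:R].
  pose A (i : 'I_(2 ^ l)) : set (measurableTypeR R) := [set (2 ^ l + i)%:R].
  have mA i : measurable (A i) by exact: measurable_set1.
  have dA i j w : A i w -> A j w -> i = j.
    by move=> /= -> /eqP; rewrite eqr_nat eqn_add2l => /eqP/val_inj.
  apply/eqP; rewrite eq_le; apply/andP; split; last first.
    apply: (fP_sum_le D (Q := predT) (A := A)) => //; first by move=> i j w _ _; exact: dA.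
    move=> i _ x /= ->; rewrite /dyadic /= in_itv /= -!natrX ler_nat ltr_nat leq_addr /=.
    by rewrite expnS mul2n -addnn ltn_add2l.
  have -> : \sum_(i < 2 ^ l) fP D [set (2 ^ l + i)%:R] =
     \sum_(i : 'I_(2 ^ l) + unit) fP D (if i is inl j then A j else ~` E).
    by rewrite big_sumType /= [X in _ = _ + X]big_const card_unit /= E0 !addr0.
  pose B (i : 'I_(2 ^ l) + unit) : set (measurableTypeR R) := if i is inl j then A j else ~` E.
  have mB i : measurable (B i) by case: i => [i|u]; [exact: mA|exact: measurableC].
  have AE i x : A i x -> E x by move=> ->; exists (2 ^ l + i)%N => //; rewrite addn_gt0 expn_gt0.
  rewrite -[leRHS]/(\sum_(i : 'I_(2 ^ l) + unit | predT i) fP D (B i)) (fP_sum D (Q := predT) (A := B)) //.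
    apply: fP_le => //; first exact: (measurable_finite_union (Q := predT)).
    move=> x dx; have [Ex|nE] := pselect (E x); last by exists (inr tt).
    case: Ex dx => k k0 ->; rewrite /dyadic /= in_itv /= -!natrX ler_nat ltr_nat => /andP[h1 h2].
    have lt : (k - 2 ^ l < 2 ^ l)%N by rewrite ltn_subLR // addnn -mul2n -expnS.
    by exists (inl (Ordinal lt)) => //=; rewrite /A /= subnKC.
  move=> [i|[]] [j|[]] w _ _ //=; first by move=> Ai Aj; rewrite (dA i j w).
    by move=> /AE.
  by move=> nE /AE.
have bnd (i : 'I_(2 ^ l)) : k1 * (2 ^+ l.+1) `^ (- tau) <= fP D [set (2 ^ l + i)%:R] <= k2 * (2 ^+ l) `^ (- tau).
  have dx : dyadic l (2 ^ l + i)%:R.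
    rewrite /dyadic /= in_itv /= -!natrX ler_nat ltr_nat leq_addr /=.
    by rewrite expnS mul2n -addnn ltn_add2l.
  have Ni : (N <= 2 ^ l + i)%N.
    by apply: leq_trans (leq_addr _ _); apply: leq_trans Nl _; exact/ltnW/ltn_expl.
  have [h1 h2] := hN _ Ni; have /andP[p1 p2] := dyadic_powR dx.
  rewrite (ger0_norm (powR_ge0 _ _)) in h1 h2.
  rewrite (ger0_norm (fP_ge0 _ _)) in h1 h2; apply/andP; split.
    by apply: le_trans h1; rewrite ler_pM2l.
  by apply: le_trans h2 _; rewrite ler_pM2l.
have cst_sum (x : R) : x * 2 ^+ l = \sum_(i < 2 ^ l) x.
  by rewrite sumr_const card_ord -[RHS]mulr_natr natrX.
rewrite DE; apply/andP; split.
  rewrite -mulrA -decay_powRS mulrA cst_sum.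
  by apply: ler_sum => i _; case/andP: (bnd i).
rewrite -decay_powR mulrA cst_sum.
by apply: ler_sum => i _; case/andP: (bnd i).
Qed.

Lemma ray_mass : fP D `[1, +oo[ = 1.
Proof.
case: hD => [[f [mf f0 fT fD]]|[E1 fT]].
  have : D (~` `[1, +oo[) = 0%E.
    by rewrite fD ?setICl ?integral_set0 //; exact: measurableC.
  rewrite probability_setC // => h; apply: EFin_inj; rewrite fPE //.
  by move/eqP: h; rewrite -(fPE D mray) -EFinB eqe subr_eq0 => /eqP <-.
apply/eqP; rewrite eq_le fP_le1 //=.
set E := [set x | exists2 k : nat, _ & _] in E1.
have mE : measurable (E : set (measurableTypeR R)).
  rewrite (_ : E = \bigcup_k (if (0 < k)%N then [set k%:R] else set0)).
    by apply: bigcup_measurable => k _; case: ifP.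
  apply/seteqP; split=> x; first by move=> [k k0 ->]; exists k => //; rewrite k0.
  by move=> [k _]; case: ifP => // k0 ->; exists k.
have fE : fP D E = 1 by rewrite /fP E1.
rewrite -[X in X <= _]fE.
apply: fP_le => // x [k k0 ->]; by rewrite /= in_itv /= andbT ler1n.
Qed.

Lemma heavy_tail (eta : R) : 0 < eta -> exists M0, forall M, (M0 <= M)%N ->
  fP D (~` `[1, 2 ^+ M[) <= eta.
Proof.
move=> eta0; pose F M : set (measurableTypeR R) := `[1, 2 ^+ M[.
have mF M : measurable (F M) by exact: (@measurable_itv R).
have : D (F M) @[M --> \oo] --> D (\bigcup_M F M).
  apply: nondecreasing_cvg_mu => //; first exact: bigcup_measurable.
  move=> i j ij; apply/subsetPset => x; rewrite /F /= !in_itv /= => /andP[-> h] /=.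
  by apply: lt_le_trans h _; rewrite ler_weXn2l // ler1n.
have -> : \bigcup_M F M = `[1, +oo[.
  apply/seteqP; split=> x; first by move=> [M _]; rewrite /F /= !in_itv /= andbT => /andP[].
  rewrite /= in_itv /= andbT => x1; have [l0 hl] := exp2_exceeds x.
  by exists l0 => //; rewrite /F /= in_itv /= x1 hl.
move=> cv; have {}cv : fP D (F M) @[M --> \oo] --> (1 : R).
  by rewrite -ray_mass; apply: fine_cvg; rewrite fineK ?fin_num_measure //; exact: cv.
have [M0 _ hM] := @cvgr_ge R _ _ _ _ _ cv (1 - eta) (ltac:(lra)).
exists M0 => M /hM h; rewrite /fP probability_setC; last exact: mF.
have -> : (1 - D `[1%R, (2 ^+ M)%R[)%E = (1 - fP D (F M))%:E by rewrite EFinB fPE.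
by rewrite /=; move: h => /=; lra.
Qed.

End PowerLaw.

(** * Elementary growth estimates *)

Section Growth.
Variable R : realType.
Implicit Types (c E x eps : R).

(** Bernoulli's inequality for the square root of [E], then squared. A quadratic lower bound already
    makes exp(-c E^i) beat every 2^(B i). *)
Lemma exp_quadratic E : 1 < E -> exists2 dl : R, 0 < dl & forall i : nat, dl * i%:R ^+ 2 <= E ^+ i.
Proof.
move=> E1; pose r := Num.sqrt E; have r1 : 1 < r by rewrite /r -sqrtr1 ltr_sqrt //; lra.
exists ((r - 1) ^+ 2); first by rewrite exprn_gt0 // subr_gt0.
move=> i; have -> : E ^+ i = (r ^+ i) ^+ 2 by rewrite -exprM mulnC exprM sqr_sqrtr //; lra.
rewrite -exprMn lerXn2r ?nnegrE ?mulr_ge0 ?exprn_ge0 //; try lra.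
have bern : 1 + i%:R * (r - 1) <= r ^+ i.
  elim: i => [|i IH]; first by rewrite mul0r addr0 expr0.
  have ri : 0 <= i%:R * (r - 1) by rewrite mulr_ge0 //; lra.
  rewrite exprS -natr1; have := ler_wpM2l (_ : 0 <= r) IH; nra.
by rewrite mulrC; lra.
Qed.

Lemma nat_above x : exists i1 : nat, forall i, (i1 <= i)%N -> x <= i%:R.
Proof.
exists (Num.truncn x).+1 => i hi; apply: (@le_trans _ _ (Num.truncn x).+1%:R); last by rewrite ler_nat.
by apply: ltW; rewrite -truncn_le_nat.
Qed.

Lemma superpoly c E (B : nat) eps : 0 < c -> 1 < E -> 0 < eps ->
  exists i1 : nat, forall i, (i1 <= i)%N -> expR (- (c * E ^+ i)) * 2 ^+ (B * i) <= eps.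
Proof.
move=> c0 E1 eps0; have [dl dl0 dlP] := exp_quadratic E1.
pose K := `|ln eps|.
have [i1 h1] := nat_above ((B%:R + K) / (c * dl)).
have [i2 h2] := nat_above 1.
exists (maxn i1 i2) => i; rewrite geq_max => /andP[/h1 g1 /h2 g2].
have two : 2 ^+ (B * i) <= expR (B * i)%:R :> R.
  have -> : expR (B * i)%:R = expR 1 ^+ (B * i) :> R by rewrite -expRM_natl mulr1.
  rewrite lerXn2r ?nnegrE ?expR_ge0 //.
  by have := expR_ge1Dx (1 : R); lra.
apply: le_trans (ler_wpM2l (expR_ge0 _) two) _.
rewrite -expRD -[leRHS](lnK (_ : eps \in Num.pos)) ?posrE // ler_expR.
have h3 : (B%:R + K) * i%:R <= c * E ^+ i.
  move: g1; rewrite ler_pdivrMr ?mulr_gt0 // => g1.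
  have := ler_wpM2l (ltW c0) (dlP i).
  have i0 : 0 <= i%:R :> R by [].
  have := ler_wpM2r i0 g1; rewrite expr2; lra.
have K0 : 0 <= K by exact: normr_ge0.
have Kl : - K <= ln eps by have := ler_norm (- ln eps); rewrite normrN -/K; lra.
rewrite natrM.
have := ler_wpM2l K0 g2; lra.
Qed.

Lemma geometric_tail x (i1 b : nat) : 0 < x < 1 ->
  \sum_(i < b | (i1 <= i)%N) x ^+ i <= x ^+ i1 / (1 - x).
Proof.
move=> /andP[x0 x1]; have y0 : 0 < 1 - x by lra.
elim: b => [|b IH]; first by rewrite big_ord0 divr_ge0 ?exprn_ge0 // ltW.
have key : forall n, \sum_(i < n) x ^+ i <= (1 - x)^-1.
  move=> n; rewrite -[leRHS]mul1r ler_pdivlMr // mulrC.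
  have := subrX1 x n; have := exprn_ge0 n (ltW x0); lra.
rewrite -(big_mkord (fun i => (i1 <= i)%N) (fun i => x ^+ i)).
have [h|h] := leqP b.+1 i1.
  rewrite big_nat_cond big_pred0 ?divr_ge0 ?exprn_ge0 // ?(ltW y0) ?(ltW x0) // => i; lia.
rewrite (@big_cat_nat _ _ _ i1) //= 1?ltnW //.
rewrite big_nat_cond big_pred0 ?add0r; last by move=> i; lia.
rewrite -{1}[i1]add0n big_addn big_mkord.
rewrite (eq_bigl predT); last by move=> i; rewrite /= leq_addl.
under eq_bigr do rewrite addnC exprD.
by rewrite -mulr_sumr ler_wpM2l ?exprn_ge0 // ltW.
Qed.

Lemma geometric_small x C eps : 0 < x < 1 -> 0 < eps ->
  exists i1 : nat, forall i, (i1 <= i)%N -> C * x ^+ i <= eps.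
Proof.
move=> /andP[x0 x1] eps0.
have E1 : 1 < x^-1 by rewrite invf_gt1.
have [dl dl0 dlP] := exp_quadratic E1.
have [i1 h1] := nat_above (`|C| / (eps * dl)).
have [i2 h2] := nat_above 1.
exists (maxn i1 i2) => i; rewrite geq_max => /andP[/h1 g1 /h2 g2].
apply: le_trans (ler_wpM2r (exprn_ge0 i (ltW x0)) (ler_norm C)) _.
rewrite -ler_pdivlMr ?exprn_gt0 // -exprVn.
apply: le_trans (ler_wpM2l (ltW eps0) (dlP i)).
move: g1; rewrite ler_pdivrMr ?mulr_gt0 // => g1.
have ii : i%:R <= i%:R ^+ 2 :> R by rewrite expr2 ler_peMl.
have := ler_wpM2l (ltW (mulr_gt0 eps0 dl0)) ii; lra.
Qed.

End Growth.

(** * Exponents of the hub construction *)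

Section Scales.
Variables (R : realType) (d : nat) (tau alpha gam eta th : R).
Hypothesis d_gt0 : (0 < d)%N.
Hypotheses (tau2 : 2 < tau) (alpha1 : 1 < alpha) (gam1 : 1 < gam) (eta0 : 0 < eta) (th0 : 0 < th).
Hypothesis etaP : eta * (12 * (tau - 1) + 1 + alpha * gam) < 1 - alpha * gam * (tau - 2).

Definition sigma : R := (1 - eta) / (tau - 1).
Definition hub_class (i : nat) : nat := Num.truncn (d%:R * sigma * i%:R).
Definition sub_scale (i : nat) : nat := Num.truncn (sigma * i%:R).
Definition up_scale (i : nat) : nat := Num.truncn (gam * i%:R).
Definition next_scale (b i : nat) : nat := minn b (up_scale i).

Let dR : 1 <= d%:R :> R. Proof. by rewrite ler1n. Qed.
Local Ltac slra := move: tau2 alpha1 gam1 eta0 => *; lra.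
Let ag0 : 0 < alpha * gam. Proof. by rewrite mulr_gt0 //; slra. Qed.

Lemma eta_lt1 : eta < 1.
Proof. have h1 := tau2; have h2 := etaP; have h3 := eta0.
have h4 : 0 <= alpha * gam * (tau - 2) by rewrite mulr_ge0 ?(ltW ag0) //; lra.
have h5 : 0 <= eta * (12 * (tau - 1) + alpha * gam) by rewrite mulr_ge0 ?(ltW h3) // addr_ge0 ?(ltW ag0) //; lra.
lra. Qed.

Lemma sigma_gt0 : 0 < sigma.
Proof. by rewrite /sigma divr_gt0 //; have := eta_lt1; slra. Qed.

Lemma sigma_lt1 : sigma < 1.
Proof. by rewrite /sigma ltr_pdivrMr; slra. Qed.

Lemma sigma_tau : sigma * (tau - 1) = 1 - eta.
Proof. by rewrite /sigma mulfVK // gt_eqF //; slra. Qed.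

(* Two hubs at scales i and gam * i have about 2^(e6 * i) common neighbours in
   the sub-box of the lower one. *)
Definition e6 : R := d%:R * (sigma - alpha * gam * (1 - sigma)).

(** A two-round hop loses the square of the degree cap, that is [load_base] to the power 4i, or 2^(8
    d eta i); the constant 12 leaves room beyond 8. *)
Lemma e6_large : 12 * (d%:R * eta) < e6.
Proof.
have h := sigma_tau; have t1 : 0 < tau - 1 by slra.
have key : 12 * eta < sigma - alpha * gam * (1 - sigma).
  rewrite -(ltr_pM2r t1).
  have -> : (sigma - alpha * gam * (1 - sigma)) * (tau - 1) =
    sigma * (tau - 1) - alpha * gam * ((tau - 1) - sigma * (tau - 1)) by ring.
  rewrite h; have := etaP; lra.
by rewrite /e6 mulrCA ltr_pM2l // (lt_le_trans ltr01 dR).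
Qed.

Lemma sub_scale_bounds i : sigma * i%:R - 1 <= (sub_scale i)%:R <= sigma * i%:R.
Proof.
have s0 : 0 <= sigma * i%:R by rewrite mulr_ge0 // ltW // sigma_gt0.
apply/andP; split; last by rewrite -truncn_ge_nat // leqnn.
rewrite lerBlDr natr1; apply: ltW; by rewrite -truncn_le_nat.
Qed.

Lemma hub_class_bounds i : d%:R * sigma * i%:R - 1 <= (hub_class i)%:R <= d%:R * sigma * i%:R.
Proof.
have s0 : 0 <= d%:R * sigma * i%:R by apply: mulr_ge0 => //; apply: mulr_ge0 => //; exact/ltW/sigma_gt0.
apply/andP; split; last by rewrite -truncn_ge_nat // leqnn.
rewrite lerBlDr natr1; apply: ltW; by rewrite -truncn_le_nat.
Qed.

Lemma hub_class_le i : (hub_class i <= d * i)%N.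
Proof.
rewrite -(ler_nat R) natrM; have /andP[_ h] := hub_class_bounds i; apply: le_trans h _.
by rewrite ler_wpM2r // ler_piMr // ltW // sigma_lt1.
Qed.

Lemma sub_scale_le i : (sub_scale i <= i)%N.
Proof.
rewrite -(ler_nat R); have /andP[_ h] := sub_scale_bounds i; apply: le_trans h _.
by rewrite ler_piMl // ltW // sigma_lt1.
Qed.

Lemma up_scale_bounds i : gam * i%:R - 1 <= (up_scale i)%:R <= gam * i%:R.
Proof.
have s0 : 0 <= gam * i%:R by rewrite mulr_ge0 //; slra.
apply/andP; split; last by rewrite -truncn_ge_nat // leqnn.
rewrite lerBlDr natr1; apply: ltW; by rewrite -truncn_le_nat.
Qed.

Lemma up_scale_ge i : (i <= up_scale i)%N.
Proof. by rewrite truncn_ge_nat ?ler_peMl ?mulr_ge0 //; slra. Qed.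

Lemma next_scale_ge b i : (i < b)%N -> (i <= next_scale b i)%N.
Proof. by move=> ib; rewrite leq_min (ltnW ib) up_scale_ge. Qed.

Lemma next_scale_le b i : (next_scale b i <= b)%N.
Proof. exact: geq_minl. Qed.

Lemma next_scale_gam b i : (next_scale b i)%:R <= gam * i%:R.
Proof.
have /andP[_ h] := up_scale_bounds i; apply: le_trans h.
by rewrite ler_nat geq_minr.
Qed.

(** Lower bound for the link to a hub of scale j inside a box of scale at most sigma j + t. The
    excess 2 d + 1 collects [lam <= 2 ^+ d], the factor 2 between radius and side in d dimensions,
    and the rounding of the hub class. *)
Definition hlink (t : R) : R := th * 2 `^ (- (alpha * (2 * d%:R + 1 + d%:R * t))).

Lemma hlink_gt0 t : 0 < hlink t.
Proof. by rewrite mulr_gt0 // powR_gt0. Qed.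

Lemma hlinkD t : hlink t = hlink 0 * 2 `^ (- (alpha * d%:R * t)).
Proof.
rewrite /hlink -mulrA -powRD; last by rewrite pnatr_eq0 implybT.
by congr (_ * _ `^ _); ring.
Qed.

Lemma pow2_powR (k : nat) : 2 ^+ k = 2 `^ k%:R :> R.
Proof. by rewrite powR_mulrn. Qed.

Lemma pow2_le (x y : R) : x <= y -> 2 `^ x <= 2 `^ y :> R.
Proof. by move=> xy; rewrite ler_powR // ler1n. Qed.

Lemma hlink_le (lam t : R) (ly s j : nat) : 0 < lam -> lam <= 2 ^+ d -> 0 <= t ->
  s%:R <= sigma * j%:R + t ->
  hlink t <= th * Num.min ((2 ^+ (ly + hub_class j) / (lam * 2 ^+ (d * s.+1))) `^ alpha) 1.
Proof.
move=> lam0 lamd t0 st; rewrite /hlink ler_pM2l // le_min; apply/andP; split; last first.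
  rewrite -[leRHS](powRr0 2) pow2_le // oppr_le0 mulr_ge0 ?addr_ge0 ?mulr_ge0 //; slra.
rewrite [alpha * _]mulrC -mulNr powRrM.
apply: ge0_ler_powR; rewrite ?nnegrE ?powR_ge0 //; first by slra.
  by rewrite divr_ge0 ?exprn_ge0 // mulr_ge0 ?exprn_ge0 // ltW.
rewrite ler_pdivlMr ?mulr_gt0 ?exprn_gt0 //.
apply: (@le_trans _ _ (2 `^ (- (2 * d%:R + 1 + d%:R * t)) * (2 ^+ d * 2 ^+ (d * s.+1)))).
  by rewrite ler_wpM2l ?powR_ge0 // ler_wpM2r ?exprn_ge0.
rewrite !pow2_powR -!powRD ?pnatr_eq0 ?implybT //.
apply: pow2_le; rewrite natrD natrM.
have /andP[h _] := hub_class_bounds j.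
have h1 := ler_wpM2l (ler0n R d) st; have h2 : 0 <= ly%:R :> R by [].
rewrite -natr1; lra.
Qed.

(** The factor 2^(-d) absorbs the rounding of the sub-box scale, and 128 is 4 * 8 * 2 * 2: the
    factor 4 demanded by [mP], an eighth of the sub-box as candidates, and two halved edge
    probabilities. *)
Definition cm : R := 2 `^ (- d%:R) * hlink 0 ^+ 2 / 128.
Definition min_connectors (i : nat) : R := cm * (2 `^ e6) ^+ i.
Definition load_base : R := 2 `^ (2 * (d%:R * eta)).
(* The factor load_base^i exceeds the typical load; it makes the failure
   probabilities summable over the scales. *)
Definition load_bound (i : nat) : R := (2 ^ (d * sub_scale i))%:R * load_base ^+ i.
(** One more factor [load_base ^+ i] makes the Markov ratio [load_bound i / load_bound2 i] geometric
    in [i]. *)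
Definition load_bound2 (i : nat) : R := (2 ^ (d * sub_scale i))%:R * load_base ^+ (2 * i).
Definition max_degree (i : nat) : nat := (Num.truncn (16 * load_base ^+ (2 * i))).+1.

Lemma min_connectors_gt0 i : 0 < min_connectors i.
Proof. by rewrite /min_connectors /cm !mulr_gt0 ?exprn_gt0 ?powR_gt0 ?invr_gt0 // hlink_gt0. Qed.

Lemma load_base_gt1 : 1 < load_base.
Proof.
rewrite /load_base /powR pnatr_eq0 /= -[ltLHS]expR0 ltr_expR !mulr_gt0 // ?ln_gt0 ?ltr1n ?ltr0n //.
Qed.

Lemma sub_box_large i : 2 `^ (d%:R * sigma * i%:R - d%:R) <= (2 ^ (d * sub_scale i))%:R :> R.
Proof.
rewrite natrX pow2_powR; apply: pow2_le; rewrite natrM.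
have /andP[h _] := sub_scale_bounds i.
have := ler_wpM2l (ler0n R d) h; lra.
Qed.

(** With X the size of the sub-box, the cap [max_degree] discards at most X/16 vertices, and X/8 +
    X/16 fits below X/4 - 2 precisely when X is at least 32. *)
Lemma connectors_budget i : (32 <= 2 ^ (d * sub_scale i))%N ->
  (2 ^ (d * sub_scale i))%:R / 8 + load_bound2 i / (max_degree i)%:R <=
  (2 ^ (d * sub_scale i))%:R / 4 - 2 :> R.
Proof.
rewrite -(ler_nat R) /load_bound2; set X := (2 ^ _)%:R : R => X32.
have m0 : 0 < (max_degree i)%:R :> R by rewrite ltr0n.
have : X * load_base ^+ (2 * i) / (max_degree i)%:R <= X / 16.
  rewrite ler_pdivrMr // mulrAC -mulrA ler_wpM2l //.
  rewrite ler_pdivlMr // mulrC; apply: ltW.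
  by rewrite /max_degree -truncn_le_nat.
lra.
Qed.

Lemma connectors_product i :
  4 * min_connectors i <= (2 ^ (d * sub_scale i))%:R / 8 * (hlink 0 / 2) * (hlink ((1 - sigma) * gam * i%:R) / 2).
Proof.
have h := sub_box_large i.
pose x : R := d%:R * sigma * i%:R - d%:R; rewrite -/x in h.
rewrite [hlink (_ * _ * _)]hlinkD /min_connectors /cm.
have -> : (2 `^ e6) ^+ i = 2 `^ (e6 * i%:R) :> R by rewrite -powR_mulrn ?powR_ge0 // -powRrM.
have -> : e6 * i%:R = x + d%:R + - (alpha * d%:R * ((1 - sigma) * gam * i%:R)).
  by rewrite /e6 /x; ring.
clearbody x.
rewrite !powRD ?pnatr_eq0 ?implybT //.
set X := 2 `^ x in h *; set Y := 2 `^ (- (alpha * _ * _)).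
have -> : 2 `^ (- d%:R) = (2 `^ d%:R)^-1 :> R by rewrite powRN.
have p0 : 2 `^ d%:R != 0 :> R by rewrite gt_eqF // powR_gt0.
set p := 2 `^ d%:R in p0 *; set H := hlink 0.
have -> : 4 * (p^-1 * H ^+ 2 / 128 * (X * p * Y)) = X / 8 * (H / 2) * (H * Y / 2) by field.
have Y0 : 0 <= Y by exact: powR_ge0.
have H0 : 0 <= H by exact/ltW/hlink_gt0.
have HY : 0 <= H * Y / 2 by rewrite divr_ge0 // mulr_ge0.
have H2 : 0 <= H / 2 by rewrite divr_ge0.
by apply: ler_wpM2r => //; apply: ler_wpM2r => //; rewrite ler_pM2r.
Qed.

End Scales.

Section Split.
Variables (R : realType) (k : nat) (q : 'I_k -> 'I_k -> R) (hbf : 'I_k -> 'I_k) (dl : R).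
Hypothesis qp : edge_prob q.
Hypotheses (dl0 : 0 < dl) (dl_half : dl <= 2^-1).
Hypothesis hub_big : forall y v, y != v -> hub_edges hbf (ed y v) -> 2 * dl <= q y v.

(* The edge probability that, combined with an independent sprinkling of
   probability dl, gives back q. *)
Definition unsprinkled (y v : 'I_k) : R :=
  if hub_edges hbf (ed y v) then (q y v - dl) / (1 - dl) else q y v.

Let dl1 : 0 < 1 - dl. Proof. by have := dl_half; lra. Qed.

Lemma hub_edges_neq y v : hub_edges hbf (ed y v) -> y != v.
Proof.
case/existsP => x /andP[nx /eqP e]; apply/eqP => yv; subst v.
by case/eqP: nx; case: (ed_inj e) => -[<- <-].
Qed.

Lemma unsprinkled_bounds y v : q y v / 2 <= unsprinkled y v <= q y v.
Proof.
have /andP[q0 q1] := qp.2 y v; rewrite /unsprinkled; case: ifP => h.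
  have b := hub_big (hub_edges_neq h) h; have d0 := dl0; have dh := dl_half.
  rewrite ler_pdivlMr // ler_pdivrMr //; apply/andP; split; nra.
by apply/andP; split; lra.
Qed.

Lemma unsprinkled_edge_prob : edge_prob unsprinkled.
Proof.
split=> y v.
  by rewrite /unsprinkled edC qp.1.
have /andP[h1 h2] := unsprinkled_bounds y v; have /andP[q0 q1] := qp.2 y v.
by apply/andP; split; lra.
Qed.

Lemma unsprinkled_split y v : y != v ->
  1 - q y v = (1 - unsprinkled y v) * (if hub_edges hbf (ed y v) then 1 - dl else 1).
Proof.
move=> _; rewrite /unsprinkled; case: ifP => h; last by rewrite mulr1.
by field; rewrite gt_eqF.
Qed.

End Split.

Section Steps.
Variables (R : realType) (d : nat) (tau alpha beta gam eta th : R).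
Hypothesis d_gt0 : (0 < d)%N.
Hypotheses (tau2 : 2 < tau) (alpha1 : 1 < alpha) (gam1 : 1 < gam) (eta0 : 0 < eta) (th0 : 0 < th) (th1 : th <= 1).
Hypothesis etaP : eta * (12 * (tau - 1) + 1 + alpha * gam) < 1 - alpha * gam * (tau - 2).
Hypothesis beta1 : 1 < beta.
Variables (b M k : nat) (lam : R) (cc : {ffun 'I_k -> cellT d b}) (l : {ffun 'I_k -> 'I_M.+1}).
Hypotheses (lam1 : 1 <= lam) (lamd : lam <= 2 ^+ d).
Hypothesis heavy : forall i, (l i < M)%N.
Variable q : 'I_k -> 'I_k -> R.
Hypothesis adm : admissible th alpha beta lam cc (fun i => l i) q.
Variables (i0 J L : nat).
Hypothesis i0P : forall i, (i0 <= i)%N -> (32 <= 2 ^ (d * sub_scale tau eta i))%N.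

Local Notation a := (hub_class d tau eta).
Local Notation z := (sub_scale tau eta).
Local Notation nx := (next_scale gam b).
Local Notation m := (min_connectors d tau alpha gam eta th).
Local Notation Dl := (max_degree d eta).
Local Notation Mc := (load_bound d tau eta).
Local Notation Mg := (load_bound2 d tau eta).

Definition weight1 (j : 'I_M.+1) : R := if (j < M)%N then 2 `^ (beta * (nat_of_ord j)%:R) else 1.

Lemma weight1_ge1 j : 1 <= weight1 j.
Proof.
rewrite /weight1; case: ifP => // _; rewrite -[leLHS](powRr0 2) ler_powR ?ler1n // mulr_ge0 //.
exact: le_trans (ltW beta1).
Qed.

Local Notation Kf := (kernel i0 (4 `^ beta) beta weight1 cc l).

Lemma kernel_dominates y v : q y v + (vbox cc i0 y v)%:R <= Kf y v.
Proof.
case: adm => _ up _; rewrite /kernel /ker mulrDr.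
have W1 := weight1_ge1 (l y); have W2 := weight1_ge1 (l v).
apply: lerD.
  apply: le_trans (up y v) _; rewrite /weight1 !heavy.
  by rewrite le_eqVlt; apply/orP; left; apply/eqP; ring.
rewrite -[leLHS]mul1r; apply: ler_pM => //.
rewrite -[leLHS]mulr1; exact: ler_pM.
Qed.

(** The link is to any vertex of the [i0]-box, not just of the sub-box, hence the argument (1 -
    sigma) i0. The factor 1/2 leaves at least as much edge probability unsprinkled. *)
Definition hub_prob : R := hlink d alpha th ((1 - sigma tau eta) * i0%:R) / 2.

Lemma hub_prob_gt0 : 0 < hub_prob.
Proof. by rewrite divr_gt0 // hlink_gt0. Qed.

Lemma link_hub s j y h t : y != h -> same_box s (cc y) (cc h) -> (l h : nat) = a j -> 0 <= t ->
  s%:R <= sigma tau eta * j%:R + t -> hlink d alpha th t <= q y h.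
Proof.
move=> yh yhs lh t0 st; case: adm => _ _ low; apply: le_trans (low y h s yhs).
rewrite /link_low lh; apply: (@hlink_le _ d tau alpha gam eta th) => //.
exact: lt_le_trans ltr01 lam1.
Qed.

Let sig1 : 0 <= 1 - sigma tau eta.
Proof. by rewrite subr_ge0 ltW //; apply: (@sigma_lt1 _ tau alpha gam eta). Qed.

Lemma hub_prob_half : hub_prob <= 2^-1.
Proof.
rewrite /hub_prob ler_pdivrMr // mulVf ?pnatr_eq0 //.
rewrite /hlink -[leRHS]mulr1; apply: ler_pM => //; first exact: ltW.
rewrite -[leRHS](powRr0 2) ler_powR ?ler1n // oppr_le0 mulr_ge0 ?addr_ge0 ?mulr_ge0 //.
exact: le_trans (ltW alpha1).
Qed.

Lemma hub_edge_big y v : y != v -> hub_edges (hb cc (classes l) a i0) (ed y v) -> 2 * hub_prob <= q y v.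
Proof.
move=> yv /existsP[x /andP[nx /eqP e]].
have key : 2 * hub_prob <= q x (hb cc (classes l) a i0 x).
  rewrite /hub_prob mulrC divfK //.
  apply: (@link_hub i0 i0) => //.
  - by rewrite same_box_sym hb_vbox.
  - move: nx; rewrite /hb; case eh: (hub cc (classes l) a i0 (cc x)) => [h|] /=; last by rewrite eqxx.
    by move=> _; have [_] := hubP eh.
  - by rewrite mulr_ge0.
  - by rewrite mulrBl mul1r addrC subrK.
case: adm => -[qs _] _ _; case: (ed_inj e) => -[-> ->] //; by rewrite qs.
Qed.

Local Notation qg := (unsprinkled q (hb cc (classes l) a i0) hub_prob).

Let qp : edge_prob q. Proof. by case: adm. Qed.

Lemma qg_bounds y v : q y v / 2 <= qg y v <= q y v.
Proof. exact: unsprinkled_bounds qp hub_prob_gt0 hub_prob_half hub_edge_big y v. Qed.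

Lemma qg_edge_prob : edge_prob qg.
Proof. exact: unsprinkled_edge_prob qp hub_prob_gt0 hub_prob_half hub_edge_big. Qed.

Lemma qg_kernel y v : y != v -> qg y v + (vbox cc i0 y v)%:R <= Kf y v.
Proof.
move=> _; apply: le_trans (kernel_dominates y v); rewrite lerD2r.
by have /andP[] := qg_bounds y v.
Qed.

Lemma qg_step_prob i c : (i0 <= i < b)%N ->
  cgood cc (classes l) a z i0 J L Kf Mc i c -> cgood cc (classes l) a z i0 J L Kf Mc (nx i) c ->
  GE qg (fun f => (~~ stepok cc (classes l) a z nx i0 J m Dl f i c)%:R) <=
  step_fail J Mc Mg m i.
Proof.
move=> ib gi gn.
have lb1 := load_base_gt1 d_gt0 eta0.
have lb0 : 0 < load_base d eta by apply: lt_trans lb1.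
have sub0 j : 0 < (2 ^ (d * z j))%:R :> R by rewrite ltr0n expn_gt0.
have hl0 : 0 <= hlink d alpha th 0 by apply/ltW/hlink_gt0.
apply: (@step_prob R d b k cc (classes l) a z nx i0 J L Kf Mc Mg m Dl qg
  (fun=> hlink d alpha th 0 / 2) (fun i => hlink d alpha th ((1 - sigma tau eta) * gam * i%:R) / 2)
  (fun i => (2 ^ (d * z i))%:R / 8)) => //.
- exact: qg_edge_prob.
- exact: qg_kernel.
- by move=> _; rewrite divr_ge0.
- by move=> j; rewrite divr_ge0 //; apply/ltW/hlink_gt0.
- exact: (@sub_scale_le _ tau alpha gam eta).
- by move=> j jb; exact: (next_scale_ge tau2 alpha1 gam1 eta0 jb).
- move=> j y h _ yh yz lh; have /andP[h1 _] := qg_bounds y h; apply: le_trans h1.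
  rewrite ler_pM2r //; apply: (@link_hub (z j) j) => //; rewrite addr0.
  by have /andP[] := @sub_scale_bounds _ tau alpha gam eta tau2 alpha1 gam1 eta0 etaP j.
- move=> j y h _ yh yz lh; have /andP[h1 _] := qg_bounds y h; apply: le_trans h1.
  rewrite ler_pM2r //; apply: (@link_hub (nx j) (nx j)) => //.
    by rewrite !mulr_ge0 // ltW // (lt_trans ltr01).
  have h2 := next_scale_gam tau2 alpha1 gam1 eta0 b j.
  by have := ler_wpM2l sig1 h2; lra.
- move=> j /andP[ij _]; apply: le_trans (connectors_budget (i0P ij)).
  rewrite lerD2l; case: ifP => // _; rewrite divr_ge0 // mulr_ge0 // exprn_ge0 //; exact: ltW.
- by move=> j _; exact: connectors_product.
- by move=> j; rewrite mulr_gt0 // exprn_gt0.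
- exact: next_scale_le.
Qed.

End Steps.

Section ClassMass.
Local Open Scope classical_set_scope.
Variables (R : realType) (tau : R) (D : probability (measurableTypeR R) R).
Hypothesis htau : 2 < tau.
Variables (c5 C5 : R) (l0 : nat).
Hypotheses (c50 : 0 < c5) (C50 : 0 < C5).
Hypothesis massP : forall l, (l0 <= l)%N ->
  c5 * dyadic_decay tau ^+ l <= fP D (@dyadic R l) <= C5 * dyadic_decay tau ^+ l.

Lemma class_prob_ge0 M (j : 'I_M.+1) : 0 <= class_prob D j.
Proof. by rewrite fine_ge0. Qed.

Lemma class_prob_sum M : \sum_(j < M.+1) class_prob D j = 1.
Proof.
apply: (class_law_sum D (lset := @class_set R M)).
- exact: measurable_class_set.
- exact: class_set_inj.
- exact: class_set_cover.
Qed.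

Lemma class_prob_dyadic M (j : 'I_M.+1) : (j < M)%N -> class_prob D j = fP D (@dyadic R j).
Proof. by move=> jM; rewrite /class_prob /class_law /class_set /= (ltn_eqF jM). Qed.

Lemma class_prob_junk M : class_prob D (@ord_max M) = fP D (~` `[1, 2 ^+ M[).
Proof. by rewrite /class_prob /class_law /class_set /= eqxx. Qed.

Lemma class_massE M n : (n < M)%N -> class_mass (@class_prob R M D) n = fP D (@dyadic R n).
Proof.
move=> nM; have nM' : (n < M.+1)%N by apply: ltnW.
rewrite /class_mass (big_pred1 (Ordinal nM')); last by [].
exact: class_prob_dyadic.
Qed.

Definition weight_bound (bt : R) : R :=
  2 `^ (bt * l0%:R) + C5 / (1 - dyadic_decay tau * 2 `^ bt) + 1.

(** Classes below [l0] are bounded by their largest weight, those above form a geometric series with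
    ratio 2^(1 - tau + bt) < 1, and the last class contributes at most 1. *)
Lemma weight_mean (bt : R) M : 0 < bt -> bt < tau - 1 ->
  Dmean (@class_prob R M D) (@weight1 R bt M) <= weight_bound bt.
Proof.
move=> b0 bt1; rewrite /Dmean big_ord_recr /=; apply: lerD; last first.
  rewrite /weight1 ltnn mulr1 -(class_prob_sum M).
  by rewrite (bigD1 (@ord_max M)) //= lerDl sumr_ge0 // => j _; exact: class_prob_ge0.
set x := dyadic_decay tau * 2 `^ bt.
have x0 : 0 < x by rewrite mulr_gt0 ?powR_gt0.
have x1 : x < 1.
  rewrite /x /dyadic_decay -powRD ?pnatr_eq0 ?implybT //.
  by apply: two_powR_lt1; lra.
rewrite (bigID (fun j : 'I_M => (l0 <= j)%N)) /= addrC; apply: lerD.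
  apply: (@le_trans _ _ (\sum_(j < M.+1) class_prob D j * 2 `^ (bt * l0%:R))).
    rewrite [leRHS]big_ord_recr /= -[leLHS]addr0; apply: lerD; last by rewrite mulr_ge0 ?powR_ge0 ?class_prob_ge0.
    rewrite big_mkcond; apply: ler_sum => j _.
    have p0 : 0 <= class_prob D (widen_ord (leqnSn M) j) * 2 `^ (bt * l0%:R).
      by rewrite mulr_ge0 ?powR_ge0 ?class_prob_ge0.
    case: ifP => // jl; rewrite ler_wpM2l ?class_prob_ge0 // /weight1 /= ltn_ord.
    rewrite ler_powR ?ler1n // ler_wpM2l ?(ltW b0) // ler_nat ltnW // ltnNge; exact: jl.
  by rewrite -mulr_suml class_prob_sum mul1r.
apply: (@le_trans _ _ (\sum_(j < M | (l0 <= j)%N) C5 * x ^+ j)).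
  apply: ler_sum => j lj; rewrite class_prob_dyadic ?ltn_ord // /weight1 /= ltn_ord //.
  have /andP[_ h] := massP lj.
  apply: le_trans (ler_wpM2r (powR_ge0 _ _) h) _.
  rewrite -mulrA ler_pM2l // /x exprMn le_eqVlt; apply/orP; left; apply/eqP; congr (_ * _).
  by rewrite -powR_mulrn ?powR_ge0 // -powRrM.
rewrite -mulr_sumr ler_pM2l //.
apply: le_trans (geometric_tail l0 M _) _; first by rewrite x0 x1.
rewrite -[leRHS]mul1r ler_wpM2r ?invr_ge0 ?subr_ge0 ?(ltW x1) //.
by rewrite exprn_ile1 // ltW.
Qed.

End ClassMass.

Section ScaleProb.
Local Open Scope classical_set_scope.
Variables (R : realType) (d : nat) (tau alpha gam eta : R) (D : probability (measurableTypeR R) R).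
Hypothesis d_gt0 : (0 < d)%N.
Hypotheses (tau2 : 2 < tau) (alpha1 : 1 < alpha) (gam1 : 1 < gam) (eta0 : 0 < eta).
Hypothesis etaP : eta * (12 * (tau - 1) + 1 + alpha * gam) < 1 - alpha * gam * (tau - 2).
Variables (c5 C5 : R) (l0 : nat).
Hypotheses (c50 : 0 < c5) (C50 : 0 < C5).
Hypothesis massP : forall l, (l0 <= l)%N ->
  c5 * dyadic_decay tau ^+ l <= fP D (@dyadic R l) <= C5 * dyadic_decay tau ^+ l.
Local Notation a := (hub_class d tau eta).
Local Notation z := (sub_scale tau eta).

Definition hub_growth : R := 2 `^ (d%:R * eta).

Lemma hub_growth_gt1 : 1 < hub_growth.
Proof.
rewrite /hub_growth /powR pnatr_eq0 /= -[ltLHS]expR0 ltr_expR !mulr_gt0 // ?ln_gt0 ?ltr1n ?ltr0n //.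
Qed.

(** Expected number of hub candidates in a box, up to constants: 1 - sigma (tau - 1) = eta leaves
    the exponent d eta i. The factor 2^(tau - 1) is the rounding of the class. *)
Lemma hub_count i : hub_growth ^+ i <= 2 ^+ (d * i) * dyadic_decay tau ^+ a i <=
  2 `^ (tau - 1) * hub_growth ^+ i.
Proof.
have t0 := tau2; have /andP[a1 a2] := hub_class_bounds d tau2 alpha1 gam1 eta0 etaP i.
have st := sigma_tau tau2 alpha1 gam1 eta0.
have e1 : hub_growth ^+ i = 2 `^ (d%:R * eta * i%:R).
  by rewrite /hub_growth -powR_mulrn ?powR_ge0 // -powRrM.
have e2 : 2 ^+ (d * i) * dyadic_decay tau ^+ a i = 2 `^ (d%:R * i%:R + (1 - tau) * (a i)%:R).
  rewrite /dyadic_decay -[_ ^+ a i]powR_mulrn ?powR_ge0 // -powRrM pow2_powR natrM -powRD //.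
  by rewrite pnatr_eq0 implybT.
have key : d%:R * eta * i%:R = d%:R * i%:R + (1 - tau) * (d%:R * sigma tau eta * i%:R).
  have -> : d%:R * i%:R + (1 - tau) * (d%:R * sigma tau eta * i%:R) =
    d%:R * (1 - sigma tau eta * (tau - 1)) * i%:R by ring.
  by rewrite st; ring.
rewrite e2 e1 -powRD ?pnatr_eq0 ?implybT //; apply/andP; split; apply: pow2_le; rewrite key.
  by rewrite lerD2l ler_wnM2l //; lra.
have h : (1 - tau) * (a i)%:R <= (1 - tau) * (d%:R * sigma tau eta * i%:R - 1).
  by rewrite ler_wnM2l //; lra.
lra.
Qed.

Variables (M : nat).

Lemma hubless_small lam i : 1 <= lam -> (l0 <= a i)%N -> (a i < M)%N ->
  hubless_prob d lam (@class_prob R M D) a i <= expR (- (c5 * hub_growth ^+ i)).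
Proof.
move=> lam1 al aM; rewrite /hubless_prob ler_expR lerN2 class_massE //.
have /andP[h _] := massP al; have /andP[g _] := hub_count i.
have := ler_wpM2l (ltW c50) g => /le_trans; apply.
rewrite mulrCA -[lam * _ * _]mulrA -[leLHS]mul1r.
apply: ler_pM => //; first by rewrite !mulr_ge0 ?exprn_ge0 ?powR_ge0 // ltW.
by rewrite natrX ler_wpM2l ?exprn_ge0.
Qed.

Lemma hub_mass_bound i : (l0 <= a i)%N -> (a i < M)%N ->
  (2 ^ (d * i))%:R * class_mass (@class_prob R M D) (a i) <= C5 * 2 `^ (tau - 1) * hub_growth ^+ i.
Proof.
move=> al aM; rewrite class_massE //.
have /andP[_ h] := massP al; have /andP[_ g] := hub_count i.
rewrite -mulrA natrX; apply: le_trans (ler_wpM2l (ltW C50) g); rewrite mulrCA.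
by rewrite ler_wpM2l ?exprn_ge0.
Qed.

Lemma few_small i : few_prob R d (z i) <= expR (- (2 `^ (- d%:R) / 4 * (2 `^ (d%:R * sigma tau eta)) ^+ i)).
Proof.
rewrite /few_prob ler_expR lerN2 mulrAC ler_pM2r ?invr_gt0 //.
apply: le_trans (sub_box_large d tau2 alpha1 gam1 eta0 etaP i).
rewrite -powR_mulrn ?powR_ge0 // -powRrM -powRD ?pnatr_eq0 ?implybT //.
by apply: pow2_le; lra.
Qed.

End ScaleProb.

Section ChainCells.
Local Open Scope classical_set_scope.
Variables (R : realType) (d b B K : nat) (lam : R).
Local Notation C := (cellT d b).
Variables (pi : forall k, {ffun 'I_k -> C} -> R) (D : 'I_B -> R).
Hypothesis lam1 : 1 <= lam.
Hypothesis pi0 : forall k c, 0 <= pi (k := k) c.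
Hypothesis D0 : forall l, 0 <= D l.
Hypothesis D1 : \sum_l D l = 1.
Hypothesis piP : forall psi : C -> nat -> R, (forall x m, 0 <= psi x m) ->
  \sum_(k < K) \sum_(c : {ffun 'I_k -> C}) pi c * \prod_x psi x (cnt c x)
    <= \prod_x \sum_(m < K) pois lam m * psi x m.
Variables (a z : nat -> nat) (i0 J L : nat) (KA beta : R) (W1 : 'I_B -> R) (Mc : nat -> R).
Hypothesis z_le : forall i, (z i <= i)%N.
Hypothesis i0b : (i0 <= b)%N.
Hypothesis KA0 : 0 <= KA.
Hypothesis beta1 : 1 < beta.
Hypothesis W1ge1 : forall l, 1 <= W1 l.
Hypothesis Mc0 : forall i, 0 < Mc i.
Local Notation CEx := (@CE R C 'I_B K pi D).

Definition scale_fail i : R := hubless_prob d lam D a i + (2 ^ (d * i))%:R * few_prob R d (z i).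
Definition bad_hub_rate i : R := 3 * pois_cube lam * ((2 ^ (d * i))%:R * (2 ^ (d * z i))%:R * ker_mass d i0 KA beta) *
    (class_mass D (a i) * mean1 D W1 * mean1 D W1) / Mc i.

Lemma not_cgood k (cc : {ffun 'I_k -> C}) (l : {ffun 'I_k -> 'I_B}) i c :
  ~~ cgood cc (classes l) a z i0 J L (kernel i0 KA beta W1 cc l) Mc i c ->
  [|| no_hub a i c cc l, [exists c', same_box i c' c && few (z i) c' cc l],
      (i == i0) && (L < box_count cc i c)%N |
      (J <= i)%N && bad_hub a z i0 KA beta W1 i Mc c cc l].
Proof.
rewrite /cgood !negb_and => /or4P[h|h|h|h]; apply/or4P.
- by constructor 1.
- constructor 2; move: h; rewrite negb_forall => /existsP[c']; rewrite negb_imply -ltnNge => h.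
  by apply/existsP; exists c'.
- by constructor 3; move: h; rewrite negb_imply -ltnNge.
- constructor 4; move: h; rewrite negb_imply => /andP[-> /=]; rewrite negb_forall => /existsP[h].
  by rewrite negb_imply -ltNge => hh; apply/existsP; exists h.
Qed.

Lemma nonchain_mean :
  CEx (fun k cc l => #|[pred c | ~~ cchain cc (classes l) a z i0 J L (kernel i0 KA beta W1 cc l) Mc c]|%:R) <=
  (2 ^ (d * b))%:R * (overfull_prob d lam i0 L + \sum_(i < b.+1 | (i0 <= i)%N) scale_fail i +
    \sum_(i < b.+1 | (i0 <= i)%N && (J <= i)%N) bad_hub_rate i).
Proof.
apply: (@le_trans _ _ (CEx (fun k cc l => \sum_(c : C) ((L < box_count cc i0 c)%N%:R +
   \sum_(i < b.+1 | (i0 <= i)%N) ((no_hub a i c cc l)%:R + \sum_(c' | same_box i c' c) (few (z i) c' cc l)%:R) +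
   \sum_(i < b.+1 | (i0 <= i)%N && (J <= i)%N) (bad_hub a z i0 KA beta W1 i Mc c cc l)%:R)))).
  apply: le_CE => // k cc l; rewrite -sum1_card natr_sum big_mkcond; apply: ler_sum => c _.
  set S1 := \sum_(i < b.+1 | (i0 <= i)%N) _; set S2 := \sum_(i < b.+1 | _) _.
  have s1 : 0 <= S1 by apply: sumr_ge0 => i _; rewrite addr_ge0 // sumr_ge0.
  have s2 : 0 <= S2 by apply: sumr_ge0.
  rewrite inE; case: ifP => h; last by rewrite !addr_ge0.
  move: h; rewrite negb_forall => /existsP[i]; rewrite negb_imply => /andP[i0i /not_cgood/or4P[h|h|h|h]].
  - apply: (@le_trans _ _ S1); last by rewrite -addrA addrCA lerDl addr_ge0.
    rewrite /S1 (bigD1 i) //= h -addrA lerDl addr_ge0 ?sumr_ge0 // => j _.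
    by rewrite addr_ge0 // sumr_ge0.
  - apply: (@le_trans _ _ S1); last by rewrite -addrA addrCA lerDl addr_ge0.
    case/existsP: h => c' /andP[cc' f].
    rewrite /S1 (bigD1 i) //= (bigD1 (P := fun x => same_box i x c) c') //= f.
    apply: (@le_trans _ _ (0 + (1 + 0) + 0)); first by rewrite add0r !addr0.
    apply: lerD; last by apply: sumr_ge0 => j _; rewrite addr_ge0 // sumr_ge0.
    by apply: lerD => //; rewrite lerD2l sumr_ge0.
  - by case/andP: h => /eqP <- ->; rewrite -addrA lerDl addr_ge0.
  - case/andP: h => Ji bh; apply: (@le_trans _ _ S2); last by rewrite lerDr addr_ge0.
    by rewrite /S2 (bigD1 i) ?i0i //= bh lerDl sumr_ge0.
rewrite (CE_sum _ _ _ _ _ (fun (c : C) k cc l => (L < box_count cc i0 c)%N%:R +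
   \sum_(i < b.+1 | (i0 <= i)%N) ((no_hub a i c cc l)%:R + \sum_(c' | same_box i c' c) (few (z i) c' cc l)%:R) +
   \sum_(i < b.+1 | (i0 <= i)%N && (J <= i)%N) (bad_hub a z i0 KA beta W1 i Mc c cc l)%:R)).
apply: sum_const_le => c; rewrite !CED; apply: lerD; first apply: lerD.
- exact: (overfull_box_prob lam1 pi0 D0 D1 piP).
- rewrite (CE_sum _ _ _ _ _ (fun (i : 'I_b.+1) k cc l => (no_hub a i c cc l)%:R + \sum_(c' | same_box i c' c) (few (z i) c' cc l)%:R)).
  apply: ler_sum => i _; have ib : (i <= b)%N by rewrite -ltnS.
  rewrite CED; apply: lerD; first exact: (no_hub_prob lam1 pi0 D0 D1 piP).
  rewrite (CE_sum _ _ _ _ _ (fun (c' : C) k cc l => (few (z i) c' cc l)%:R)).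
  apply: (@le_trans _ _ (\sum_(c' | same_box i c' c) few_prob R d (z i))).
    apply: ler_sum => c' _; apply: (few_box_prob lam1 pi0 D0 D1 piP).
    exact: leq_trans (z_le i) ib.
  rewrite sumr_const -(card_same_box c ib) mulr_natl le_eqVlt; apply/orP; left; apply/eqP.
  by congr (_ *+ _); apply: eq_card => c'; rewrite !inE same_box_sym.
- rewrite (CE_sum _ _ _ _ _ (fun (i : 'I_b.+1) k cc l => (bad_hub a z i0 KA beta W1 i Mc c cc l)%:R)).
  apply: ler_sum => i _; have ib : (i <= b)%N by rewrite -ltnS.
  apply: (bad_hub_prob lam1 pi0 D0 D1 piP) => //; exact: leq_trans (z_le i) ib.
Qed.

End ChainCells.

(** * From the discrete bounds to asymptotics *)

Section LocalGraph.
Variables (R : realType) (d : nat) (tau alpha beta bt2 gam eta th : R).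
Hypothesis d_gt0 : (0 < d)%N.
Hypotheses (tau2 : 2 < tau) (alpha1 : 1 < alpha) (gam1 : 1 < gam) (eta0 : 0 < eta) (th0 : 0 < th) (th1 : th <= 1).
Hypothesis etaP : eta * (12 * (tau - 1) + 1 + alpha * gam) < 1 - alpha * gam * (tau - 2).
Hypothesis beta1 : 1 < beta.
Hypothesis bt21 : 1 < bt2.
Variables (b M : nat) (lam : R).
Hypotheses (lam1 : 1 <= lam) (lamd : lam <= 2 ^+ d).
Variables (i0 J L s jJ N Dp e : nat) (A A3 ep eps y0 y1 y2 y3 y4 y5 : R).
Hypothesis i0P : forall i, (i0 <= i)%N -> (32 <= 2 ^ (d * sub_scale tau eta i))%N.
Local Notation C := (cellT d b).
Local Notation nC := ((2 ^ (d * b))%:R : R).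
Local Notation a := (hub_class d tau eta).
Local Notation z := (sub_scale tau eta).
Local Notation nx := (next_scale gam b).
Local Notation m := (min_connectors d tau alpha gam eta th).
Local Notation Dl := (max_degree d eta).
Local Notation Mc := (load_bound d tau eta).
Local Notation Mg := (load_bound2 d tau eta).
Local Notation dl := (hub_prob d tau alpha eta th i0).
Hypothesis i0b : (i0 <= b)%N.
Hypothesis jJN : (jJ <= N)%N.
Hypothesis scN : sc nx i0 N = b.
Hypothesis sc_lt : forall j, (j < N)%N -> (i0 <= sc nx i0 j < b)%N.
Hypothesis scJ : forall j, (jJ <= j < N)%N -> (J <= sc nx i0 j)%N.
Hypothesis scJb : forall j, (j < jJ)%N -> (sc nx i0 j <= J)%N.
Hypotheses (ep0 : 0 < ep) (eps0 : 0 < eps) (A1 : 0 < A) (A31 : 0 < A3).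
Hypotheses (y10 : 0 < y1) (y20 : 0 < y2) (y30 : 0 < y3) (y40 : 0 < y4).
Hypothesis wA : forall j : nat, 2 `^ (beta * j%:R) <= A ^- 2 * 2 `^ (bt2 * j%:R) + A ^+ e.
Hypothesis y1P : \sum_(i < b | (i0 <= i)%N) step_fail J Mc Mg m i <= ep * y1.
Hypothesis budget : y2 * (1 - dl) ^+ s / ep +
  (y2 / A3 + A3 * (y0 + y1) + y4 / ep / Dp.+1%:R) * (1 + (s * L)%:R * A ^+ e.+1) +
  (s * L)%:R * (y3 / ep + y5) / A <= eps.

Definition local_config k (cc : {ffun 'I_k -> C}) (l : {ffun 'I_k -> 'I_M.+1}) : bool :=
  let K := kernel i0 (4 `^ beta) beta (@weight1 R beta M) cc l in
  [&& [forall i, (l i < M)%N],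
      #|[pred c | ~~ cchain cc (classes l) a z i0 J L K Mc c]|%:R <= nC * y0,
      \sum_c (cell_count cc c)%:R ^+ 2 <= nC * y2,
      sqload_sum i0 (4 `^ beta) beta (@weight1 R beta M) cc l <= nC * y3,
      boxload_sum i0 (4 `^ beta) beta (@weight1 R beta M) J cc l <= nC * y4 &
      \sum_v @weight1 R bt2 M (l v) <= nC * y5].

Definition unreached k (g : rel 'I_k) (H : 'I_k) : pred 'I_k := fun u =>
  (s * L < #|[set y | connect g u y]%SET|)%N &&
  ~~ `[< reach nx i0 m Dl g Dp (s * L + 1 + 2 * jJ) jJ N u H >].

Definition local_graph k (f : {ffun 'I_k * 'I_k -> bool}) : bool :=
  (k == 0)%N || [exists H, #|unreached (adjf f) H|%:R <= eps * nC].

(** Four Markov bounds of size [ep]: broken chains, weighted squared degrees, loads, and spread-out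
    balls without a sprinkled edge. Outside these events [failing_bound] and [budget] apply
    deterministically. *)
Lemma local_graph_prob k (cc : {ffun 'I_k -> C}) (l : {ffun 'I_k -> 'I_M.+1}) (q : 'I_k -> 'I_k -> R) :
  local_config cc l -> admissible th alpha beta lam cc (fun i => l i) q ->
  GE q (fun f => (~~ local_graph f)%:R) <= 4 * ep.
Proof.
set K := kernel i0 (4 `^ beta) beta (@weight1 R beta M) cc l.
move=> /andP[/forallP heavy /and5P[n0 n2 n3 n4 n5]] adm.
have [k0|k_gt0] := posnP k.
  rewrite /GE (eq_PE _ (G := fun=> 0)) ?PE_cst ?mulr_ge0 ?(ltW ep0) //.
    by case: adm => qp _ _; exact: GE_pmf.
  by move=> f; rewrite /local_graph (introT eqP k0 : (k == 0)%N).
have nC0 : 0 < nC by rewrite ltr0n expn_gt0.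
set hbf := hb cc (classes l) a i0.
pose qg := unsprinkled q hbf dl.
have qgp : edge_prob qg by apply: (qg_edge_prob tau2 alpha1 gam1 eta0 th0 th1 etaP lam1 lamd adm).
have qgK y v : y != v -> qg y v + (vbox cc i0 y v)%:R <= K y v.
  exact: (qg_kernel tau2 alpha1 gam1 eta0 th0 th1 etaP beta1 lam1 lamd heavy adm).
have qp : edge_prob q by case: adm.
have dlh := hub_prob_half d tau2 alpha1 gam1 eta0 th0 th1 i0.
have dl0 : 0 < dl by exact: hub_prob_gt0.
pose H0 : 'I_k := Ordinal k_gt0.
pose H := odflt H0 (hub cc (classes l) a b (cc H0)).
have HP c h : hub cc (classes l) a b c = Some h -> h = H.
  by rewrite /H (hub_eq _ _ _ (same_box_top c (cc H0) (leqnn b))) => ->.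
pose w y : R := (@weight1 R beta M (l y))^-1.
pose Mw y : R := @weight1 R bt2 M (l y).
have W1 y : 1 <= @weight1 R beta M (l y) by exact: weight1_ge1.
have w0 y : 0 < w y by rewrite invr_gt0 (lt_le_trans ltr01).
have wM y : (w y)^-1 <= A ^- 2 * Mw y + A ^+ e by rewrite /w invrK /Mw /weight1 !heavy.
have z_le i : (z i <= i)%N by exact: (sub_scale_le tau2 alpha1 gam1 eta0 etaP).
have m0 i : 0 < m i by exact: min_connectors_gt0.
pose Y1 f : bool := (nC * y1 < (broken_chains cc (classes l) a z nx i0 J L K Mc m Dl f)%:R).
pose Y2 f : bool := (nC * y3 / ep < weighted_sqdegree cc i0 w f).
pose Y3 f : bool := (nC * y4 / ep < (total_load cc i0 J f)%:R).
pose x4 : R := nC * y2 * (1 - dl) ^+ s / ep.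
pose Y4 f f' : bool := (x4 < (unlinked_spread cc (classes l) a z nx i0 J L K Mc m Dl J Dp s f f')%:R).
rewrite -(GE_sprinkled _ qp qgp (unsprinkled_split q hbf dlh)).
have hl01 : 0 <= dl <= 1 by rewrite (ltW dl0) (le_trans dlh) // invf_le1 // ler1n.
have Phl : is_pmf (bern (hub_law hbf dl)).
  by apply: bern_pmf => x; rewrite /hub_law; case: ifP => _ //; rewrite lexx ler01.
have GP := GE_pmf qgp.
have det f f' : (~~ local_graph (sprinkled hbf f f'))%:R <= (Y1 f)%:R + (Y2 f)%:R + (Y3 f)%:R + (Y4 f f')%:R :> R.
  case y1' : (Y1 f); first by rewrite -!addrA -[leLHS]addr0 lerD ?lern1 ?leq_b1 ?addr_ge0.
  case y2' : (Y2 f); first by rewrite add0r -!addrA -[leLHS]addr0 lerD ?lern1 ?leq_b1 ?addr_ge0.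
  case y3' : (Y3 f); first by rewrite !add0r -[leLHS]addr0 lerD ?lern1 ?leq_b1 ?addr_ge0.
  case y4' : (Y4 f f'); first by rewrite !add0r lern1 leq_b1.
  rewrite !add0r; have -> // : local_graph (sprinkled hbf f f').
  rewrite /local_graph; apply/orP; right; apply/existsP; exists H.
  move/negbT: y1'; move/negbT: y2'; move/negbT: y3'; move/negbT: y4'; rewrite /Y1 /Y2 /Y3 /Y4 -!leNgt.
  move=> h4 h3 h2 h1.
  have nv := nonvgood_card Dp A31 n0 h1 h3 n2.
  have M0 y : 0 <= Mw y by apply: le_trans (weight1_ge1 bt21 (l y)).
  have := failing_bound i0b jJN scN sc_lt scJ scJb m0 z_le HP A1 w0 wM h2 n5 M0 nv h4.
  move=> fb; apply: le_trans fb _; rewrite [leRHS]mulrC.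
  apply: le_trans (ler_wpM2l (ltW nC0) budget).
  by rewrite le_eqVlt; apply/orP; left; apply/eqP; rewrite /x4; ring.
apply: (@le_trans _ _ (GE qg (fun f => (Y1 f)%:R + (Y2 f)%:R + (Y3 f)%:R + PE (bern (hub_law hbf dl)) (fun f' => (Y4 f f')%:R)))).
  apply: (le_PE GP) => f; rewrite -(PE_cst Phl ((Y1 f)%:R + (Y2 f)%:R + (Y3 f)%:R)) -PED.
  by apply: (le_PE Phl) => f'; exact: det.
have sf0 i : 0 <= step_fail J Mc Mg m i.
  rewrite /step_fail addr_ge0 ?expR_ge0 //; case: ifP => // _.
  have lb : 0 < load_base d eta by apply: lt_trans (load_base_gt1 d_gt0 eta0).
  by rewrite divr_ge0 // /load_bound /load_bound2 mulr_ge0 ?exprn_ge0 ?(ltW lb).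
have markov (F : {ffun 'I_k * 'I_k -> bool} -> R) x : 0 < x -> (forall f, 0 <= F f) ->
    GE qg F <= nC * x -> GE qg (fun f => (nC * x / ep < F f)%R%:R) <= ep.
  move=> x0 F0 FE; have X0 : 0 < nC * x / ep by rewrite divr_gt0 // mulr_gt0.
  apply: le_trans (PE_markov_lt GP X0 F0) _.
  by rewrite ler_pdivrMr // mulrC divfK // gt_eqF.
have p1 : GE qg (fun f => (Y1 f)%:R) <= ep.
  have -> : GE qg (fun f => (Y1 f)%:R) = GE qg (fun f => (nC * (ep * y1) / ep < (broken_chains cc (classes l) a z nx i0 J L K Mc m Dl f)%:R)%R%:R).
    by rewrite mulrCA mulrAC divff ?mul1r // gt_eqF.
  apply: markov => //; first by rewrite mulr_gt0.
  apply: le_trans (broken_chains_mean qgp (sf := step_fail J Mc Mg m) sf0 _) _.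
    move=> i c ib cc_ok; have /andP[i0i ib'] := ib.
    apply: (qg_step_prob d_gt0 tau2 alpha1 gam1 eta0 th0 th1 etaP beta1 lam1 lamd heavy adm i0P ib).
      by apply: (cchainP cc_ok); rewrite i0i ltnW.
    apply: (cchainP cc_ok); rewrite next_scale_le andbT; apply: leq_trans i0i _.
    exact: (next_scale_ge tau2 alpha1 gam1 eta0 ib').
  by rewrite card_cellT ler_wpM2l // ltW.
have p2 : GE qg (fun f => (Y2 f)%:R) <= ep.
  apply: markov => //.
    by move=> f; apply: sumr_ge0 => y _; rewrite mulr_ge0 ?exprn_ge0 // ltW.
  exact: le_trans (weighted_sqdegree_mean qgp qgK (fun y => ltW (w0 y))) n3.
have p3 : GE qg (fun f => (Y3 f)%:R) <= ep.
  by apply: markov => //; exact: le_trans (total_load_mean J qgp qgK) n4.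
have p4 f : PE (bern (hub_law hbf dl)) (fun f' => (Y4 f f')%:R) <= ep.
  have dl1 : 0 < 1 - dl by have := dlh; lra.
  have X0 : 0 < x4 by rewrite /x4 divr_gt0 // !mulr_gt0 // exprn_gt0.
  apply: le_trans (PE_markov_lt Phl X0 (fun f' => ler0n _ _)) _.
  rewrite ler_pdivrMr //; apply: le_trans (unlinked_spread_mean cc (classes l) a z nx i0 J L K Mc m Dl J Dp s f hl01) _.
  rewrite /x4 mulrCA divff ?gt_eqF // mulr1 ler_wpM2r ?exprn_ge0 ?(ltW dl1) //.
  apply: le_trans n2.
  have -> : k%:R = \sum_c (cell_count cc c)%:R :> R.
    rewrite -natr_sum -[X in X%:R = _]card_ord -sum1_card (partition_big cc predT) //=.
    by congr (_%:R); apply: eq_bigr => c _; rewrite /cell_count -sum1_card; apply: eq_bigl => u; rewrite inE.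
  apply: ler_sum => c _; rewrite -natrX ler_nat; case: (cell_count cc c) => // x.
  by rewrite -mulnn leq_pmulr.
have -> : 4 * ep = ep + ep + ep + ep by ring.
rewrite /GE !PED; apply: lerD; first by apply: lerD => //; apply: lerD.
apply: le_trans (le_PE GP p4) _; by rewrite PE_cst.
Qed.

End LocalGraph.

Section CellgoodBox.
Variables (R : realType) (d b k : nat) (cell : 'I_k -> cellT d b) (cl : 'I_k -> nat).
Variables (a z nxt : nat -> nat) (i0 J L : nat) (Kf : 'I_k -> 'I_k -> R).
Variables (Mc m : nat -> R) (Dl : nat -> nat).
Hypothesis Jb : (b <= J)%N.
Hypothesis nxt_ge : forall i, (i < b)%N -> (i <= nxt i)%N.

Lemma cgood_box i c c' : same_box i c c' ->
  cgood cell cl a z i0 J L Kf Mc i c = cgood cell cl a z i0 J L Kf Mc i c'.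
Proof.
move=> cc; have E x : same_box i x c = same_box i x c'.
  by rewrite ![same_box i x _]same_box_sym (same_box_eq _ cc).
rewrite /cgood (hub_eq _ _ _ cc) /box_count; congr [&& _, _, _ & _].
- by apply: eq_forallb => x; rewrite E.
- by congr (_ ==> (_ <= _)%N); apply: eq_card => x; rewrite !inE E.
- by congr (_ ==> _); apply: eq_forallb => x; rewrite E.
Qed.

Lemma cellgood_box f c c' : same_box i0 c c' ->
  cellgood cell cl a z nxt i0 J L Kf Mc m Dl f c = cellgood cell cl a z nxt i0 J L Kf Mc m Dl f c'.
Proof.
move=> cc; congr andb; apply: eq_forallb => i; case: (leqP i0 i) => //= i0i.
  exact: (cgood_box (same_boxW i0i cc)).
apply: stp_box => //; exact: (same_boxW i0i cc).
Qed.

End CellgoodBox.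

Lemma sum_ord_split (R : realType) (F : nat -> R) (i0 j n : nat) : (j <= n)%N ->
  \sum_(i < n | (i0 <= i)%N) F i =
  \sum_(i < j | (i0 <= i)%N) F i + \sum_(i < n | (i0 <= i)%N && (j <= i)%N) F i.
Proof.
move=> jn; rewrite (bigID (fun i : 'I_n => (j <= i)%N)) /= addrC; congr (_ + _).
rewrite -(big_mkord (fun i => (i0 <= i)%N && ~~ (j <= i)%N) F) (@big_cat_nat _ _ _ j) //=.
rewrite [X in _ + X]big_nat_cond [X in _ + X]big_pred0 ?addr0; last first.
  by move=> i; case: (leqP j i); rewrite ?andbF.
by rewrite big_mkord; apply: eq_bigl => i; rewrite -ltnNge ltn_ord andbT.
Qed.

Section ConfigChernoff.
Variables (R : realType) (d b B K : nat) (lam : R).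
Local Notation C := (cellT d b).
Variables (pi : forall k, {ffun 'I_k -> C} -> R) (D : 'I_B -> R).
Hypothesis lam1 : 1 <= lam.
Hypothesis pi0 : forall k c, 0 <= pi (k := k) c.
Hypothesis D0 : forall l, 0 <= D l.
Hypothesis D1 : \sum_l D l = 1.
Hypothesis piP : forall psi : C -> nat -> R, (forall x m, 0 <= psi x m) ->
  \sum_(k < K) \sum_(c : {ffun 'I_k -> C}) pi c * \prod_x psi x (cnt c x)
    <= \prod_x \sum_(m < K) pois lam m * psi x m.
Variables (a z : nat -> nat) (i0 J2 : nat) (Kf : forall k, {ffun 'I_k -> C} -> {ffun 'I_k -> 'I_B} -> 'I_k -> 'I_k -> R) (Mc : nat -> R).
Hypothesis z_le : forall i, (z i <= i)%N.
Local Notation CEx := (@CE R C 'I_B K pi D).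
Local Notation nC := ((2 ^ (d * b))%:R : R).

(** The threshold is the integer part of th n/2, at least th n/2 - 1, whence the summand 1/2; the
    exponent is at most th n/8 - th n/4 + 1/2. *)
Lemma config_chernoff i (p th : R) (X : C -> forall k, {ffun 'I_k -> C} -> {ffun 'I_k -> 'I_B} -> bool) :
  0 <= p -> p <= th / 8 ->
  (forall S : {set C}, S \subset is_base d b i ->
    CEx (fun k cc l => \prod_(c in S) (X c k cc l)%:R) <= p ^+ #|S|) ->
  CEx (fun k cc l => (th / 2 * #|is_base d b i|%:R <
     #|[pred c | (c \in is_base d b i) && X c k cc l]|%:R)%R%:R) <=
  expR (2^-1 - th / 8 * #|is_base d b i|%:R).
Proof.
move=> p0 pth XS; set n := #|is_base d b i|%:R.
have th0 : 0 <= th by lra.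
have n0 : 0 <= n by [].
pose x := Num.truncn (th / 2 * n).
have xP : th / 2 * n - 1 <= x%:R.
  by rewrite lerBlDr natr1; apply: ltW; rewrite -truncn_le_nat.
pose O := {k : nat & ({ffun 'I_k -> C} * {ffun 'I_k -> 'I_B})%type}.
pose E (F : O -> R) := CEx (fun k cc l => F (existT _ k (cc, l))).
pose XO c (w : O) := X c (projT1 w) (projT2 w).1 (projT2 w).2.
have := @chernoff_count R O E C (is_base d b i) XO p x p0.
move=> /(_ _ _ _ _)/le_trans; move=> key.
apply: (@le_trans _ _ (E (fun w => (x <= \sum_(c in is_base d b i) XO c w)%N%:R))).
  apply: le_CE => // k cc l; rewrite ler_nat; case: ltP => // h; rewrite lt0b.
  rewrite /= -(ler_nat R); apply: le_trans (_ : th / 2 * n <= _); first by rewrite -truncn_ge_nat // mulr_ge0 // divr_ge0.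
  apply: le_trans (ltW h) _; rewrite ler_nat -sum1_card [X in (X <= _)%N]big_mkcond [X in (_ <= X)%N]big_mkcond.
  by apply: leq_sum => c _; rewrite !inE /XO /=; case: (_ == c); case: (X _ _ _ _).
apply: key.
- by move=> F G FG; apply: le_CE.
- by move=> c F; rewrite /E CEZ.
- by move=> A F; rewrite /E (CE_sum _ _ _ _ _ (fun a0 k cc l => F a0 (existT _ k (cc, l)))).
- exact: XS.
- rewrite ler_expR -/n; have := ler_wpM2r n0 pth; lra.
Qed.

Lemma no_hub_many i (th : R) : (i <= b)%N -> hubless_prob d lam D a i <= th / 8 ->
  CEx (fun k cc l => (th / 2 * nC < #|[pred c | no_hub a i c cc l]|%:R)%R%:R) <=
  expR (2^-1 - th / 8 * #|is_base d b i|%:R).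
Proof.
move=> ib hth; apply: le_trans (config_chernoff (expR_ge0 _) hth (X := fun c k cc l => no_hub a i c cc l) _); last first.
  by move=> S SB; exact: (no_hub_joint lam1 pi0 D0 D1 piP).
apply: le_CE => // k cc l; rewrite (@sum_base d b i) //; last first.
  by move=> c c' cc'; rewrite !inE /no_hub (hub_eq _ _ _ cc').
rewrite -(card_base d ib) !natrM mulrA ltr_pM2r ?ltr0n ?expn_gt0 //.
Qed.

Lemma few_box_eq i c c' k (cc : {ffun 'I_k -> C}) (l : {ffun 'I_k -> 'I_B}) :
  same_box i c c' -> few i c cc l = few i c' cc l.
Proof.
move=> h; rewrite /few /box_count; congr (_ * _ < _)%N; apply: eq_card => v.
by rewrite !inE ![same_box i (cc v) _]same_box_sym (same_box_eq _ h).
Qed.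

(** A single thin sub-box spoils the whole surrounding box of 2^(d i) cells, so the admissible
    proportion of thin sub-boxes is smaller by that factor. *)
Lemma few_many i (th : R) : (i <= b)%N -> few_prob R d (z i) <= th / (2 ^ (d * i))%:R / 8 ->
  CEx (fun k cc l => (th / 2 * nC < #|[pred c | [exists c', same_box i c' c && few (z i) c' cc l]]|%:R)%R%:R) <=
  expR (2^-1 - th / (2 ^ (d * i))%:R / 8 * #|is_base d b (z i)|%:R).
Proof.
move=> ib hth; have zb : (z i <= b)%N := leq_trans (z_le i) ib.
have s0 : 0 < (2 ^ (d * i))%:R :> R by rewrite ltr0n expn_gt0.
have th0 : 0 <= th / (2 ^ (d * i))%:R by have := expR_ge0 (- ((2 ^ (d * z i))%:R / 4) : R); rewrite /few_prob in hth; lra.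
apply: le_trans (config_chernoff (expR_ge0 _) hth (X := fun c k cc l => few (z i) c cc l) _); last first.
  by move=> S SB; exact: (few_joint lam1 pi0 D0 D1 piP).
apply: le_CE => // k cc l; rewrite ler_nat; case: ltP => // h; rewrite lt0b.
set F := #|[pred c | _ && few _ _ _ _]|.
have hF : (#|[pred c | [exists c', same_box i c' c && few (z i) c' cc l]]| <= F * 2 ^ (d * i))%N.
  apply: (@leq_trans (\sum_(c' | (c' \in is_base d b (z i)) && few (z i) c' cc l) #|[pred c | same_box i c' c]|)%N); last first.
    rewrite (eq_bigr (fun=> 2 ^ (d * i))%N) ?sum_nat_const //.
    by move=> c' _; rewrite card_same_box.
  under eq_bigr => c' _ do rewrite -sum1_card big_mkcond.
  rewrite exchange_big /= -sum1_card [X in (X <= _)%N]big_mkcond; apply: leq_sum => c _.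
  rewrite inE; case: ifP => // /existsP[c' /andP[cc' fc']].
  have bb := box_base_same (z i) c'.
  rewrite (bigD1 (box_base (z i) c')) /=; last by rewrite box_base_is_base (few_box_eq _ _ bb).
  rewrite inE; have -> // : same_box i (box_base (z i) c') c.
  exact: same_box_trans (same_boxW (z_le i) bb) cc'.
have h2 : th / 2 * nC < F%:R * (2 ^ (d * i))%:R.
  by apply: lt_le_trans h _; rewrite -natrM ler_nat.
apply: le_lt_trans (_ : th / (2 ^ (d * i))%:R / 2 * nC < _); last first.
  rewrite -(ltr_pM2r s0); apply: le_lt_trans h2; rewrite le_eqVlt; apply/orP; left; apply/eqP.
  by rewrite mulrAC [_ / 2 * _]mulrAC divfK ?gt_eqF.
apply: ler_wpM2l; first by rewrite divr_ge0.
by rewrite ler_nat -(card_base d zb) leq_pmulr // expn_gt0.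
Qed.

Local Notation bad i k cc l := (#|[pred c | ~~ cgood cc (classes l) a z i0 b.+1 k (Kf cc l) Mc i c]|%:R : R).

(** With [b.+1] for [J] and [k] for [L] the last two clauses of [cgood] hold trivially; existence of
    a large component needs no degree control. *)
Lemma cgood_box_few i k (cc : {ffun 'I_k -> C}) (l : {ffun 'I_k -> 'I_B}) c : (i <= b)%N ->
  ~~ cgood cc (classes l) a z i0 b.+1 k (Kf cc l) Mc i c ->
  no_hub a i c cc l || [exists c', same_box i c' c && few (z i) c' cc l].
Proof.
move=> ib; rewrite /cgood !negb_and => /or4P[h|h|h|h]; apply/orP.
- by left.
- right; move: h; rewrite negb_forall => /existsP[c']; rewrite negb_imply -ltnNge => h.
  by apply/existsP; exists c'.
- move: h; rewrite negb_imply => /andP[_ /negP[]].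
  by apply: leq_trans (max_card _) _; rewrite card_ord.
- by move: h; rewrite negb_imply ltnNge ib.
Qed.

(** Below [J2] each scale is bounded separately, by concentration. From [J2] on only the sum is
    bounded, by Markov, since high scales have too few boxes to concentrate. *)
Definition exist_config (fb : nat -> R) k (cc : {ffun 'I_k -> C}) (l : {ffun 'I_k -> 'I_B}) : bool :=
  [forall i : 'I_J2, (i0 <= i)%N ==> (bad i k cc l <= 8 * fb i * nC)] &&
  (\sum_(i < b.+1 | (i0 <= i)%N && (J2 <= i)%N) bad i k cc l <= nC / 8).

Lemma bad_mean i : (i <= b)%N -> CEx (fun k cc l => bad i k cc l) <= nC * scale_fail d lam D a z i.
Proof.
move=> ib; apply: (@le_trans _ _ (CEx (fun k cc l => \sum_(c : C) ((no_hub a i c cc l)%:R + \sum_(c' | same_box i c' c) (few (z i) c' cc l)%:R)))).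
  apply: le_CE => // k cc l; rewrite -sum1_card natr_sum big_mkcond; apply: ler_sum => c _.
  have s0 : 0 <= \sum_(c' | same_box i c' c) (few (z i) c' cc l)%:R :> R by apply: sumr_ge0.
  rewrite inE; case: ifP => h; last by rewrite addr_ge0.
  case/orP: (cgood_box_few ib h) => [->|/existsP[c' /andP[cc' f]]]; first by rewrite lerDl.
  rewrite (bigD1 c') //= f; apply: (@le_trans _ _ (0 + (1 + 0))); first by rewrite add0r addr0.
  by apply: lerD => //; rewrite lerD2l sumr_ge0.
rewrite (CE_sum _ _ _ _ _ (fun (c : C) k cc l => (no_hub a i c cc l)%:R + \sum_(c' | same_box i c' c) (few (z i) c' cc l)%:R)).
apply: sum_const_le => c; rewrite CED; apply: lerD; first exact: (no_hub_prob lam1 pi0 D0 D1 piP).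
rewrite (CE_sum _ _ _ _ _ (fun (c' : C) k cc l => (few (z i) c' cc l)%:R)).
apply: (@le_trans _ _ (\sum_(c' | same_box i c' c) few_prob R d (z i))).
  apply: ler_sum => c' _; apply: (few_box_prob lam1 pi0 D0 D1 piP).
  exact: leq_trans (z_le i) ib.
rewrite sumr_const -(card_same_box c ib) mulr_natl le_eqVlt; apply/orP; left; apply/eqP.
by congr (_ *+ _); apply: eq_card => c'; rewrite !inE same_box_sym.
Qed.

Lemma base_mono i j : (i <= j)%N -> (j <= b)%N -> (#|is_base d b j| <= #|is_base d b i|)%N.
Proof.
move=> ij jb; have ej := card_base d jb; have ei := card_base d (leq_trans ij jb).
rewrite -(@leq_pmul2r (2 ^ (d * i))) ?expn_gt0 // ei -ej leq_mul2l leq_exp2l // leq_mul2l ij orbT.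
by rewrite orbT.
Qed.

Lemma exist_config_prob (fb : nat -> R) : (J2 <= b)%N ->
  (forall i, (i0 <= i <= b)%N -> 0 < fb i /\ scale_fail d lam D a z i <= fb i) ->
  CEx (fun k cc l => (~~ exist_config fb cc l)%:R) <=
  \sum_(i < J2 | (i0 <= i)%N) 2 * expR (2^-1 - fb i / (2 ^ (d * i))%:R * #|is_base d b i|%:R) +
  8 * \sum_(i < b.+1 | (i0 <= i)%N && (J2 <= i)%N) fb i.
Proof.
move=> J2b fbP.
have nC0 : 0 < nC by rewrite ltr0n expn_gt0.
apply: (@le_trans _ _ (CEx (fun k cc l => \sum_(i < J2 | (i0 <= i)%N) ((8 * fb i / 2 * nC < #|[pred c | no_hub a i c cc l]|%:R)%R%:R +
    (8 * fb i / 2 * nC < #|[pred c | [exists c', same_box i c' c && few (z i) c' cc l]]|%:R)%R%:R) +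
    (nC / 8 <= \sum_(i < b.+1 | (i0 <= i)%N && (J2 <= i)%N) bad i k cc l)%R%:R))).
  apply: le_CE => // k cc l.
  set S1 := \sum_(i < J2 | _) _; have S10 : 0 <= S1 by apply: sumr_ge0 => i _; rewrite addr_ge0.
  case: (boolP (exist_config fb cc l)) => /=; first by rewrite addr_ge0.
  rewrite negb_and => /orP[|]; last first.
    by rewrite -ltNge => /ltW ->; rewrite lerDr.
  rewrite negb_forall => /existsP[i]; rewrite negb_imply -ltNge => /andP[i0i h].
  rewrite -[leLHS]addr0; apply: lerD => //; rewrite /S1 (bigD1 i) //= -[leLHS]addr0.
  apply: lerD; last by apply: sumr_ge0 => j _; rewrite addr_ge0.
  have ib : (i <= b)%N by apply: leq_trans J2b; apply: ltnW.
  have le : bad i k cc l <= #|[pred c | no_hub a i c cc l]|%:R + #|[pred c | [exists c', same_box i c' c && few (z i) c' cc l]]|%:R.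
    rewrite -natrD ler_nat -cardUI; apply: leq_trans (leq_addr _ _).
    by apply/subset_leq_card/fintype.subsetP => c; rewrite !inE; exact: cgood_box_few.
  case: ltP => h1; first by rewrite lerDl.
  case: ltP => h2; first by rewrite lerDr.
  lra.
rewrite CED; apply: lerD.
  rewrite (CE_sum _ _ _ _ _ (fun (i : 'I_J2) k cc l => (8 * fb i / 2 * nC < #|[pred c | no_hub a i c cc l]|%:R)%R%:R +
    (8 * fb i / 2 * nC < #|[pred c | [exists c', same_box i c' c && few (z i) c' cc l]]|%:R)%R%:R)).
  apply: ler_sum => i i0i; have ib : (i <= b)%N by apply: leq_trans J2b; apply: ltnW.
  have [fb0 fbs] : 0 < fb i /\ scale_fail d lam D a z i <= fb i by apply: fbP; rewrite i0i.
  have s0 : 0 < (2 ^ (d * i))%:R :> R by rewrite ltr0n expn_gt0.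
  have s1 : 1 <= (2 ^ (d * i))%:R :> R by rewrite ler1n expn_gt0.
  have hp : 0 <= hubless_prob d lam D a i by exact: expR_ge0.
  have fp : 0 <= few_prob R d (z i) by exact: expR_ge0.
  have sfp : 0 <= (2 ^ (d * i))%:R * few_prob R d (z i) by rewrite mulr_ge0.
  rewrite CED [leRHS]mulr_natl [leRHS]mulr2n; rewrite /scale_fail in fbs; apply: lerD.
    apply: le_trans (no_hub_many ib _) _; first lra.
    rewrite ler_expR lerD2l lerN2 ler_wpM2r //.
    rewrite ler_pdivrMr //; nra.
  apply: le_trans (few_many ib _) _.
    rewrite mulrAC ler_pdivlMr //; lra.
  rewrite ler_expR lerD2l lerN2; apply: ler_pM => //.
  - by rewrite divr_ge0 // ltW.
  - rewrite le_eqVlt; apply/orP; left; apply/eqP; field; by rewrite gt_eqF.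
  - by rewrite ler_nat base_mono.
apply: (@le_trans _ _ (CEx (fun k cc l => \sum_(i < b.+1 | (i0 <= i)%N && (J2 <= i)%N) bad i k cc l) / (nC / 8))).
  by apply: CE_markov => // k cc l; apply: sumr_ge0.
rewrite (CE_sum _ _ _ _ _ (fun (i : 'I_b.+1) k cc l => bad i k cc l)).
rewrite ler_pdivrMr ?divr_gt0 //.
have -> : 8 * (\sum_(i < b.+1 | (i0 <= i)%N && (J2 <= i)%N) fb i) * (nC / 8) =
  nC * \sum_(i < b.+1 | (i0 <= i)%N && (J2 <= i)%N) fb i by field.
rewrite mulr_sumr.
apply: ler_sum => i /andP[i0i _]; apply: le_trans (bad_mean _) _; first by rewrite -ltnS.
rewrite ler_pM2l //; apply: (proj2 (fbP _ _)); by rewrite i0i -ltnS ltn_ord.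
Qed.

Lemma exist_config_chain (fb : nat -> R) k (cc : {ffun 'I_k -> C}) (l : {ffun 'I_k -> 'I_B}) : (J2 <= b)%N ->
  8 * \sum_(i < J2 | (i0 <= i)%N) fb i <= 8^-1 -> exist_config fb cc l ->
  #|[pred c | ~~ cchain cc (classes l) a z i0 b.+1 k (Kf cc l) Mc c]|%:R <= nC / 4.
Proof.
move=> J2b fbs /andP[/forallP h1 h2].
apply: (@le_trans _ _ (\sum_(i < b.+1 | (i0 <= i)%N) bad i k cc l)).
  rewrite -natr_sum ler_nat.
  under eq_bigr => i _ do rewrite -sum1_card big_mkcond.
  rewrite exchange_big /= -sum1_card [X in (X <= _)%N]big_mkcond; apply: leq_sum => c _.
  rewrite inE; case: ifP => //; rewrite negb_forall => /existsP[i].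
  by rewrite negb_imply => /andP[i0i ns]; rewrite (bigD1 i) //= inE ns.
rewrite (sum_ord_split (fun i => bad i k cc l) i0 (leqW J2b)).
have -> : nC / 4 = 8^-1 * nC + nC / 8 by field.
apply: lerD => //; apply: le_trans (ler_wpM2r (ler0n _ _) fbs); rewrite mulr_sumr mulr_suml.
by apply: ler_sum => i i0i; have := h1 i; rewrite i0i.
Qed.

End ConfigChernoff.

Section ExistGraph.
Variables (R : realType) (d : nat) (tau alpha beta gam eta th : R).
Hypothesis d_gt0 : (0 < d)%N.
Hypotheses (tau2 : 2 < tau) (alpha1 : 1 < alpha) (gam1 : 1 < gam) (eta0 : 0 < eta) (th0 : 0 < th) (th1 : th <= 1).
Hypothesis etaP : eta * (12 * (tau - 1) + 1 + alpha * gam) < 1 - alpha * gam * (tau - 2).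
Hypothesis beta1 : 1 < beta.
Variables (b M : nat) (lam : R).
Hypotheses (lam1 : 1 <= lam) (lamd : lam <= 2 ^+ d).
Variables (i0 J2 N : nat).
Hypothesis i0P : forall i, (i0 <= i)%N -> (32 <= 2 ^ (d * sub_scale tau eta i))%N.
Local Notation C := (cellT d b).
Local Notation nC := ((2 ^ (d * b))%:R : R).
Local Notation a := (hub_class d tau eta).
Local Notation z := (sub_scale tau eta).
Local Notation nx := (next_scale gam b).
Local Notation m := (min_connectors d tau alpha gam eta th).
Local Notation Dl := (max_degree d eta).
Local Notation Mc := (load_bound d tau eta).
Local Notation Mg := (load_bound2 d tau eta).
Local Notation dl := (hub_prob d tau alpha eta th i0).
Hypotheses (i0b : (i0 <= b)%N) (J2b : (J2 <= b)%N).
Hypothesis scN : sc nx i0 N = b.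
Hypothesis sc_lt : forall j, (j < N)%N -> (i0 <= sc nx i0 j < b)%N.

Definition big_component (c0 : R) k (f : {ffun 'I_k * 'I_k -> bool}) : bool :=
  [exists H, c0 * nC <= #|[set y | connect (adjf f) H y]%SET|%:R].

(** At most a quarter of the cells lack a chain in the configuration and a further quarter have a
    broken one, so half are good. Then at least nC/16 vertices are attachable, a fraction dl/4 of
    them gets attached, and all attached vertices are connected to [H]. *)
Lemma big_component_prob (fb : nat -> R) k (cc : {ffun 'I_k -> C}) (l : {ffun 'I_k -> 'I_M.+1}) (q : 'I_k -> 'I_k -> R) :
  8 * \sum_(i < J2 | (i0 <= i)%N) fb i <= 8^-1 ->
  8 * \sum_(i < J2 | (i0 <= i)%N) expR (- m i) <= 8^-1 ->
  (forall i, (l i < M)%N) ->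
  exist_config a z i0 J2 (@kernel R d b M.+1 i0 (4 `^ beta) beta (@weight1 R beta M)) Mc fb cc l ->
  admissible th alpha beta lam cc (fun i => l i) q ->
  GE q (fun f => (~~ big_component (dl / 64) f)%:R) <=
  \sum_(i < J2 | (i0 <= i)%N) expR (2^-1 - expR (- m i) * #|is_base d b i|%:R) +
  8 * \sum_(i < b | (i0 <= i)%N && (J2 <= i)%N) expR (- m i) + expR (- (dl * nC / 64)).
Proof.
move=> fbs sbs heavy cfg adm.
have nC0 : 0 < nC by rewrite ltr0n expn_gt0.
have Jb : (b <= b.+1)%N by [].
set K := kernel i0 (4 `^ beta) beta (@weight1 R beta M) cc l.
have z_le i : (z i <= i)%N by exact: (sub_scale_le tau2 alpha1 gam1 eta0 etaP).
have nxt_ge i : (i < b)%N -> (i <= nx i)%N by exact: (next_scale_ge tau2 alpha1 gam1 eta0).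
have m0 i : 0 < m i by exact: min_connectors_gt0.
have chainb : #|[pred c | ~~ cchain cc (classes l) a z i0 b.+1 k K Mc c]|%:R <= nC / 4.
  exact: exist_config_chain cfg.
have [c0 c0P] : exists c0, cchain cc (classes l) a z i0 b.+1 k K Mc c0.
  have [c0 c0P|no] := pickP (cchain cc (classes l) a z i0 b.+1 k K Mc); first by exists c0.
  exfalso; move: chainb; rewrite (eq_card (B := predT)); last by move=> c; rewrite !inE no.
  by rewrite card_cellT; lra.
have [H eH] : exists H, hub cc (classes l) a b c0 = Some H.
  have := cchainP c0P (i := b); rewrite i0b leqnn => /(_ isT)/and4P[+ _ _ _].
  by case: (hub _ _ _ _ _) => [h|//] _; exists h.
have HP c h : hub cc (classes l) a b c = Some h -> h = H.
  by rewrite (hub_eq _ _ _ (same_box_top c c0 (leqnn b))) eH => -[].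
set hbf := hb cc (classes l) a i0.
pose qg := unsprinkled q hbf dl.
have qgp : edge_prob qg by apply: (qg_edge_prob tau2 alpha1 gam1 eta0 th0 th1 etaP lam1 lamd adm).
have qp : edge_prob q by case: adm.
have dlh := hub_prob_half d tau2 alpha1 gam1 eta0 th0 th1 i0.
have dl0 : 0 < dl by exact: hub_prob_gt0.
have GP := GE_pmf qgp.
rewrite -(GE_sprinkled _ qp qgp (unsprinkled_split q hbf dlh)).
have hl01 : 0 <= dl <= 1 by rewrite (ltW dl0) (le_trans dlh) // invf_le1 // ler1n.
have Phl : is_pmf (bern (hub_law hbf dl)).
  by apply: bern_pmf => x; rewrite /hub_law; case: ifP => _ //; rewrite lexx ler01.
pose sb i : R := expR (- m i).
have sb0 i : 0 <= sb i by exact: expR_ge0.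
have sbP i c : (i0 <= i < b)%N -> cchain cc (classes l) a z i0 b.+1 k K Mc c ->
    GE qg (fun f => (~~ stepok cc (classes l) a z nx i0 b.+1 m Dl f i c)%:R) <= sb i.
  move=> ib cc_ok; have /andP[i0i ib'] := ib.
  apply: le_trans (qg_step_prob (L := k) d_gt0 tau2 alpha1 gam1 eta0 th0 th1 etaP beta1 lam1 lamd heavy adm i0P ib _ _) _.
  - by apply: (cchainP cc_ok); rewrite i0i ltnW.
  - by apply: (cchainP cc_ok); rewrite next_scale_le andbT; apply: leq_trans i0i _; exact: nxt_ge.
  - by rewrite /step_fail ltnNge (ltnW ib') /= addr0.
pose sfl i f := step_failures cc (classes l) a z nx i0 b.+1 k K Mc m Dl i f.
(* Four times the mean number of failing boxes: the Chernoff exponent becomes n sb - 2 n sb + 1/2,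
   with n the number of boxes. *)
pose x i := Num.truncn (4 * sb i * #|is_base d b i|%:R).
pose Y1 f : R := \sum_(i < J2 | (i0 <= i)%N) (x i * 2 ^ (d * i) <= sfl i f)%N%:R.
pose Y2 f : bool := nC / 8 <= \sum_(i < b | (i0 <= i)%N && (J2 <= i)%N) (sfl i f)%:R.
have Y10 f : 0 <= Y1 f by apply: sumr_ge0.
pose good f c := cellgood cc (classes l) a z nx i0 b.+1 k K Mc m Dl f c.
pose att f f' := #|attached cc (classes l) a z nx i0 b.+1 k K Mc m Dl f f'|.
have goodP f : Y1 f < 1 -> ~~ Y2 f -> nC / 2 <= #|good f|%:R.
  rewrite /Y2 -ltNge => y1 y2.
  have s1 (i : 'I_J2) : (i0 <= i)%N -> (sfl i f)%:R <= 4 * sb i * nC.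
    move=> i0i; have ib : (i <= b)%N by apply: leq_trans J2b; apply: ltnW.
    have : (sfl i f < x i * 2 ^ (d * i))%N.
      rewrite ltnNge; apply/negP => h; move: y1; rewrite ltNge /Y1 (bigD1 i) //= h => /negP[].
      by rewrite lerDl sumr_ge0.
    move=> /ltnW; rewrite -(ler_nat R) => /le_trans; apply.
    rewrite -(card_base d ib) !natrM mulrA ler_wpM2r // /x.
    by rewrite -truncn_ge_nat // !mulr_ge0.
  have ng : #|[pred c | cchain cc (classes l) a z i0 b.+1 k K Mc c && ~~ gchain cc (classes l) a z nx i0 b.+1 m Dl f c]|%:R <= nC / 4.
    apply: (@le_trans _ _ (\sum_(i < b | (i0 <= i)%N) (sfl i f)%:R)).
      by rewrite -natr_sum ler_nat; exact: nongchain_count.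
    rewrite (sum_ord_split (fun i => (sfl i f)%:R) i0 J2b).
    have -> : nC / 4 = 8^-1 * nC + nC / 8 by field.
    apply: lerD; last exact: ltW.
    apply: le_trans (_ : (4 * \sum_(i < J2 | (i0 <= i)%N) sb i) * nC <= _); last first.
      rewrite ler_wpM2r // ; apply: le_trans sbs; rewrite ler_wpM2r ?ler_nat //.
      by apply: sumr_ge0 => i _; exact: sb0.
    rewrite mulr_sumr mulr_suml.
    exact: ler_sum.
  have : (2 ^ (d * b) <= #|good f| + (#|[pred c | ~~ cchain cc (classes l) a z i0 b.+1 k K Mc c]| +
      #|[pred c | cchain cc (classes l) a z i0 b.+1 k K Mc c && ~~ gchain cc (classes l) a z nx i0 b.+1 m Dl f c]|))%N.
    rewrite -(card_cellT d b) -(cardC (good f)) leq_add2l -cardUI; apply: leq_trans (leq_addr _ _).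
    apply/subset_leq_card/fintype.subsetP => c; rewrite !inE /in_mem /= /good /cellgood negb_and.
    by case: (cchain _ _ _ _ _ _ _ _ _ c).
  rewrite -(ler_nat R) !natrD; lra.
have det f : PE (bern (hub_law hbf dl)) (fun f' => (~~ big_component (dl / 64) (sprinkled hbf f f'))%:R) <=
    Y1 f + (Y2 f)%:R + expR (- (dl * nC / 64)).
  have e0 : 0 <= expR (- (dl * nC / 64)) by exact: expR_ge0.
  have le1 : PE (bern (hub_law hbf dl)) (fun f' => (~~ big_component (dl / 64) (sprinkled hbf f f'))%:R) <= 1.
    by rewrite -[leRHS](PE_cst Phl); apply: (le_PE Phl) => f'; rewrite lern1 leq_b1.
  case: (ltP (Y1 f) 1) => y1; last by apply: le_trans le1 _; rewrite -addrA -[leLHS]addr0 lerD // addr_ge0.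
  case y2 : (Y2 f); first by apply: le_trans le1 _; rewrite addrAC lerDr addr_ge0.
  rewrite addr0; apply: le_trans (_ : expR (- (dl * nC / 64)) <= _); last by rewrite lerDr.
  have gc := goodP f y1 (negbT y2).
  have big8 : (8 <= 2 ^ (d * i0))%N.
    apply: leq_trans (_ : 2 ^ (d * z i0) <= _)%N; first exact: leq_trans (i0P (leqnn i0)).
    by rewrite leq_exp2l // leq_mul2l z_le orbT.
  have ac := attachable_card Jb z_le i0b big8 (fun c c' => @cellgood_box R d b k cc (classes l) a z nx i0 b.+1 k K Mc m Dl nxt_ge f c c').
  have ac' : nC / 16 <= #|attachable cc (classes l) a z nx i0 b.+1 k K Mc m Dl f|%:R.
    by have := ac; rewrite -(ler_nat R) natrM -/(good f) => h; move: gc; rewrite /good; lra.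
  apply: le_trans (_ : PE (bern (hub_law hbf dl)) (fun f' => ((att f f')%:R < dl * (nC / 16) / 4)%R%:R) <= _).
    apply: (le_PE Phl) => f'; rewrite ler_nat; case: ltP => [_|h]; first exact: leq_b1.
    rewrite leqn0 eqb0 negbK; apply/existsP; exists H; apply: (@le_trans _ _ (att f f')%:R).
      by apply: le_trans h; rewrite le_eqVlt; apply/orP; left; apply/eqP; field.
    rewrite ler_nat; exact: (attached_component z b.+1 k K Mc Dl f i0b f' scN sc_lt m0 HP).
  apply: le_trans (attached_few hl01 ac') _.
  by rewrite ler_expR le_eqVlt; apply/orP; left; apply/eqP; field.
apply: le_trans (le_PE GP det) _.
rewrite !PED (PE_cst GP) lerD2r; apply: lerD.
  rewrite /Y1 PE_sum; apply: ler_sum => i i0i.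
  have ib : (i0 <= i < b)%N by rewrite i0i (leq_trans (ltn_ord i)).
  apply: le_trans (step_failures_count Jb z_le nxt_ge qgp sb0 sbP (x i) ib) _.
  rewrite ler_expR -/(sb i).
  have : 4 * sb i * #|is_base d b i|%:R - 1 <= (x i)%:R.
    by rewrite lerBlDr natr1; apply: ltW; rewrite -truncn_le_nat.
  lra.
apply: le_trans (PE_markov GP _ _) _; first by rewrite divr_gt0.
  by move=> f; apply: sumr_ge0.
rewrite PE_sum ler_pdivrMr ?divr_gt0 //.
have -> : 8 * (\sum_(i < b | (i0 <= i)%N && (J2 <= i)%N) expR (- m i)) * (nC / 8) =
  nC * \sum_(i < b | (i0 <= i)%N && (J2 <= i)%N) expR (- m i) by field.
rewrite mulr_sumr.
apply: ler_sum => i /andP[i0i _]; have ib : (i0 <= i < b)%N by rewrite i0i ltn_ord.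
rewrite mulrC; exact: (step_failures_mean qgp sb0 sbP ib).
Qed.

End ExistGraph.

Section Tails.
Variable R : realType.
Implicit Types (c E eps : R).

(** Both exponential factors are absorbed in one application of [superpoly], with an exponent one
    larger, which leaves a geometric series of ratio 1/2. *)
Lemma exp_tail c E (B B' : nat) eps : 0 < c -> 1 < E -> 0 < eps ->
  exists i1 : nat, forall j b, (i1 <= j)%N ->
  \sum_(i < b | (j <= i)%N) expR (- (c * E ^+ i)) * 2 ^+ (B * i) <= eps / 2 ^+ (B' * j).
Proof.
move=> c0 E1 eps0; have [i1 h1] := @superpoly R c E (B + B').+1 1 c0 E1 ltr01.
have half01 : 0 < (2^-1 : R) < 1 by lra.
have [i2 h2] := @geometric_small R 2^-1 2 eps half01 eps0.
exists (maxn i1 i2) => j b; rewrite geq_max => /andP[ij1 ij2].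
rewrite ler_pdivlMr ?exprn_gt0 //.
apply: (@le_trans _ _ (\sum_(i < b | (j <= i)%N) 2^-1 ^+ i)).
  rewrite mulr_suml; apply: ler_sum => i ji; have := h1 i (leq_trans ij1 ji).
  rewrite mulSn addnC exprD mulrA -ler_pdivlMr ?exprn_gt0 // => h.
  apply: le_trans (_ : expR (- (c * E ^+ i)) * 2 ^+ ((B + B') * i) <= _); last by rewrite exprVn -[leRHS]mul1r.
  rewrite mulnDl exprD mulrA ler_wpM2l ?mulr_ge0 ?expR_ge0 ?exprn_ge0 //.
  by rewrite ler_weXn2l ?ler1n // leq_mul2l ji orbT.
apply: le_trans (geometric_tail j b half01) _; apply: le_trans (h2 j ij2).
by rewrite mulrC; have -> : (1 - 2^-1)^-1 = 2 :> R by field.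
Qed.

Lemma base_card_ge d b i : (0 < d)%N -> (i <= b)%N -> (b - i <= #|is_base d b i|)%N.
Proof.
move=> d0 ib; rewrite -(@leq_pmul2r (2 ^ (d * i))) ?expn_gt0 // card_base //.
have -> : (2 ^ (d * b) = 2 ^ (d * (b - i)) * 2 ^ (d * i))%N by rewrite -expnD -mulnDr subnK.
rewrite leq_mul2r; apply/orP; right; apply: leq_trans (ltnW (ltn_expl _ (ltnSn 1))) _.
by rewrite leq_exp2l // leq_pmull.
Qed.

(** Only boundedly many scales occur, and at each of them the number of boxes tends to infinity with
    [b]. *)
Lemma base_exp_small d (i0 j : nat) (g : nat -> R) eps : (0 < d)%N -> (forall i, (i0 <= i)%N -> 0 < g i) -> 0 < eps ->
  exists b1 : nat, forall b, (b1 <= b)%N ->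
  \sum_(i < j | (i0 <= i)%N) expR (2^-1 - g i * #|is_base d b i|%:R) <= eps.
Proof.
move=> d0 g0; elim: j eps => [|j IH] eps eps0.
  by exists 0%N => b _; rewrite big_ord0 ltW.
have e2 : 0 < eps / 2 by rewrite divr_gt0.
have [b1 h1] := IH _ e2; case: (leqP i0 j) => i0j; last first.
  exists b1 => b bb; rewrite big_mkcond big_ord_recr /= -big_mkcond leqNgt i0j addr0.
  by apply: le_trans (h1 b bb) _; lra.
have [y hy] := nat_above ((2^-1 - ln (eps / 2)) / g j).
exists (maxn b1 (j + y)) => b; rewrite geq_max => /andP[bb jb].
rewrite big_mkcond big_ord_recr /= -big_mkcond i0j /=.
have -> : eps = eps / 2 + eps / 2 by field.
apply: lerD; first exact: h1.
rewrite -[leRHS](lnK (_ : eps / 2 \in Num.pos)) ?posrE // ler_expR.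
have ib : (j <= b)%N := leq_trans (leq_addr _ _) jb.
have yb : (y <= b - j)%N by move: jb; clear; lia.
have := hy (b - j)%N yb; rewrite ler_pdivrMr ?g0 // => h.
have : (b - j)%:R * g j <= #|is_base d b j|%:R * g j.
  by rewrite ler_wpM2r ?ler_nat ?base_card_ge // ltW // g0.
lra.
Qed.

End Tails.

Section ScaleSequence.
Variables (nx : nat -> nat) (i0 b : nat).
Hypothesis i0b : (i0 <= b)%N.
Hypothesis nx_le : forall i, (nx i <= b)%N.
Hypothesis nx_gt : forall i, (i0 <= i < b)%N -> (i < nx i)%N.

Lemma scale_sequence : exists2 N, sc nx i0 N = b & forall j, (j < N)%N -> (i0 <= sc nx i0 j < b)%N.
Proof.
have lb j : (sc nx i0 j <= b)%N by case: j => [|j] //=; exact: nx_le.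
have grow j : (forall j', (j' < j)%N -> sc nx i0 j' != b) -> (i0 + j <= sc nx i0 j)%N.
  elim: j => [|j IH] h; first by rewrite addn0.
  have h1 := IH (fun j' jj => h j' (ltnW jj)).
  have := nx_gt (i := sc nx i0 j); rewrite -[nx _]/(sc nx i0 j.+1).
  rewrite ltn_neqAle h //= lb andbT => /(_ (leq_trans (leq_addr _ _) h1)).
  by move=> h2; rewrite addnS; apply: leq_ltn_trans h2.
have ex : exists j, sc nx i0 j == b.
  have [/existsP[j /eqP e]|] := boolP [exists j : 'I_b.+1, sc nx i0 j == b]; first by exists j; rewrite e.
  rewrite negb_exists => /forallP h.
  have := grow b.+1 (fun j' jj => h (Ordinal jj)); have := lb b.+1; lia.
exists (ex_minn ex); first by case: ex_minnP => N /eqP.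
case: ex_minnP => N _ mn j jN.
have ne j' : (j' <= j)%N -> sc nx i0 j' != b.
  by move=> jj; apply/negP => /mn; rewrite leqNgt (leq_ltn_trans jj).
rewrite ltn_neqAle ne // lb !andbT; apply: leq_trans (grow j _); first exact: leq_addr.
by move=> j' jj; apply: ne; apply: ltnW.
Qed.

End ScaleSequence.

Section Existence.
Variables (R : realType) (d : nat) (tau alpha beta gam eta th : R) (D : probability (measurableTypeR R) R).
Hypothesis d_gt0 : (0 < d)%N.
Hypotheses (tau2 : 2 < tau) (alpha1 : 1 < alpha) (gam1 : 1 < gam) (eta0 : 0 < eta) (th0 : 0 < th) (th1 : th <= 1).
Hypothesis etaP : eta * (12 * (tau - 1) + 1 + alpha * gam) < 1 - alpha * gam * (tau - 2).
Hypothesis beta1 : 1 < beta.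
Variables (c5 C5 : R) (l0 : nat).
Hypotheses (c50 : 0 < c5) (C50 : 0 < C5).
Hypothesis massP : forall l, (l0 <= l)%N ->
  c5 * dyadic_decay tau ^+ l <= fP D (@dyadic R l) <= C5 * dyadic_decay tau ^+ l.
Local Notation a := (hub_class d tau eta).
Local Notation z := (sub_scale tau eta).
Local Notation m := (min_connectors d tau alpha gam eta th).

Lemma pow2_gt1 (x : R) : 0 < x -> 1 < 2 `^ x.
Proof.
move=> x0; rewrite /powR pnatr_eq0 /= -[ltLHS]expR0 ltr_expR mulr_gt0 // ln_gt0 // (ltr_nat R 1 2)//.
Qed.

Lemma sigma_pos : 0 < sigma tau eta.
Proof. exact: (sigma_gt0 tau2 alpha1 gam1 eta0 etaP). Qed.

(* Below this scale hubs or sub-boxes may be missing with too large a probability. *)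
Lemma scales_large : exists i1 : nat, forall i, (i1 <= i)%N ->
  [/\ (32 <= 2 ^ (d * z i))%N, (l0 <= a i)%N & (i < up_scale gam i)%N].
Proof.
have s0 := sigma_pos.
have dR : 1 <= d%:R :> R by rewrite ler1n.
have [i1 h1] := nat_above (6 / sigma tau eta).
have [i2 h2] := nat_above ((l0%:R + 1) / sigma tau eta).
have [i3 h3] := nat_above (3 / (gam - 1)).
have g0 : 0 < gam - 1 by rewrite subr_gt0.
exists (maxn i1 (maxn i2 i3)) => i; rewrite !geq_max => /and3P[/h1 g1 /h2 g2 /h3 g3].
move: g1 g2 g3; rewrite !ler_pdivrMr // => g1 g2 g3; split.
- have /andP[z1 _] := sub_scale_bounds tau2 alpha1 gam1 eta0 etaP i.
  have z5 : (5 <= z i)%N by rewrite -(ler_nat R); lra.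
  apply: (@leq_trans (2 ^ 5)) => //; rewrite leq_exp2l //; apply: leq_trans z5 _.
  by rewrite leq_pmull.
- have /andP[a1 _] := hub_class_bounds d tau2 alpha1 gam1 eta0 etaP i.
  rewrite -(ler_nat R).
  have : sigma tau eta * i%:R <= d%:R * sigma tau eta * i%:R.
    by rewrite ler_wpM2r // ler_peMl // ltW.
  lra.
- have /andP[u1 _] := up_scale_bounds tau2 alpha1 gam1 eta0 i.
  rewrite -(ltr_nat R); lra.
Qed.

Definition config_fail i : R := expR (- (c5 * hub_growth d eta ^+ i)) +
  (2 ^ (d * i))%:R * expR (- (2 `^ (- d%:R) / 4 * (2 `^ (d%:R * sigma tau eta)) ^+ i)).

Lemma config_fail_gt0 i : 0 < config_fail i.
Proof. by rewrite addr_gt0 ?mulr_gt0 ?expR_gt0 // ltr0n expn_gt0. Qed.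

Lemma scale_fail_le M lam i : 1 <= lam -> (l0 <= a i)%N -> (a i < M)%N ->
  scale_fail d lam (@class_prob R M D) a z i <= config_fail i.
Proof.
move=> lam1 la aM; apply: lerD.
  exact: (hubless_small tau2 alpha1 gam1 eta0 etaP c50 massP).
by rewrite ler_wpM2l //; exact: (few_small d tau2 alpha1 gam1 eta0 etaP).
Qed.

Lemma config_fail_tail (B : nat) eps : 0 < eps -> exists i1 : nat, forall j b, (i1 <= j)%N ->
  \sum_(i < b | (j <= i)%N) config_fail i <= eps / 2 ^+ (B * j).
Proof.
move=> eps0; have e2 : 0 < eps / 2 by rewrite divr_gt0.
have E1 := hub_growth_gt1 d_gt0 eta0.
have E2 : 1 < 2 `^ (d%:R * sigma tau eta) :> R.
  by apply: pow2_gt1; rewrite mulr_gt0 ?sigma_pos // ltr0n.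
have c2 : 0 < 2 `^ (- d%:R) / 4 :> R by rewrite divr_gt0 // powR_gt0.
have [i1 h1] := exp_tail 0 B c50 E1 e2; have [i2 h2] := exp_tail d B c2 E2 e2.
exists (maxn i1 i2) => j b; rewrite geq_max => /andP[j1 j2].
rewrite big_split /=; have -> : eps / 2 ^+ (B * j) = eps / 2 / 2 ^+ (B * j) + eps / 2 / 2 ^+ (B * j).
  by rewrite -mulrDl -splitr.
apply: lerD.
  apply: le_trans (h1 j b j1); apply: ler_sum => i _; by rewrite mul0n mulr1.
by apply: le_trans (h2 j b j2); apply: ler_sum => i _; rewrite natrX mulrC.
Qed.

Lemma connectors_growth : 1 < 2 `^ e6 d tau alpha gam eta :> R.
Proof.
apply: pow2_gt1; apply: lt_trans (e6_large d_gt0 tau2 alpha1 gam1 eta0 etaP).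
by rewrite !mulr_gt0 // ltr0n.
Qed.

Lemma cm_gt0 : 0 < cm d alpha th.
Proof. by rewrite /cm !mulr_gt0 ?powR_gt0 ?exprn_gt0 ?hlink_gt0 // invr_gt0. Qed.

Lemma connectors_tail (B : nat) eps : 0 < eps -> exists i1 : nat, forall j b, (i1 <= j)%N ->
  \sum_(i < b | (j <= i)%N) expR (- m i) <= eps / 2 ^+ (B * j).
Proof.
move=> eps0; have [i1 h1] := exp_tail 0 B cm_gt0 connectors_growth eps0.
exists i1 => j b ij; apply: le_trans (h1 j b ij); apply: ler_sum => i _.
by rewrite mul0n mulr1.
Qed.

(** The order of choices matters: [i0], and with it [c0], is fixed first by tails of size 1/64. Only
    then does [eps] determine [J2], above which Markov is precise enough, and finally [b1], from
    which the concentration below [J2] takes effect. *)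
Lemma giant_exists : exists2 c0 : R, 0 < c0 & forall eps : R, 0 < eps ->
  exists b1 : nat, forall b n M, (b1 <= b)%N -> (d * b < M)%N ->
  1 <= @cell_rate R d n b <= 2 ^+ d ->
  exists conf : (forall k, {ffun 'I_k -> cellT d b} -> {ffun 'I_k -> 'I_M.+1} -> bool),
  (forall K pi, @sub_poisson R d n b K pi -> CE K pi (@class_prob R M D) (fun k c l => (~~ conf k c l)%:R) <= eps) /\
  (forall k (c : {ffun 'I_k -> cellT d b}) (l : {ffun 'I_k -> 'I_M.+1}) q,
    (forall i, (l i < M)%N) -> conf k c l ->
    admissible th alpha beta (@cell_rate R d n b) c (fun i => l i) q ->
    GE q (fun f => (~~ big_component d b c0 f)%:R) <= eps).
Proof.
have e64 : 0 < 64^-1 :> R by rewrite invr_gt0.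
have [i1 h1] := scales_large; have [i2 h2] := config_fail_tail 0 e64; have [i3 h3] := connectors_tail 0 e64.
have [i0 [i10 i20 i30]] : exists i0, [/\ i1 <= i0, i2 <= i0 & i3 <= i0]%N.
  by exists (maxn i1 (maxn i2 i3)); rewrite !leq_max !leqnn !orbT.
have i0P i : (i0 <= i)%N -> (32 <= 2 ^ (d * z i))%N by move=> ii; have [] := h1 i (leq_trans i10 ii).
have dl0 := hub_prob_gt0 d tau alpha eta th0 i0.
exists (hub_prob d tau alpha eta th i0 / 64); first by rewrite divr_gt0.
set dl := hub_prob d tau alpha eta th i0 in dl0 *.
move=> eps eps0.
have e4 : 0 < eps / 32 by rewrite divr_gt0.
have [j1 g1] := config_fail_tail 0 e4; have [j2 g2] := connectors_tail 0 e4.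
have w0 (F : nat -> R) (j1' : nat) x : (forall j b, (j1' <= j)%N -> \sum_(i < b | (j <= i)%N) F i <= x / 2 ^+ (0 * j)) ->
    forall j b, (j1' <= j)%N -> \sum_(i < b | (j <= i)%N) F i <= x.
  by move=> h j b /(h j b); rewrite mul0n divr1.
have {}h2 := w0 _ _ _ h2; have {}h3 := w0 (fun i => expR (- m i)) _ _ h3; have {}g1 := w0 _ _ _ g1; have {}g2 := w0 (fun i => expR (- m i)) _ _ g2.
have [J2 [i0J j1J j2J]] : exists J2, [/\ i0 <= J2, j1 <= J2 & j2 <= J2]%N.
  by exists (maxn i0 (maxn j1 j2)); rewrite !leq_max !leqnn !orbT.
have gA i : (i0 <= i)%N -> 0 < config_fail i / (2 ^ (d * i))%:R.
  by move=> _; rewrite divr_gt0 ?config_fail_gt0 // ltr0n expn_gt0.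
have gB i : (i0 <= i)%N -> 0 < expR (- m i) by move=> _; exact: expR_gt0.
have [b1 k1] := base_exp_small J2 d_gt0 gA e4; have [b2 k2] := base_exp_small J2 d_gt0 gB e4.
have [b3 k3] := nat_above (- ln (eps / 32) / (dl / 64)).
exists (maxn J2 (maxn b1 (maxn b2 b3))) => b n M; rewrite !geq_max => /and4P[bJ bb1 bb2 bb3] dM /andP[lam1 lamd].
have i0b : (i0 <= b)%N by exact: leq_trans i0J bJ.
set lam := @cell_rate R d n b in lam1 lamd *.
have nxg i : (i0 <= i < b)%N -> (i < next_scale gam b i)%N.
  by move=> /andP[ii ib]; rewrite leq_min ib; have [] := h1 i (leq_trans i10 ii).
have [N scN sc_lt] := scale_sequence i0b (next_scale_le gam b) nxg.
have z_le i : (z i <= i)%N by exact: (sub_scale_le tau2 alpha1 gam1 eta0 etaP).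
exists (exist_config a z i0 J2 (@kernel R d b M.+1 i0 (4 `^ beta) beta (@weight1 R beta M)) (load_bound d tau eta) config_fail).
have sumJ (F : nat -> R) (x : R) (j : nat) : (forall i, 0 < F i) -> (j <= J2)%N ->
    (forall b, \sum_(i < b | (j <= i)%N) F i <= x) -> forall b, \sum_(i < b | (i0 <= i)%N && (J2 <= i)%N) F i <= x.
  move=> F0 jJ Fx b'; apply: le_trans (Fx b'); rewrite big_mkcond [leRHS]big_mkcond; apply: ler_sum => i _.
  case: (leqP j i) => ji; case: ifP => // h; first exact: ltW.
  by case/andP: h => _; rewrite leqNgt (leq_trans ji jJ).
split.
  move=> K pi [pi0 piP].
  apply: le_trans (exist_config_prob lam1 pi0 (@class_prob_ge0 R D M) (class_prob_sum D M) piP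
    (@kernel R d b M.+1 i0 (4 `^ beta) beta (@weight1 R beta M)) (load_bound d tau eta) z_le bJ (fb := config_fail) _) _.
    move=> i /andP[ii ib]; split; first exact: config_fail_gt0.
    have [_ la _] := h1 i (leq_trans i10 ii); apply: scale_fail_le => //.
    apply: leq_ltn_trans dM; apply: leq_trans (hub_class_le d tau2 alpha1 gam1 eta0 etaP i) _.
    by rewrite leq_mul2l ib orbT.
  have t1 := k1 b bb1; rewrite -mulr_sumr.
  have t2 := sumJ config_fail (eps / 32) j1 config_fail_gt0 _ (fun b => g1 j1 b (leqnn _)).
    have := t2 j1J b.+1; lra.
move=> k c l q heavy cfg adm.
have tail64 (F : nat -> R) (j : nat) : (forall i, 0 < F i) -> (j <= i0)%N ->
    (forall j' b', (j <= j')%N -> \sum_(i < b' | (j' <= i)%N) F i <= 64^-1) -> 8 * \sum_(i < J2 | (i0 <= i)%N) F i <= 8^-1.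
  by move=> F0 ji Fx; have := Fx i0 J2 ji; lra.
apply: le_trans (big_component_prob d_gt0 tau2 alpha1 gam1 eta0 th0 th1 etaP beta1 lam1 lamd i0P i0b bJ scN sc_lt _ _ heavy cfg adm) _.
- exact: (tail64 _ i2 config_fail_gt0 i20 h2).
- exact: (tail64 (fun i => expR (- m i)) i3 (fun i => expR_gt0 _) i30 h3).
have t1 := k2 b bb2.
have t2 := sumJ (fun i => expR (- m i)) (eps / 32) j2 (fun i => expR_gt0 _) j2J (fun b => g2 j2 b (leqnn _)) b.
have t3 : expR (- (dl * (2 ^ (d * b))%:R / 64)) <= eps / 32.
  rewrite -[leRHS](lnK (_ : eps / 32 \in Num.pos)) ?posrE // ler_expR lerNl.
  have d64 : 0 < dl / 64 by rewrite pmulr_rgt0 // invr_gt0.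
  have := k3 (2 ^ (d * b))%N; rewrite (ler_pdivrMr _ _ d64) => h.
  apply: le_trans (h _) _; last by lra.
  apply: leq_trans bb3 (leq_trans (ltnW (ltn_expl _ (ltnSn 1))) _).
  by rewrite leq_exp2l // leq_pmull.
rewrite -/dl; lra.
Qed.

End Existence.

Section LocalConfig.
Variables (R : realType) (d : nat) (tau alpha beta bt2 gam eta : R) (D : probability (measurableTypeR R) R).
Hypothesis d_gt0 : (0 < d)%N.
Hypotheses (tau2 : 2 < tau) (alpha1 : 1 < alpha) (gam1 : 1 < gam) (eta0 : 0 < eta).
Hypothesis etaP : eta * (12 * (tau - 1) + 1 + alpha * gam) < 1 - alpha * gam * (tau - 2).
Hypotheses (beta1 : 1 < beta) (beta_tau : beta < tau - 1) (bt21 : 1 < bt2) (bt2_tau : bt2 < tau - 1).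
Variables (c5 C5 : R) (l0 : nat).
Hypotheses (c50 : 0 < c5) (C50 : 0 < C5).
Hypothesis massP : forall l, (l0 <= l)%N ->
  c5 * dyadic_decay tau ^+ l <= fP D (@dyadic R l) <= C5 * dyadic_decay tau ^+ l.
Variables (n b M K : nat) (pi : forall k, {ffun 'I_k -> cellT d b} -> R).
Local Notation lam := (@cell_rate R d n b).
Hypotheses (lam1 : 1 <= lam) (lamd : lam <= 2 ^+ d).
Hypothesis subp : @sub_poisson R d n b K pi.
Hypothesis dM : (d * b < M)%N.
Variables (i0 J L : nat) (y0 y2 y3 y4 y5 : R).
Hypotheses (i0b : (i0 <= b)%N) (Jb : (J <= b)%N).
Hypotheses (y00 : 0 < y0) (y20 : 0 < y2) (y30 : 0 < y3) (y40 : 0 < y4) (y50 : 0 < y5).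
Hypothesis i0l : forall i, (i0 <= i)%N -> (l0 <= hub_class d tau eta i)%N.
Local Notation a := (hub_class d tau eta).
Local Notation z := (sub_scale tau eta).
Local Notation Mc := (load_bound d tau eta).
Local Notation nC := ((2 ^ (d * b))%:R : R).
Local Notation C3 := (pois_cube (2 ^+ d : R)).
Local Notation km := (ker_mass d i0 (4 `^ beta) beta).
Local Notation mu := (weight_bound tau C5 l0 beta).
Local Notation CEx := (@CE R (cellT d b) 'I_M.+1 K pi (@class_prob R M D)).

Let pi0 := proj1 subp.
Let piP := proj2 subp.
Let D0 := @class_prob_ge0 R D M.
Let D1 := class_prob_sum D M.
Let lam0 : 0 <= lam. Proof. exact: le_trans ler01 lam1. Qed.
Let nC0 : 0 < nC. Proof. by rewrite ltr0n expn_gt0. Qed.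
Let KA0 : 0 <= 4 `^ beta :> R. Proof. exact: powR_ge0. Qed.
Let W1 := @weight1_ge1 R beta beta1 M.

Lemma pois_cube_mono (x y : R) : x <= y -> pois_cube x <= pois_cube y.
Proof.
by move=> xy; rewrite ler_pM2l // ler_expR ler_wpM2r // subr_ge0 -expR0 ler_expR.
Qed.

Lemma pois_cube_gt0 (x : R) : 0 < pois_cube x.
Proof. by rewrite mulr_gt0 ?expR_gt0. Qed.

Let C3le : pois_cube lam <= C3. Proof. exact: pois_cube_mono. Qed.
Let C30 : 0 <= pois_cube lam. Proof. exact/ltW/pois_cube_gt0. Qed.

Lemma mean1_bounds : 1 <= mean1 (@class_prob R M D) (@weight1 R beta M) <= mu.
Proof.
apply/andP; split; first exact: (mean1_ge1 D0 D1 W1).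
by apply: (weight_mean C50 massP) => //; apply: lt_trans ltr01 beta1.
Qed.

Lemma bad_hub_rate_le i : (i0 <= i)%N -> (i <= b)%N ->
  bad_hub_rate d lam (@class_prob R M D) a z i0 (4 `^ beta) beta (@weight1 R beta M) Mc i <=
  3 * C3 * (C5 * 2 `^ (tau - 1)) * km * mu ^+ 2 * (hub_growth d eta)^-1 ^+ i.
Proof.
move=> ii ib; rewrite /bad_hub_rate /load_bound.
have /andP[m1 m2] := mean1_bounds; set m := mean1 _ _ in m1 m2 *.
have km0 := ker_mass_ge0 d i0 KA0 beta1.
have aM : (a i < M)%N.
  apply: leq_ltn_trans dM; apply: leq_trans (hub_class_le d tau2 alpha1 gam1 eta0 etaP i) _.
  by rewrite leq_mul2l ib orbT.
have hm := hub_mass_bound tau2 alpha1 gam1 eta0 etaP C50 massP (i0l ii) aM.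
have z0 : 0 < (2 ^ (d * z i))%:R :> R by rewrite ltr0n expn_gt0.
have hg0 : 0 < hub_growth d eta by apply: lt_trans (hub_growth_gt1 d_gt0 eta0).
have lbE : load_base d eta ^+ i = hub_growth d eta ^+ i * hub_growth d eta ^+ i.
  rewrite -exprMn; congr (_ ^+ _); rewrite /load_base /hub_growth -powRD ?pnatr_eq0 ?implybT //.
  by congr (_ `^ _); ring.
rewrite lbE exprVn; set h := hub_growth d eta ^+ i in hm *.
have h0 : 0 < h by rewrite exprn_gt0.
set x := (2 ^ (d * i))%:R in hm *; set y := class_mass _ _ in hm *; set zz := (2 ^ (d * z i))%:R in z0 *.
have m0 : 0 <= m := le_trans ler01 m1.
have xy0 : 0 <= x * y.
  by rewrite mulr_ge0 // /y /class_mass sumr_ge0.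
have -> : 3 * pois_cube lam * (x * zz * km) * (y * m * m) / (zz * (h * h)) =
   3 * pois_cube lam * km * (m * m) * (x * y) / (h * h).
  by field; rewrite !gt_eqF.
have -> : 3 * C3 * (C5 * 2 `^ (tau - 1)) * km * mu ^+ 2 / h =
   3 * C3 * km * (mu * mu) * (C5 * 2 `^ (tau - 1) * h) / (h * h).
  by field; rewrite gt_eqF.
rewrite ler_pM2r ?invr_gt0 ?mulr_gt0 //.
apply: ler_pM => //; first by rewrite !mulr_ge0.
apply: ler_pM; rewrite ?mulr_ge0 //; last exact: ler_pM.
by apply: ler_wpM2r => //; rewrite ler_pM2l.
Qed.

Lemma local_config_prob :
  CEx (fun k cc l => (~~ local_config tau beta bt2 eta i0 J L y0 y2 y3 y4 y5 cc l)%:R) <=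
  3 * C3 * nC * class_prob D (@ord_max M) +
  (overfull_prob d lam i0 L + \sum_(i < b.+1 | (i0 <= i)%N) scale_fail d lam (@class_prob R M D) a z i +
    \sum_(i < b.+1 | (i0 <= i)%N && (J <= i)%N)
      bad_hub_rate d lam (@class_prob R M D) a z i0 (4 `^ beta) beta (@weight1 R beta M) Mc i) / y0 +
  C3 / y2 + 3 * C3 * (km + km ^+ 2) * mu ^+ 3 / y3 + 3 * C3 * (3 * (2 ^ (d * J))%:R * km) * mu ^+ 2 / y4 +
  3 * C3 * weight_bound tau C5 l0 bt2 / y5.
Proof.
have /andP[m1 m2] := mean1_bounds; set mm := mean1 _ _ in m1 m2 *.
have mm0 : 0 <= mm := le_trans ler01 m1.
have mu0 : 0 <= mu := le_trans mm0 m2.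
have km0 := ker_mass_ge0 d i0 KA0 beta1.
have Mc0 i : 0 < Mc i.
  rewrite /load_bound mulr_gt0 ?ltr0n ?expn_gt0 // exprn_gt0 //.
  by apply: lt_trans (load_base_gt1 d_gt0 eta0).
have z_le i : (z i <= i)%N by exact: (sub_scale_le tau2 alpha1 gam1 eta0 etaP).
pose F0 k (cc : {ffun 'I_k -> cellT d b}) (l : {ffun 'I_k -> 'I_M.+1}) : R := \sum_i (val (l i) == M)%:R.
pose F1 k (cc : {ffun 'I_k -> cellT d b}) (l : {ffun 'I_k -> 'I_M.+1}) : R :=
  #|[pred c | ~~ cchain cc (classes l) a z i0 J L (kernel i0 (4 `^ beta) beta (@weight1 R beta M) cc l) Mc c]|%:R.
pose F2 k (cc : {ffun 'I_k -> cellT d b}) (l : {ffun 'I_k -> 'I_M.+1}) : R := \sum_c (cell_count cc c)%:R ^+ 2.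
pose F3 k (cc : {ffun 'I_k -> cellT d b}) (l : {ffun 'I_k -> 'I_M.+1}) : R :=
  sqload_sum i0 (4 `^ beta) beta (@weight1 R beta M) cc l.
pose F4 k (cc : {ffun 'I_k -> cellT d b}) (l : {ffun 'I_k -> 'I_M.+1}) : R :=
  boxload_sum i0 (4 `^ beta) beta (@weight1 R beta M) J cc l.
pose F5 k (cc : {ffun 'I_k -> cellT d b}) (l : {ffun 'I_k -> 'I_M.+1}) : R := \sum_v @weight1 R bt2 M (l v).
have k0 k (cc : {ffun 'I_k -> cellT d b}) l y v : 0 <= kernel i0 (4 `^ beta) beta (@weight1 R beta M) cc l y v.
  by rewrite /kernel !mulr_ge0 ?ker_ge0 // (le_trans ler01).
have w0 (j : 'I_M.+1) : 0 <= @weight1 R beta M j by apply: le_trans ler01 (W1 j).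
have F00 k cc l : 0 <= F0 k cc l by exact: sumr_ge0.
have F30 k cc l : 0 <= F3 k cc l.
  apply: sumr_ge0 => y _; rewrite mulr_ge0 ?invr_ge0 // addr_ge0 ?sumr_ge0 // => v _.
  by apply: sumr_ge0 => t _; rewrite mulr_ge0.
have F40 k cc l : 0 <= F4 k cc l.
  by apply: sumr_ge0 => y _; apply: sumr_ge0 => v _; apply: sumr_ge0.
have F50 k cc l : 0 <= F5 k cc l.
  by apply: sumr_ge0 => v _; apply: le_trans ler01 (weight1_ge1 bt21 _).
have mk F y : 0 < y -> (forall k cc l, 0 <= F k cc l) -> forall x, CEx F <= nC * x ->
    CEx (fun k cc l => (nC * y <= F k cc l)%R%:R) <= x / y.
  move=> yp Fp x Fx; apply: le_trans (CE_markov K pi0 D0 D1 (mulr_gt0 nC0 yp) Fp) _.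
  rewrite ler_pdivrMr ?mulr_gt0 // mulrA [x / y * nC]mulrAC divfK ?gt_eqF // mulrC.
  exact: Fx.
apply: (@le_trans _ _ (CEx (fun k cc l => F0 k cc l + (nC * y0 <= F1 k cc l)%R%:R + (nC * y2 <= F2 k cc l)%R%:R +
   (nC * y3 <= F3 k cc l)%R%:R + (nC * y4 <= F4 k cc l)%R%:R + (nC * y5 <= F5 k cc l)%R%:R))).
  apply: le_CE => // k cc l.
  rewrite /local_config !negb_and -!ltNge.
  have nn (B : bool) : (0 : R) <= B%:R by [].
  have f0 := F00 k cc l.
  have h0 : ~~ [forall i, (l i < M)%N] -> 1 <= F0 k cc l.
    rewrite negb_forall => /existsP[i]; rewrite -leqNgt => Ml.
    rewrite /F0 (bigD1 i) //= eqn_leq Ml -ltnS ltn_ord lerDl sumr_ge0 //.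
  case: [forall i, _] h0 => /= [_|/(_ isT) h0]; last first.
    by rewrite -!addrA; apply: le_trans h0 _; rewrite lerDl !addr_ge0.
  rewrite -/(F1 k cc l) -/(F2 k cc l) -/(F3 k cc l) -/(F4 k cc l) -/(F5 k cc l).
  have n1 := nn (nC * y0 <= F1 k cc l)%R; have n2 := nn (nC * y2 <= F2 k cc l)%R.
  have n3 := nn (nC * y3 <= F3 k cc l)%R; have n4 := nn (nC * y4 <= F4 k cc l)%R.
  have n5 := nn (nC * y5 <= F5 k cc l)%R.
  case: (leP (F1 k cc l)) => h1 /=; last by rewrite (ltW h1) /=; lra.
  case: (leP (F2 k cc l)) => h2 /=; last by rewrite (ltW h2) /=; lra.
  case: (leP (F3 k cc l)) => h3 /=; last by rewrite (ltW h3) /=; lra.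
  case: (leP (F4 k cc l)) => h4 /=; last by rewrite (ltW h4) /=; lra.
  case: (leP (F5 k cc l)) => h5 /=; last by rewrite (ltW h5) /=; lra.
  by rewrite !addr_ge0.
rewrite !CED; repeat apply: lerD.
- have := CE_moment1 lam0 pi0 D0 D1 piP (A := fun=> 1) (a := fun j : 'I_M.+1 => (val j == M)%:R) (fun=> ler01) (fun=> ler0n _ _).
  rewrite sumr_const card_cellT => h.
  apply: le_trans (_ : 3 * pois_cube lam * nC * class_prob D (@ord_max M) <= _); last first.
    apply: ler_wpM2r; first exact: D0.
    by apply: ler_wpM2r; [exact: ltW|rewrite ler_pM2l].
  apply: le_trans (le_trans h _).
    by apply: le_CE => // k cc l; apply: ler_sum => i _; rewrite mul1r.
  rewrite ler_wpM2l ?mulr_ge0 // /Dmean (bigD1 ord_max) //= eqxx mulr1 big1 ?addr0 //.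
  by move=> j; rewrite -val_eqE /= => /negbTE ->; rewrite mulr0.
- apply: mk => //; exact: (nonchain_mean lam1 pi0 D0 D1 piP).
- apply: mk => //; first by move=> *; exact: sumr_ge0.
  apply: le_trans (cells_square_mean lam1 pi0 D0 D1 piP) _; by rewrite ler_pM2l.
- apply: mk => //; apply: le_trans (sqload_mean lam1 pi0 D0 D1 piP i0b KA0 beta1 W1) _.
  rewrite -/mm.
  have -> : 3 * pois_cube lam * (nC * (km + km ^+ 2)) * mm ^+ 3 = nC * (3 * pois_cube lam * (km + km ^+ 2) * mm ^+ 3) by ring.
  have kk0 : 0 <= km + km ^+ 2 := addr_ge0 km0 (exprn_ge0 2 km0).
  rewrite ler_pM2l //; apply: ler_pM; rewrite ?mulr_ge0 ?exprn_ge0 //.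
    by apply: ler_wpM2r; rewrite // ler_pM2l.
  by rewrite lerXn2r.
- apply: mk => //; apply: le_trans (boxload_mean lam1 pi0 D0 D1 piP i0b KA0 beta1 W1 Jb) _.
  rewrite -/mm.
  have -> : 3 * pois_cube lam * (nC * (3 * (2 ^ (d * J))%:R * km)) * mm ^+ 2 = nC * (3 * pois_cube lam * (3 * (2 ^ (d * J))%:R * km) * mm ^+ 2) by ring.
  rewrite ler_pM2l //; apply: ler_pM; rewrite ?mulr_ge0 ?exprn_ge0 //.
    by apply: ler_wpM2r; rewrite ?mulr_ge0 // ler_pM2l.
  by rewrite lerXn2r.
- apply: mk => //; apply: le_trans (sum_W2_mean lam1 pi0 D0 D1 piP (W2 := @weight1 R bt2 M) _) _.
    by move=> j; apply: le_trans ler01 (weight1_ge1 bt21 _).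
  have w20 : 0 <= Dmean (@class_prob R M D) (@weight1 R bt2 M).
    by apply: Dmean_ge0 => // j; apply: le_trans ler01 (weight1_ge1 bt21 _).
  have -> : 3 * pois_cube lam * nC * Dmean (@class_prob R M D) (@weight1 R bt2 M) =
    nC * (3 * pois_cube lam * Dmean (@class_prob R M D) (@weight1 R bt2 M)) by ring.
  rewrite ler_pM2l //; apply: ler_pM; rewrite ?mulr_ge0 //; first by rewrite ler_pM2l.
  by apply: (weight_mean C50 massP) => //; apply: lt_trans ltr01 bt21.
Qed.

End LocalConfig.

Section Budget.
Variable R : realType.

(** All parameters are powers of 2^i0, chosen in turn: [s] beats the inverse hub probability, [A]
    beats [s * L] times the squared-degree bound, [A3] beats the factor [T]. Every failure
    probability at scale [i0] must then be below 2^(-B i0), which [exp_tail] grants for any [B]. *)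
Lemma budget_powers (ep eps y2 y5 ch ck : R) (g h d' e : nat) :
  0 < ep -> 0 < eps -> 0 < y2 -> 0 < y5 -> 0 < ch -> 0 < ck ->
  exists s1 A1 A2 B i1 : nat, forall i0, (i1 <= i0)%N -> forall dl y3,
  ch / 2 ^+ (g * i0) <= dl -> dl <= 1 -> 0 <= y3 -> y3 <= ck * 2 ^+ (h * i0) ->
  let sL : R := (2 ^ (s1 * i0) * 2 ^ (d' * i0))%:R in
  let A : R := 2 ^+ (A1 * i0) in let A3 : R := 2 ^+ (A2 * i0) in
  let T := 1 + sL * A ^+ e.+1 in
  [/\ y2 * (1 - dl) ^+ (2 ^ (s1 * i0)) / ep <= eps / 4,
      y2 / A3 * T <= eps / 4, sL * (y3 / ep + y5) / A <= eps / 4 & A3 * T <= 2 * 2 ^+ (B * i0)].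
Proof.
move=> ep0 eps0 y20 y50 ch0 ck0.
pose s1 := g.+1; pose A1 := (g.+1 + d' + h).+1; pose B0 := (g.+1 + d' + A1 * e.+1)%N.
exists s1, A1, B0.+1, (B0.+1 + B0)%N.
have e1 : 0 < eps / 4 / (y2 / ep) by rewrite !divr_gt0.
have [i1 h1] := superpoly 0 ch0 (ltr1n R 2 : 1 < 2) e1.
have half01 : 0 < (2^-1 : R) < 1 by lra.
have e4 : 0 < eps / 4 by rewrite divr_gt0.
have [i2 h2] := geometric_small (2 * y2) half01 e4.
have [i3 h3] := geometric_small (ck / ep + y5) half01 e4.
exists (maxn i1 (maxn i2 i3)) => i0; rewrite !geq_max => /and3P[/h1 k1 /h2 k2 /h3 k3] dl y3 dlo dl1 y30 y3h sL A A3 T.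
have p0 (x : nat) : 0 < 2 ^+ x :> R by rewrite exprn_gt0.
have p1 (x : nat) : 1 <= 2 ^+ x :> R by rewrite exprn_ege1 // ler1n.
have pn (x : nat) : 2 ^+ x != 0 :> R by rewrite gt_eqF.
have sLE : sL = 2 ^+ ((g.+1 + d') * i0) by rewrite /sL -expnD -mulnDl natrX.
have TE : T <= 2 * 2 ^+ (B0 * i0).
  have -> : T = 1 + 2 ^+ (B0 * i0).
    by rewrite /T sLE /A -exprM -exprD; congr (_ + 2 ^+ _); rewrite /B0; ring.
  by rewrite mulr_natl mulr2n lerD2r.
split.
- rewrite -mulrA mulrCA -ler_pdivlMr ?divr_gt0 //.
  move: k1; rewrite mul0n expr0 mulr1; apply: le_trans.
  have d0 : 0 <= 1 - dl by rewrite subr_ge0.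
  apply: le_trans (_ : expR (- dl) ^+ (2 ^ (s1 * i0)) <= _).
    rewrite lerXn2r ?nnegrE ?expR_ge0 //; have := expR_ge1Dx (- dl); lra.
  rewrite -expRM_natl ler_expR mulrN lerN2.
  apply: le_trans (_ : (2 ^ (s1 * i0))%:R * (ch / 2 ^+ (g * i0)) <= _); last by rewrite ler_wpM2l.
  rewrite natrX /s1 mulSn exprD le_eqVlt; apply/orP; left; apply/eqP; field; exact: pn.
- apply: le_trans (ler_wpM2l _ TE) _; first by rewrite divr_ge0 ?(ltW y20) // (ltW (p0 _)).
  apply: le_trans k2; rewrite /A3 mulSn exprD exprVn le_eqVlt; apply/orP; left; apply/eqP.
  by field; rewrite !pn.
- have -> : sL * (y3 / ep + y5) / A = (y3 / ep + y5) / (2 ^+ ((h.+1) * i0)).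
    rewrite sLE /A /A1; have -> : ((g.+1 + d' + h).+1 * i0 = (g.+1 + d') * i0 + h.+1 * i0)%N by ring.
    by rewrite exprD; field; rewrite !pn gt_eqF.
  apply: le_trans k3; rewrite exprVn ler_pdivrMr // mulSn exprD.
  have -> : (ck / ep + y5) / 2 ^+ i0 * (2 ^+ i0 * 2 ^+ (h * i0)) = (ck / ep + y5) * 2 ^+ (h * i0).
    by field; rewrite pn gt_eqF.
  rewrite mulrDl; apply: lerD; last by rewrite ler_peMr // ltW.
  by rewrite mulrAC ler_pM2r ?invr_gt0.
- by apply: le_trans (ler_wpM2l (ltW (p0 _)) TE) _; rewrite mulrCA ler_pM2l // /A3 -exprD -mulnDl.
Qed.

End Budget.

Section ScaleIterates.
Variables (R : realType) (tau alpha gam eta : R).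
Hypotheses (tau2 : 2 < tau) (alpha1 : 1 < alpha) (gam1 : 1 < gam) (eta0 : 0 < eta).
Variables (i0 b N jJ : nat).
Local Notation up := (@up_scale R gam).
Local Notation nx := (next_scale gam b).
Hypothesis scN : sc nx i0 N = b.
Hypothesis sc_lt : forall j, (j < N)%N -> (i0 <= sc nx i0 j < b)%N.
Hypothesis grow : forall i, (i0 <= i)%N -> (i < up i)%N.
Hypothesis Jb : (iter jJ up i0 < b)%N.

Lemma up_scale_mono i j : (i <= j)%N -> (up i <= up j)%N.
Proof.
move=> ij; rewrite /up_scale truncn_ge_nat; last by rewrite mulr_ge0 // ltW // (lt_trans ltr01).
have /andP[_ h] := up_scale_bounds tau2 alpha1 gam1 eta0 i; apply: le_trans h _.
by rewrite ler_pM2l ?ler_nat // (lt_trans ltr01).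
Qed.

Lemma iter_up_ge j : (i0 + j <= iter j up i0)%N.
Proof.
elim: j => [|j IH] /=; first by rewrite addn0.
by rewrite addnS; apply: leq_ltn_trans (IH) (grow (leq_trans (leq_addr _ _) IH)).
Qed.

Lemma iter_up_mono j j' : (j <= j')%N -> (iter j up i0 <= iter j' up i0)%N.
Proof.
move=> /subnKC <-; elim: (j' - j)%N => [|m IH]; first by rewrite addn0.
rewrite addnS /=; apply: leq_trans IH (ltnW (grow _)).
by apply: leq_trans (iter_up_ge _); rewrite leq_addr.
Qed.

Lemma sc_le_iter j : (sc nx i0 j <= iter j up i0)%N.
Proof.
elim: j => [|j IH] //; rewrite -[sc _ _ _]/(nx (sc nx i0 j)) iterS.
by apply: leq_trans (geq_minr _ _) (up_scale_mono IH).
Qed.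

Lemma sc_iter j : (j < N)%N -> sc nx i0 j = iter j up i0.
Proof.
elim: j => [|j IH] jN //; have /andP[_ lt] := sc_lt jN.
rewrite -[sc _ _ _]/(nx (sc nx i0 j)) iterS /next_scale -IH ?(ltnW jN) // in lt *.
by move: lt; rewrite gtn_min ltnn => /ltnW lt; apply/minn_idPr.
Qed.

(** Below the cap [b] the scales are the plain iterates of [up_scale], so the scale reached after
    [jJ] steps does not depend on [b]. *)
Lemma scale_window :
  [/\ (jJ <= N)%N, forall j, (jJ <= j < N)%N -> (iter jJ up i0 <= sc nx i0 j)%N &
      forall j, (j < jJ)%N -> (sc nx i0 j <= iter jJ up i0)%N].
Proof.
split.
- rewrite leqNgt; apply/negP => Nj; move: Jb; rewrite ltnNge => /negP[].
  by rewrite -scN; apply: leq_trans (sc_le_iter N) (iter_up_mono (ltnW Nj)).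
- by move=> j /andP[jj jN]; rewrite sc_iter // iter_up_mono.
- by move=> j jj; apply: leq_trans (sc_le_iter j) (iter_up_mono (ltnW jj)).
Qed.

End ScaleIterates.

Section LocalAsymptotic.
Variables (R : realType) (d : nat) (tau alpha beta bt2 gam eta th : R) (D : probability (measurableTypeR R) R).
Hypothesis d_gt0 : (0 < d)%N.
Hypotheses (tau2 : 2 < tau) (alpha1 : 1 < alpha) (gam1 : 1 < gam) (eta0 : 0 < eta) (th0 : 0 < th) (th1 : th <= 1).
Hypothesis etaP : eta * (12 * (tau - 1) + 1 + alpha * gam) < 1 - alpha * gam * (tau - 2).
Hypotheses (beta1 : 1 < beta) (beta_bt2 : beta < bt2) (bt2_tau : bt2 < tau - 1).
Variables (c5 C5 : R) (l0 : nat).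
Hypotheses (c50 : 0 < c5) (C50 : 0 < C5).
Hypothesis massP : forall l, (l0 <= l)%N ->
  c5 * dyadic_decay tau ^+ l <= fP D (@dyadic R l) <= C5 * dyadic_decay tau ^+ l.
Local Notation a := (hub_class d tau eta).
Local Notation z := (sub_scale tau eta).
Local Notation m := (min_connectors d tau alpha gam eta th).
Local Notation C3 := (pois_cube (2 ^+ d : R)).
Local Notation Mc := (load_bound d tau eta).
Local Notation Mg := (load_bound2 d tau eta).
Local Notation mu := (weight_bound tau C5 l0 beta).
Local Notation mu2 := (weight_bound tau C5 l0 bt2).

(** Put x = 2^((bt2 - beta) j). If x is at least A^2, the first term suffices; otherwise 2^(beta j),
    a power of x with exponent beta/(bt2 - beta), is at most A^(2 beta/(bt2 - beta)). *)
Lemma weight_split : exists e : nat, forall A : R, 1 <= A -> forall j : nat,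
  2 `^ (beta * j%:R) <= A ^- 2 * 2 `^ (bt2 * j%:R) + A ^+ e.
Proof.
have x0 : 0 < bt2 - beta by rewrite subr_gt0.
have [e he] := nat_above (2 * beta / (bt2 - beta)); exists e => A A1 j.
have A0 : 0 < A by apply: lt_le_trans A1.
set x := 2 `^ ((bt2 - beta) * j%:R).
have E : 2 `^ (bt2 * j%:R) = 2 `^ (beta * j%:R) * x :> R.
  by rewrite /x -powRD ?pnatr_eq0 ?implybT //; congr (_ `^ _); ring.
have p0 y : 0 <= 2 `^ y :> R by exact: powR_ge0.
have [h|h] := leP (A ^+ 2) x.
  rewrite -[leLHS]addr0; apply: lerD; last exact/ltW/exprn_gt0.
  by rewrite E mulrCA ler_peMr // mulrC ler_pdivlMr ?exprn_gt0 // mul1r.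
rewrite -[leLHS]add0r; apply: lerD; first by rewrite mulr_ge0 // invr_ge0 exprn_ge0 // ltW.
have -> : 2 `^ (beta * j%:R) = x `^ (beta / (bt2 - beta)).
  by rewrite /x -powRrM; congr (_ `^ _); field; rewrite gt_eqF.
have q0 : 0 <= beta / (bt2 - beta) by rewrite divr_ge0 ?(ltW x0) // ltW // (lt_trans ltr01).
apply: (@le_trans _ _ ((A ^+ 2) `^ (beta / (bt2 - beta)))).
  by apply: ge0_ler_powR => //; rewrite ?nnegrE ?exprn_ge0 ?powR_ge0 // ltW.
rewrite -powR_mulrn ?(ltW A0) // -powRrM -(powR_mulrn e (ltW A0)).
by rewrite ler_powR //; have := he e (leqnn e); rewrite mulrA.
Qed.

Lemma ker_mass_le i0 : ker_mass d i0 (4 `^ beta) beta <=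
  (4 `^ beta * (4 * decay_sum beta) ^+ d + 1) * 2 ^+ (d * i0).
Proof.
rewrite /ker_mass natrX [leRHS]mulrDl [1 * _]mul1r; apply: lerD => //.
have p1 : 1 <= 2 ^+ (d * i0) :> R by rewrite exprn_ege1 // ler1n.
rewrite ler_peMr // mulr_ge0 ?powR_ge0 // exprn_ge0 // mulr_ge0 //.
by rewrite /decay_sum addr_ge0 // invr_ge0 subr_ge0 ltW // two_powR_lt1 // subr_lt0.
Qed.

Lemma hub_prob_ge : exists2 g : nat, True & forall i0,
  hlink d alpha th 0 / 2 / 2 ^+ (g * i0) <= hub_prob d tau alpha eta th i0.
Proof.
have [g hg] := nat_above (alpha * d%:R); exists g => // i0.
rewrite /hub_prob [hlink _ _ _ (_ * _)]hlinkD [leLHS]mulrAC ler_pM2r // ler_pM2l ?hlink_gt0 //.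
rewrite pow2_powR -powRN; apply: pow2_le; rewrite lerN2 natrM.
have s0 := sigma_gt0 tau2 alpha1 gam1 eta0 etaP; have s1 := sigma_lt1 tau2 alpha1 gam1 eta0.
rewrite mulrA; apply: ler_pM => //.
  have a1 := alpha1; rewrite !mulr_ge0 //; lra.
apply: le_trans (hg g (leqnn _)); have a1 := alpha1; rewrite ler_piMr ?mulr_ge0 //; lra.
Qed.

Lemma overfull_small (B : nat) (eps : R) : 0 < eps -> exists i1 : nat, forall i0 (lam : R), (i1 <= i0)%N ->
  0 <= lam -> lam <= 2 ^+ d -> overfull_prob d lam i0 (2 ^ (d.+1 * i0)) <= eps / 2 ^+ (B * i0).
Proof.
move=> eps0; have E1 : 1 < 2 ^+ d.+1 :> R by rewrite exprn_egt1 // ltr1n.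
have c0 : 0 < 2^-1 :> R by rewrite invr_gt0.
have [i1 h1] := superpoly B c0 E1 eps0.
exists (maxn i1 d.+3) => i0 lam; rewrite geq_max => /andP[/h1 k1 di] lam0 lamd.
rewrite ler_pdivlMr ?exprn_gt0 //; apply: le_trans k1; rewrite ler_wpM2r ?exprn_ge0 //.
rewrite /overfull_prob ler_expR -exprM !natrX.
have e3 : expR 1 - 1 <= 3 :> R.
  have h4 : expR (2^-1) <= 2 :> R.
    by have := half_le_expR R; rewrite expRN lef_pV2 ?posrE ?expR_gt0.
  have -> : expR 1 = expR (2^-1) ^+ 2 :> R by rewrite -expRM_natl divff.
  have := expR_ge0 (2^-1 : R); nra.
have e0 : 0 <= expR 1 - 1 :> R by rewrite subr_ge0 -expR0 ler_expR.
have p0 (x : nat) : 0 <= 2 ^+ x :> R by rewrite exprn_ge0.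
have h2 : lam * 2 ^+ (d * i0) * (expR 1 - 1) <= 2 ^+ d * 2 ^+ (d * i0) * 3.
  by apply: ler_pM; rewrite ?mulr_ge0 //; apply: ler_pM.
have h3 : 8 * (2 ^+ d * 2 ^+ (d * i0)) <= 2 ^+ (d.+1 * i0) :> R.
  have -> : (d.+1 * i0 = i0 + d * i0)%N by ring.
  rewrite exprD mulrA ler_wpM2r //.
  apply: le_trans (_ : 2 ^+ d.+3 <= _); first by rewrite !exprS; lra.
  by rewrite ler_weXn2l ?ler1n.
have aux (x y t : R) : 0 <= x -> y <= x * 3 -> 8 * x <= t -> y - t <= - (2^-1 * t) by lra.
exact: aux (mulr_ge0 (p0 d) (p0 (d * i0)%N)) h2 h3.
Qed.

Lemma step_ratio_tail (eps : R) : 0 < eps -> exists J0 : nat, forall i0 J b, (J0 <= J)%N ->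
  \sum_(i < b | (i0 <= i)%N) (if (J <= i)%N then Mc i / Mg i else 0) <= eps.
Proof.
move=> eps0; have lb1 := load_base_gt1 d_gt0 eta0.
have lb0 : 0 < load_base d eta by apply: lt_trans lb1.
have x01 : 0 < (load_base d eta)^-1 < 1 by rewrite invr_gt0 lb0 invf_lt1.
have [J0 h0] := geometric_small (1 - (load_base d eta)^-1)^-1 x01 eps0.
exists J0 => i0 J b hJ; apply: le_trans (h0 J hJ).
apply: (@le_trans _ _ (\sum_(i < b | (J <= i)%N) (load_base d eta)^-1 ^+ i)); last first.
  by apply: le_trans (geometric_tail J b x01) _; rewrite mulrC.
rewrite big_mkcond [leRHS]big_mkcond; apply: ler_sum => i _.
case: ifP => _; case: ifP => // _; last by rewrite exprn_ge0 // invr_ge0 ltW.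
rewrite /load_bound /load_bound2 mul2n -addnn exprD exprVn le_eqVlt; apply/orP; left; apply/eqP.
field; rewrite gt_eqF ?exprn_gt0 //= pnatr_eq0 -lt0n expn_gt0 //.
Qed.

(** Parameters in order of dependence: [i0], then the powers of 2^i0 ([s], [L], [A], [A3]), then
    [jJ] and with it [J], for which the geometric errors fall below a quantity depending on [i0].
    The load bound [y4] grows with [J], so the degree bound [Dp] comes last. None of them depends on
    [b]. *)
Lemma local_asymptotic (eps : R) (imin : nat) : 0 < eps ->
  exists i0 L s jJ Dp b1 : nat, exists2 junk : R, 0 < junk & (imin <= i0)%N /\ (1 < Dp)%N /\
  forall b n M, (b1 <= b)%N -> (d * b < M)%N -> (2 ^ (d * b))%:R * fP D (~` `[1, 2 ^+ M[)%classic <= junk ->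
  1 <= @cell_rate R d n b <= 2 ^+ d ->
  exists N, [/\ (jJ <= N)%N, sc (next_scale gam b) i0 N = b,
    forall j, (j < N)%N -> (i0 <= sc (next_scale gam b) i0 j < b)%N &
  exists conf : (forall k, {ffun 'I_k -> cellT d b} -> {ffun 'I_k -> 'I_M.+1} -> bool),
  [/\ forall K pi, @sub_poisson R d n b K pi -> CE K pi (@class_prob R M D) (fun k c l => (~~ conf k c l)%:R) <= eps,
    forall k (c : {ffun 'I_k -> cellT d b}) (l : {ffun 'I_k -> 'I_M.+1}), conf k c l -> forall i, (l i < M)%N &
    forall k (c : {ffun 'I_k -> cellT d b}) (l : {ffun 'I_k -> 'I_M.+1}) q, conf k c l ->
    admissible th alpha beta (@cell_rate R d n b) c (fun i => l i) q ->
    GE q (fun f => (~~ local_graph d tau alpha gam eta th b i0 L s jJ N Dp eps f)%:R) <= eps]].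
Proof.
move=> eps0.
have bt21 : 1 < bt2 by apply: lt_trans beta_bt2.
have beta_tau : beta < tau - 1 by apply: lt_trans bt2_tau.
have C30 : 0 < C3 by exact: pois_cube_gt0.
have wb0 bt : 0 < bt -> bt < tau - 1 -> 0 < weight_bound tau C5 l0 bt.
  move=> b0 bl; rewrite /weight_bound ltr_wpDl // addr_ge0 ?powR_ge0 // divr_ge0 ?(ltW C50) // subr_ge0.
  by rewrite /dyadic_decay -powRD ?pnatr_eq0 ?implybT // ltW // two_powR_lt1 //; lra.
have mu0 : 0 < mu by apply: wb0 => //; apply: lt_trans ltr01 beta1.
have mu20 : 0 < mu2 by apply: wb0 => //; apply: lt_trans ltr01 bt21.
pose ep := eps / 4; have ep0 : 0 < ep by rewrite divr_gt0.
pose y2 := 6 * C3 / eps; pose y5 := 6 * (3 * C3 * mu2) / eps.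
have y20 : 0 < y2 by rewrite !(mulr_gt0, invr_gt0).
have y50 : 0 < y5 by rewrite !(mulr_gt0, invr_gt0).
pose ch := hlink d alpha th 0 / 2; have ch0 : 0 < ch by rewrite divr_gt0 // hlink_gt0.
pose k0 : R := 4 `^ beta * (4 * decay_sum beta) ^+ d + 1.
have k01 : 1 <= k0.
  rewrite lerDr mulr_ge0 ?powR_ge0 // exprn_ge0 // mulr_ge0 //.
  by rewrite /decay_sum addr_ge0 // invr_ge0 subr_ge0 ltW // two_powR_lt1 // subr_lt0.
have k0_gt0 : 0 < k0 by apply: lt_le_trans k01.
pose ck := 6 * (3 * C3 * (2 * k0 ^+ 2) * mu ^+ 3) / eps.
have ck0 : 0 < ck by rewrite divr_gt0 // !(mulr_gt0, exprn_gt0).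
have [g _ hg] := hub_prob_ge; have [e he] := weight_split.
have [s1 [A1 [A2 [B [i1 h1]]]]] := budget_powers g (d * 2) d.+1 e ep0 eps0 y20 y50 ch0 ck0.
have w0 : 0 < eps / 32 by rewrite divr_gt0.
have e18 : 0 < eps / 18 * (eps / 32) by rewrite mulr_gt0 // divr_gt0.
have ew : 0 < ep * (eps / 32) / 2 by rewrite divr_gt0 // mulr_gt0.
have [i2 h2] := overfull_small B e18.
have [i3 h3] := config_fail_tail d_gt0 tau2 alpha1 gam1 eta0 etaP c50 B e18.
have [i4 h4] := connectors_tail (th := th) d_gt0 tau2 alpha1 gam1 eta0 th0 etaP B ew.
have [i5 h5] := scales_large d_gt0 tau2 alpha1 gam1 eta0 etaP l0.
have [i0 [ii1 ii2 ii3 ii4 [ii5 ii6]]] : exists i0, [/\ i1 <= i0, i2 <= i0, i3 <= i0, i4 <= i0 & i5 <= i0 /\ imin <= i0]%N.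
  by exists (maxn i1 (maxn i2 (maxn i3 (maxn i4 (maxn i5 imin))))); rewrite !leq_max !leqnn !orbT.
pose w := eps / 32 / 2 ^+ (B * i0).
have p0 (x : nat) : 0 < 2 ^+ x :> R by rewrite exprn_gt0.
have wpos : 0 < w by rewrite divr_gt0.
pose km := ker_mass d i0 (4 `^ beta) beta.
have KA0 : 0 <= 4 `^ beta :> R by exact: powR_ge0.
have km1 : 1 <= km.
  rewrite /km /ker_mass; apply: le_trans (_ : (2 ^ (d * i0))%:R <= _); first by rewrite ler1n expn_gt0.
  rewrite lerDr mulr_ge0 // exprn_ge0 // mulr_ge0 //.
  by rewrite /decay_sum addr_ge0 // invr_ge0 subr_ge0 ltW // two_powR_lt1 // subr_lt0.
have km0 : 0 < km by apply: lt_le_trans km1.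
have kmk : km <= k0 * 2 ^+ (d * i0) by exact: ker_mass_le.
pose y3 := 6 * (3 * C3 * (km + km ^+ 2) * mu ^+ 3) / eps.
have kk0 : 0 < km + km ^+ 2 := addr_gt0 km0 (exprn_gt0 2 km0).
have y30 : 0 < y3 by rewrite /y3 divr_gt0 // !mulr_gt0 // exprn_gt0.
have y3h : y3 <= ck * 2 ^+ (d * 2 * i0).
  rewrite /y3 /ck.
  have q : km + km ^+ 2 <= 2 * k0 ^+ 2 * 2 ^+ (d * 2 * i0).
    have -> : 2 * k0 ^+ 2 * 2 ^+ (d * 2 * i0) = 2 * (k0 * 2 ^+ (d * i0)) ^+ 2.
      have -> : (d * 2 * i0 = d * i0 * 2)%N by ring.
      by rewrite exprM; ring.
    apply: le_trans (_ : 2 * km ^+ 2 <= _); last by rewrite ler_pM2l // lerXn2r ?nnegrE ?(ltW km0) // mulr_ge0 ?(ltW k0_gt0) ?(ltW (p0 _)).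
    by rewrite mulr_natl mulr2n lerD2r expr2 ler_peMl // ltW.
  have -> : 6 * (3 * C3 * (2 * k0 ^+ 2) * mu ^+ 3) / eps * 2 ^+ (d * 2 * i0) =
     6 * (3 * C3 * (2 * k0 ^+ 2 * 2 ^+ (d * 2 * i0)) * mu ^+ 3) / eps by ring.
  rewrite ler_pM2r ?invr_gt0 // ler_pM2l // ler_pM2r ?exprn_gt0 // ler_pM2l // mulr_gt0 //.
set dl := hub_prob d tau alpha eta th i0 in hg.
have dlh := hub_prob_half d tau2 alpha1 gam1 eta0 th0 th1 i0.
have dl1 : dl <= 1 by apply: le_trans dlh _; rewrite invf_le1 // ler1n.
have [n1 n2 n3 n4] := h1 i0 ii1 dl y3 (hg i0) dl1 (ltW y30) y3h.
have x01 : 0 < (hub_growth d eta)^-1 < 1.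
  have g1 := hub_growth_gt1 d_gt0 eta0.
  by rewrite invr_gt0 (lt_trans ltr01) // invf_lt1 // (lt_trans ltr01).
pose cb := 3 * C3 * (C5 * 2 `^ (tau - 1)) * km * mu ^+ 2.
have ew2 : 0 < ep * w / 2 by rewrite divr_gt0 // mulr_gt0.
have e18w : 0 < eps / 18 * w by rewrite mulr_gt0 // divr_gt0.
have [j1 g1] := geometric_small (cb / (1 - (hub_growth d eta)^-1)) x01 e18w.
have [j2 g2] := step_ratio_tail ew2.
pose jJ := maxn j1 j2; pose J := iter jJ (up_scale gam) i0.
have grow i : (i0 <= i)%N -> (i < up_scale gam i)%N by move=> ii; have [] := h5 i (leq_trans ii5 ii).
have J12 : (j1 <= J)%N && (j2 <= J)%N.
  rewrite -geq_max; apply: leq_trans (iter_up_ge grow jJ); exact: leq_addl.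
case/andP: J12 => J1 J2.
pose y4 := 6 * (3 * C3 * (3 * (2 ^ (d * J))%:R * km) * mu ^+ 2) / eps.
have y40 : 0 < y4.
  by rewrite /y4 divr_gt0 // !mulr_gt0 ?exprn_gt0 // ltr0n expn_gt0.
pose L := (2 ^ (d.+1 * i0))%N; pose s := (2 ^ (s1 * i0))%N.
pose A : R := 2 ^+ (A1 * i0); pose A3 : R := 2 ^+ (A2 * i0).
pose T := 1 + (s * L)%:R * A ^+ e.+1.
have A_gt0 : 0 < A := p0 _; have A3_gt0 : 0 < A3 := p0 _.
have T0 : 0 < T by rewrite ltr_pwDl // mulr_ge0 // exprn_ge0 // ltW.
have [Dp0 hDp] := nat_above (y4 / ep * T / (eps / 8)).
(* The summand 2 gives [1 < Dp], so that the failure probability of a single low-link attempt lies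
   strictly between 0 and 1. *)
pose Dp := Dp0.+2; exists i0, L, s, jJ, Dp, J.+1; exists (eps / 6 / (3 * C3)).
  by rewrite !divr_gt0 // mulr_gt0.
split=> //; split=> // b n M Jb dM junk /andP[lam1 lamd].
have i0b : (i0 <= b)%N.
  by apply: leq_trans (ltnW Jb); apply: leq_trans (iter_up_ge grow jJ); exact: leq_addr.
have nxg i : (i0 <= i < b)%N -> (i < next_scale gam b i)%N.
  by move=> /andP[ii ib]; rewrite leq_min ib grow.
have [N scN sc_lt] := scale_sequence i0b (next_scale_le gam b) nxg.
have [jJN scJ scJb] := scale_window tau2 alpha1 gam1 eta0 scN sc_lt grow Jb.
exists N; split=> //.
exists (fun k cc l => local_config tau beta bt2 eta i0 J L w y2 y3 y4 y5 cc l).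
have i0l i : (i0 <= i)%N -> (l0 <= a i)%N by move=> ii; have [] := h5 i (leq_trans ii5 ii).
have aM i : (i <= b)%N -> (a i < M)%N.
  move=> ib; apply: leq_ltn_trans dM; apply: leq_trans (hub_class_le d tau2 alpha1 gam1 eta0 etaP i) _.
  by rewrite leq_mul2l ib orbT.
have lam0 : 0 <= @cell_rate R d n b by apply: le_trans lam1.
split.
- move=> K pi subp.
  apply: le_trans (local_config_prob d_gt0 tau2 alpha1 gam1 eta0 etaP beta1 beta_tau bt21 bt2_tau C50 massP M lam1 lamd subp L
     i0b (ltnW Jb) wpos y20 y30 y40 y50) _.
  have eps6 x : 0 < x -> x / (6 * x / eps) = eps / 6 by move=> x0; field; rewrite !gt_eqF.
  have t0 : 3 * C3 * (2 ^ (d * b))%:R * class_prob D (@ord_max M) <= eps / 6.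
    by rewrite class_prob_junk -mulrA mulrC -ler_pdivlMr // mulr_gt0.
  have t2 : C3 / y2 = eps / 6 by exact: eps6.
  have t3 : 3 * C3 * (km + km ^+ 2) * mu ^+ 3 / y3 = eps / 6.
    by apply: eps6; rewrite !mulr_gt0 // exprn_gt0.
  have t4 : 3 * C3 * (3 * (2 ^ (d * J))%:R * km) * mu ^+ 2 / y4 = eps / 6.
    by apply: eps6; rewrite !mulr_gt0 ?exprn_gt0 // ltr0n expn_gt0.
  have t5 : 3 * C3 * mu2 / y5 = eps / 6 by apply: eps6; rewrite !mulr_gt0.
  have b1 : overfull_prob d (@cell_rate R d n b) i0 L <= eps / 18 * w.
    by apply: le_trans (h2 i0 _ ii2 lam0 lamd) _; rewrite /w !mulrA.
  have b2 : \sum_(i < b.+1 | (i0 <= i)%N) scale_fail d (@cell_rate R d n b) (@class_prob R M D) a z i <= eps / 18 * w.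
    apply: le_trans (_ : eps / 18 * (eps / 32) / 2 ^+ (B * i0) <= _); last by rewrite /w !mulrA.
    apply: le_trans (h3 i0 b.+1 ii3); apply: ler_sum => i ii.
    apply: (scale_fail_le tau2 alpha1 gam1 eta0 etaP c50 massP) => //; first exact: i0l.
    by apply: aM; rewrite -ltnS.
  have b3 : \sum_(i < b.+1 | (i0 <= i)%N && (J <= i)%N)
      bad_hub_rate d (@cell_rate R d n b) (@class_prob R M D) a z i0 (4 `^ beta) beta (@weight1 R beta M) Mc i <= eps / 18 * w.
    apply: (@le_trans _ _ (\sum_(i < b.+1 | (i0 <= i)%N && (J <= i)%N) cb * (hub_growth d eta)^-1 ^+ i)).
      apply: ler_sum => i /andP[ii _].
      apply: (bad_hub_rate_le d_gt0 tau2 alpha1 gam1 eta0 etaP beta1 beta_tau C50 massP lamd dM i0l ii).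
      by rewrite -ltnS.
    have cb0 : 0 <= cb by rewrite !mulr_ge0 ?exprn_ge0 ?powR_ge0 // ltW.
    rewrite -mulr_sumr; apply: le_trans (g1 J J1).
    rewrite -[leRHS]mulrA ler_wpM2l // [leRHS]mulrC.
    apply: le_trans (geometric_tail J b.+1 x01).
    rewrite big_mkcond [leRHS]big_mkcond; apply: ler_sum => i _.
    case: (J <= i)%N; rewrite ?andbF ?andbT //; case: ifP => // _.
    by rewrite exprn_ge0 // ltW //; case/andP: x01.
  have t1 : (overfull_prob d (@cell_rate R d n b) i0 L +
    \sum_(i < b.+1 | (i0 <= i)%N) scale_fail d (@cell_rate R d n b) (@class_prob R M D) a z i +
    \sum_(i < b.+1 | (i0 <= i)%N && (J <= i)%N)
      bad_hub_rate d (@cell_rate R d n b) (@class_prob R M D) a z i0 (4 `^ beta) beta (@weight1 R beta M) Mc i) / w <= eps / 6.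
    rewrite ler_pdivrMr // [leRHS](_ : _ = eps / 18 * w + eps / 18 * w + eps / 18 * w); last by field.
    by rewrite !lerD.
  rewrite -/km t2 t3 t4 t5 [leRHS](_ : _ = eps / 6 + eps / 6 + eps / 6 + eps / 6 + eps / 6 + eps / 6); last by field.
  by rewrite !lerD.
- by move=> k c l /andP[/forallP].
- move=> k c l q cfg adm.
  have i0P i : (i0 <= i)%N -> (32 <= 2 ^ (d * z i))%N by move=> ii; have [] := h5 i (leq_trans ii5 ii).
  apply: le_trans (local_graph_prob d_gt0 tau2 alpha1 gam1 eta0 th0 th1 etaP beta1 bt21 lam1 lamd i0P i0b jJN scN sc_lt scJ scJb
    ep0 A_gt0 A3_gt0 wpos y20 y30 y40 (he A _) _ _ cfg adm) _.
  + by rewrite exprn_ege1 // ler1n.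
  + rewrite big_split /=; apply: le_trans (lerD (h4 i0 b ii4) (g2 i0 J b J2)) _.
    have -> : ep * (eps / 32) / 2 / 2 ^+ (B * i0) = ep * w / 2 by rewrite /w; field; rewrite gt_eqF.
    by rewrite -splitr.
  + rewrite -/dl -/T.
    have m1 : y4 / ep / Dp.+1%:R * T <= eps / 8.
      have D0 : 0 < Dp.+1%:R :> R by rewrite ltr0n.
      rewrite mulrAC ler_pdivrMr // [leRHS]mulrC -ler_pdivrMr ?divr_gt0 //.
      by apply: hDp; rewrite /Dp -(addn3 Dp0) leq_addr.
    have m2 : A3 * (w + w) * T <= eps / 8.
      have -> : A3 * (w + w) * T = (w + w) * (A3 * T) by ring.
      apply: le_trans (ler_wpM2l _ n4) _; first by rewrite addr_ge0 // ltW.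
      by rewrite /w le_eqVlt; apply/orP; left; apply/eqP; field; rewrite gt_eqF.
    have m3 : (s * L)%:R * (y3 / ep + y5) / A <= eps / 4 by exact: n3.
    have m4 : y2 / A3 * T <= eps / 4 by exact: n2.
    have m5 : y2 * (1 - dl) ^+ s / ep <= eps / 4 by exact: n1.
    rewrite !mulrDl [leRHS](_ : _ = eps / 4 + (eps / 4 + eps / 8 + eps / 8) + eps / 4); last by field.
    by rewrite !lerD.
  + by rewrite /ep mulrC divfK.
Qed.

End LocalAsymptotic.

(** * Speed of the rumour *)

Section Rumour.
Variables (R : realType) (V : finType) (T : nat) (g : rel V).
Local Notation spr := (@spreads R V T g).

Lemma spreads_leq r r' e x y : (r <= r')%N -> spr r e x y -> spr r' e x y.
Proof.
move=> rr h t0 tT; apply: le_trans (h t0 (leq_trans _ tT)); last by rewrite leq_add2l.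
apply: (le_PE (choice_law_pmf R T g)) => f; rewrite ler_nat.
case: (boolP (y \in spread _ _ _ r)) => [yS|_]; last exact: leq_b1.
by rewrite (fintype.subsetP (spread_sub (pp_contact g f) t0 [set x]%SET rr)).
Qed.

Lemma spreads_ball (r : rel V) (Q : nat) (e : R) l x y : 0 <= e ->
  (forall u v, r u v -> spr Q e u v) -> y \in ball_in r l x -> spr (Q * l) (e * l%:R) x y.
Proof.
move=> e0 rs; elim: l y => [|l IH] y /=.
  by rewrite inE => /eqP ->; apply: spreads_refl; rewrite mulr0.
rewrite inE => /orP[yB|].
  apply: (@spreads_leq (Q * l)); first by rewrite leq_mul2l leqnSn orbT.
  by apply: spreads_le (IH y yB); rewrite ler_wpM2l // ler_nat.
rewrite inE => /existsP[z /andP[zB zy]].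
rewrite mulnS addnC -natr1 mulrDr mulr1; exact: spreads_comp (IH z zB) (rs z y zy).
Qed.

Variables (h : nat -> V) (F : nat -> R) (j0 : nat).

Lemma spreads_chain n :
  (forall j, (j0 <= j < j0 + n)%N -> spr 2 (F j) (h j) (h j.+1)) ->
  spr (2 * n) (\sum_(j0 <= j < j0 + n) F j) (h j0) (h (j0 + n)%N).
Proof.
elim: n => [|n IH] hF; first by rewrite addn0 big_geq //; exact: spreads_refl.
rewrite addnS big_nat_recr ?leq_addr //= mulnS addnC.
apply: spreads_comp (hF (j0 + n)%N _); last by rewrite addnS leqnn leq_addr.
by apply: IH => j /andP[j1 j2]; apply: hF; rewrite j1 addnS ltnW.
Qed.

Lemma spreads_chain_rev n :
  (forall j, (j0 <= j < j0 + n)%N -> spr 2 (F j) (h j.+1) (h j)) ->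
  spr (2 * n) (\sum_(j0 <= j < j0 + n) F j) (h (j0 + n)%N) (h j0).
Proof.
elim: n => [|n IH] hF; first by rewrite addn0 big_geq //; exact: spreads_refl.
rewrite addnS big_nat_recr ?leq_addr //= mulnS addrC.
apply: spreads_comp (hF (j0 + n)%N _) _; first by rewrite addnS leqnn leq_addr.
by apply: IH => j /andP[j1 j2]; apply: hF; rewrite j1 addnS ltnW.
Qed.

End Rumour.

(** * From climbing paths to the giant and the transmission time *)

Section GraphWin.
Variables (R : realType) (d : nat) (tau alpha gam eta th : R).
Hypothesis d_gt0 : (0 < d)%N.
Hypotheses (tau2 : 2 < tau) (alpha1 : 1 < alpha) (gam1 : 1 < gam) (eta0 : 0 < eta) (th0 : 0 < th).
Hypothesis etaP : eta * (12 * (tau - 1) + 1 + alpha * gam) < 1 - alpha * gam * (tau - 2).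
Local Notation m := (min_connectors d tau alpha gam eta th).
Local Notation Dl := (max_degree d eta).

Definition hop_error (i : nat) : R := expR (- (m i / (Dl i).+2%:R ^+ 2)).

(** The number of connectors grows like 2^(e6 i), the squared degree cap like [load_base] to the
    power 4i; by [e6_large] the quotient still grows exponentially. The constant 32 absorbs 16 and
    the additive 3. *)
Lemma hop_error_tail (eps : R) : 0 < eps -> exists i1 : nat, forall j b, (i1 <= j)%N ->
  \sum_(i < b | (j <= i)%N) hop_error i <= eps.
Proof.
move=> eps0; have lb1 := load_base_gt1 d_gt0 eta0.
have lb0 : 0 < load_base d eta by apply: lt_trans lb1.
pose E := 2 `^ e6 d tau alpha gam eta / load_base d eta ^+ 4.
have E1 : 1 < E.
  rewrite /E ltr_pdivlMr ?exprn_gt0 // mul1r /load_base -powR_mulrn ?powR_ge0 // -powRrM.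
  rewrite /powR pnatr_eq0 /= ltr_expR ltr_pM2r; last by rewrite ln_gt0 // (ltr_nat R 1 2).
  have := e6_large d_gt0 tau2 alpha1 gam1 eta0 etaP.
  have : 0 < d%:R * eta by rewrite mulr_gt0 // ltr0n.
  lra.
have c0 : 0 < cm d alpha th / 32 ^+ 2 by rewrite divr_gt0 ?exprn_gt0 // (cm_gt0 d alpha th0).
have [i1 h1] := exp_tail 0 0 c0 E1 eps0.
exists i1 => j b ij; have := h1 j b ij; rewrite mul0n expr0 divr1; apply: le_trans.
apply: ler_sum => i _; rewrite ?mul0n ?expr0 mulr1 ler_expR lerN2.
have l2 : 1 <= load_base d eta ^+ (2 * i) by rewrite exprn_ege1 // ltW.
have dd : (Dl i).+2%:R <= 32 * load_base d eta ^+ (2 * i).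
  have h0 : 0 <= 16 * load_base d eta ^+ (2 * i) by rewrite mulr_ge0 // (le_trans ler01).
  have : (Num.truncn (16 * load_base d eta ^+ (2 * i)))%:R <= 16 * load_base d eta ^+ (2 * i).
    by rewrite -truncn_ge_nat.
  rewrite /max_degree -[_.+3]addn3 natrD; lra.
rewrite ler_pdivlMr ?exprn_gt0 ?ltr0n //.
apply: le_trans (_ : cm d alpha th / 32 ^+ 2 * E ^+ i * (32 * load_base d eta ^+ (2 * i)) ^+ 2 <= _).
  apply: ler_wpM2l; first exact: mulr_ge0 (ltW c0) (exprn_ge0 _ (le_trans ler01 (ltW E1))).
  by rewrite lerXn2r ?nnegrE // mulr_ge0 // (le_trans ler01).
rewrite /min_connectors /E expr_div_n -exprM.
have -> : load_base d eta ^+ (4 * i) = load_base d eta ^+ (2 * i) ^+ 2.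
  by rewrite -exprM [(2 * i * 2)%N]mulnAC.
rewrite le_eqVlt; apply/orP; left; apply/eqP; field.
by rewrite gt_eqF // (lt_le_trans ltr01).
Qed.

Variables (b n i0 L s jJ N Dp Q : nat) (eps c0 c dl : R).
Local Notation nx := (next_scale gam b).
Local Notation nC := ((2 ^ (d * b))%:R : R).
Local Notation l := (s * L + 1 + 2 * jJ)%N.
Hypothesis jJN : (jJ <= N)%N.
Hypothesis scN : sc nx i0 N = b.
Hypothesis sc_lt : forall j, (j < N)%N -> (i0 <= sc nx i0 j < b)%N.
Hypothesis grow : forall i, (i0 <= i)%N -> (i < up_scale gam i)%N.
Hypothesis Dp0 : (0 < Dp)%N.
Hypothesis tail : \sum_(i < b | (i0 <= i)%N) hop_error i <= dl.
Hypothesis link : (1 - Dp%:R^-1) ^+ Q * l%:R <= dl.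
Hypotheses (c_gt0 : 0 < c) (cn0 : c * n%:R <= c0 * nC) (epsc : eps * nC < c * n%:R) (sLc : (s * L)%:R < c * n%:R).
Hypothesis nCn : nC <= n%:R.
Hypothesis eps0 : 0 <= eps.
Hypothesis dl4 : 4 * dl <= 1.

(** The scales [sc nx i0 j] increase strictly before reaching [b], so the sum over hops is part of
    the sum over all scales. *)
Lemma scale_sum : \sum_(jJ <= j < N) hop_error (sc nx i0 j) <= dl.
Proof.
apply: le_trans tail; rewrite big_geq_mkord.
pose G i : R := if (i0 <= i)%N then hop_error i else 0.
have G0 i : 0 <= G i by rewrite /G; case: ifP => // _; exact: expR_ge0.
have -> : \sum_(i < b | (i0 <= i)%N) hop_error i = \sum_(i < b) G i by rewrite big_mkcond.
rewrite (eq_bigr (fun j : 'I_N => G (sc nx i0 j))); last first.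
  by move=> j _; rewrite /G; have /andP[-> _] := sc_lt (ltn_ord j).
apply: (ler_sum_inj (phi := fun j : 'I_N => sc nx i0 j)) => //.
  by move=> j _; have /andP[] := sc_lt (ltn_ord j).
have lt (j j' : 'I_N) : (j < j')%N -> (sc nx i0 j < sc nx i0 j')%N.
  move=> jj; rewrite !(sc_iter sc_lt) //.
  apply: leq_trans (iter_up_mono grow jj); rewrite iterS; apply: grow.
  by apply: leq_trans (iter_up_ge grow j); rewrite leq_addr.
move=> j j' _ _ e; apply: val_inj; case: (ltngtP j j') => // /lt; rewrite e ltnn //.
Qed.

Section Fixed.
Variables (k : nat) (f : {ffun 'I_k * 'I_k -> bool}).
Local Notation g := (adjf f).
Local Notation r := (Q * l + 2 * (N - jJ))%N.

Lemma hop_spreads T i x y : hop m Dl g i x y -> spreads T g 2 (hop_error i) x y.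
Proof.
case/orP => [/eqP ->|mh]; first by apply: spreads_refl; exact: expR_ge0.
apply: spreads_le (@spreads_hop R _ T g _ (Dl i).+2 x y (leqnn _)).
set w := #|_| in mh *.
have D0 : 0 < (Dl i).+2%:R :> R by rewrite ltr0n.
have D1 : (Dl i).+2%:R ^- 2 <= 1 :> R by rewrite invf_le1 ?exprn_gt0 // exprn_ege1 // ler1n.
apply: le_trans (_ : expR (- (Dl i).+2%:R ^- 2) ^+ w <= _).
  rewrite lerXn2r ?nnegrE ?subr_ge0 ?expR_ge0 //; exact: onem_le_expRN.
rewrite -expRM_natl ler_expR mulrN lerN2 /hop_error ler_wpM2r // invr_ge0 exprn_ge0 // ltW.
Qed.

Lemma hop_sym i x y : hop m Dl g i x y = hop m Dl g i y x.
Proof.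
rewrite /hop eq_sym; congr (_ || (_ <= _%:R)); apply: eq_card => z; rewrite !inE.
by rewrite andbCA.
Qed.

Lemma link_spreads T x y : low_link g Dp x y -> spreads T g Q ((1 - Dp%:R^-1) ^+ Q : R) x y.
Proof. by move=> /andP[gxy dg]; apply: (spreads_link R (@adjfC _ f)). Qed.

Lemma reach_spreads T u H : reach nx i0 m Dl g Dp l jJ N u H ->
  spreads T g r (2 * dl) u H /\ spreads T g r (2 * dl) H u.
Proof.
move=> [h [hB hh hN]].
have q0 : 0 <= (1 - Dp%:R^-1) ^+ Q :> R.
  by rewrite exprn_ge0 // subr_ge0 invf_le1 ?ler1n // ltr0n.
have NE : (jJ + (N - jJ) = N)%N by rewrite subnKC.
have s0 := scale_sum.
have hB' : u \in ball_in (low_link g Dp) l (h jJ).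
  by apply: ball_sym hB; apply: low_linkC; exact: adjfC.
split.
- apply: (@spreads_le R _ T g r ((1 - Dp%:R^-1) ^+ Q * l%:R + \sum_(jJ <= j < jJ + (N - jJ)) hop_error (sc nx i0 j))).
    by have lk := link; rewrite NE; lra.
  apply: spreads_comp (spreads_ball q0 (@link_spreads T) hB) _.
  rewrite -hN -[in h N]NE; apply: spreads_chain => j; rewrite NE => jb.
  exact: hop_spreads (hh j jb).
- apply: (@spreads_le R _ T g r (\sum_(jJ <= j < jJ + (N - jJ)) hop_error (sc nx i0 j) + (1 - Dp%:R^-1) ^+ Q * l%:R)).
    by have lk := link; rewrite NE; lra.
  rewrite addnC; apply: spreads_comp (spreads_ball q0 (@link_spreads T) hB').
  rewrite -hN -[in h N]NE; apply: spreads_chain_rev => j; rewrite NE => jb.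
  by apply: hop_spreads; rewrite hop_sym; exact: (hh j jb).
Qed.

Lemma hop_connect i x y : 0 < m i -> hop m Dl g i x y -> connect g x y.
Proof.
move=> m0 /orP[/eqP -> //|mh].
have : 0 < #|[pred y' | [&& g y' x, g y' y & (#|g y'| <= (Dl i).+2)%N]]|%:R :> R by apply: lt_le_trans mh.
rewrite ltr0n => /card_gt0P[z]; rewrite inE => /and3P[zx zy _].
by apply: connect_trans (connect1 _) (connect1 zy); rewrite adjfC.
Qed.

Lemma reach_connect u H : reach nx i0 m Dl g Dp l jJ N u H -> connect g u H.
Proof.
move=> [h [hB hh hN]].
have bc t y : y \in ball_in (low_link g Dp) t u -> connect g u y.
  elim: t y => [|t IH] y /=; first by rewrite inE => /eqP ->.
  rewrite !inE => /orP[/IH //|/existsP[z /andP[/IH uz /andP[zy _]]]].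
  exact: connect_trans uz (connect1 zy).
apply: connect_trans (bc _ _ hB) _; rewrite -hN -(subnKC jJN).
have : (jJ + (N - jJ) <= N)%N by rewrite subnKC.
elim: (N - jJ)%N => [|j IH] jN; first by rewrite addn0.
rewrite addnS; apply: connect_trans (IH _) _; first by rewrite ltnW // -addnS.
apply: (@hop_connect (sc nx i0 (jJ + j))); first exact: min_connectors_gt0.
by apply: hh; rewrite leq_addr -addnS.
Qed.

(** Every large component contains a reached vertex, hence [H], which gives uniqueness. For two
    reached endpoints the rumour climbs to [H] and descends by the reversed path, each with error
    [2 * dl]; at most a fraction [eps / c] of the giant is unreached, and this is paid for both
    endpoints. *)
Lemma graph_win : local_graph d tau alpha gam eta th b i0 L s jJ N Dp eps f ->
  big_component d b c0 f ->
  exists2 K, is_giant c n g K & 1 - (2 * (eps / c) + 4 * dl) <= win R (2 * r) g K.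
Proof.
move=> /orP[/eqP k0|/existsP[H uH]] /existsP[H0 bH0]; first by subst k; case: H0 bH0.
have symg := sym_connect_sym (@adjfC _ f).
set U := unreached d tau alpha gam eta th b i0 L s jJ N Dp g H in uH.
have reached u : c * n%:R <= #|[set y | connect g u y]%SET|%:R -> ~~ U u ->
    reach nx i0 m Dl g Dp l jJ N u H.
  move=> big; rewrite /U /unreached negb_and negbK; case/orP => [|/asboolP //].
  by rewrite -leqNgt -(ler_nat R) => h; exfalso; have := sLc; move: big h; lra.
(* Unreached vertices number at most [eps * nC], which is less than [c * n%:R], so they cannot fill
   a component of that size. *)
have toH u : c * n%:R <= #|[set y | connect g u y]%SET|%:R -> connect g u H.
  move=> big.
  have [y] : exists y, (y \in [set y | connect g u y]%SET) && ~~ U y.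
    apply/existsP; rewrite -negb_forall_in; apply/negP => /forallP all.
    have : (#|[set y | connect g u y]%SET| <= #|U|)%N.
      by apply/subset_leq_card/fintype.subsetP => y yS; have := all y; rewrite yS.
    rewrite -(ler_nat R) => h; have := epsc; move: uH h big; lra.
  rewrite inE => /andP[uy nU].
  have same : [set z | connect g y z]%SET = [set z | connect g u z]%SET.
    by apply/setP => z; rewrite !inE (same_connect symg uy).
  by apply: connect_trans uy (reach_connect (reached y _ nU)); rewrite same.
pose K := [set y | connect g H y]%SET.
have compK u : c * n%:R <= #|[set y | connect g u y]%SET|%:R -> [set y | connect g u y]%SET = K.
  by move=> /toH uH'; apply/setP => z; rewrite !inE (same_connect symg uH').
have big0 : c * n%:R <= #|[set y | connect g H0 y]%SET|%:R by exact: le_trans cn0 bH0.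
have Kbig : c * n%:R <= #|K|%:R by rewrite -(compK _ big0).
exists K.
  split; [by exists H|exact: Kbig|].
  by move=> K' [x ->]; exact: compK.
have K0 : 0 < #|K|%:R :> R.
  apply: lt_le_trans Kbig; apply: le_lt_trans epsc; by rewrite mulr_ge0.
pose A := [set u in K | ~~ U u]%SET.
have reachA u : u \in A -> reach nx i0 m Dl g Dp l jJ N u H.
  rewrite !inE => /andP[Hu nU]; apply: reached => //.
  have -> // : [set y | connect g u y]%SET = K.
  by apply/setP => z; rewrite !inE -(same_connect symg Hu).
have PC := choice_law_pmf R (2 * r) g.
have suc a b' : a \in A -> b' \in A -> 1 - 4 * dl <= PE (@choice_law R _ (2 * r) g) (fun f => (success g a b' f)%:R).
  move=> /reachA/(reach_spreads (2 * r))[aH _] /reachA/(reach_spreads (2 * r))[_ Hb].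
  have rr : (r + r <= 2 * r)%N by rewrite addnn -mul2n.
  have fail := spreads_leq rr (spreads_comp aH Hb) (leqnn (0 + 2 * r)).
  have -> : PE (@choice_law R _ (2 * r) g) (fun f0 => (success g a b' f0)%:R) =
     1 - PE (@choice_law R _ (2 * r) g) (fun f0 => (b' \notin spread (pp_contact g f0) 0 [set a]%SET (2 * r))%:R).
    apply/eqP; rewrite -subr_eq0 opprB addrA -PED subr_eq0; apply/eqP.
    rewrite (eq_PE _ (G := fun=> 1)) ?(PE_cst PC) // => f0.
    by rewrite /success informed_spread; case: (_ \in _); rewrite ?addr0 ?add0r.
  lra.
have AK : (1 - eps / c) * #|K|%:R <= #|A|%:R.
  have : (#|K| <= #|A| + #|U|)%N.
    rewrite -cardUI; apply: leq_trans (leq_addr _ _).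
    by apply/subset_leq_card/fintype.subsetP => u uK; rewrite !inE in uK *; rewrite uK /=; case: (boolP (U u)) => uU; rewrite ?orbT // orbF.
  rewrite -(ler_nat R) natrD => h1.
  have h2 : eps * nC <= eps / c * #|K|%:R.
    rewrite mulrAC ler_pdivlMr // -mulrA ler_wpM2l // mulrC.
    by apply: le_trans Kbig; rewrite ler_pM2l.
  move: uH h1 h2; lra.
have p0 a b' : 0 <= PE (@choice_law R _ (2 * r) g) (fun f => (success g a b' f)%:R).
  by apply: (PE_ge0 PC).
apply: (@le_trans _ _ (\sum_(a in A) \sum_(b' in A) #|K|%:R ^- 2 * (1 - 4 * dl))).
  have E (x : R) (q : nat) : x *+ q *+ q = q%:R * (q%:R * x).
    by rewrite -[_ *+ q *+ q]mulr_natl -[x *+ q]mulr_natl.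
  rewrite !sumr_const E.
  set x := eps / c in AK *.
  have y0 : 0 <= 1 - 4 * dl by rewrite subr_ge0.
  have a0 : 0 <= #|A|%:R :> R by [].
  have -> : #|A|%:R * (#|A|%:R * (#|K|%:R ^- 2 * (1 - 4 * dl))) = (#|A|%:R / #|K|%:R) ^+ 2 * (1 - 4 * dl).
    by field; rewrite gt_eqF.
  have q : 1 - x <= #|A|%:R / #|K|%:R by rewrite ler_pdivlMr.
  set t := _ / _ in q *; have t0 : 0 <= t by rewrite divr_ge0.
  have x0 : 0 <= x by rewrite divr_ge0 // ltW.
  have tt : 1 - 2 * x <= t ^+ 2 by nra.
  have d0 : 0 <= dl by apply: le_trans tail; apply: sumr_ge0 => i _; exact: expR_ge0.
  have := ler_wpM2r y0 tt; nra.
rewrite /win; apply: le_trans (_ : \sum_(a in A) \sum_(b' in A) #|K|%:R ^- 2 * PE (@choice_law R _ (2 * r) g) (fun f => (success g a b' f)%:R) <= _).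
  apply: ler_sum => a aA; apply: ler_sum => b' bA.
  by rewrite ler_wpM2l ?suc // invr_ge0 exprn_ge0.
have i2 : 0 <= #|K|%:R ^- 2 :> R by rewrite invr_ge0 exprn_ge0.
rewrite big_mkcond [leRHS]big_mkcond; apply: ler_sum => a _.
rewrite [in X in X <= _]inE; case: (boolP (a \in K)) => aK //=.
case: ifP => _; last by apply: sumr_ge0 => b' _; rewrite mulr_ge0.
rewrite big_mkcond [leRHS]big_mkcond; apply: ler_sum => b' _.
rewrite [in X in X <= _]inE; case: (boolP (b' \in K)) => bK //=.
by case: ifP => _ //; rewrite mulr_ge0.
Qed.

End Fixed.
End GraphWin.

(** * The diagonal argument and the final estimate *)

Section Diagonal.
Local Open Scope classical_set_scope.
Variable R : realType.

(** The rate of growth loses the factor 1 - eps/32 twice: once in choosing [gam] below 1/(alpha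
    (tau-2)), once in passing to [gam2] to absorb the integer parts of the scales. *)
Lemma speed_slack (eps : R) : 0 < eps -> eps <= 1 ->
  4 <= (4 + eps / 2) * (1 - eps / 32) ^+ 2.
Proof. by move=> e0 e1; rewrite expr2; nra. Qed.

Lemma error_budget (eps u w : R) : 0 <= u -> u <= eps / 20 -> 0 <= w -> w <= eps / 20 ->
  eps <= 1 ->
  [/\ 1 - eps <= (1 - (2 * w + 4 * u)) * (1 - (u + u)) * (1 - u - (u + u)),
      u + u <= 1 & 2 * w + 4 * u <= 1].
Proof.
move=> u0 ue w0 we e1; split; [|lra|lra].
have p1 (a b : R) : 0 <= a -> 0 <= b -> 1 - (a + b) <= (1 - a) * (1 - b).
  by move=> a0 b0; rewrite mulrBl mul1r mulrBr mulr1; have := mulr_ge0 a0 b0; lra.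
have -> : 1 - u - (u + u) = 1 - 3 * u by ring.
apply: (@le_trans _ _ ((1 - (2 * w + 4 * u + (u + u))) * (1 - 3 * u))); last first.
  by rewrite ler_wpM2r ?p1 //; lra.
by apply: le_trans (p1 _ _ _ _); lra.
Qed.

(** At time n the tolerance is 1/(k+1) for the largest k < n whose threshold has already been
    passed; each fixed k is eventually exceeded. *)
Lemma diagonal_sequence (P : nat -> R -> R) :
  (forall n x, (0 < n)%N -> P n x <= 1) ->
  (forall eps, 0 < eps <= 1 -> exists n0, forall n, (n0 <= n)%N -> 1 - eps <= P n eps) ->
  exists2 eps : nat -> R, eps n @[n --> \oo] --> (0 : R) & P n (eps n) @[n --> \oo] --> (1 : R).
Proof.
move=> P1 HP.
pose e (k : nat) : R := k.+1%:R^-1.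
have e01 k : 0 < e k <= 1 by rewrite invr_gt0 ltr0n /= invf_le1 ?ler1n ?ltr0n.
have [N NP] := boolp.choice (fun k => HP (e k) (e01 k)).
pose K (n : nat) := \max_(k < n | (N k <= n)%N) (k : nat).
have KP n : (maxn 1 (N 0%N) <= n)%N -> (N (K n) <= n)%N.
  rewrite geq_max => /andP[n1 n0].
  have c0 : (0 < #|[pred k : 'I_n | (N k <= n)%N]|)%N.
    by apply/card_gt0P; exists (Ordinal n1); rewrite inE.
  have [k kP kE] := eq_bigmax_cond (fun k : 'I_n => k : nat) c0.
  by rewrite /K (_ : \max_(k < n | _) _ = k) //; rewrite inE in kP.
have Kge k : \forall n \near \oo, (k <= K n)%N.
  exists (maxn k.+1 (N k)) => // n /=; rewrite geq_max => /andP[kn Nk].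
  exact: (leq_bigmax_cond (F := fun i : 'I_n => i : nat) (Ordinal kn)).
have ecvg : e (K n) @[n --> \oo] --> (0 : R).
  apply/cvgrPdist_le => x x0; have [k hk] := nat_above x^-1.
  apply: filterS (Kge k) => n kn; rewrite sub0r normrN ger0_norm; last by rewrite invr_ge0.
  rewrite /e invf_ple ?posrE ?ltr0n // ; apply: hk; exact: leqW.
exists (fun n => e (K n)) => //.
apply: (@squeeze_cvgr _ _ _ _ (fun n => 1 - e (K n)) (fun=> 1)); last exact: cvg_cst.
  exists (maxn 1 (N 0%N)) => // n /= hn; rewrite P1 ?andbT; last by move: hn; rewrite geq_max => /andP[].
  exact: NP (KP n hn).
by rewrite -[X in _ --> X]subr0; apply: cvgB => //; exact: cvg_cst.
Qed.

End Diagonal.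

Section Transmission.
Local Open Scope classical_set_scope.
Variables (R : realType) (tau alpha theta1 theta2 : R) (d : nat) (D : probability (measurableTypeR R) R).
Hypotheses (htau : 2 < tau) (halpha1 : 1 < alpha) (halpha2 : alpha < (tau - 2)^-1).
Hypotheses (htheta1 : 0 < theta1) (htheta12 : theta1 <= theta2) (htheta2 : theta2 <= 1).
Hypotheses (hd : (0 < d)%N) (hD : power_law tau D).

Let x : R := alpha * (tau - 2).

Let x01 : 0 < x < 1.
Proof.
have t0 : 0 < tau - 2 by rewrite subr_gt0.
apply/andP; split; first by rewrite mulr_gt0 // (lt_trans ltr01).
by rewrite /x -ltr_pdivlMr // mul1r.
Qed.

(* The paper's speed is governed by gam < 1 / (alpha * (tau - 2)); any such gam leaves room for eta. *)
Lemma slack gam : 1 < gam -> gam * x < 1 -> exists2 eta : R, 0 < eta &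
  eta * (12 * (tau - 1) + 1 + alpha * gam) < 1 - alpha * gam * (tau - 2).
Proof.
move=> g1 gx; pose y := 12 * (tau - 1) + 1 + alpha * gam.
have a0 : 0 < alpha * gam by rewrite mulr_gt0 // (lt_trans ltr01).
have t2 := htau; have y0 : 0 < y by rewrite /y; lra.
have z0 : 0 < 1 - alpha * gam * (tau - 2) by move: gx; rewrite /x; lra.
exists ((1 - alpha * gam * (tau - 2)) / (2 * y)); first by rewrite divr_gt0 // mulr_gt0.
rewrite -/y; have -> : (1 - alpha * gam * (tau - 2)) / (2 * y) * y = (1 - alpha * gam * (tau - 2)) / 2.
  by field; rewrite gt_eqF.
lra.
Qed.

Lemma iter_growth (gam gam2 : R) i0 j : (0 < i0)%N -> 0 < gam2 ->
  (forall i, (i0 <= i)%N -> gam2 * i%:R <= (up_scale gam i)%:R) ->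
  (forall i, (i0 <= i)%N -> (i < up_scale gam i)%N) ->
  gam2 ^+ j <= (iter j (up_scale gam) i0)%:R.
Proof.
move=> i00 g0 gr grow; elim: j => [|j IH]; first by rewrite expr0 ler1n.
rewrite exprS iterS; apply: le_trans (gr _ _); first by rewrite ler_pM2l.
by apply: leq_trans (iter_up_ge grow j); rewrite leq_addr.
Qed.

Lemma loglog_large (y : R) : exists n0 : nat, forall n, (n0 <= n)%N -> 0 < ln (n%:R : R) /\ y <= ln (ln n%:R).
Proof.
have [n0 h] := nat_above (expR (expR y)); exists n0 => n /h hn.
have e0 : 0 < expR (expR y) :> R by exact: expR_gt0.
have n0' : 0 < n%:R :> R by apply: lt_le_trans hn.
have l1 : expR y <= ln n%:R by rewrite -[leLHS]expRK ler_ln ?posrE.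
have l0 : 0 < ln (n%:R : R) by apply: lt_le_trans l1; exact: expR_gt0.
by split=> //; rewrite -[leLHS]expRK ler_ln ?posrE // expR_gt0.
Qed.

Lemma transmission : exists2 c0 : R, 0 < c0 & forall c, 0 < c <= c0 ->
  forall (p : nat -> vertex R d -> vertex R d -> R) (S : nat -> rumour_space R d),
  (forall n, (0 < n)%N -> girg (S n) alpha theta1 theta2 n D (p n)) ->
  (forall n, (0 < n)%N -> push_pull (S n) c n) ->
  forall eps, 0 < eps <= 1 -> exists n0, forall n, (n0 <= n)%N ->
  1 - eps <= fP (Pr (S n)) (transmitted_within (S := S n) c n
         ((4 + eps) * (ln (ln n%:R) / `|ln (alpha * (tau - 2))|))).
Proof.
have /andP[x0 x1] := x01.
have th1 : theta1 <= 1 by exact: le_trans htheta2.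
have [c5 [C5 [l0 [c50 C50 massP]]]] := dyadic_mass htau hD.
have t1 : 1 < tau - 1 by have := htau; lra.
have [beta [bt2 [beta1 beta_bt2 beta_le bt2_tau]]] : exists beta bt2 : R,
    [/\ 1 < beta, beta < bt2, beta <= alpha & bt2 < tau - 1].
  pose y := Num.min alpha (tau - 1).
  have y1 : 1 < y by rewrite lt_min halpha1.
  have ya : y <= alpha by rewrite ge_min lexx.
  have yt : y <= tau - 1 by rewrite ge_min lexx orbT.
  exists (1 + (y - 1) / 3), (1 + (y - 1) / 2); clearbody y; split; lra.
pose lam := - ln x; have lam0 : 0 < lam by rewrite oppr_gt0 ln_lt0 // x0.
have xE : x = expR (- lam) by rewrite opprK lnK.
have gamx rho : rho < 1 -> expR (rho * lam) * x < 1.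
  by move=> r1; rewrite xE -expRD -[ltRHS]expR0 ltr_expR; nra.
have gam1 rho : 0 < rho -> 1 < expR (rho * lam).
  by move=> r0; rewrite -[ltLHS]expR0 ltr_expR mulr_gt0.
have [cb cb0 cbP] : exists2 c0 : R, 0 < c0 & forall eps : R, 0 < eps ->
  exists b1 : nat, forall b n M, (b1 <= b)%N -> (d * b < M)%N ->
  1 <= @cell_rate R d n b <= 2 ^+ d ->
  exists conf : (forall k, {ffun 'I_k -> cellT d b} -> {ffun 'I_k -> 'I_M.+1} -> bool),
  (forall K pi, @sub_poisson R d n b K pi -> CE K pi (@class_prob R M D) (fun k c l => (~~ conf k c l)%:R) <= eps) /\
  (forall k (c : {ffun 'I_k -> cellT d b}) (l : {ffun 'I_k -> 'I_M.+1}) q,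
    (forall i, (l i < M)%N) -> conf k c l ->
    admissible theta1 alpha beta (@cell_rate R d n b) c (fun i => l i) q ->
    GE q (fun f => (~~ big_component d b c0 f)%:R) <= eps).
  (* Existence does not involve speed, so [rho] is 1/2 here and [cb] is independent of [eps]. *)
  have h2 : 0 < 2^-1 :> R by rewrite invr_gt0.
  have h21 : 2^-1 < 1 :> R by lra.
  have [eta eta0 etaP] := slack (gam1 _ h2) (gamx _ h21).
  exact: (giant_exists hd htau halpha1 (gam1 _ h2) eta0 htheta1 th1 etaP beta1 c50 massP).
(* The number of vertices n is at most 2^d times the number of cells, so [c * n%:R] stays below [cb]
   times the number of cells. *)
exists (cb / 2 ^+ d); first by rewrite divr_gt0 // exprn_gt0.
move=> c /andP[c0 ccb] p S hgirg hpp eps /andP[eps0 eps1].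
pose rho : R := 1 - eps / 32.
have r0 : 0 < rho by rewrite /rho; lra.
have r1 : rho < 1 by rewrite /rho; lra.
pose gam := expR (rho * lam); pose gam2 := expR (rho ^+ 2 * lam).
have rho4 : 4 <= (4 + eps / 2) * rho ^+ 2 by exact: speed_slack.
have g1 : 1 < gam by exact: gam1.
have rr : rho ^+ 2 < rho by rewrite expr2; nra.
have g2 : gam2 < gam by rewrite ltr_expR ltr_pM2r.
have [eta eta0 etaP] := slack g1 (gamx _ r1).
(* Both [dl] and [dl / c] must be at most [eps / 20]: the latter bounds the unreached fraction of
   the giant. *)
pose dl := Num.min 1 c * (eps / 20).
have mc0 : 0 < Num.min 1 c by rewrite lt_min ltr01.
have e20 : 0 < eps / 20 by rewrite divr_gt0.
have dl0 : 0 < dl by rewrite mulr_gt0.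
have dle : dl <= eps / 20 by rewrite ler_piMl ?(ltW e20) // ge_min lexx.
have dlc : dl <= c * (eps / 20) by rewrite ler_wpM2r ?(ltW e20) // ge_min lexx orbT.
have dlc1 : dl < c by apply: le_lt_trans dlc _; rewrite gtr_pMr //; lra.
have dl4 : 4 * dl <= 1 by lra.
have [i1 h1] := scales_large hd htau halpha1 g1 eta0 etaP 0.
have [i2 h2] := hop_error_tail hd htau halpha1 g1 eta0 htheta1 etaP dl0.
(* From here on [gam * i - 1] is at least [gam2 * i], so the integer parts cost only the passage
   from [gam] to [gam2]. *)
have [i3 h3] := nat_above (gam - gam2)^-1.
have [i0 [L [s [jJ [Dp [b1 [junk junk0 [i0min [Dp1 loc]]]]]]]]] :=
  local_asymptotic hd htau halpha1 g1 eta0 htheta1 th1 etaP beta1 beta_bt2 bt2_tau c50 C50 massP (maxn 1 (maxn i1 (maxn i2 i3))) dl0.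
have [i00 [i01 i02 i03]] : (0 < i0)%N /\ [/\ i1 <= i0, i2 <= i0 & i3 <= i0]%N.
  by move: i0min; rewrite !geq_max => /and4P[? ? ? ?]; split.
have grow i : (i0 <= i)%N -> (i < up_scale gam i)%N by move=> ii; have [] := h1 i (leq_trans i01 ii).
have gr2 i : (i0 <= i)%N -> gam2 * i%:R <= (up_scale gam i)%:R.
  move=> ii; have /andP[u1 _] := up_scale_bounds htau halpha1 g1 eta0 i; apply: le_trans u1.
  have gg : 0 < gam - gam2 by rewrite subr_gt0.
  have := h3 i (leq_trans i03 ii); rewrite -[_^-1]div1r ler_pdivrMr //; lra.
have [b2 giant] := cbP dl dl0.
pose l := (s * L + 1 + 2 * jJ)%N.
have q01 : 0 < 1 - Dp%:R^-1 :> R /\ 1 - Dp%:R^-1 < 1 :> R.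
  have D0 : 0 < Dp%:R :> R by rewrite ltr0n ltnW.
  by rewrite subr_gt0 invf_lt1 // ltr1n Dp1 gtrBl invr_gt0.
have [Q hQ] : exists Q : nat, (1 - Dp%:R^-1) ^+ Q * l%:R <= dl.
  have [Q hQ] := @geometric_small R (1 - Dp%:R^-1) l%:R dl (introT andP q01) dl0.
  by exists Q; rewrite mulrC; exact: hQ.
have lg2 : ln gam2 = rho ^+ 2 * lam by rewrite expRK.
pose A := rho ^+ 2 * lam; have A0 : 0 < A by rewrite mulr_gt0 // exprn_gt0.
(* [C1] comes from 2^b <= n after two logarithms. [C2] gathers all rounds that do not grow with n;
   half of [eps] in the final bound absorbs it, the other half absorbs the loss of speed. *)
pose C1 : R := - ln (ln 2).
pose C2 : R := (2 * (Q * l) + 4)%:R + 4 * C1 / A.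
have [n1 hn1] := loglog_large (Num.max 0 (C2 * lam / (eps / 2))).
have [n2 hn2] := nat_above ((s * L).+1%:R / c).
exists (maxn 1 (maxn n1 (maxn n2 (2 ^ (d * maxn b1 b2))))) => n.
rewrite !geq_max => /and4P[n_gt0 nn1 nn2 nb].
have [ln0 lln'] := hn1 n nn1; move: lln'; rewrite ge_max => /andP[ll0 lln].
have p2 : (1 < 2 ^ d)%N by rewrite -{1}(expn0 2) ltn_exp2l.
pose b := trunc_log (2 ^ d) n.
have pb : (2 ^ (d * b) <= n)%N by rewrite expnM; exact: trunc_logP.
have bb : (maxn b1 b2 <= b)%N by apply: trunc_log_max => //; rewrite -expnM.
move: bb; rewrite geq_max => /andP[bb1 bb2].
have nC0 : 0 < (2 ^ (d * b))%:R :> R by rewrite ltr0n expn_gt0.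
have nCn : (2 ^ (d * b))%:R <= n%:R :> R by rewrite ler_nat.
have rate1 : 1 <= @cell_rate R d n b by rewrite /cell_rate ler_pdivlMr ?exprn_gt0 // mul1r -natrX.
have rate2 : @cell_rate R d n b <= 2 ^+ d.
  rewrite /cell_rate ler_pdivrMr ?exprn_gt0 // -exprD -natrX ler_nat ltnW //.
  by rewrite -mulnS expnM; exact: trunc_log_ltn.
have rate : 1 <= @cell_rate R d n b <= 2 ^+ d by rewrite rate1 rate2.
have jk : 0 < junk / (2 ^ (d * b))%:R by rewrite divr_gt0.
have [M0 hM0] := heavy_tail hD jk.
(* The number of classes grows with n: hub classes up to scale [b] must be proper classes, and among
   about 2^(db) vertices none should fall into the last one. *)
pose M := maxn M0 (d * b).+1.
have dM : (d * b < M)%N by exact: leq_maxr.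
have hM : (2 ^ (d * b))%:R * fP D (~` `[1, 2 ^+ M[) <= junk.
  by rewrite mulrC -ler_pdivlMr //; apply: hM0; exact: leq_maxl.
have [N [jJN scN sc_lt [conf1 [c1 hv c2]]]] := loc b n M bb1 dM hM rate.
have [conf2 [c3 c4]] := giant b n M bb2 dM rate.
have ncn : c * n%:R <= cb * (2 ^ (d * b))%:R.
  have -> : n%:R = @cell_rate R d n b * (2 ^ (d * b))%:R :> R by rewrite natrX -lamE.
  rewrite mulrA ler_wpM2r ?(ltW nC0) //; apply: le_trans (ler_pM (ltW c0) _ ccb rate2) _.
    exact: le_trans ler01 rate1.
  by rewrite divfK // gt_eqF // exprn_gt0.
have cn : c * (2 ^ (d * b))%:R <= c * n%:R by rewrite ler_pM2l.
have dcn : dl * (2 ^ (d * b))%:R < c * n%:R by apply: lt_le_trans cn; rewrite ltr_pM2r.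
have sLc : (s * L)%:R < c * n%:R.
  by have := hn2 n nn2; rewrite ler_pdivrMr // mulrC; apply: lt_le_trans; rewrite ltr_nat.
pose T := (2 * (Q * l + 2 * (N - jJ)))%N.
have b_gt0 : (0 < b)%N.
  case: (posnP N) => [N0|/sc_lt/andP[_]]; last exact: leq_trans.
  by move: scN; rewrite N0 => <-.
have lnb : ln b%:R <= ln (ln n%:R) + C1.
  have l2 : 0 < ln (2 : R) by rewrite ln_gt0 // (ltr_nat R 1 2).
  have b0 : 0 < b%:R :> R by rewrite ltr0n.
  rewrite /C1 -lerBlDr opprK -lnM ?posrE // ler_ln ?posrE ?mulr_gt0 //.
  rewrite mulr_natl -lnXn // ler_ln ?posrE ?exprn_gt0 ?ltr0n // -natrX ler_nat.
  by apply: leq_trans pb; rewrite leq_exp2l // leq_pmull.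
have NB : N%:R <= 1 + (ln (ln n%:R) + C1) / A.
  apply: (@le_trans _ _ (1 + ln b%:R / A)); last by rewrite lerD2l ler_pM2r ?invr_gt0.
  case: (posnP N) => [->|Npos].
    by rewrite addr_ge0 // divr_ge0 ?(ltW A0) // ln_ge0 // ler1n.
  have Nlt : (N.-1 < N)%N by rewrite prednK.
  have /andP[_ lt] := sc_lt _ Nlt.
  have g20 : 0 < gam2 by exact: expR_gt0.
  rewrite -(prednK Npos) -natr1 addrC lerD2l ler_pdivlMr // /A -lg2 mulr_natl -lnXn //.
  rewrite ler_ln ?posrE ?exprn_gt0 ?ltr0n //.
  apply: le_trans (iter_growth N.-1 i00 g20 gr2 grow) _.
  by rewrite -(sc_iter sc_lt Nlt) ler_nat ltnW.
have nx : `|ln (alpha * (tau - 2))| = lam by rewrite -/x ltr0_norm // ln_lt0 // x0.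
set y := ln (ln n%:R) in ll0 lln NB *.
have TL : T%:R <= (4 + eps) * (y / `|ln (alpha * (tau - 2))|).
  rewrite nx; apply: (@le_trans _ _ (C2 + 4 * y / A)).
    apply: (@le_trans _ _ ((2 * (Q * l))%:R + 4 * N%:R)).
      by rewrite -natrM -natrD ler_nat /T mulnDr leq_add2l mulnA; apply: leq_mul; rewrite ?leq_subr.
    have -> : C2 + 4 * y / A = (2 * (Q * l))%:R + 4 * (1 + (y + C1) / A).
      by rewrite /C2 natrD; field; rewrite gt_eqF.
    by rewrite lerD2l ler_pM2l.
  have h4 : C2 <= eps / 2 * (y / lam).
    by move: lln; rewrite ler_pdivrMr ?divr_gt0 // => h; rewrite mulrA ler_pdivlMr // [eps / 2 * y]mulrC.
  have h5 : 4 * y / A <= (4 + eps / 2) * (y / lam).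
    rewrite /A invfM mulrACA.
    rewrite ler_wpM2r ?divr_ge0 ?(ltW lam0) // ler_pdivrMr ?exprn_gt0 //.
  have -> : (4 + eps) * (y / lam) = eps / 2 * (y / lam) + (4 + eps / 2) * (y / lam).
    by rewrite -mulrDl addrCA -splitr.
  exact: lerD h4 h5.
have dc : dl / c <= eps / 20 by rewrite ler_pdivrMr // mulrC.
have dc0 : 0 <= dl / c by rewrite divr_ge0 // ltW.
have [bud1 bud2 bud3] := error_budget (ltW dl0) dle dc0 dc eps1.
pose good k (cc : {ffun 'I_k -> cellT d b}) (ll : {ffun 'I_k -> 'I_M.+1}) := conf1 k cc ll && conf2 k cc ll.
pose Gam k : pred {ffun 'I_k * 'I_k -> bool} := fun f =>
  local_graph d tau alpha gam eta theta1 b i0 L s jJ N Dp dl f && big_component d b cb f.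
have or_le (u v : bool) : (~~ (u && v))%:R <= (~~ u)%:R + (~~ v)%:R :> R.
  by case: u; case: v; rewrite /= ?addr0 ?add0r // ?lerDl ?ler01.
have key := @transmitted_discrete R d n b M alpha beta theta1 theta2 D (S n) (p n) n_gt0 beta1 beta_le htheta1 htheta12 htheta2
  (hgirg n n_gt0) c (hpp n n_gt0) rate1 T ((4 + eps) * (y / `|ln (alpha * (tau - 2))|)) (dl + dl) (dl + dl) (2 * (dl / c) + 4 * dl) good Gam TL.
have {}key := key _ _ _ _ _ _ dl dl0.
apply: le_trans (key _ _ _ _ _ _).
- exact: bud1.
- by move=> k cc ll /andP[h _]; exact: hv h.
- move=> K pi subp; apply: le_trans (lerD (c1 K pi subp) (c3 K pi subp)); rewrite -CED.
  apply: le_CE => [k cc|j||k cc ll]; [exact: subp.1|exact: class_prob_ge0|exact: class_prob_sum|exact: or_le].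
- move=> k cc ll /andP[h1' h2'] q adm.
  apply: le_trans (lerD (c2 k cc ll q h1' adm) (c4 k cc ll q (hv k cc ll h1') h2' adm)); rewrite /GE -PED.
  have GP : is_pmf (bern (edge_law q)) by apply: GE_pmf; case: adm.
  by apply: (le_PE GP) => f; exact: or_le.
- move=> k f /andP[lg bc].
  exact: (graph_win htheta1 jJN sc_lt grow (ltnW Dp1) (h2 i0 b i02) hQ c0 ncn dcn sLc nCn (ltW dl0) dl4 lg bc).
- exact: bud2.
- exact: bud3.
Qed.

End Transmission.

Theorem theorem2p4 (R : realType) (tau alpha theta1 theta2 : R) (d : nat)
    (D : probability (measurableTypeR R) R)
    (htau : 2 < tau) (halpha1 : 1 < alpha) (halpha2 : alpha < (tau - 2)^-1)
    (htheta1 : 0 < theta1) (htheta12 : theta1 <= theta2) (htheta2 : theta2 <= 1)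
    (hd : (0 < d)%N) (hD : power_law tau D) :
  exists2 c0 : R, 0 < c0 &
  forall (c : R) (hc : 0 < c <= c0)
    (p : nat -> vertex R d -> vertex R d -> R)
    (S : nat -> rumour_space R d)
    (hgirg : forall n, (0 < n)%N -> girg (S n) alpha theta1 theta2 n D (p n))
    (hpp : forall n, (0 < n)%N -> push_pull (S n) c n),
  exists2 eps : nat -> R, eps n @[n --> \oo] --> (0 : R) &
    Pr (S n)
      (transmitted_within (S := S n) c n
         ((4 + eps n) * (ln (ln n%:R) / `|ln (alpha * (tau - 2))|)))
    @[n --> \oo] --> 1%E.
Proof.
have [c0 c00 h] := transmission htau halpha1 halpha2 htheta1 htheta12 htheta2 hd hD.
exists c0 => // c hc p S hgirg hpp.
have mT n e : (0 < n)%N -> measurable (transmitted_within (S := S n) c n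
    ((4 + e) * (ln (ln n%:R) / `|ln (alpha * (tau - 2))|))).
  by move=> n0; apply: measurable_transmitted; have [] := hpp n n0.
have [|eps e0 e1] := diagonal_sequence _ (h c hc p S hgirg hpp).
  by move=> n e n0; apply: fP_le1; exact: mT.
exists eps => //; apply: cvg_EFin => //.
by exists 1%N => // n /= n0; apply: fin_num_measure; exact: mT.
Qed.
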